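(* Let $A$ be a simple $C^*$-algebra which is essentially tracially in $\mathcal C_{\mathcal Z}$, the class of separable $\mathcal Z$-stable $C^*$-algebras. Then $W(A)$ is almost unperforated.
   Context: $\mathcal Z$ is the Jiang–Su algebra; a $C^*$-algebra $D$ is $\mathcal Z$-stable if $D\otimes\mathcal Z\cong D$. **Cuntz semigroup.** For a $C^*$-algebra $A$ let $M_\infty(A)_+=\bigcup_nM_n(A)_+$, identifying $x\in M_n(A)$ with $\mathrm{diag}(x,0)\in M_{n+m}(A)$. For $a,b\in M_n(A)_+$, $a\lesssim b$ means there are $x_i\in M_n(A)$ with $\|a-x_i^*bx_i\|\to0$; $a\sim b$ means $a\lesssim b$ and $b\lesssim a$. $W(A)=M_\infty(A)_+/\sim$, with classes $\langle a\rangle$, addition induced by $a\oplus b=\mathrm{diag}(a,b)$, and order $\langle a\rangle\le\langle b\rangle$ iff $a\lesssim b$. $W(A)$ is almost unperforated if for all $\langle a\rangle,\langle b\rangle\in W(A)$ and $k\in\mathbb N$, $(k+1)\langle a\rangle\le k\langle b\rangle$ implies $\langle a\rangle\le\langle b\rangle$. **Essential tracial approximation.** $A_+^1$ is the set of positive elements of norm $\le1$; $a\in_\varepsilon S$ means $\|a-x\|<\varepsilon$ for some $x\in S$. Let $\mathcal P$ be a class of $C^*$-algebras. A simple $C^*$-algebra $A$ is *essentially tracially in* $\mathcal P$ if for any finite $\mathcal F\subset A$, $\varepsilon>0$ and $s\in A_+\setminus\{0\}$ there are $e\in A_+^1$ and a nonzero $C^*$-subalgebra $B\subset A$ with $B\in\mathcal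 P$ such that (1) $\|ex-xe\|<\varepsilon$ for all $x\in\mathcal F$; (2) $(1-e)x\in_\varepsilon B$ and $\|(1-e)x\|\ge\|x\|-\varepsilon$ for all $x\in\mathcal F$; (3) $e\lesssim s$. (Here $1$ is the unit of $A$, or of the unitization if $A$ is non-unital.) *)

(* Defs.v *)
From HB Require Import structures.
From mathcomp Require Import all_boot all_order all_algebra.
From mathcomp Require Import all_classical all_reals all_analysis.
From mathcomp Require Import complex mxtens.

Set Implicit Arguments.
Unset Strict Implicit.
Unset Printing Implicit Defensive.

Import Order.TTheory GRing.Theory Num.Theory numFieldNormedType.Exports.

Local Open Scope classical_set_scope.
Local Open Scope complex_scope.
Local Open Scope ring_scope.

(** * C*-algebras (not necessarily unital) over the complex numbers R[i] *)

(* MathComp rings are unital, hence the bespoke product [cmul]. *)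
HB.mixin Record CompleteNormedModule_isCStarAlgebra (R : realType) A
    of CompleteNormedModule R[i] A := {
  cmul : A -> A -> A ;
  cstar : A -> A ;
  cmulA : forall x y z, cmul x (cmul y z) = cmul (cmul x y) z ;
  cmulPl : forall (a : R[i]) x y z,
    cmul (a *: x + y) z = a *: cmul x z + cmul y z ;
  cmulPr : forall (a : R[i]) x y z,
    cmul z (a *: x + y) = a *: cmul z x + cmul z y ;
  cstarK : forall x, cstar (cstar x) = x ;
  cstarP : forall (a : R[i]) x y,
    cstar (a *: x + y) = a^*%C *: cstar x + cstar y ;
  cstarM : forall x y, cstar (cmul x y) = cmul (cstar y) (cstar x) ;
  cnormM : forall x y, `|cmul x y| <= `|x| * `|y| ;
  cnormCstar : forall x, `|cmul (cstar x) x| = `|x| ^+ 2 }.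

#[short(type="cstarAlgType")]
HB.structure Definition CStarAlgebra (R : realType) :=
  {A of CompleteNormedModule R[i] A &
        CompleteNormedModule_isCStarAlgebra R A}.

(* MathComp norms on R[i]-modules take their (real) values in R[i]. *)
Definition cnorm (R : realType) (A : cstarAlgType R) (x : A) : R :=
  complex.Re `|x|.

Definition cpositive (R : realType) (A : cstarAlgType R) (a : A) : Prop :=
  exists y : A, a = cmul (cstar y) y.

Definition star_hom (R : realType) (A B : cstarAlgType R) (f : A -> B) : Prop :=
  [/\ forall (a : R[i]) x y, f (a *: x + y) = a *: f x + f y,
      forall x y, f (cmul x y) = cmul (f x) (f y) &
      forall x, f (cstar x) = cstar (f x)].

Definition star_isomorphic (R : realType) (A B : cstarAlgType R) : Prop :=
  exists f : A -> B, star_hom f /\ bijective f.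

(* A C*-subalgebra of A, given as a C*-algebra B with its inclusion map. *)
Definition cstar_embedding (R : realType) (B A : cstarAlgType R)
    (i : B -> A) : Prop :=
  star_hom i /\ forall b, cnorm (i b) = cnorm b.

Definition closed_ideal (R : realType) (A : cstarAlgType R) (I : set A) : Prop :=
  [/\ closed I, I 0,
      forall (a : R[i]) x y, I x -> I y -> I (a *: x + y) &
      forall a x, I x -> I (cmul a x) /\ I (cmul x a)].

Definition simple_cstar (R : realType) (A : cstarAlgType R) : Prop :=
  forall I : set A, closed_ideal I -> I = [set 0] \/ I = setT.

Definition separable_cstar (R : realType) (A : cstarAlgType R) : Prop :=
  exists D : set A, countable D /\ dense D.

Definition cunit (R : realType) (A : cstarAlgType R) (u : A) : Prop :=
  forall x, cmul u x = x /\ cmul x u = x.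

(** * The C*-algebras M_n(A) *)

Definition mxcmul (R : realType) (A : cstarAlgType R) m n p
    (x : 'M[A]_(m, n)) (y : 'M[A]_(n, p)) : 'M[A]_(m, p) :=
  \matrix_(i, k) \sum_j cmul (x i j) (y j k).

Definition mxcstar (R : realType) (A : cstarAlgType R) m n
    (x : 'M[A]_(m, n)) : 'M[A]_(n, m) :=
  \matrix_(i, j) cstar (x j i).

(* The norm of a column v, in the Hilbert A-module A^n: the square root of
   the norm of the sum of the (v_i)^* v_i. *)
Definition colnorm (R : realType) (A : cstarAlgType R) n (v : 'cV[A]_n) : R :=
  Num.sqrt (cnorm (mxcmul (mxcstar v) v ord0 ord0)).

(* The C*-norm of M_n(A): M_n(A) acts faithfully on A^n by adjointable
   operators, so its unique C*-norm is the operator norm of that action. *)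
Definition mxcnorm (R : realType) (A : cstarAlgType R) n (x : 'M[A]_n) : R :=
  sup [set colnorm (mxcmul x v) | v in [set v : 'cV[A]_n | colnorm v <= 1]].

Definition mxcpositive (R : realType) (A : cstarAlgType R) n
    (a : 'M[A]_n) : Prop :=
  exists y : 'M[A]_n, a = mxcmul (mxcstar y) y.

(** * Cuntz comparison and the Cuntz semigroup W(A) *)

Definition cuntz_le (R : realType) (A : cstarAlgType R) n
    (a b : 'M[A]_n) : Prop :=
  exists x : nat -> 'M[A]_n,
    mxcnorm (a - mxcmul (mxcstar (x k)) (mxcmul b (x k))) @[k --> \oo] --> 0.

(* <a> <= <b> in W(A), where a and b may have different sizes: they are
   compared after the identifications of a with diag(a, 0) and of b with
   diag(b, 0) (the cast only exchanges m + n for n + m). *)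
Definition W_le (R : realType) (A : cstarAlgType R) n m
    (a : 'M[A]_n) (b : 'M[A]_m) : Prop :=
  cuntz_le (block_mx a 0 0 0 : 'M[A]_(n + m))
    (castmx (addnC m n, addnC m n) (block_mx b 0 0 0 : 'M[A]_(m + n))).

(* The class k <a> of W(A) is represented by diag(a, ..., a). *)
Definition W_almost_unperforated (R : realType) (A : cstarAlgType R) : Prop :=
  forall (n m : nat) (a : 'M[A]_n) (b : 'M[A]_m) (k : nat),
    mxcpositive a -> mxcpositive b ->
    W_le (\mxdiag_(i < k.+1) a) (\mxdiag_(i < k) b) -> W_le a b.

(** * Tensor products *)

(* t d z stands for the elementary tensor of d and z. The last two conditions
   say that the linear map from the algebraic tensor product of D and B to E
   induced by t is injective, and has dense range: E is the completion of the
   algebraic tensor product for some C*-norm. *)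
Definition cstar_tensor (R : realType) (D B E : cstarAlgType R)
    (t : D -> B -> E) : Prop :=
  (forall (a : R[i]) x y z, t (a *: x + y) z = a *: t x z + t y z) /\
  (forall (a : R[i]) x y z, t x (a *: y + z) = a *: t x y + t x z) /\
  (forall x x' y y', t (cmul x x') (cmul y y') = cmul (t x y) (t x' y')) /\
  (forall x y, t (cstar x) (cstar y) = cstar (t x y)) /\
  (forall n (d : 'I_n -> D) (b : 'I_n -> B),
     (forall c : 'I_n -> R[i], \sum_i c i *: b i = 0 -> forall i, c i = 0) ->
     \sum_i t (d i) (b i) = 0 -> forall i, d i = 0) /\
  dense [set x | exists n (d : 'I_n -> D) (b : 'I_n -> B),
                   x = \sum_i t (d i) (b i)].

(* The minimal tensor product: its norm is the least C*-norm on the algebraic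
   tensor product. *)
Definition cstar_min_tensor (R : realType) (D B E : cstarAlgType R)
    (t : D -> B -> E) : Prop :=
  cstar_tensor t /\
  forall (F : cstarAlgType R) (t' : D -> B -> F), cstar_tensor t' ->
  forall n (d : 'I_n -> D) (b : 'I_n -> B),
    cnorm (\sum_i t (d i) (b i)) <= cnorm (\sum_i t' (d i) (b i)).

(* The tensor product of D and B is isomorphic to D. *)
Definition tensor_stable (R : realType) (B D : cstarAlgType R) : Prop :=
  exists (E : cstarAlgType R) (t : D -> B -> E),
    cstar_min_tensor t /\ star_isomorphic E D.

(** * The Jiang-Su algebra *)

(* The dimension drop algebra of the continuous f : [0, 1] -> M_p (x) M_q with
   f 0 in M_p (x) 1 and f 1 in 1 (x) M_q. Its elements are represented by
   functions on R, whose values outside [0, 1] are irrelevant. *)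
Definition dimension_drop (R : realType) (p q : nat)
    (f : R -> 'M[R[i]]_(p * q)) : Prop :=
  [/\ forall i j, {within `[0, 1], continuous (fun x : R => complex.Re (f x i j))},
      forall i j, {within `[0, 1], continuous (fun x : R => complex.Im (f x i j))},
      exists g : 'M[R[i]]_p, f 0 = g *t (1%:M : 'M[R[i]]_q) &
      exists h : 'M[R[i]]_q, f 1 = (1%:M : 'M[R[i]]_p) *t h].

(* A unital injective *-homomorphism from the dimension drop algebra to Z. *)
Definition dimension_drop_embedding (R : realType) (Z : cstarAlgType R)
    (p q : nat) (phi : (R -> 'M[R[i]]_(p * q)) -> Z) : Prop :=
  (forall (a : R[i]) f g, dimension_drop f -> dimension_drop g ->
     phi (fun x => a *: f x + g x) = a *: phi f + phi g) /\
  (forall f g, dimension_drop f -> dimension_drop g ->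
     phi (fun x => f x *m g x) = cmul (phi f) (phi g)) /\
  (forall f, dimension_drop f ->
     phi (fun x => (map_mx (fun z => z^*%C) (f x))^T) = cstar (phi f)) /\
  cunit (phi (fun=> 1%:M)) /\
  (forall f, dimension_drop f ->
     phi f = 0 <-> forall x : R, `[0, 1]%classic x -> f x = 0).

(* Z is the limit of an inductive sequence, with unital injective connecting
   maps, of prime dimension drop algebras: the latter are identified with an
   increasing sequence of subalgebras of Z. *)
Definition prime_dimension_drop_limit (R : realType) (Z : cstarAlgType R) :
    Prop :=
  exists (p q : nat -> nat)
         (phi : forall n, (R -> 'M[R[i]]_(p n * q n)) -> Z),
  (forall n, [/\ (0 < p n)%N, (0 < q n)%N & coprime (p n) (q n)]) /\
  (forall n, dimension_drop_embedding (phi n)) /\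
  (forall n f, dimension_drop f ->
     exists2 g, dimension_drop g & phi n.+1 g = phi n f) /\
  dense [set z | exists n f, dimension_drop f /\ z = phi n f].

Definition tracial_state (R : realType) (A : cstarAlgType R)
    (tau : A -> R[i]) : Prop :=
  [/\ forall (a : R[i]) x y, tau (a *: x + y) = a * tau x + tau y,
      forall x, 0 <= tau (cmul (cstar x) x),
      forall u, cunit u -> tau u = 1 &
      forall x y, tau (cmul x y) = tau (cmul y x)].

(* By the Jiang-Su classification theorem, these conditions determine Z up to
   isomorphism. Z has a unit, and infinite dimension, because it contains
   unital copies of dimension drop algebras. *)
Definition jiang_su (R : realType) (Z : cstarAlgType R) : Prop :=
  [/\ simple_cstar Z, prime_dimension_drop_limit Z &
      exists! tau : Z -> R[i], tracial_state tau].

(* The class of separable Z-stable C*-algebras. *)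
Definition separable_stable (R : realType) (Z D : cstarAlgType R) : Prop :=
  separable_cstar D /\ tensor_stable Z D.

(** * Essential tracial approximation *)

(* The class P is meant to be invariant under isomorphism. The element
   (1 - e) x of A is written x - e x, which makes sense whether or not A has a
   unit; e <~ s is Cuntz comparison in M_1(A). *)
Definition essentially_tracially_in (R : realType)
    (P : cstarAlgType R -> Prop) (A : cstarAlgType R) : Prop :=
  forall (F : seq A) (eps : R) (s : A),
    0 < eps -> cpositive s -> s <> 0 ->
  exists (e : A) (B : cstarAlgType R) (i : B -> A),
    [/\ cpositive e /\ cnorm e <= 1,
        [/\ cstar_embedding i, exists b : B, b <> 0 & P B],
        forall x, x \in F -> cnorm (cmul e x - cmul x e) < eps,
        forall x, x \in F ->
          (exists b : B, cnorm ((x - cmul e x) - i b) < eps) /\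
          cnorm x - eps <= cnorm (x - cmul e x) &
        cuntz_le (const_mx e : 'M[A]_1) (const_mx s : 'M[A]_1)].

(* Main.v *)
(* Write [a = alpha^* alpha], [b = beta^* beta], and let [x_ji], [j < K], [i <= K],
   witness [(K + 1) a <= K b]. For every K the Jiang-Su algebra contains an
   approximately central family [m_ji] with [m_ji^* m_j'i' ~ [j = j'] g_ii'] and
   [sum_i g_ii ~ 1]; hence [Y = sum_ji m_ji x_ji] has
   [Y^* b Y ~ sum_ii' g_ii' (sum_j x_ji^* b x_ji') ~ sum_i g_ii a ~ a].
   In a tracial approximation, with [c = 1 - e], this applies to [c b c] and
   gives [y^* b y ~ alpha^* c^4 alpha]. The rest of [a],
   [alpha^* (1 - c^4) alpha = alpha^* W e W alpha], lies under [e], which is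
   Cuntz below any prescribed positive element.

   Room for the rest is made beforehand: after multiplying the inequality, [b]
   is replaced by some [y1^* b y1] which still satisfies it and is orthogonal to
   columns [w_i] with [w_i^* b w_j = [i = j] s], [s <> 0]. Such columns are found
   by cutting one of many nearly equal, nearly orthogonal columns, which exist by
   the same tracial approximation, and primeness of A makes the [s] equal.

   The families [m_ji] are built in a dimension drop algebra. In each fibre, the
   exact solutions commuting with a given finite-dimensional algebra exist if
   its multiplicities are large, which the simplicity of Z ensures, and are path
   connected, since isometries are. By real induction along [0, 1], local
   solutions are joined into a continuous one that nearly commutes with a given
   finite set, and has the right values at both ends. *)

(* The count behind the amplification: [a] is an n by n matrix, so its remainder under [e] needs n
   spare columns, one for each row of [alpha]. With n columns made spare, N copies of [b] only lie
   below n + N copies of the new element. For N = (n + 1) k the hypothesis, taken n + 1 times, then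
   puts (n + 1)(k + 1) = (n + N) + 1 copies of [a] below n + N copies, which is again of the form (K
   + 1) a <= K b.

   The obstacle in a fibre: a finite-dimensional representation of a dimension drop algebra has
   spectrum in [0, 1] that moves with the fibre, and cells of [0, 1] become projections only if they
   are cut away from it. A window holding more disjoint bumps than the dimension has one that the
   representation kills, and the cut is made there. Two solutions may belong to different cuts;
   taking the even cuts of one and the odd cuts of the other gives a third system of cuts that links
   them.

   No spectral theory is used: an inequality of norms serves as positivity, and roots come from one
   iteration. *)
Require Import Defs.
From HB Require Import structures.
From mathcomp Require Import all_boot all_order all_algebra.
From mathcomp Require Import all_classical all_reals all_analysis.
From mathcomp Require Import complex mxtens.
From mathcomp Require Import zify ring lra.

Set Implicit Arguments.
Unset Strict Implicit.
Unset Printing Implicit Defensive.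

Import Order.TTheory GRing.Theory Num.Theory numFieldNormedType.Exports.

Local Open Scope classical_set_scope.
Local Open Scope complex_scope.
Local Open Scope ring_scope.

Import Normc.
Arguments normc : simpl never.

(* Decides noncommutative ring identities: expand both sides, then cancel
   opposite monomials. *)
Ltac bring_last m :=
  repeat match goal with
  | |- ?a + m + _ = 0 => fail 1
  | |- m + _ = 0 => fail 1
  | |- context [?a + m + ?b] => assert_fails (constr_eq b m); rewrite [a + m + b]addrAC
  | |- context [m + ?b] => assert_fails (constr_eq b m); rewrite [m + b]addrC
  end.
Ltac cancel_last :=
  match goal with
  | |- 0 = 0 => reflexivity
  | |- _ + - ?m = 0 =>
      let x := fresh "x" in set x := m; bring_last x; (rewrite addrK || rewrite subrr)
  | |- _ + ?m = 0 =>
      let x := fresh "x" in set x := - m; bring_last x; rewrite /x;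
      (rewrite subrK || rewrite addNr)
  end.
Ltac ncring :=
  apply/eqP; rewrite -subr_eq0; apply/eqP;
  do ?rewrite (mulrDl, mulrDr, mulrN, mulNr, opprD, opprK, mulr1, mul1r, mulr0,
    mul0r, oppr0, addr0, add0r, mulrA, addrA);
  repeat cancel_last.

(** * C*-algebras, their unitizations, square roots and positivity *)

Section Basics.
Context {R : realType} {A : cstarAlgType R}.
Implicit Types (x y z : A) (a b : R[i]).

Lemma cmulDl x y z : cmul (x + y) z = cmul x z + cmul y z.
Proof. by rewrite -[x in LHS]scale1r cmulPl scale1r. Qed.

Lemma cmulDr x y z : cmul z (x + y) = cmul z x + cmul z y.
Proof. by rewrite -[x in LHS]scale1r cmulPr scale1r. Qed.

Lemma cmul0l z : cmul 0 z = 0.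
Proof. by apply: (addrI (cmul 0 z)); rewrite -cmulDl !addr0. Qed.

Lemma cmul0r z : cmul z 0 = 0.
Proof. by apply: (addrI (cmul z 0)); rewrite -cmulDr !addr0. Qed.

Lemma cmulZl a x z : cmul (a *: x) z = a *: cmul x z.
Proof. by rewrite -[a *: x]addr0 cmulPl cmul0l addr0. Qed.

Lemma cmulZr a x z : cmul z (a *: x) = a *: cmul z x.
Proof. by rewrite -[a *: x]addr0 cmulPr cmul0r addr0. Qed.

Lemma cstarD x y : cstar (x + y) = cstar x + cstar y.
Proof. by rewrite -[x in LHS]scale1r cstarP conjc1 scale1r. Qed.

Lemma cstar0 : cstar (0 : A) = 0.
Proof. by apply: (addrI (cstar 0)); rewrite -cstarD !addr0. Qed.

Lemma cstarZ a x : cstar (a *: x) = a^*%C *: cstar x.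
Proof. by rewrite -[a *: x]addr0 cstarP cstar0 addr0. Qed.

Lemma cnormE x : `|x| = (cnorm x)%:C.
Proof.
have := normr_ge0 x; rewrite /cnorm; case: `|x| => r i.
by rewrite lecE /= => /andP[/eqP -> _].
Qed.

Lemma cnorm_ge0 x : 0 <= cnorm x.
Proof. by rewrite -lecR -cnormE; exact: normr_ge0. Qed.

Lemma cnormD x y : cnorm (x + y) <= cnorm x + cnorm y.
Proof. by rewrite -lecR rmorphD /= -!cnormE ler_normD. Qed.

Lemma cnormN x : cnorm (- x) = cnorm x.
Proof. by rewrite /cnorm normrN. Qed.

Lemma cnorm0 : cnorm (0 : A) = 0.
Proof. by rewrite /cnorm normr0. Qed.

Lemma cnorm_eq0 x : (cnorm x == 0) = (x == 0).
Proof. by rewrite -[RHS]normr_eq0 cnormE -(inj_eq (@complexI R)). Qed.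

Lemma cnorm_gt0 x : (0 < cnorm x) = (x != 0).
Proof. by rewrite lt_def cnorm_ge0 andbT cnorm_eq0. Qed.

Lemma cnormZ a x : cnorm (a *: x) = normc a * cnorm x.
Proof. by apply: complexI; rewrite rmorphM /= -!cnormE normrZ. Qed.

Lemma cnorm_mul x y : cnorm (cmul x y) <= cnorm x * cnorm y.
Proof. by rewrite -lecR rmorphM /= -!cnormE cnormM. Qed.

Lemma cnorm_starmul x : cnorm (cmul (cstar x) x) = cnorm x ^+ 2.
Proof. by apply: complexI; rewrite rmorphXn /= -!cnormE cnormCstar. Qed.

(** The C*-identity gives |y|^2 <= |y^*| |y|, hence |y| <= |y^*|; apply this to y and to its
    adjoint. *)
Lemma cnorm_star x : cnorm (cstar x) = cnorm x.
Proof.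
have le y : cnorm y <= cnorm (cstar y).
  have := cnorm_mul (cstar y) y; rewrite cnorm_starmul expr2.
  have [->|y0] := eqVneq y 0; first by rewrite cstar0.
  by rewrite ler_pM2r // cnorm_gt0.
by apply/eqP; rewrite eq_le le andbT; have := le (cstar x); rewrite cstarK.
Qed.

Lemma normc_ge0 a : 0 <= normc a.
Proof. by case: a => u v; rewrite /normc sqrtr_ge0. Qed.

Lemma normc_real (r : R) : normc r%:C = `|r|.
Proof. by rewrite /normc /= expr0n addr0 sqrtr_sqr. Qed.

Lemma normc_conj a : normc (a^*%C) = normc a.
Proof. by case: a => u v; rewrite /normc /= sqrrN. Qed.

Lemma normc_eq0 a : (normc a == 0) = (a == 0).
Proof.
apply/eqP/eqP => [/eq0_normc//|->].
by rewrite (_ : 0 = 0%:C) // normc_real normr0.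
Qed.

Lemma normcMconj a : a^*%C * a = (normc a ^+ 2)%:C.
Proof.
by rewrite mulrC -sqr_normc normc_def /= rmorphXn /=; case: a.
Qed.

End Basics.

(** * The unitization and its norm *)

Definition uniz {R : realType} (A : cstarAlgType R) : Type := (A * R[i])%type.

Section Unitization.
Context {R : realType} {A : cstarAlgType R}.

HB.instance Definition _ := Choice.copy (uniz A) (A * R[i])%type.
HB.instance Definition _ := GRing.Zmodule.copy (uniz A) (A * (R[i])^o)%type.
HB.instance Definition _ := GRing.Lmodule.copy (uniz A) (A * (R[i])^o)%type.

Definition unizmul (u v : uniz A) : uniz A :=
  (cmul u.1 v.1 + u.2 *: v.1 + v.2 *: u.1, u.2 * v.2).

Definition unizone : uniz A := (0, 1).

Lemma unizP (u v : uniz A) : u.1 = v.1 -> u.2 = v.2 -> u = v.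
Proof. by case: u v => [? ?] [? ?] /= -> ->. Qed.

Fact unizmulA : associative unizmul.
Proof.
move=> [x a] [y b] [z c]; apply: unizP; rewrite /= ?mulrA //.
rewrite !cmulDl !cmulDr !scalerDr !cmulZl !cmulZr !cmulA !scalerA.
rewrite [c * a]mulrC [c * b]mulrC.
by rewrite [LHS](AC (3*3*1) (1*4*2*5*3*6*7))%AC [RHS](AC (4*3) (1*2*3*4*5*6*7))%AC.
Qed.
Fact uniz1l : left_id unizone unizmul.
Proof.
by move=> [x a]; apply: unizP; rewrite /= ?mul1r // cmul0l scale1r scaler0 add0r addr0.
Qed.
Fact uniz1r : right_id unizone unizmul.
Proof.
by move=> [x a]; apply: unizP; rewrite /= ?mulr1 // cmul0r scale1r scaler0 !add0r.
Qed.
Fact unizDl : left_distributive unizmul +%R.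
Proof.
move=> [x a] [y b] [z c]; apply: unizP; rewrite /= ?mulrDl //.
rewrite cmulDl scalerDl scalerDr.
by rewrite [LHS](AC (2*2*2) (1*3*5*2*4*6))%AC [RHS](AC (3*3) (1*2*3*4*5*6))%AC.
Qed.
Fact unizDr : right_distributive unizmul +%R.
Proof.
move=> [x a] [y b] [z c]; apply: unizP; rewrite /= ?mulrDr //.
rewrite cmulDr scalerDl scalerDr.
by rewrite [LHS](AC (2*2*2) (1*3*5*2*4*6))%AC [RHS](AC (3*3) (1*2*3*4*5*6))%AC.
Qed.
Fact uniz1n0 : unizone != 0.
Proof. by apply/eqP => /(congr1 snd)/eqP; rewrite oner_eq0. Qed.

HB.instance Definition _ := GRing.Zmodule_isNzRing.Build (uniz A)
  unizmulA uniz1l uniz1r unizDl unizDr uniz1n0.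

Fact unizscaleAl (a : R[i]) (u v : uniz A) : a *: (u * v) = (a *: u) * v.
Proof.
case: u v => [x b] [y c]; apply: unizP => /=; last by rewrite /GRing.scale/= mulrA.
rewrite !scalerDr cmulZl; congr (_ + _ + _); first by rewrite scalerA.
by rewrite !scalerA mulrC.
Qed.
HB.instance Definition _ :=
  GRing.Lmodule_isLalgebra.Build R[i] (uniz A) unizscaleAl.
Fact unizscaleAr (a : R[i]) (u v : uniz A) : a *: (u * v) = u * (a *: v).
Proof.
case: u v => [x b] [y c]; apply: unizP => /=; last first.
  by rewrite /GRing.scale/= mulrCA.
rewrite !scalerDr cmulZr; congr (_ + _ + _); first by rewrite !scalerA mulrC.
by rewrite scalerA.
Qed.
HB.instance Definition _ :=
  GRing.Lalgebra_isAlgebra.Build R[i] (uniz A) unizscaleAr.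

End Unitization.

Definition ustar {R : realType} {A : cstarAlgType R} (u : uniz A) : uniz A :=
  (cstar u.1, u.2^*%C).
Definition inA {R : realType} {A : cstarAlgType R} (a : A) : uniz A := (a, 0).
Definition uact {R : realType} {A : cstarAlgType R} (u : uniz A) (x : A) : A :=
  cmul u.1 x + u.2 *: x.
Definition opn {R : realType} {A : cstarAlgType R} (u : uniz A) : R :=
  sup [set cnorm (uact u x) | x in [set x | cnorm x <= 1]].
(** The scalar part is the value of the character that kills A. Without the maximum this would fail
    to be a norm when A already has a unit p: the operator (-p, 1) is 0 on A. *)
Definition un {R : realType} {A : cstarAlgType R} (u : uniz A) : R :=
  Num.max (opn u) (normc u.2).

Section UnitizationTheory.
Context {R : realType} {A : cstarAlgType R}.
Implicit Types (u v w : uniz A) (x y a b : A) (l : R[i]).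

Lemma ustarK u : ustar (ustar u) = u.
Proof. by apply: unizP; rewrite /= ?cstarK // conjcK. Qed.

Lemma ustarD u v : ustar (u + v) = ustar u + ustar v.
Proof. by apply: unizP; rewrite /= ?cstarD // rmorphD. Qed.

Lemma ustarZ l u : ustar (l *: u) = l^*%C *: ustar u.
Proof. by apply: unizP; rewrite /= ?cstarZ // /GRing.scale/= rmorphM. Qed.

Lemma ustarN u : ustar (- u) = - ustar u.
Proof. by rewrite -scaleN1r ustarZ rmorphN1 scaleN1r. Qed.

Lemma ustarB u v : ustar (u - v) = ustar u - ustar v.
Proof. by rewrite ustarD ustarN. Qed.

Lemma ustar0 : ustar 0 = 0 :> uniz A.
Proof. by apply: unizP; [exact: cstar0|exact: conjc0]. Qed.

Lemma ustar1 : ustar 1 = 1 :> uniz A.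
Proof. by apply: unizP; [exact: cstar0|exact: conjc1]. Qed.

Lemma ustarM u v : ustar (u * v) = ustar v * ustar u.
Proof.
apply: unizP => /=; last by rewrite rmorphM mulrC.
by rewrite !cstarD cstarM !cstarZ -!addrA [X in _ + X]addrC.
Qed.

Lemma ustar_sum I (r : seq I) (P : pred I) (F : I -> uniz A) :
  ustar (\sum_(i <- r | P i) F i) = \sum_(i <- r | P i) ustar (F i).
Proof. exact: (big_morph _ ustarD ustar0). Qed.

Lemma inAD a b : inA (a + b) = inA a + inA b.
Proof. by apply: unizP; rewrite //= addr0. Qed.

Lemma inA0 : inA (0 : A) = 0. Proof. by []. Qed.

Lemma inAN a : inA (- a) = - inA a.
Proof. by apply: unizP; rewrite //= oppr0. Qed.

Lemma inAB a b : inA (a - b) = inA a - inA b.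
Proof. by rewrite inAD inAN. Qed.

Lemma inAZ l a : inA (l *: a) = l *: inA a.
Proof. by apply: unizP; rewrite //= /GRing.scale/= mulr0. Qed.

Lemma inA_sum I (r : seq I) (P : pred I) (F : I -> A) :
  inA (\sum_(i <- r | P i) F i) = \sum_(i <- r | P i) inA (F i).
Proof. exact: (big_morph _ inAD inA0). Qed.

Lemma inAM a b : inA (cmul a b) = inA a * inA b.
Proof. by apply: unizP; rewrite /= ?scale0r ?addr0 ?mulr0. Qed.

Lemma inA_star a : inA (cstar a) = ustar (inA a).
Proof. by apply: unizP => //; rewrite /ustar [RHS]conjc0. Qed.

Lemma inAact u a : inA (uact u a) = u * inA a.
Proof. by apply: unizP; rewrite /= ?mulr0 // scale0r addr0. Qed.

Lemma inAI : injective (@inA R A).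
Proof. by move=> x y [->]. Qed.

Lemma inAE u : u.2 = 0 -> u = inA u.1.
Proof. by case: u => x l /= ->. Qed.

Lemma unizE u : u = inA u.1 + u.2 *: 1.
Proof.
apply: unizP; rewrite /= ?scaler0 ?addr0 // /GRing.scale/= mulr1 ?add0r //.
Qed.

Lemma cnormB a b : cnorm (a - b) = cnorm (b - a).
Proof. by rewrite -cnormN opprB. Qed.

Lemma uact_bound u x : cnorm (uact u x) <= (cnorm u.1 + normc u.2) * cnorm x.
Proof.
by rewrite (le_trans (cnormD _ _)) // mulrDl cnormZ lerD // cnorm_mul.
Qed.

Lemma uactZ u l x : uact u (l *: x) = l *: uact u x.
Proof. by rewrite /uact cmulZr scalerDr !scalerA mulrC. Qed.

Lemma opn_ge u x : cnorm x <= 1 -> cnorm (uact u x) <= opn u.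
Proof.
move=> x1; apply: ub_le_sup; last by exists x.
exists (cnorm u.1 + normc u.2) => _ [y /= y1 <-].
rewrite (le_trans (uact_bound u y)) // ler_piMr //.
by rewrite addr_ge0 ?cnorm_ge0 ?normc_ge0.
Qed.

Lemma opn_ge0 u : 0 <= opn u.
Proof. by apply: le_trans (cnorm_ge0 _) (opn_ge (x := 0) _ _); rewrite cnorm0. Qed.

Lemma uact_le u x : cnorm (uact u x) <= opn u * cnorm x.
Proof.
have [->|x0] := eqVneq x 0.
  by rewrite /uact cmul0r scaler0 addr0 cnorm0 mulr0.
have nx : 0 < cnorm x by rewrite cnorm_gt0.
have -> : x = (cnorm x)%:C *: ((cnorm x)^-1%:C *: x).
  by rewrite scalerA -rmorphM divff ?gt_eqF // scale1r.
rewrite uactZ !cnormZ normc_real (gtr0_norm nx) mulrCA ler_pM2l //.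
rewrite normc_real gtr0_norm ?invr_gt0 // mulVf ?gt_eqF // mulr1.
by apply: opn_ge; rewrite cnormZ normc_real gtr0_norm ?invr_gt0 // mulVf ?gt_eqF.
Qed.

Lemma un_ge0 u : 0 <= un u.
Proof. by rewrite /un le_max opn_ge0. Qed.

Lemma un_act u x : cnorm (uact u x) <= un u * cnorm x.
Proof.
by rewrite (le_trans (uact_le u x)) // ler_wpM2r ?cnorm_ge0 // /un le_max lexx.
Qed.

Lemma un_snd u : normc u.2 <= un u.
Proof. by rewrite /un le_max lexx orbT. Qed.

Lemma un_le u c : 0 <= c -> normc u.2 <= c ->
  (forall x, cnorm (uact u x) <= c * cnorm x) -> un u <= c.
Proof.
move=> c0 u2 H; rewrite /un ge_max u2 andbT; apply: ge_sup.
  by exists (cnorm (uact u 0)), 0 => //=; rewrite cnorm0.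
by move=> _ [x /= x1 <-]; rewrite (le_trans (H x)) // ler_piMr.
Qed.

Lemma unD u v : un (u + v) <= un u + un v.
Proof.
apply: un_le; rewrite ?addr_ge0 ?un_ge0 //.
  by rewrite (le_trans (le_normcD _ _)) // lerD ?un_snd.
move=> x; have -> : uact (u + v) x = uact u x + uact v x.
  by rewrite /uact cmulDl scalerDl addrACA.
by rewrite (le_trans (cnormD _ _)) // mulrDl lerD ?un_act.
Qed.

Lemma uactM u v x : uact (u * v) x = uact u (uact v x).
Proof. by apply: inAI; rewrite !inAact mulrA. Qed.

Lemma unM u v : un (u * v) <= un u * un v.
Proof.
apply: un_le; rewrite ?mulr_ge0 ?un_ge0 //.
  by rewrite normcM ler_pM ?normc_ge0 ?un_snd.
move=> x; rewrite uactM (le_trans (un_act _ _)) // -mulrA ler_wpM2l ?un_ge0 //.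
exact: un_act.
Qed.

Lemma unZ_le l u : un (l *: u) <= normc l * un u.
Proof.
apply: un_le; rewrite ?mulr_ge0 ?un_ge0 ?normc_ge0 //.
  by rewrite /= /GRing.scale/= normcM ler_wpM2l ?normc_ge0 ?un_snd.
move=> x; have -> : uact (l *: u) x = l *: uact u x.
  by apply: inAI; rewrite inAZ !inAact -scalerAl.
by rewrite cnormZ -mulrA ler_wpM2l ?normc_ge0 ?un_act.
Qed.

Lemma unN u : un (- u) = un u.
Proof.
have le v : un (- v) <= un v.
  rewrite -scaleN1r (le_trans (unZ_le _ _)) // normcN /=.
  by rewrite -[X in normc X](rmorph1 (real_complex R)) normc_real normr1 mul1r.
by apply/eqP; rewrite eq_le le /= -{1}[u]opprK le.
Qed.

Lemma unB u v : un (u - v) = un (v - u).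
Proof. by rewrite -unN opprB. Qed.

Lemma un_triangle w u v : un (u - v) <= un (u - w) + un (w - v).
Proof. by apply: le_trans (unD _ _); rewrite addrA subrK. Qed.

Lemma un_triD u v : un u <= un (u - v) + un v.
Proof. by apply: le_trans (unD _ _); rewrite subrK. Qed.

Lemma un0 : un (0 : uniz A) = 0.
Proof.
apply/eqP; rewrite eq_le un_ge0 andbT.
by rewrite -(scale0r (0 : uniz A)) (le_trans (unZ_le _ _)) // normc0 mul0r.
Qed.

(** The C*-identity passes from A to operators on A, because |u x|^2 is the norm of x^* (u^* u
    x). *)
Lemma un_star_sqr u : un u ^+ 2 <= un (ustar u * u).
Proof.
set c := un (_ * _); have c0 : 0 <= c by exact: un_ge0.
rewrite -(sqr_sqrtr c0) ler_pXn2r ?nnegrE ?un_ge0 ?sqrtr_ge0 //.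
apply: un_le => [||x]; rewrite ?sqrtr_ge0 //.
  rewrite -(@ler_pXn2r _ 2) ?nnegrE ?sqrtr_ge0 ?normc_ge0 // sqr_sqrtr //.
  by apply: le_trans (un_snd _); rewrite /= normcM normc_conj.
rewrite -(@ler_pXn2r _ 2) ?nnegrE ?mulr_ge0 ?sqrtr_ge0 ?cnorm_ge0 //.
rewrite exprMn sqr_sqrtr // -cnorm_starmul.
have -> : cmul (cstar (uact u x)) (uact u x) = cmul (cstar x) (uact (ustar u * u) x).
  by apply: inAI; rewrite !inAM !inA_star !inAact ustarM !mulrA.
rewrite (le_trans (cnorm_mul _ _)) // cnorm_star expr2 mulrCA.
by rewrite ler_wpM2l ?cnorm_ge0 // un_act.
Qed.

Lemma un_star u : un (ustar u) = un u.
Proof.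
have le v : un v <= un (ustar v).
  have := le_trans (un_star_sqr v) (unM _ _); rewrite expr2.
  have [->|v0] := eqVneq (un v) 0; first by rewrite un_ge0.
  by rewrite ler_pM2r // lt_def v0 un_ge0.
by apply/eqP; rewrite eq_le le andbT; have := le (ustar u); rewrite ustarK.
Qed.

Lemma un_starmul u : un (ustar u * u) = un u ^+ 2.
Proof.
apply/eqP; rewrite eq_le un_star_sqr andbT (le_trans (unM _ _)) //.
by rewrite un_star expr2.
Qed.

Lemma un_mulstar u : un (u * ustar u) = un u ^+ 2.
Proof. by rewrite -{1}[u]ustarK un_starmul un_star. Qed.

Lemma un_inA a : un (inA a) = cnorm a.
Proof.
apply/eqP; rewrite eq_le; apply/andP; split.
  apply: un_le => [||x]; rewrite ?cnorm_ge0 //= ?normc0 ?cnorm_ge0 //.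
  by rewrite /uact /= scale0r addr0 cnorm_mul.
have := un_act (inA a) (cstar a); rewrite /uact /= scale0r addr0.
have -> : cmul a (cstar a) = cmul (cstar (cstar a)) (cstar a) by rewrite cstarK.
rewrite cnorm_starmul expr2 cnorm_star.
have [/eqP|a0] := eqVneq (cnorm a) 0.
  by rewrite cnorm_eq0 => /eqP->; rewrite cnorm0 un_ge0.
by rewrite ler_pM2r // lt_def a0 cnorm_ge0.
Qed.

Lemma un1 : un (1 : uniz A) = 1.
Proof.
apply/eqP; rewrite eq_le; apply/andP; split.
  apply: un_le => [||x]; rewrite /= ?normc1 //.
  by rewrite /uact /= cmul0l add0r scale1r mul1r.
by apply: le_trans (un_snd _); rewrite /= normc1.
Qed.

Lemma unZ l u : un (l *: u) = normc l * un u.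
Proof.
apply/eqP; rewrite eq_le unZ_le /=.
have [->|l0] := eqVneq l 0; first by rewrite normc0 mul0r un_ge0.
have nl : 0 < normc l by rewrite lt_def normc_ge0 normc_eq0 l0.
rewrite -ler_pdivlMl // -{1}[u](scale1r) -(mulVf l0) -scalerA.
by rewrite (le_trans (unZ_le _ _)) // normcV.
Qed.

Lemma un_fst u : cnorm u.1 <= 2 * un u.
Proof.
rewrite -un_inA.
have -> : inA u.1 = u - u.2 *: 1 by rewrite {2}(unizE u) addrK.
rewrite (le_trans (unD _ _)) // unN unZ un1 mulr1.
by have := un_snd u; lra.
Qed.

Lemma un_eq0 u : un u = 0 -> u = 0.
Proof.
move=> u0; have le0 := un_snd u; rewrite u0 in le0.
apply: unizP => /=; apply/eqP; last first.
  by rewrite -normc_eq0 eq_le normc_ge0 andbT.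
by rewrite -cnorm_eq0 eq_le cnorm_ge0 andbT; have := un_fst u; rewrite u0 mulr0.
Qed.

Lemma un_sum I (r : seq I) (P : pred I) (F : I -> uniz A) :
  un (\sum_(i <- r | P i) F i) <= \sum_(i <- r | P i) un (F i).
Proof.
elim/big_rec2: _ => [|i c u _ le]; first by rewrite un0.
by rewrite (le_trans (unD _ _)) // lerD2l.
Qed.

End UnitizationTheory.

(** * Completeness of the unitization *)

Section Complete.
Context {R : realType}.

Lemma gtc0E (e : R[i]) : 0 < e -> exists2 r : R, 0 < r & e = r%:C.
Proof.
by case: e => r i; rewrite ltcE /= => /andP[/eqP -> r0]; exists r.
Qed.

Lemma normc_Re (a : R[i]) : `|complex.Re a| <= normc a.
Proof. by rewrite -lecR; exact: normc_ge_Re. Qed.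

Lemma normc_Im (a : R[i]) : `|complex.Im a| <= normc a.
Proof.
case: a => x y; have := normc_Re (Complex y x).
by rewrite /normc /= addrC.
Qed.

Lemma normc_ReIm (a : R[i]) : normc a <= `|complex.Re a| + `|complex.Im a|.
Proof.
case: a => x y /=; rewrite /normc -(@ler_pXn2r _ 2) ?nnegrE ?addr_ge0 ?sqrtr_ge0 //.
rewrite sqr_sqrtr ?addr_ge0 ?sqr_ge0 //.
rewrite -(real_normK (num_real x)) -(real_normK (num_real y)).
by have := normr_ge0 x; have := normr_ge0 y; nra.
Qed.

Lemma cstar_complete (A : cstarAlgType R) (u : nat -> A) :
  (forall e : R, 0 < e -> exists N, forall m n, (N <= m)%N -> (N <= n)%N ->
    cnorm (u m - u n) < e) ->
  exists l : A, forall e : R, 0 < e -> exists N, forall n, (N <= n)%N ->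
    cnorm (u n - l) < e.
Proof.
move=> cau.
have cv : cvg (u @ \oo).
  apply/cauchy_cvgP/cauchy_exP => e /gtc0E[r r0 ->].
  have [N H] := cau r r0; exists (u N); exists N => // n /= Nn.
  rewrite -ball_normE /= cnormE ltcR; exact: H.
exists (lim (u @ \oo)) => e e0.
have e0' : 0 < e%:C :> R[i] by rewrite ltcR.
have /cvgrPdist_lt /(_ _ e0') [N _ H] := cv.
by exists N => n Nn; have := H n Nn; rewrite /= cnormE ltcR cnormB.
Qed.

Lemma real_complete (u : nat -> R) :
  (forall e : R, 0 < e -> exists N, forall m n, (N <= m)%N -> (N <= n)%N ->
    `|u m - u n| < e) ->
  exists l : R, forall e : R, 0 < e -> exists N, forall n, (N <= n)%N ->
    `|u n - l| < e.
Proof.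
move=> cau.
have cv : cvg (u @ \oo).
  apply/cauchy_cvgP/cauchy_exP => r r0.
  have [N H] := cau r r0; exists (u N); exists N => // n /= Nn.
  rewrite -ball_normE /=; exact: H.
exists (lim (u @ \oo)) => e e0.
have /cvgrPdist_lt /(_ _ e0) [N _ H] := cv.
by exists N => n Nn; have := H n Nn; rewrite /= distrC.
Qed.

Lemma complex_complete (u : nat -> R[i]) :
  (forall e : R, 0 < e -> exists N, forall m n, (N <= m)%N -> (N <= n)%N ->
    normc (u m - u n) < e) ->
  exists l : R[i], forall e : R, 0 < e -> exists N, forall n, (N <= n)%N ->
    normc (u n - l) < e.
Proof.
move=> cau.
have [|x xP] := @real_complete (fun n => complex.Re (u n)).
  move=> e e0; have [N H] := cau e e0; exists N => m n Nm Nn.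
  by apply: le_lt_trans (H m n Nm Nn); rewrite -raddfB normc_Re.
have [|y yP] := @real_complete (fun n => complex.Im (u n)).
  move=> e e0; have [N H] := cau e e0; exists N => m n Nm Nn.
  by apply: le_lt_trans (H m n Nm Nn); rewrite -raddfB normc_Im.
exists (Complex x y) => e e0; have e20 : 0 < e / 2 by rewrite divr_gt0.
have [N1 H1] := xP _ e20; have [N2 H2] := yP _ e20.
exists (maxn N1 N2) => n; rewrite geq_max => /andP[n1 n2].
apply: le_lt_trans (normc_ReIm _) _.
have := H1 n n1; have := H2 n n2; case: (u n) => a b /=; lra.
Qed.

Lemma uniz_complete (A : cstarAlgType R) (u : nat -> uniz A) :
  (forall e : R, 0 < e -> exists N, forall m n, (N <= m)%N -> (N <= n)%N ->
    un (u m - u n) < e) ->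
  exists l : uniz A, forall e : R, 0 < e -> exists N, forall n, (N <= n)%N ->
    un (u n - l) < e.
Proof.
move=> cau.
have [|x xP] := @cstar_complete A (fun n => (u n).1).
  move=> e e0; have e20 : 0 < e / 2 by rewrite divr_gt0.
  have [N H] := cau _ e20; exists N => m n Nm Nn.
  by have := H m n Nm Nn; have := un_fst (u m - u n) => /=; lra.
have [|l lP] := @complex_complete (fun n => (u n).2).
  move=> e e0; have [N H] := cau _ e0; exists N => m n Nm Nn.
  by apply: le_lt_trans (H m n Nm Nn); exact: (un_snd (u m - u n)).
exists (x, l) => e e0; have e20 : 0 < e / 2 by rewrite divr_gt0.
have [N1 H1] := xP _ e20; have [N2 H2] := lP _ e20.
exists (maxn N1 N2) => n; rewrite geq_max => /andP[n1 n2].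
rewrite (unizE (u n - _)); apply: le_lt_trans (unD _ _) _.
rewrite un_inA unZ un1 mulr1 /=.
by have := H1 n n1; have := H2 n n2; lra.
Qed.

End Complete.

(** * Square roots, positivity and inverses *)

Section FunctionalCalculus.
Context {R : realType} {A : cstarAlgType R}.
Implicit Types (u v w h y z : uniz A).

Definition usa u := ustar u = u.

(* The operator norm of [t - u] is at most [t]: for self-adjoint [u] this is
   positivity together with [u <= 2 t]. *)
Definition unn (t : R) u := un (t%:C *: 1 - u) <= t.

Lemma un_lim_eq u v : (forall e : R, 0 < e -> un (u - v) <= e) -> u = v.
Proof.
move=> H; apply/eqP; rewrite -subr_eq0; apply/eqP/un_eq0/eqP.
rewrite eq_le un_ge0 andbT leNgt; apply/negP => p.
by have := H (un (u - v) / 2) (divr_gt0 p (ltr0Sn _ _)); lra.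
Qed.

Lemma usa_lim (f : nat -> uniz A) l : (forall n, usa (f n)) ->
  (forall e : R, 0 < e -> exists N, forall n, (N <= n)%N -> un (f n - l) < e) ->
  usa l.
Proof.
move=> fs fl; apply: un_lim_eq => e e0.
have [|N H] := fl (e / 2); first by rewrite divr_gt0.
have := H N (leqnn N) => lt.
rewrite (le_trans (un_triangle (f N) _ _)) //.
have -> : ustar l - f N = - ustar (f N - l) by rewrite ustarB fs opprB.
by rewrite unN un_star; lra.
Qed.

Lemma comm_lim (f : nat -> uniz A) l y : (forall n, GRing.comm y (f n)) ->
  (forall e : R, 0 < e -> exists N, forall n, (N <= n)%N -> un (f n - l) < e) ->
  GRing.comm y l.
Proof.
move=> fs fl; apply: un_lim_eq => e e0.
have p : 0 < un y + 1 by rewrite ltr_wpDl ?un_ge0.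
have [|N H] := fl (e / (2 * (un y + 1))); first by rewrite divr_gt0 // mulr_gt0.
have := H N (leqnn N) => lt.
rewrite (le_trans (un_triangle (y * f N) _ _)) //.
have -> : y * l - y * f N = - (y * (f N - l)) by rewrite mulrBr opprB.
rewrite fs -mulrBl unN.
have := unM y (f N - l); have := unM (f N - l) y.
have h : (un y + 1) * un (f N - l) <= e / 2.
  rewrite -ler_pdivlMl //; apply: le_trans (ltW lt) _.
  by rewrite invfM mulrA mulrC.
by have := un_ge0 (f N - l); lra.
Qed.

Lemma commBr u v w : GRing.comm u v -> GRing.comm u w -> GRing.comm u (v - w).
Proof. by move=> uv uw; apply: commrD => //; apply: commrN. Qed.

Lemma commZr l u v : GRing.comm u v -> GRing.comm u (l *: v).
Proof. by rewrite /GRing.comm => uv; rewrite -scalerAl -scalerAr uv. Qed.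

Lemma commZ1 l u : GRing.comm u (l *: 1).
Proof. exact/commZr/commr1. Qed.

Lemma usaD u v : usa u -> usa v -> usa (u + v).
Proof. by rewrite /usa ustarD => -> ->. Qed.

Lemma usaN u : usa u -> usa (- u).
Proof. by rewrite /usa ustarN => ->. Qed.

Lemma usaB u v : usa u -> usa v -> usa (u - v).
Proof. by move=> us vs; apply: usaD => //; apply: usaN. Qed.

Lemma usaZ (r : R) u : usa u -> usa (r%:C *: u).
Proof. by rewrite /usa ustarZ conjc_real => ->. Qed.

Lemma usaM u v : usa u -> usa v -> GRing.comm u v -> usa (u * v).
Proof. by rewrite /usa ustarM => -> -> ->. Qed.

Lemma usa1 : usa 1. Proof. exact: ustar1. Qed.

Lemma usa_sum I (r : seq I) (P : pred I) (F : I -> uniz A) :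
  (forall i, P i -> usa (F i)) -> usa (\sum_(i <- r | P i) F i).
Proof. by move=> H; rewrite /usa ustar_sum; apply: eq_bigr => i /H. Qed.

Lemma usa_starmul u : usa (ustar u * u).
Proof. by rewrite /usa ustarM ustarK. Qed.

Lemma unZr (r : R) u : 0 <= r -> un (r%:C *: u) = r * un u.
Proof. by move=> r0; rewrite unZ normc_real ger0_norm. Qed.

Lemma un_sqr u : usa u -> un (u * u) = un u ^+ 2.
Proof. by move=> us; rewrite -un_starmul us. Qed.

Section SqrtIteration.
Variable c : uniz A.
Hypothesis c1 : un c <= 1.

(** A limit r satisfies r = (c + r^2) / 2, that is (1 - r)^2 = 1 - c. *)
Fixpoint sqit n : uniz A :=
  if n is m.+1 then (2^-1)%:C *: (c + sqit m * sqit m) else 0.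

(** A majorant: the same iteration run on the number [un c]. Its increments dominate those of
    [sqit], so convergence becomes a matter of one monotone real sequence. *)
Fixpoint sqrho n : R := if n is m.+1 then 2^-1 * (un c + sqrho m * sqrho m) else 0.

Lemma sqrho_ge0 n : 0 <= sqrho n.
Proof. by case: n => //= n; rewrite mulr_ge0 // addr_ge0 ?un_ge0 // -expr2 sqr_ge0. Qed.

Lemma sqrho_le n : sqrho n <= un c.
Proof.
elim: n => [|n IH] /=; first exact: un_ge0.
have h : sqrho n * sqrho n <= un c.
  apply: (le_trans _ IH); rewrite ler_piMl ?sqrho_ge0 //; exact: (le_trans IH c1).
by lra.
Qed.

Lemma sqrho_mono n : sqrho n <= sqrho n.+1.
Proof.
elim: n => [|n IH]; first exact: sqrho_ge0.
change (2^-1 * (un c + sqrho n * sqrho n) <= 2^-1 * (un c + sqrho n.+1 * sqrho n.+1)).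
by rewrite ler_pM2l // lerD2l ler_pM ?sqrho_ge0.
Qed.

Lemma sqit_le n : un (sqit n) <= sqrho n.
Proof.
elim: n => [|n IH] /=; first by rewrite un0.
rewrite unZr // ler_pM2l // (le_trans (unD _ _)) // lerD2l.
by rewrite (le_trans (unM _ _)) // ler_pM // un_ge0.
Qed.

Lemma sqit_step n : un (sqit n.+1 - sqit n) <= sqrho n.+1 - sqrho n.
Proof.
elim: n => [|n IH].
  rewrite /= !mulr0 !addr0 !subr0 unZr //.
have -> : sqit n.+2 - sqit n.+1 = (2^-1)%:C *: (c + sqit n.+1 * sqit n.+1) - (2^-1)%:C *: (c + sqit n * sqit n) by [].
have -> : sqrho n.+2 - sqrho n.+1 = 2^-1 * (un c + sqrho n.+1 * sqrho n.+1) - 2^-1 * (un c + sqrho n * sqrho n) by [].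
rewrite -scalerBr -mulrBr unZr // ler_pM2l // opprD addrACA subrr add0r.
have -> : sqit n.+1 * sqit n.+1 - sqit n * sqit n =
    (sqit n.+1 - sqit n) * sqit n.+1 + sqit n * (sqit n.+1 - sqit n).
  by rewrite mulrBl mulrBr addrA subrK.
rewrite (le_trans (unD _ _)) //.
have -> : un c + sqrho n.+1 * sqrho n.+1 - (un c + sqrho n * sqrho n) =
   (sqrho n.+1 - sqrho n) * sqrho n.+1 + sqrho n * (sqrho n.+1 - sqrho n) by ring.
apply: lerD; rewrite (le_trans (unM _ _)) // ler_pM ?un_ge0 // ?sqit_le //.
Qed.

Lemma sqit_diff n k : un (sqit (n + k) - sqit n) <= sqrho (n + k) - sqrho n.
Proof.
elim: k => [|k IH]; first by rewrite addn0 !subrr un0.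
rewrite addnS (le_trans (un_triangle (sqit (n + k)) _ _)) //.
by have := sqit_step (n + k); lra.
Qed.

(** Monotone and bounded by 1: every failure of the Cauchy property adds at least [e], and about 2 /
    e of them exceed the bound. *)
Lemma sqrho_cauchy e : 0 < e -> exists N, forall n k, (N <= n)%N ->
  sqrho (n + k) - sqrho n < e.
Proof.
move=> e0; apply: contrapT => /forallNP H.
have step N : exists M, sqrho N + e <= sqrho M.
  have /existsNP[n /existsNP[k /not_implyP[Nn /negP]]] := H N.
  rewrite -leNgt => le; exists (n + k)%N.
  have : sqrho N <= sqrho n.
    rewrite -(subnKC Nn); elim: (n - N)%N => [|j IH]; rewrite ?addn0 // addnS.
    exact: le_trans IH (sqrho_mono _).
  lra.
have big k : exists M, k%:R * e <= sqrho M.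
  elim: k => [|k [M IH]]; first by exists 0%N; rewrite mul0r.
  have [M' H'] := step M; exists M'; apply: le_trans H'.
  by rewrite -natr1 mulrDl mul1r lerD2r.
have [M HM] := big (Num.bound (2 / e)).
have := sqrho_le M; have := archi_boundP (x := 2 / e).
rewrite divr_ge0 ?(ltW e0) // => /(_ isT); rewrite ltr_pdivrMr //.
by move=> h1 h2; have := le_lt_trans (le_trans HM h2) (le_lt_trans c1 (ltr1n R 2)); move/(lt_trans h1); rewrite ltxx.
Qed.

(** The majorant converges even for [un c = 1], the boundary case on which [unn_sqrt] depends.
    Self-adjointness and commutation pass to r because it is a limit of real polynomials in c. *)
Lemma usqrt_lim : exists r : uniz A,
  [/\ un r <= un c, (1 - r) * (1 - r) = 1 - c, usa c -> usa r &
      forall y, GRing.comm y c -> GRing.comm y r].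
Proof.
have [|r rP] := @uniz_complete _ _ sqit.
  move=> e e0; have [N H] := sqrho_cauchy e0; exists N.
  have H2 m n : (N <= m)%N -> (m <= n)%N -> un (sqit n - sqit m) < e.
    move=> Nm mn; rewrite -(subnKC mn); apply: le_lt_trans (sqit_diff _ _) _.
    exact: H.
  move=> m n Nm Nn; case: (leqP m n) => [mn|/ltnW nm]; last exact: H2.
  by rewrite unB; exact: H2.
exists r; split.
- apply/ler_addgt0Pr => e e0; have [N /(_ N (leqnn N)) H] := rP e e0.
  have := un_triD r (sqit N); rewrite unB => le.
  have := sqit_le N; have := sqrho_le N; lra.
- have -> : (1 - r) * (1 - r) = 1 - (r + r - r * r).
      ncring.
  congr (1 - _); apply: un_lim_eq => e e0.
  have d0 : 0 < Num.min (e / 8) 1 by rewrite lt_min ltr01 andbT divr_gt0.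
  have [N H] := rP _ d0; have HN := H N (leqnn N); have HN1 := H N.+1 (leqnSn N).
  move: (ltW HN) (ltW HN1); rewrite !le_min => /andP[n1 n2] /andP[n3 n4].
  have cE : c = sqit N.+1 + sqit N.+1 - sqit N * sqit N.
    rewrite /= -scalerDl -rmorphD.
    have -> : (2^-1 + 2^-1 : R) = 1 by field.
    by rewrite scale1r addrK.
  rewrite {1}cE.
  have -> : r + r - r * r - (sqit N.+1 + sqit N.+1 - sqit N * sqit N) =
    ((r - sqit N.+1) + (r - sqit N.+1)) + ((sqit N - r) * r + sqit N * (sqit N - r)).
    ncring.
  have rb : un r <= 2.
    have := un_triD r (sqit N); rewrite unB.
    by have := le_trans (sqit_le N) (le_trans (sqrho_le N) c1); lra.
  have sb : un (sqit N) <= 1 := le_trans (sqit_le N) (le_trans (sqrho_le N) c1).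
  have := unD (r - sqit N.+1 + (r - sqit N.+1)) ((sqit N - r) * r + sqit N * (sqit N - r)).
  have := unD (r - sqit N.+1) (r - sqit N.+1).
  have := unD ((sqit N - r) * r) (sqit N * (sqit N - r)).
  have := unM (sqit N - r) r; have := unM (sqit N) (sqit N - r).
  rewrite (unB r (sqit N.+1)); have := un_ge0 r; have := un_ge0 (sqit N).
  have := un_ge0 (sqit N - r) => p0 s0 q0.
  have h1 : un (sqit N - r) * un r <= (e / 8) * 2 by apply: ler_pM.
  have h2 : un (sqit N) * un (sqit N - r) <= 1 * (e / 8) by apply: ler_pM.
  lra.
- move=> cs; apply: usa_lim rP => n; elim: n => [|n IH] /=; first exact: ustar0.
  apply/usaZ/usaD => //; apply: usaM => //.
- move=> y yc; apply: comm_lim rP => n; elim: n => [|n IH] /=; first exact: commr0.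
  by apply/commZr/commrD => //; apply: commrM.
Qed.

End SqrtIteration.

Definition ii : R[i] := (0 +i* 1)%C.

Lemma ii_conj : ii^*%C = - ii.
Proof. by rewrite /ii /= /GRing.opp /= oppr0. Qed.

Lemma ii_sqr : ii * ii = -1.
Proof. exact: sqr_i. Qed.

Lemma cconjM (a b : R[i]) : (a * b)^*%C = a^*%C * b^*%C.
Proof. exact: rmorphM. Qed.

Lemma scale2C u : 2%:C *: u = u + u.
Proof. by rewrite -[u in RHS]scale1r -scalerDl -[1 + 1]/(2%:R) rmorph_nat. Qed.

Lemma scaleMM (a b : R[i]) u v : (a *: u) * (b *: v) = (a * b) *: (u * v).
Proof. by rewrite -scalerAl -scalerAr scalerA. Qed.

(* [u + i v] and [u - i v] have norm [sqrt s], and [u], [v] are averages of them. *)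
Lemma un_circle (s : R) u v : usa u -> usa v -> GRing.comm u v -> 0 <= s ->
  u * u + v * v = s%:C *: 1 -> un u ^+ 2 <= s /\ un v ^+ 2 <= s.
Proof.
move=> us vs uv s0 E.
have uU : un (u + ii *: v) ^+ 2 = s.
  rewrite -un_starmul ustarD ustarZ us vs ii_conj scaleNr.
  have -> : (u - ii *: v) * (u + ii *: v) = u * u + v * v.
    rewrite mulrBl !mulrDr -!scalerAl -!scalerAr uv scalerA ii_sqr scaleN1r.
    ncring.
  rewrite E. rewrite (unZr 1 s0). by rewrite un1 mulr1.
have uV : un (u - ii *: v) = un (u + ii *: v).
  by rewrite -un_star ustarB ustarZ us vs ii_conj scaleNr opprK.
have hU := un_ge0 (u + ii *: v).
have n2 : normc (2%:C : R[i]) = 2 by rewrite normc_real ger0_norm.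
split.
  have : un (2%:C *: u) <= 2 * un (u + ii *: v).
    have -> : 2%:C *: u = (u + ii *: v) + (u - ii *: v).
      rewrite scale2C; ncring.
    by have := unD (u + ii *: v) (u - ii *: v); lra.
  by rewrite unZ n2 ler_pM2l // => le; rewrite -uU ler_pXn2r ?nnegrE ?un_ge0.
have : un ((2%:C * ii) *: v) <= 2 * un (u + ii *: v).
  have -> : (2%:C * ii) *: v = (u + ii *: v) - (u - ii *: v).
    rewrite -scalerA scale2C; ncring.
  by have := unD (u + ii *: v) (- (u - ii *: v)); rewrite unN; lra.
rewrite unZ normcM n2 -mulrA ler_pM2l // => le.
rewrite -uU ler_pXn2r ?nnegrE ?un_ge0 //; apply: le_trans le.
by rewrite /normc /= expr0n expr1n add0r sqrtr1 mul1r.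
Qed.

Lemma unn_ge (t t' : R) u : 0 <= t -> t <= t' -> unn t u -> unn t' u.
Proof.
move=> t0 tt; rewrite /unn => H.
have -> : t'%:C *: 1 - u = (t' - t)%:C *: 1 + (t%:C *: 1 - u).
  by rewrite addrA -scalerDl -rmorphD subrK.
by rewrite (le_trans (unD _ _)) // unZr ?subr_ge0 // un1; lra.
Qed.

Lemma unnD (t t' : R) u u' : unn t u -> unn t' u' -> unn (t + t') (u + u').
Proof.
rewrite /unn => H H'; rewrite rmorphD scalerDl opprD addrACA.
by rewrite (le_trans (unD _ _)) // lerD.
Qed.

Lemma unn0 t : 0 <= t -> unn t 0.
Proof. by move=> t0; rewrite /unn subr0 unZr // un1 mulr1. Qed.

Lemma unnZ (s t : R) u : 0 <= s -> unn t u -> unn (s * t) (s%:C *: u).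
Proof.
rewrite /unn => s0 H.
by rewrite rmorphM -scalerA -scalerBr unZr // ler_wpM2l.
Qed.

Lemma unn_sum I (r : seq I) (P : pred I) (F : I -> uniz A) (t : I -> R) :
  (forall i, unn (t i) (F i)) ->
  unn (\sum_(i <- r | P i) t i) (\sum_(i <- r | P i) F i).
Proof.
move=> H; elim/big_rec2: _ => [|i u s _ IH]; first exact: unn0.
exact: unnD.
Qed.

(** With 1 - r the root of 1 - u^2, [un_circle] applied to (1 - r)^2 + u^2 = 1 bounds 1 - r, and so
    its square 1 - u^2. *)
Lemma unn_sqr1 u : usa u -> un u <= 1 -> unn 1 (u * u).
Proof.
move=> us u1; have c1 : un (u * u) <= 1 by rewrite un_sqr // expr_le1 ?un_ge0.
have [r [rc rE rs rcomm]] := usqrt_lim c1.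
have uu : GRing.comm u (u * u) by apply: commrM.
have cs : usa (u * u) by apply: usaM.
have r1s : usa (1 - r) by apply: usaB; [exact: usa1|exact: rs].
have [|//|le _] := un_circle (s := 1) r1s us _ ler01.
- exact/commr_sym/commBr/rcomm/uu/commr1.
- by rewrite rE subrK scale1r.
rewrite /unn scale1r -rE (le_trans (unM _ _)) // -expr2 //.
Qed.

Lemma unn_sqr u : usa u -> unn (un u ^+ 2) (u * u).
Proof.
move=> us; have [/un_eq0->|u0] := eqVneq (un u) 0.
  by rewrite mulr0 un0 expr0n; apply: unn0.
have up : 0 < un u by rewrite lt_def u0 un_ge0.
have -> : u * u = (un u ^+ 2)%:C *: (((un u)^-1%:C *: u) * ((un u)^-1%:C *: u)).
  rewrite scaleMM scalerA -!rmorphM.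
  have -> : un u ^+ 2 * ((un u)^-1 * (un u)^-1) = 1 by field.
  by rewrite scale1r.
rewrite -[X in unn X]mulr1; apply: unnZ; rewrite ?sqr_ge0 //.
apply: unn_sqr1; first exact: usaZ.
by rewrite unZr ?invr_ge0 ?un_ge0 // mulVf.
Qed.

(** The root is sqrt t (1 - r) for c = 1 - u / t, and [unn t u] says precisely that this c is a
    contraction. The last clause keeps the roots of elements of A inside A. *)
Lemma unn_sqrt (t : R) u : 0 < t -> usa u -> unn t u -> exists q : uniz A,
  [/\ usa q, q * q = u, unn (Num.sqrt t) q,
    (forall y, GRing.comm y u -> GRing.comm y q) & (u.2 = 0 -> q.2 = 0)].
Proof.
move=> t0 us ut; pose c := t^-1%:C *: (t%:C *: 1 - u).
have tV : t^-1 * t = 1 by rewrite mulVf ?gt_eqF.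
have c1 : un c <= 1.
  by rewrite unZr ?invr_ge0 ?(ltW t0) // mulrC ler_pdivrMr // mul1r.
have cs : usa c by apply/usaZ/usaB => //; apply/usaZ/usa1.
have [r [rc rE rs rcomm]] := usqrt_lim c1.
have st : 0 < Num.sqrt t by rewrite sqrtr_gt0.
have qq : (Num.sqrt t)%:C *: (1 - r) * ((Num.sqrt t)%:C *: (1 - r)) = u.
  rewrite scaleMM rE -rmorphM -expr2 sqr_sqrtr ?ltW // /c scalerBr scalerA.
  by rewrite -rmorphM mulrC tV scale1r opprB addrC subrK.
exists ((Num.sqrt t)%:C *: (1 - r)); split=> //.
- by apply/usaZ/usaB; [exact: usa1|exact: rs].
- rewrite /unn scalerBr opprB addrC subrK unZr ?sqrtr_ge0 //.
  by rewrite ger_pMr // (le_trans rc).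
- move=> y yu; apply/commZr/commBr; first exact: commr1.
  by apply: rcomm; apply/commZr/commBr => //; exact: commZ1.
- by rewrite -{1}qq /= => /eqP; rewrite mulf_eq0 orbb => /eqP.
Qed.

(** Monotonicity of the norm. Let s be the norm of u^2 + v. Then s - u^2 is positive, because (t +
    s) - (s - u^2) = (t - v) + (u^2 + v) has norm at most t + s. With K its root, u^2 + K^2 = s and
    [un_circle] applies. *)
Lemma un_sqr_le_add (t : R) u v : 0 < t -> usa u -> usa v -> unn t v ->
  un (u * u) <= un (u * u + v).
Proof.
move=> t0 us vs vt; set S := _ + v; set s := un S.
have s0 : 0 <= s by exact: un_ge0.
have uus : usa (u * u) by apply: usaM.
have [|||K [Ks KK _ Kc _]] := @unn_sqrt (t + s) (s%:C *: 1 - u * u).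
- by rewrite ltr_wpDr.
- by apply: usaB => //; apply/usaZ/usa1.
- rewrite /unn rmorphD scalerDl opprB.
  have -> : t%:C *: 1 + s%:C *: 1 + (u * u - s%:C *: 1) = (t%:C *: 1 - v) + S.
    rewrite /S; ncring.
  by rewrite (le_trans (unD _ _)) // lerD.
have [|//|le _] := un_circle (s := s) us Ks _ s0.
- by apply: Kc; apply: commBr; [exact: commZ1|exact: commrM].
- by rewrite KK addrC subrK.
by rewrite un_sqr.
Qed.

(* With [w_ij = x_i x_j^*] one has
   [sum_j x_j S x_j^* = sum_ij w_ij^* w_ij = sum_ij (c_ij^2 + d_ij^2)], where
   [c_ij] and [d_ij] are the real and imaginary parts of [w_ij]. *)
Lemma un_sum_starmul n (x : 'I_n -> uniz A) (j0 : 'I_n) :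
  un (x j0) ^+ 2 <= n%:R * un (\sum_i ustar (x i) * x i).
Proof.
set S := \sum_i _; set s := un S.
have s0 : 0 <= s by exact: un_ge0.
have n0 : (0 < n)%N by case: n j0 {x S s s0} => [[]|].
have [j1 _ j1P] := @arg_maxP _ _ _ j0 predT (fun j => un (x j)) isT.
set M := un (x j1) in j1P.
suff le : M ^+ 2 <= n%:R * s.
  by apply: le_trans le; rewrite ler_pXn2r ?nnegrE ?un_ge0 //; exact: j1P.
have M0 : 0 <= M by exact: un_ge0.
have [->|Mn0] := eqVneq M 0; first by rewrite expr0n mulr_ge0.
have Mp : 0 < M by rewrite lt_def Mn0.
suff : M ^+ 4 <= n%:R * s * M ^+ 2.
  by rewrite (_ : M ^+ 4 = M ^+ 2 * M ^+ 2) ?ler_pM2r ?exprn_gt0 //; ring.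
pose w i j := x i * ustar (x j).
have wS i j : ustar (w i j) = w j i by rewrite /w ustarM ustarK.
pose c i j := 2^-1%:C *: (w i j + w j i).
pose d i j := (2^-1%:C * ii) *: (w j i - w i j).
have h2 : (2^-1)%:C * 2%:C = 1 :> R[i] by rewrite -rmorphM mulVf.
have cs i j : usa (c i j) by apply: usaZ; rewrite /usa ustarD !wS addrC.
have ds i j : usa (d i j).
  rewrite /usa ustarZ ustarB !wS cconjM conjc_real ii_conj mulrN scaleNr.
  by rewrite -scalerN opprB.
have E : \sum_j x j * S * ustar (x j) =
    \sum_i \sum_j (c i j * c i j + d i j * d i j).
  have -> : \sum_j x j * S * ustar (x j) = \sum_i \sum_j w i j * w j i.
    rewrite exchange_big /= [RHS]exchange_big /=; apply: eq_bigr => i _.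
    rewrite mulr_sumr mulr_suml; apply: eq_bigr => j _.
    by rewrite /w !mulrA.
  have cd i j : c i j * c i j + d i j * d i j =
      2^-1%:C *: (w i j * w j i + w j i * w i j).
    rewrite /c /d !scaleMM mulrACA ii_sqr mulrN1 scaleNr -scalerBr -!scalerA.
    congr (_ *: _); rewrite -[RHS]scale1r -h2 -scalerA scale2C; congr (_ *: _).
    ncring.
  under [RHS]eq_bigr do (under eq_bigr do rewrite cd scalerDr; rewrite big_split /=).
  rewrite big_split /= [X in _ + X]exchange_big /= -big_split /=.
  apply: eq_bigr => i _; rewrite -big_split /=; apply: eq_bigr => j _.
  by rewrite -scalerDr -scale2C scalerA h2 scale1r.
have -> : M ^+ 4 = un (c j1 j1 * c j1 j1).
  have -> : c j1 j1 = w j1 j1 by rewrite /c -scale2C scalerA h2 scale1r.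
  rewrite un_sqr; last by rewrite /usa wS.
  by rewrite /w un_mulstar -exprM.
pose t : R := un (d j1 j1) ^+ 2 + \sum_(p : 'I_n * 'I_n | p != (j1, j1))
   (un (c p.1 p.2) ^+ 2 + un (d p.1 p.2) ^+ 2).
have t0 : 0 <= t.
  rewrite addr_ge0 ?sqr_ge0 // sumr_ge0 // => p _.
  by rewrite addr_ge0 ?sqr_ge0.
apply: (@le_trans _ _ (un (\sum_j x j * S * ustar (x j)))).
  rewrite E pair_big /= (bigD1 (j1, j1)) //= -addrA.
  apply: (@un_sqr_le_add (t + 1)) => //.
  - by rewrite ltr_wpDl.
  - apply: usaD; first by apply: usaM.
    by apply: usa_sum => p _; apply: usaD; apply: usaM.
  apply: (@unn_ge t) => //; first by rewrite lerDl.
  apply: (unnD (unn_sqr (ds j1 j1))).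
  apply: (@unn_sum _ _ _ (fun p => c p.1 p.2 * c p.1 p.2 + d p.1 p.2 * d p.1 p.2)
    (fun p => un (c p.1 p.2) ^+ 2 + un (d p.1 p.2) ^+ 2)) => p.
  exact: unnD (unn_sqr (cs _ _)) (unn_sqr (ds _ _)).
rewrite (le_trans (un_sum _ _ _)) //.
apply: (@le_trans _ _ (\sum_(j < n) M * s * M)).
  apply: ler_sum => j _; rewrite (le_trans (unM _ _)) // ler_pM ?un_ge0 //.
    by rewrite (le_trans (unM _ _)) // ler_wpM2r //; exact: j1P.
  by rewrite un_star; exact: j1P.
by rewrite sumr_const card_ord -mulr_natl le_eqVlt; apply/orP; left; apply/eqP; ring.
Qed.

(** Kaplansky's theorem that h = u^* u is positive. Let p be the root of h^2, k the root of p, and z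
    = p - h, twice the negative part of h. Then h z = - p z, so (u z)^* (u z) = z h z = - (k z)^2; a
    vanishing sum of two such squares forces k z = 0 by [un_sum_starmul]. Hence z^2 = 2 p z = 0 and
    h = p. *)
Lemma unn_starmul u : unn (un u ^+ 2) (ustar u * u).
Proof.
set h : uniz A := ustar u * u.
have hs : usa h by exact: usa_starmul.
have uh : un h = un u ^+ 2 by exact: un_starmul.
have [u0|un0'] := eqVneq (un u) 0.
  by rewrite u0 expr0n /h (un_eq0 u0) mulr0; apply: unn0.
have up : 0 < un u by rewrite lt_def un0' un_ge0.
have tp : 0 < un h ^+ 2 by rewrite uh !exprn_gt0.
have hhs : usa (h * h) by apply: usaM.
have [p [ps pp pn pc _]] := unn_sqrt tp hhs (unn_sqr hs).
rewrite sqrtr_sqr ger0_norm ?un_ge0 // in pn.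
have hp : GRing.comm h p by apply: pc; apply: commrM.
have uh0 : 0 < un h by rewrite uh exprn_gt0.
have [k [ks kk _ kc _]] := unn_sqrt uh0 ps pn.
suff -> : h = p by rewrite -uh.
pose z : uniz A := p - h.
have zs : usa z by apply: usaB.
have pz : GRing.comm p z by apply: commBr => //; exact: commr_sym.
have zk : GRing.comm z k by apply: kc; exact: commr_sym.
have hz : h * z = - (p * z).
  apply/eqP; rewrite -addr_eq0 -mulrDl /z mulrDl !mulrBr pp hp; apply/eqP.
  ncring.
have zhz : z * h * z = - (k * z * (k * z)).
  rewrite -mulrA hz mulrN; congr (- _).
  by rewrite -kk !mulrA zk -!mulrA; congr (_ * _); rewrite !mulrA zk.
pose x (i : 'I_2) := if i == 0 then u * z else k * z.
have kzs : usa (k * z) by apply: usaM => //; exact: commr_sym.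
have S0 : \sum_i ustar (x i) * x i = 0.
  rewrite big_ord_recl big_ord1 /x /= kzs ustarM zs.
  have -> : z * ustar u * (u * z) = z * h * z by rewrite /h !mulrA.
  by rewrite zhz addNr.
have := un_sum_starmul x ord_max; rewrite S0 un0 mulr0 /x /=.
move=> le; have kz0 : k * z = 0.
  by apply/un_eq0/eqP; rewrite -sqrf_eq0 eq_le le sqr_ge0.
have zzz : z * z = 2%:C *: (p * z).
  by rewrite scale2C {1}/z mulrBl hz opprK.
have : un (z * z * (z * z)) = 0.
  rewrite {1}zzz -kk -scalerAl -(mulrA k) kz0 mulr0 mul0r scaler0 un0 //.
rewrite un_sqr; last by apply: usaM.
rewrite un_sqr // => /eqP; rewrite !sqrf_eq0 => /eqP /un_eq0 /eqP.
by rewrite /z subr_eq0 => /eqP ->.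
Qed.

Lemma uinv_lim (G : uniz A) (k : R) : un G <= k -> k < 1 ->
  exists w : uniz A, w * (1 - G) = 1 /\ (1 - G) * w = 1.
Proof.
move=> Gk k1; pose f n := \sum_(i < n) G ^+ i.
have k0 : 0 <= k by apply: le_trans (un_ge0 _) Gk.
have uX n : un (G ^+ n) <= k ^+ n.
  elim: n => [|n IH]; first by rewrite !expr0 un1.
  by rewrite !exprS (le_trans (unM _ _)) // ler_pM ?un_ge0.
have fE n : f n * (1 - G) = 1 - G ^+ n.
  elim: n => [|n IH]; first by rewrite /f big_ord0 mul0r expr0 subrr.
  by rewrite /f big_ord_recr /= mulrDl -/(f n) IH mulrBr mulr1 -exprSr addrA subrK.
have Xlim e : 0 < e -> exists N, forall n, (N <= n)%N -> k ^+ n < e.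
  move=> e0; have : (fun n => k ^+ n) @ \oo --> (0 : R).
    by apply: cvg_expr; rewrite ger0_norm.
  move/cvgrPdist_lt => /(_ _ e0) [N _ H]; exists N => n Nn.
  by have := H n Nn; rewrite /= sub0r normrN ger0_norm // exprn_ge0.
have fd n m : un (f (n + m)%N - f n) <= k ^+ n / (1 - k).
  have k1' : 0 < 1 - k by rewrite subr_gt0.
  rewrite ler_pdivlMr //; suff : un (f (n + m)%N - f n) * (1 - k) <= k ^+ n - k ^+ (n + m).
    by move/le_trans; apply; rewrite gerBl exprn_ge0.
  elim: m => [|m IH]; first by rewrite addn0 !subrr un0 mul0r.
  have -> : f (n + m.+1)%N - f n = (f (n + m)%N - f n) + G ^+ (n + m).
    by rewrite addnS /f big_ord_recr /= addrAC.
  have := unD (f (n + m)%N - f n) (G ^+ (n + m)); have := uX (n + m)%N.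
  rewrite addnS [k ^+ _.+1]exprS; set a := k ^+ (n + m) in IH *; nra.
have [|w wP] := @uniz_complete _ _ f.
  move=> e e0; have k1' : 0 < 1 - k by rewrite subr_gt0.
  have [N H] := Xlim (e * (1 - k)) (mulr_gt0 e0 k1'); exists N.
  have H2 m n : (N <= m)%N -> (m <= n)%N -> un (f n - f m) < e.
    move=> Nm mn; rewrite -(subnKC mn); apply: le_lt_trans (fd _ _) _.
    by rewrite ltr_pdivrMr //; exact: H.
  move=> m n Nm Nn; case: (leqP m n) => [mn|/ltnW nm]; last exact: H2.
  by rewrite unB; exact: H2.
have wc : GRing.comm (1 - G) w.
  apply: comm_lim wP => n; apply: commr_sum => i _; apply: commrX.
  by apply/commr_sym/commBr => //; exact: commr1.
suff wE : w * (1 - G) = 1 by exists w; split => //; exact: etrans wc wE.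
apply: un_lim_eq => e e0; have p : 0 < un (1 - G) + 1 by rewrite ltr_wpDl ?un_ge0.
have [N1 H1] := wP (e / 2 / (un (1 - G) + 1)) (divr_gt0 (divr_gt0 e0 (ltr0Sn _ _)) p).
have [N2 H2] := Xlim (e / 2) (divr_gt0 e0 (ltr0Sn _ _)).
pose N := maxn N1 N2; have := H1 N (leq_maxl _ _); have := H2 N (leq_maxr _ _).
have -> : w * (1 - G) - 1 = - ((f N - w) * (1 - G) + G ^+ N).
  by rewrite mulrBl fE; ncring.
rewrite unN => a; rewrite ltr_pdivlMr // => b.
have := unD ((f N - w) * (1 - G)) (G ^+ N); have := unM (f N - w) (1 - G).
have := uX N; have := un_ge0 (f N - w); nra.
Qed.

(** Write d + p = (d + t)(1 - G). Then G has norm at most t / (d + t) < 1 and the Neumann series of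
    [uinv_lim] converges. *)
Lemma uinv_pos (t d : R) p : 0 <= t -> 0 < d -> usa p -> unn t p ->
  exists w : uniz A, [/\ usa w, w * (d%:C *: 1 + p) = 1, (d%:C *: 1 + p) * w = 1 &
    forall y, GRing.comm y p -> GRing.comm y w].
Proof.
move=> t0 d0 ps pt.
have s0 : 0 < d + t by rewrite ltr_wpDr.
pose G := (d + t)^-1%:C *: (t%:C *: 1 - p).
have [||w [w1 w2]] := @uinv_lim G (t / (d + t)).
- by rewrite unZr ?invr_ge0 ?(ltW s0) // mulrC ler_pM2r // invr_gt0.
- by rewrite ltr_pdivrMr // mul1r ltrDr.
have GE : d%:C *: 1 + p = (d + t)%:C *: (1 - G).
  rewrite scalerBr scalerA -rmorphM divff ?gt_eqF // scale1r rmorphD scalerDl.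
  ncring.
pose v := (d + t)^-1%:C *: w.
have sV : (d + t)^-1%:C * (d + t)%:C = 1 :> R[i] by rewrite -rmorphM mulVf ?gt_eqF.
have v1 : v * (d%:C *: 1 + p) = 1 by rewrite GE scaleMM sV w1 scale1r.
have v2 : (d%:C *: 1 + p) * v = 1 by rewrite GE scaleMM mulrC sV w2 scale1r.
exists v; split => //.
- have xs : usa (d%:C *: 1 + p) by apply: usaD => //; exact/usaZ/usa1.
  rewrite /usa -[LHS]mulr1 -v2 mulrA -{1}xs -ustarM v2 ustar1 mul1r //.
- move=> y yp; have yc : GRing.comm y (d%:C *: 1 + p).
    by apply: commrD => //; exact: commZ1.
  by rewrite /GRing.comm -[y * v]mul1r -v1 -(mulrA v) (mulrA _ y) -yc -!mulrA v2 mulr1.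
Qed.

End FunctionalCalculus.

Ltac ncmx :=
  apply/eqP; rewrite -subr_eq0; apply/eqP;
  do ?rewrite (mulmxDl, mulmxDr, mulmxN, mulNmx, opprD, opprK, mulmx1, mul1mx,
    mulmx0, mul0mx, oppr0, addr0, add0r, mulmxA, addrA);
  repeat cancel_last.

(** * Approximate solutions in matrix algebras over C *)

Section Adjoint.
Context {R : realType}.
Local Notation C := R[i].

Definition hadj m n (A : 'M[C]_(m, n)) : 'M[C]_(n, m) :=
  (map_mx (fun z => z^*%C) A)^T.

Lemma hadjE m n (A : 'M[C]_(m, n)) i j : hadj A i j = (A j i)^*%C.
Proof. by rewrite !mxE. Qed.

Lemma hadjK m n (A : 'M[C]_(m, n)) : hadj (hadj A) = A.
Proof. by apply/matrixP => i j; rewrite !hadjE conjcK. Qed.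

Lemma hadjD m n (A B : 'M[C]_(m, n)) : hadj (A + B) = hadj A + hadj B.
Proof. by apply/matrixP => i j; rewrite !mxE rmorphD. Qed.

Lemma hadjZ m n a (A : 'M[C]_(m, n)) : hadj (a *: A) = a^*%C *: hadj A.
Proof. by apply/matrixP => i j; rewrite !mxE rmorphM. Qed.

Lemma hadj0 m n : hadj (0 : 'M[C]_(m, n)) = 0.
Proof. by apply/matrixP => i j; rewrite !mxE conjc0. Qed.

Lemma hadjN m n (A : 'M[C]_(m, n)) : hadj (- A) = - hadj A.
Proof. by rewrite -scaleN1r hadjZ rmorphN1 scaleN1r. Qed.

Lemma hadjB m n (A B : 'M[C]_(m, n)) : hadj (A - B) = hadj A - hadj B.
Proof. by rewrite hadjD hadjN. Qed.

Lemma hadj1 n : hadj (1%:M : 'M[C]_n) = 1%:M.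
Proof.
apply/matrixP => i j; rewrite !mxE eq_sym; case: (_ == _); rewrite ?mulr1n ?mulr0n.
  exact: conjc1.
exact: conjc0.
Qed.

Lemma hadjM m n p (A : 'M[C]_(m, n)) (B : 'M[C]_(n, p)) :
  hadj (A *m B) = hadj B *m hadj A.
Proof.
apply/matrixP => i j; rewrite !mxE rmorph_sum; apply: eq_bigr => k _.
by rewrite !mxE rmorphM mulrC.
Qed.

Lemma hadj_sum m n I (r : seq I) (P : pred I) (F : I -> 'M[C]_(m, n)) :
  hadj (\sum_(i <- r | P i) F i) = \sum_(i <- r | P i) hadj (F i).
Proof. exact: (big_morph _ (@hadjD m n) (@hadj0 m n)). Qed.

Lemma hadj_row_mx m n1 n2 (A : 'M[C]_(m, n1)) (B : 'M[C]_(m, n2)) :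
  hadj (row_mx A B) = col_mx (hadj A) (hadj B).
Proof. by rewrite /hadj map_row_mx tr_row_mx. Qed.

Lemma hadj_col_mx m1 m2 n (A : 'M[C]_(m1, n)) (B : 'M[C]_(m2, n)) :
  hadj (col_mx A B) = row_mx (hadj A) (hadj B).
Proof. by rewrite /hadj map_col_mx tr_col_mx. Qed.

Lemma hadj_submxrow m q (p_ : 'I_q -> nat) (A : 'M[C]_(m, \sum_i p_ i)) i :
  submxcol (hadj A) i = hadj (submxrow A i).
Proof. by apply/matrixP => x y; rewrite !mxE. Qed.

Lemma hadj_submxcol m q (p_ : 'I_q -> nat) (A : 'M[C]_(\sum_i p_ i, m)) i :
  submxrow (hadj A) i = hadj (submxcol A i).
Proof. by apply/matrixP => x y; rewrite !mxE. Qed.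

Lemma hadj_mxrow m q (p_ : 'I_q -> nat) (A : forall i, 'M[C]_(m, p_ i)) :
  hadj (\mxrow_i A i) = \mxcol_i hadj (A i).
Proof. by apply/mxcolP => i; rewrite mxcolK hadj_submxrow mxrowK. Qed.

Lemma hadj_mxcol m q (p_ : 'I_q -> nat) (A : forall i, 'M[C]_(p_ i, m)) :
  hadj (\mxcol_i A i) = \mxrow_i hadj (A i).
Proof. by apply/mxrowP => i; rewrite mxrowK hadj_submxcol mxcolK. Qed.

Definition nv n (v : 'cV[C]_n) : R := \sum_i normc (v i ord0) ^+ 2.

Lemma nv_ge0 n (v : 'cV[C]_n) : 0 <= nv v.
Proof. by apply: sumr_ge0 => i _; rewrite sqr_ge0. Qed.

Lemma nvE n (v : 'cV[C]_n) : hadj v *m v = (nv v)%:C%:M.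
Proof.
apply/matrixP => i j; rewrite !ord1 !mxE mulr1n rmorph_sum; apply: eq_bigr => k _.
by rewrite hadjE normcMconj.
Qed.

Lemma nv_eq0 n (v : 'cV[C]_n) : nv v = 0 -> v = 0.
Proof.
move=> /eqP; rewrite psumr_eq0 => [/allP H|i _]; last exact: sqr_ge0.
apply/colP => i; have := H i (mem_index_enum i); rewrite sqrf_eq0 normc_eq0 mxE.
by move/eqP.
Qed.

Lemma hadjmul_eq0 m n (A : 'M[C]_(m, n)) : hadj A *m A = 0 -> A = 0.
Proof.
move=> H; apply/matrixP => i j.
have : nv (col j A) = 0.
  apply: complexI; have := nvE (col j A) => /matrixP /(_ ord0 ord0).
  rewrite [in RHS]mxE mulr1n => <-.
  have -> : (hadj (col j A) *m col j A) ord0 ord0 = (hadj A *m A) j j.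
    by rewrite !mxE; apply: eq_bigr => k _; rewrite !mxE.
  by rewrite H mxE.
by move/nv_eq0/colP => /(_ i); rewrite !mxE.
Qed.

Definition isom m n (X : 'M[C]_(m, n)) := hadj X *m X = 1%:M.

Lemma isom_le m n (X : 'M[C]_(m, n)) : isom X -> (n <= m)%N.
Proof.
by move=> H; rewrite -{1}(mxrank1 C n) -H; apply: (leq_trans (mulmx_max_rank _ _)).
Qed.

Lemma isomM m n p (X : 'M[C]_(m, n)) (Y : 'M[C]_(n, p)) :
  isom X -> isom Y -> isom (X *m Y).
Proof. by rewrite /isom hadjM mulmxA => HX HY; rewrite -(mulmxA (hadj Y)) HX mulmx1. Qed.

Lemma isom_row m n p (X : 'M[C]_(m, n)) (Y : 'M[C]_(m, p)) :
  isom X -> isom Y -> hadj X *m Y = 0 -> isom (row_mx X Y).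
Proof.
rewrite /isom => HX HY H; rewrite hadj_row_mx mul_col_row HX HY H.
have -> : hadj Y *m X = 0 by rewrite -[LHS]hadjK hadjM hadjK H hadj0.
by rewrite -scalar_mx_block.
Qed.

Lemma isom_unit m (u : 'cV[C]_m) : u != 0 -> exists c, isom (c *: u).
Proof.
move=> u0; have nu : 0 < nv u.
  by rewrite lt_def nv_ge0 andbT; apply: contra_neq u0 => /nv_eq0.
exists (Num.sqrt (nv u))^-1%:C; rewrite /isom hadjZ conjc_real -scalemxAl -scalemxAr.
rewrite scalerA nvE -!rmorphM -invfM -expr2 sqr_sqrtr ?nv_ge0 // scale_scalar_mx.
by rewrite -rmorphM mulVf ?gt_eqF.
Qed.

(** Gram-Schmidt: while M is not fixed by the projection X X^*, a nonzero column of the residual is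
    normalized and added to X. This stops since an isometry has at most m columns. [S] records that
    the basis consists of combinations of the columns of M, which [sol_solform] reuses for other
    rows of a solution. *)
Lemma colspace_basis m s (M : 'M[C]_(m, s)) :
  exists r (X : 'M[C]_(m, r)) (S : 'M[C]_(s, r)),
    [/\ isom X, X = M *m S & M = X *m hadj X *m M].
Proof.
suff H k : forall r (X : 'M[C]_(m, r)) (S : 'M[C]_(s, r)), (m - r <= k)%N ->
    isom X -> X = M *m S -> exists r (X : 'M[C]_(m, r)) (S : 'M[C]_(s, r)),
    [/\ isom X, X = M *m S & M = X *m hadj X *m M].
  apply: (H m 0%N 0 0); rewrite ?mulmx0 ?subn0 // /isom hadj0 mul0mx.
  by apply/matrixP => -[].
elim: k => [|k IH] r X S mr HX XE.
all: have [E|/eqP NE] := eqVneq M (X *m hadj X *m M); first by exists r, X, S.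
all: have [j ju] : exists j, col j (M - X *m hadj X *m M) != 0.
  1,3: apply: contrapT => /forallNP H; apply: NE; apply/eqP; rewrite -subr_eq0; apply/eqP.
  1,2: apply/matrixP => a b; have := H b; move/negP; rewrite negbK => /eqP/colP/(_ a).
  1,2: by rewrite !mxE.
all: have [c cu] := isom_unit ju; set w := c *: _ in cu.
all: have Xw : hadj X *m w = 0.
  1,3: rewrite /w -scalemxAr colE mulmxA mulmxBr !mulmxA HX mul1mx subrr mul0mx scaler0 //.
all: have X'i := isom_row HX cu Xw.
- by have := isom_le X'i; rewrite leqn0 subn_eq0 in mr; rewrite addn1 ltnNge mr.
- apply: (IH _ (row_mx X w) (row_mx S (c *: (delta_mx j ord0 - S *m hadj X *m M *m delta_mx j ord0)))) => //.
    by have := isom_le X'i; rewrite addn1 => rm; rewrite subnS -ltnS prednK // subn_gt0.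
  rewrite mul_mx_row -XE; congr row_mx; rewrite -scalemxAr; congr (_ *: _).
  by rewrite colE mulmxBl mulmxBr !mulmxA -XE.
Qed.

(** As long as Y = (X, W) has fewer than m columns, Y Y^* has too small a rank to be 1, so the
    residual has a nonzero column. *)
Lemma isom_extend m d e (X : 'M[C]_(m, d)) : isom X -> (d + e <= m)%N ->
  exists W : 'M[C]_(m, e), isom W /\ hadj X *m W = 0.
Proof.
move=> HX; elim: e => [|e IH] de.
  exists 0; split; last by rewrite mulmx0.
  by rewrite /isom mulmx0; apply/matrixP => -[].
have [|W [HW XW]] := IH; first by apply: leq_trans de; rewrite addnS.
have HY := isom_row HX HW XW; set Y := row_mx X W in HY.
have [j ju] : exists j, col j (1%:M - Y *m hadj Y) != 0.
  apply: contrapT => /forallNP H.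
  suff E : Y *m hadj Y = 1%:M.
    have := mulmx_max_rank Y (hadj Y); rewrite E mxrank1 => le.
    by move: de; rewrite addnS ltnNge le.
  apply/eqP; rewrite eq_sym -subr_eq0; apply/eqP; apply/matrixP => a b.
  by have := H b; move/negP; rewrite negbK => /eqP/colP/(_ a); rewrite !mxE.
have [c cu] := isom_unit ju; set w := c *: _ in cu.
have Yw : hadj Y *m w = 0.
  by rewrite /w -scalemxAr colE mulmxA mulmxBr !mulmxA HY mul1mx mulmx1 subrr mul0mx scaler0.
move: Yw; rewrite /Y hadj_row_mx mul_col_mx => /eqP; rewrite col_mx_eq0 => /andP[/eqP h1 /eqP h2].
rewrite -addn1; exists (row_mx W w); split; first exact: isom_row.
by rewrite mul_mx_row XW h1 row_mx0.
Qed.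

(** A unit vector in the range of each matrix gives an orthonormal family. This counting is used in
    both directions: to find a bump that a representation kills, and to bound a multiplicity from
    below. *)
Lemma sa_orth_le n k (h : 'I_k -> 'M[C]_n) : (forall i, h i != 0) ->
  (forall i, hadj (h i) = h i) -> (forall i j, i != j -> h i *m h j = 0) ->
  (k <= n)%N.
Proof.
move=> h0 hs ho.
have /choice[v vP] i : exists v : 'cV[C]_n, isom v /\ exists u, v = h i *m u.
  have [j ju] : exists j, col j (h i) != 0.
    apply: contrapT => /forallNP H; move/eqP: (h0 i); apply; apply/matrixP => a b.
    by have := H b; move/negP; rewrite negbK => /eqP/colP/(_ a); rewrite !mxE.
  have [c cu] := isom_unit ju; exists (c *: col j (h i)); split => //.
  by exists (c *: delta_mx j ord0); rewrite colE scalemxAr.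
apply: (@isom_le n k (\matrix_(a, i) v i a ord0)).
apply/matrixP => i j; rewrite [LHS]mxE [RHS]mxE.
have -> : \sum_a hadj (\matrix_(a, i) v i a ord0) i a * (\matrix_(a, i) v i a ord0) a j =
   (hadj (v i) *m v j) ord0 ord0.
  by rewrite !mxE; apply: eq_bigr => a _; rewrite !mxE.
have [<-|ij] := eqVneq i j; first by rewrite (vP i).1 mxE eqxx.
have [_ [a ->]] := vP i; have [_ [b ->]] := vP j.
by rewrite hadjM hs mulmxA -(mulmxA (hadj a)) ho // mulmx0 mul0mx mxE.
Qed.

End Adjoint.

(** * Continuous matrix functions and paths *)

Section ContinuousMatrices.
Context {R : realType}.
Local Notation C := R[i].

Section Domain.
Context {T : topologicalType}.

Definition cC (f : T -> C) :=
  continuous (fun t => complex.Re (f t)) /\ continuous (fun t => complex.Im (f t)).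

Definition mcont m n (f : T -> 'M[C]_(m, n)) := forall i j, cC (fun t => f t i j).

Lemma cC_eq f g : f =1 g -> cC f -> cC g.
Proof. by move=> /funext ->. Qed.

Lemma cC_cst a : cC (fun=> a).
Proof. by split => x; exact: cvg_cst. Qed.

Lemma cC_add f g : cC f -> cC g -> cC (fun t => f t + g t).
Proof.
move=> [f1 f2] [g1 g2]; split => x.
  under eq_fun do rewrite raddfD; exact: cvgD (f1 x) (g1 x).
under eq_fun do rewrite raddfD; exact: cvgD (f2 x) (g2 x).
Qed.

Lemma cC_mul f g : cC f -> cC g -> cC (fun t => f t * g t).
Proof.
move=> [f1 f2] [g1 g2]; split => x.
  rewrite (_ : (fun _ => _) = (fun t => complex.Re (f t) * complex.Re (g t) -
    complex.Im (f t) * complex.Im (g t))); last first.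
    by apply/funext => t; case: (f t) (g t) => [a b] [c d].
  apply: cvgB; first exact: cvgM (f1 x) (g1 x).
  exact: cvgM (f2 x) (g2 x).
rewrite (_ : (fun _ => _) = (fun t => complex.Re (f t) * complex.Im (g t) +
    complex.Im (f t) * complex.Re (g t))); last first.
  by apply/funext => t; case: (f t) (g t) => [a b] [c d].
apply: cvgD; first exact: cvgM (f1 x) (g2 x).
exact: cvgM (f2 x) (g1 x).
Qed.

Lemma cC_conj f : cC f -> cC (fun t => (f t)^*%C).
Proof.
move=> [f1 f2]; split => x.
  rewrite (_ : (fun _ => _) = (fun t => complex.Re (f t))); last first.
    by apply/funext => t; case: (f t).
  exact: f1.
rewrite (_ : (fun _ => _) = (fun t => - complex.Im (f t))); last first.
  by apply/funext => t; case: (f t).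
exact: cvgN (f2 x).
Qed.

Lemma cC_real (h : T -> R) : continuous h -> cC (fun t => (h t)%:C).
Proof. by move=> hc; split => x; [exact: hc|exact: cvg_cst]. Qed.

Lemma cC_sum I (r : seq I) (P : pred I) (F : I -> T -> C) :
  (forall i, cC (F i)) -> cC (fun t => \sum_(i <- r | P i) F i t).
Proof.
move=> H; elim: r => [|i r IH].
  by apply: cC_eq (cC_cst 0) => t; rewrite big_nil.
have [Pi|Pi] := boolP (P i).
  by apply: cC_eq (cC_add (H i) IH) => t; rewrite big_cons Pi.
by apply: cC_eq IH => t; rewrite big_cons (negbTE Pi).
Qed.

Lemma mcont_eq m n (f g : T -> 'M[C]_(m, n)) : f =1 g -> mcont f -> mcont g.
Proof. by move=> /funext ->. Qed.

Lemma mcont_cst m n (A : 'M[C]_(m, n)) : mcont (fun=> A).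
Proof. by move=> i j; exact: cC_cst. Qed.

Lemma mcontD m n (f g : T -> 'M[C]_(m, n)) :
  mcont f -> mcont g -> mcont (fun t => f t + g t).
Proof.
by move=> F G i j; apply: cC_eq (cC_add (F i j) (G i j)) => t; rewrite !mxE.
Qed.

Lemma mcontM m n p (f : T -> 'M[C]_(m, n)) (g : T -> 'M[C]_(n, p)) :
  mcont f -> mcont g -> mcont (fun t => f t *m g t).
Proof.
move=> F G i j; apply: (@cC_eq (fun t => \sum_k f t i k * g t k j)).
  by move=> t; rewrite mxE.
by apply: cC_sum => k; apply: cC_mul.
Qed.

Lemma mcontZ m n (h : T -> C) (f : T -> 'M[C]_(m, n)) :
  cC h -> mcont f -> mcont (fun t => h t *: f t).
Proof.
by move=> H F i j; apply: cC_eq (cC_mul H (F i j)) => t; rewrite !mxE.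
Qed.

Lemma mcontN m n (f : T -> 'M[C]_(m, n)) : mcont f -> mcont (fun t => - f t).
Proof.
move=> F; apply: mcont_eq (mcontZ (cC_cst (-1)) F) => t.
by rewrite scaleN1r.
Qed.

Lemma mcontB m n (f g : T -> 'M[C]_(m, n)) :
  mcont f -> mcont g -> mcont (fun t => f t - g t).
Proof. by move=> F G; apply: mcontD => //; apply: mcontN. Qed.

Lemma mcont_adj m n (f : T -> 'M[C]_(m, n)) : mcont f -> mcont (fun t => hadj (f t)).
Proof. by move=> F i j; apply: cC_eq (cC_conj (F j i)) => t; rewrite hadjE. Qed.

Lemma mcont_sum m n I (r : seq I) (P : pred I) (F : I -> T -> 'M[C]_(m, n)) :
  (forall i, mcont (F i)) -> mcont (fun t => \sum_(i <- r | P i) F i t).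
Proof.
move=> H i j; apply: cC_eq (cC_sum r P (fun k => H k i j)) => t.
by rewrite summxE.
Qed.

Lemma mcont_submxrow m q (p_ : 'I_q -> nat) (A : T -> 'M[C]_(m, \sum_i p_ i)) i :
  mcont A -> mcont (fun t => submxrow (A t) i).
Proof. by move=> H x y; apply: cC_eq (H x (tagnat.Rank i y)) => t; rewrite !mxE. Qed.

Lemma mcont_submxcol m q (p_ : 'I_q -> nat) (A : T -> 'M[C]_(\sum_i p_ i, m)) i :
  mcont A -> mcont (fun t => submxcol (A t) i).
Proof. by move=> H x y; apply: cC_eq (H (tagnat.Rank i x) y) => t; rewrite !mxE. Qed.

End Domain.

Lemma cC_comp (T T' : topologicalType) (f : T -> C) (h : T' -> T) : cC f -> continuous h -> cC (fun t => f (h t)).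
Proof.
move=> [f1 f2] hc; split => x.
  exact: (@continuous_comp T' T _ h (fun t => complex.Re (f t)) x (hc x) (f1 _)).
exact: (@continuous_comp T' T _ h (fun t => complex.Im (f t)) x (hc x) (f2 _)).
Qed.

Lemma mcont_comp (T T' : topologicalType) m n (f : T -> 'M[C]_(m, n)) (h : T' -> T) :
  mcont f -> continuous h -> mcont (fun t => f (h t)).
Proof. by move=> F H i j; exact: (cC_comp (F i j) H). Qed.

Definition clamp (t : R) : R := Num.max 0 (Num.min 1 t).

Lemma clamp_cont : continuous clamp.
Proof.
move=> x; apply: continuous_max; first exact: cvg_cst.
by apply: continuous_min; [exact: cvg_cst|exact: cvg_id].
Qed.

Lemma clamp_ge0 t : 0 <= clamp t. Proof. by rewrite /clamp le_max lexx. Qed.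

Lemma clamp_le1 t : clamp t <= 1.
Proof. by rewrite /clamp ge_max ler01 ge_min lexx. Qed.

Lemma clamp_le0 t : t <= 0 -> clamp t = 0.
Proof. by move=> t0; rewrite /clamp (min_r (le_trans t0 ler01)) max_l. Qed.

Lemma clamp_ge1 t : 1 <= t -> clamp t = 1.
Proof. by move=> t0; rewrite /clamp (min_l t0) max_r. Qed.

(** Paths live on the whole line and are constant outside [0, 1], so that they are concatenated and
    pasted by formulas. The index type [I] lets a whole family move at once, [S] being a condition
    on the family. *)
Definition pconn (I : Type) m n (S : (I -> 'M[C]_(m, n)) -> Prop)
    (A B : I -> 'M[C]_(m, n)) : Prop :=
  exists g : R -> I -> 'M[C]_(m, n), [/\ forall i, mcont (fun t => g t i),
    forall t, t <= 0 -> g t = A, forall t, 1 <= t -> g t = B & forall t, S (g t)].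

Lemma pconn_sub I m n (S S' : (I -> 'M[C]_(m, n)) -> Prop) A B :
  (forall x, S x -> S' x) -> pconn S A B -> pconn S' A B.
Proof. by move=> H [g [g1 g2 g3 g4]]; exists g; split => // t; apply: H. Qed.

Lemma pconn_trans I m n (S : (I -> 'M[C]_(m, n)) -> Prop) A B D :
  pconn S A B -> pconn S B D -> pconn S A D.
Proof.
move=> [g [g1 g2 g3 g4]] [h [h1 h2 h3 h4]].
(* At every t one of the first two terms equals [B], which makes this the concatenation. *)
exists (fun t i => g (2 * t) i + h (2 * t - 1) i - B i); split.
- move=> i; apply: mcontB (mcont_cst _); apply: mcontD.
    apply: (mcont_comp (h := fun t : R => 2 * t) (g1 i)) => x.
    by apply: cvgM; [exact: cvg_cst|exact: cvg_id].
  apply: (mcont_comp (h := fun t : R => 2 * t - 1) (h1 i)) => x.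
  apply: cvgB; last exact: cvg_cst.
  by apply: cvgM; [exact: cvg_cst|exact: cvg_id].
- move=> t t0; apply/funext => i; rewrite g2 ?h2 ?addrK //; lra.
- move=> t t1; apply/funext => i; rewrite g3 ?h3; [|lra|lra].
  by rewrite addrC addrA addNr add0r.
- move=> t; have [t1|t1] := leP t 2^-1.
    rewrite (_ : (fun _ => _) = g (2 * t)) //; apply/funext => i.
    by rewrite h2 ?addrK //; lra.
  rewrite (_ : (fun _ => _) = h (2 * t - 1)) //; apply/funext => i.
  by rewrite g3; [rewrite addrC addrA addNr add0r|lra].
Qed.

Lemma pconn_segment I m n (S : (I -> 'M[C]_(m, n)) -> Prop) A B :
  (forall s : R, 0 <= s <= 1 -> S (fun i => (1 - s)%:C *: A i + s%:C *: B i)) ->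
  pconn S A B.
Proof.
move=> H; exists (fun t i => (1 - clamp t)%:C *: A i + (clamp t)%:C *: B i); split.
- move=> i; apply: mcontD; apply: mcontZ (mcont_cst _).
    apply: (cC_real (h := fun t => 1 - clamp t)) => x.
    by apply: cvgB; [exact: cvg_cst|exact: clamp_cont].
  exact: cC_real clamp_cont.
- by move=> t t0; apply/funext => i; rewrite clamp_le0 // subr0 scale1r scale0r addr0.
- by move=> t t0; apply/funext => i; rewrite clamp_ge1 // subrr scale1r scale0r add0r.
- by move=> t; apply: H; rewrite clamp_ge0 clamp_le1.
Qed.

End ContinuousMatrices.

(** * Isometries are path connected *)

Section UnitaryPaths.
Context {R : realType}.
Local Notation C := R[i].

(** The real part moves linearly from 1 to that of z; the imaginary part completes it to modulus 1
    with a fixed sign [s]. *)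
Lemma unimodular_path (z : C) : z^*%C * z = 1 -> exists g : R -> C,
  [/\ cC g, forall t, t <= 0 -> g t = 1, forall t, 1 <= t -> g t = z &
      forall t, (g t)^*%C * g t = 1].
Proof.
case: z => x y; rewrite normcMconj => /eqP; rewrite eq_complex /= eqxx andbT /normc.
rewrite sqr_sqrtr ?addr_ge0 ?sqr_ge0 // => /eqP xy.
have x1 : -1 <= x <= 1 by apply/andP; split; nra.
pose s : R := if 0 <= y then 1 else -1.
pose u t := 1 - clamp t * (1 - x).
have u1 t : 0 <= 1 - u t ^+ 2.
  have := clamp_ge0 t; have := clamp_le1 t; move: x1 => /andP[xa xb] ca cb.
  rewrite /u; set c := clamp t in ca cb *.
  have /andP[h1 h2] : 0 <= c * (1 - x) <= 2 by apply/andP; split; nra.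
  nra.
have uc : continuous u.
  move=> t; apply: cvgB; first exact: cvg_cst.
  by apply: cvgM; [exact: clamp_cont|exact: cvg_cst].
exists (fun t => Complex (u t) (s * Num.sqrt (1 - u t ^+ 2))); split.
- split; first exact: uc.
  move=> t; apply: cvgM; first exact: cvg_cst.
  apply: (@continuous_comp _ _ _ (fun t => 1 - u t ^+ 2) Num.sqrt t); last exact: sqrt_continuous.
  apply: cvgB; first exact: cvg_cst.
  by apply: cvgM; exact: uc.
- move=> t t0; rewrite /u clamp_le0 // mul0r subr0 expr1n subrr sqrtr0 mulr0 //.
- move=> t t1; rewrite /u clamp_ge1 // mul1r opprB addrC subrK.
  congr Complex; have -> : 1 - x ^+ 2 = y ^+ 2 by rewrite -xy addrC addKr.
  rewrite sqrtr_sqr /s; case: ifP => y0; first by rewrite ger0_norm ?mul1r.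
  by rewrite ltr0_norm ?mulN1r ?opprK // ltNge y0.
- move=> t; rewrite normcMconj /normc sqr_sqrtr ?addr_ge0 ?sqr_ge0 //.
  rewrite exprMn sqr_sqrtr // (_ : s ^+ 2 = 1) ?mul1r ?[_ + (1 - _)]addrC ?subrK //.
  by rewrite /s; case: ifP; rewrite ?sqrrN expr1n.
Qed.

Definition upath n (U : R -> 'M[C]_n) (V : 'M[C]_n) :=
  [/\ mcont U, forall t, t <= 0 -> U t = 1%:M, forall t, 1 <= t -> U t = V &
      forall t, isom (U t)].

(* [V] is a complex reflection. *)
Lemma reflection_path n (a b : 'cV[C]_n) : isom a -> isom b ->
  exists U V, [/\ upath U V, V *m a = b &
    forall d (X : 'M[C]_(n, d)), hadj a *m X = 0 -> hadj b *m X = 0 -> V *m X = X].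
Proof.
move=> ha hb; have [<-|ab] := eqVneq a b.
  exists (fun=> 1%:M), 1%:M; split; rewrite ?mul1mx //; last by move=> d X _ _; rewrite mul1mx.
  split => //; first exact: mcont_cst.
  by move=> t; rewrite /isom hadj1 mul1mx.
pose w := a - b; pose nu := nv w; pose al := (hadj a *m b) ord0 ord0.
have nu0 : nu != 0 by apply: contra_neq ab => /nv_eq0/eqP; rewrite subr_eq0 => /eqP.
have ss (x : 'M[C]_1) : x = (x ord0 ord0)%:M by exact: mx11_scalar.
have abE : hadj a *m b = al%:M by exact: ss.
have baE : hadj b *m a = (al^*%C)%:M.
  rewrite -[LHS]hadjK hadjM hadjK abE; apply/matrixP => i j.
  by rewrite !ord1 hadjE !mxE eqxx !mulr1n.
have waE : hadj w *m a = (1 - al^*%C)%:M.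
  by rewrite /w hadjB mulmxBl ha baE -scalar_mx_is_additive.
have nuE : nu%:C = (1 - al^*%C) + (1 - al).
  have := nvE w; rewrite -/nu {1}/w mulmxDr mulmxN waE.
  have -> : hadj w *m b = (al - 1)%:M.
    by rewrite /w hadjB mulmxBl hb abE -scalar_mx_is_additive.
  rewrite -!scalar_mx_is_additive => /matrixP /(_ ord0 ord0).
  by rewrite !mxE eqxx !mulr1n => <-; rewrite opprB.
have al1 : 1 - al != 0.
  apply: contra_neq nu0 => e; apply: complexI; rewrite nuE e addr0.
  by move/eqP: e; rewrite subr_eq0 => /eqP <-; rewrite conjc1 subrr.
have al1' : 1 - al^*%C != 0.
  have -> : 1 - al^*%C = (1 - al)^*%C by rewrite rmorphB rmorph1.
  by rewrite conjc_eq0.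
(* V a = b amounts to (ze - 1)(1 - al^*%C) = - nu, where nu = (1 - al^*%C) + (1 - al). The solution
   is unimodular because numerator and denominator are conjugate up to sign. *)
pose ze := - (1 - al) / (1 - al^*%C).
have conjB : (1 - al)^*%C = 1 - al^*%C by rewrite rmorphB rmorph1.
have conjB' : (1 - al^*%C)^*%C = 1 - al by rewrite rmorphB rmorph1 /= conjcK.
have ze1 : ze^*%C * ze = 1.
  rewrite /ze cconjM rmorphN /= conjc_inv conjB conjB'; field.
  by rewrite al1 al1'.
have [g [gc g0 g1 gu]] := unimodular_path ze1.
pose P : 'M[C]_n := nu^-1%:C *: (w *m hadj w).
have nV : nu^-1%:C * nu%:C = 1 by rewrite -rmorphM mulVf.
have PP : P *m P = P.
  rewrite /P -scalemxAl -scalemxAr scalerA -mulmxA (mulmxA (hadj w)) nvE -/nu.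
  by rewrite mul_scalar_mx -scalemxAr scalerA -mulrA nV mulr1.
have Ps : hadj P = P by rewrite /P hadjZ conjc_real hadjM hadjK.
pose U t : 'M[C]_n := 1%:M + (g t - 1) *: P.
exists U, (1%:M + (ze - 1) *: P); split.
- split.
  + apply: mcontD; first exact: mcont_cst.
    apply: mcontZ (mcont_cst _); apply: cC_eq (cC_add gc (cC_cst (-1))) => t //.
  + by move=> t t0; rewrite /U g0 // subrr scale0r addr0.
  + by move=> t t0; rewrite /U g1.
  + move=> t; rewrite /isom /U hadjD hadj1 hadjZ Ps mulmxDl mul1mx mulmxDr mulmx1.
    have -> : (g t - 1)^*%C *: P *m ((g t - 1) *: P) = ((g t - 1)^*%C * (g t - 1)) *: P.
      by rewrite -scalemxAl -scalemxAr PP scalerA.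
    rewrite -!addrA -!scalerDl.
    have -> : g t - 1 + ((g t - 1)^*%C + (g t - 1)^*%C * (g t - 1)) = 0.
      rewrite rmorphB rmorph1 /=; have := gu t; set x := g t; set y := x^*%C => yx.
      have idxy (p q : C) : p - 1 + (q - 1 + (q - 1) * (p - 1)) = q * p - 1 by ring.
      by rewrite idxy yx subrr.
    by rewrite scale0r addr0.
- rewrite mulmxDl mul1mx /P -scalemxAl -scalemxAl -mulmxA waE mul_mx_scalar !scalerA.
  have -> : (ze - 1) * nu^-1%:C * (1 - al^*%C) = -1.
    have -> : (ze - 1) * nu^-1%:C * (1 - al^*%C) = nu^-1%:C * (ze * (1 - al^*%C) - (1 - al^*%C)).
      by ring.
    rewrite /ze mulfVK // -[- _ - _]opprD mulrN; congr (- _); rewrite addrC -nuE //.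
  by rewrite scaleN1r /w opprB addrC subrK.
- move=> d X aX bX; rewrite mulmxDl mul1mx /P -!scalemxAl -mulmxA.
  have -> : hadj w *m X = 0 by rewrite /w hadjB mulmxBl aX bX subrr.
  by rewrite mulmx0 !scaler0 addr0.
Qed.

(** The columns are moved to their targets one at a time. The reflection that moves column k fixes
    all vectors orthogonal to its source and its target, in particular the columns already in
    place. *)
Lemma isom_path n d (X Y : 'M[C]_(n, d)) : isom X -> isom Y ->
  exists U V, upath U V /\ V *m X = Y.
Proof.
move=> hX hY.
suff H k : (k <= d)%N -> exists U V, upath U V /\
    forall j : 'I_d, (j < k)%N -> V *m col j X = col j Y.
  have [U [V [h1 h2]]] := H d (leqnn d); exists U, V; split => //.
  apply/matrixP => i j; have := h2 j (ltn_ord j) => /colP /(_ i).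
  by rewrite colE mulmxA -colE !mxE.
have corth (Z : 'M[C]_(n, d)) : isom Z -> forall i j,
    hadj (col i Z) *m col j Z = ((i == j)%:R)%:M.
  move=> hZ i j; apply/matrixP => x y; rewrite !ord1 !mxE mulr1n.
  have /matrixP /(_ i j) := hZ; rewrite !mxE => <-.
  by apply: eq_bigr => l _; rewrite !mxE.
elim: k => [|k IH] kd.
  exists (fun=> 1%:M), 1%:M; split => //; split => //; first exact: mcont_cst.
  by move=> t; rewrite /isom hadj1 mul1mx.
have [U [V [[U1 U2 U3 U4] VP]]] := IH (ltnW kd).
have hV : isom V by rewrite -(U3 1).
pose jk := Ordinal kd.
have hVX : isom (V *m X) by apply: isomM.
have ha : isom (col jk (V *m X)) by rewrite /isom corth // eqxx.
have hb : isom (col jk Y) by rewrite /isom corth // eqxx.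
have [T [W [[T1 T2 T3 T4] Wab WX]]] := reflection_path ha hb.
exists (fun t => T t *m U t), (W *m V); split.
  split; first exact: mcontM.
  - by move=> t t0; rewrite T2 // U2 // mulmx1.
  - by move=> t t0; rewrite T3 // U3.
  - by move=> t; apply: isomM.
move=> j; rewrite ltnS leq_eqVlt => /orP[/eqP jE|jk'].
  have -> : j = jk by apply: val_inj.
  by rewrite -mulmxA -Wab !colE !mulmxA.
rewrite -mulmxA VP // WX //.
  have -> : col j Y = col j (V *m X) by rewrite -VP // !colE mulmxA.
  rewrite corth // (_ : _ == _ = false) ?raddf0 //.
  by apply/eqP => /(congr1 val) /= e; rewrite -e ltnn in jk'.
rewrite corth // (_ : _ == _ = false) ?raddf0 //.
by apply/eqP => /(congr1 val) /= e; rewrite -e ltnn in jk'.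
Qed.

End UnitaryPaths.

(** * Exact solutions in a full matrix algebra *)

Section Solutions.
Context {R : realType}.
Local Notation C := R[i].

(* The relations [m_ji^* m_j'i' = delta_jj' g_ii'] and [sum_i g_ii = 1]: they
   turn [(K + 1) a <= K b] into [a <= b]. *)
Definition sol K n (m : 'I_K * 'I_K.+1 -> 'M[C]_n) : Prop :=
  [/\ forall j j' i i', j != j' -> hadj (m (j, i)) *m m (j', i') = 0,
      forall j j' i i', hadj (m (j, i)) *m m (j, i') = hadj (m (j', i)) *m m (j', i') &
      forall j, \sum_i hadj (m (j, i)) *m m (j, i) = 1%:M].

(** A factorization in which the relations decouple: the [Om j] are isometries with orthogonal
    ranges and the column of the [T i] is an isometry. Solutions of a given rank r are thus images
    of pairs of isometries, which are path connected. *)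
Definition solform K n r (m : 'I_K * 'I_K.+1 -> 'M[C]_n) : Prop :=
  exists (Om : 'I_K -> 'M[C]_(n, r)) (T : 'I_K.+1 -> 'M[C]_(r, n)),
  [/\ forall j j', hadj (Om j) *m Om j' = (j == j')%:R%:M,
      \sum_i hadj (T i) *m T i = 1%:M & forall j i, m (j, i) = Om j *m T i].

Lemma solform_sol K n r m : @solform K n r m -> sol m.
Proof.
move=> [Om [T [h1 h2 h3]]].
have E j j' i i' : hadj (m (j, i)) *m m (j', i') =
    (j == j')%:R *: (hadj (T i) *m T i').
  rewrite !h3 hadjM mulmxA -(mulmxA _ _ (Om j')) h1 mul_mx_scalar.
  by rewrite -scalemxAl.
split.
- by move=> j j' i i' /negbTE jj; rewrite E jj scale0r.
- by move=> j j' i i'; rewrite !E !eqxx.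
- move=> j; rewrite -h2; apply: eq_bigr => i _; by rewrite E eqxx scale1r.
Qed.

(** Inner products of combinations with the same coefficients in each row j do not depend on j. Any
    identity that can be tested by such products and holds in row j0 therefore holds in every
    row. *)
Lemma sol_comb K n p q (m : 'I_K * 'I_K.+1 -> 'M[C]_n) j j'
    (c : 'I_K.+1 -> 'M[C]_(n, p)) (d : 'I_K.+1 -> 'M[C]_(n, q)) j0 : sol m ->
  hadj (\sum_i m (j, i) *m c i) *m (\sum_i m (j', i) *m d i) =
  (j == j')%:R *: (hadj (\sum_i m (j0, i) *m c i) *m (\sum_i m (j0, i) *m d i)).
Proof.
move=> [h1 h2 h3].
rewrite 2!hadj_sum 2!mulmx_suml scaler_sumr; apply: eq_bigr => i _.
rewrite 2!mulmx_sumr scaler_sumr; apply: eq_bigr => i' _.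
rewrite !hadjM !mulmxA -!(mulmxA (hadj (c i)) (hadj _)).
have [<-|jj] := eqVneq j j'; first by rewrite scale1r (h2 j j0).
by rewrite h1 // mulmx0 mul0mx scale0r.
Qed.

Lemma isom_mxrow K n r (Om : 'I_K -> 'M[C]_(n, r)) :
  (forall j j', hadj (Om j) *m Om j' = (j == j')%:R%:M) <-> isom (\mxrow_j Om j).
Proof.
rewrite /isom hadj_mxrow mul_mxcol_mxrow.
have <- := @mxdiagZ _ K (fun=> r) (1 : C); rewrite /mxdiag eq_mxblockP.
suff -> : \mxblock_(i < K, j < K) (((i == j)%:R)%:M : 'M[C]_r) =
    \mxblock_(j, k) (if j == k then conform_mx 0 (1%:M : 'M[C]_r) else 0) by [].
by apply/eq_mxblock => i j; case: eqVneq => _; rewrite ?conform_mx_id ?raddf0.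
Qed.

Lemma isom_mxcol K n r (T : 'I_K -> 'M[C]_(r, n)) :
  \sum_i hadj (T i) *m T i = 1%:M <-> isom (\mxcol_i T i).
Proof. by rewrite /isom hadj_mxcol mul_mxrow_mxcol. Qed.

(** In row j0, an orthonormal basis X of the column space of the [m (j0, i)] gives the
    factorization. The combination S producing X is applied in every other row to define [Om j]; by
    [sol_comb] it is again orthonormal, and m (j, i) - Om j T i has the same Gram matrix as in row
    j0, where it is 0. *)
Lemma sol_solform K n (m : 'I_K * 'I_K.+1 -> 'M[C]_n) : (0 < K)%N -> sol m ->
  exists r, solform r m.
Proof.
move=> K0 sm; pose j0 := Ordinal K0.
have [h1 h2 h3] := sm.
have [r [X [S [HX XE ME]]]] := colspace_basis (\mxrow_i m (j0, i)).
pose c i := submxcol S i.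
pose Om j := \sum_i m (j, i) *m c i.
have Om0 : Om j0 = X.
  have SE : S = \mxcol_i c i by rewrite submxcolK.
  by rewrite XE SE mul_mxrow_mxcol.
pose T i := hadj X *m m (j0, i).
have mT i : m (j0, i) = X *m T i.
  have /mxrowP/(_ i) := ME; rewrite mxrowK => {1}->.
  by rewrite mul_mxrow mxrowK /T mulmxA.
exists r, Om, T; split.
- move=> j j'; rewrite /Om (sol_comb _ _ c c j0) // -/(Om j0) Om0 HX.
  by case: eqVneq => _; rewrite ?scale1r ?scale0r ?raddf0.
- rewrite -(h3 j0); apply: eq_bigr => i _; rewrite [in RHS]mT hadjM.
  by rewrite mulmxA -(mulmxA _ (hadj X)) HX mulmx1.
- move=> j i; apply/eqP; rewrite -subr_eq0; apply/eqP/hadjmul_eq0.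
  pose d i' := (i == i')%:R%:M - c i' *m T i.
  have dE j' : m (j', i) - Om j' *m T i = \sum_i' m (j', i') *m d i'.
    rewrite /d; under eq_bigr do rewrite mulmxBr mul_mx_scalar mulmxA.
    rewrite big_split /= sumrN -mulmx_suml -/(Om j') (bigD1 i) //= eqxx scale1r.
    rewrite big1 ?addr0 // => k; rewrite eq_sym => /negbTE ->; rewrite scale0r //.
  by rewrite dE (sol_comb _ _ d d j0) // -dE Om0 -mT subrr mulmx0 scaler0.
Qed.

Lemma solform_le K n r (m : 'I_K * 'I_K.+1 -> 'M[C]_n) :
  solform r m -> (K * r <= n)%N.
Proof.
by move=> [Om [T [/isom_mxrow/isom_le + _ _]]]; rewrite sum_nat_const card_ord.
Qed.

Lemma solform_add K n r e (m : 'I_K * 'I_K.+1 -> 'M[C]_n) :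
  (K * (r + e) <= n)%N -> solform r m -> solform (r + e) m.
Proof.
move=> Kre [Om [T [h1 h2 h3]]]; have hO := h1; move/isom_mxrow: hO => hO.
have [|W [HW OW]] := @isom_extend _ _ _ (\sum_(j < K) e) _ hO.
  by rewrite !sum_nat_const card_ord -mulnDr.
exists (fun j => row_mx (Om j) (submxrow W j)), (fun i => col_mx (T i) 0); split.
- move=> j j'; rewrite hadj_row_mx mul_col_row h1.
  have W1 : hadj (submxrow W j) *m submxrow W j' = (j == j')%:R%:M.
    by move: HW; rewrite -{1}(submxrowK W) => /isom_mxrow.
  have W2 i i' : hadj (Om i) *m submxrow W i' = 0.
    have := OW; rewrite hadj_mxrow -{1}(submxrowK W) mul_mxcol_mxrow.
    by move/(congr1 (fun A => submxblock A i i')); rewrite mxblockK submxblock0.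
  have -> : hadj (submxrow W j) *m Om j' = 0 by rewrite -[LHS]hadjK hadjM hadjK W2 hadj0.
  by rewrite W1 W2 -scalar_mx_block.
- by rewrite -h2; apply: eq_bigr => i _; rewrite hadj_col_mx hadj0 mul_row_col mul0mx addr0.
- by move=> j i; rewrite mul_row_col mulmx0 addr0 h3.
Qed.

(** Padding [T] by zeros and extending [Om] orthonormally raises every solution to the largest
    possible rank, so that two solutions have factors of the same sizes and can be joined factor by
    factor. *)
Lemma sol_solform_max K n (m : 'I_K * 'I_K.+1 -> 'M[C]_n) : (0 < K)%N -> sol m ->
  solform (n %/ K) m.
Proof.
move=> K0 /(sol_solform K0)[r sr]; have Kr := solform_le sr.
have rn : (r <= n %/ K)%N by rewrite leq_divRL // mulnC.
rewrite -(subnKC rn); apply: solform_add => //.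
by rewrite subnKC // mulnC leq_trunc_div.
Qed.

Lemma sol_conn K n (m m' : 'I_K * 'I_K.+1 -> 'M[C]_n) : (0 < K)%N ->
  sol m -> sol m' -> pconn (@sol K n) m m'.
Proof.
move=> K0 /(sol_solform_max K0) [Om [T [h1 h2 h3]]].
move=> /(sol_solform_max K0) [Om' [T' [k1 k2 k3]]].
have hO := h1; move/isom_mxrow: hO => hO; have kO := k1; move/isom_mxrow: kO => kO.
have hT := h2; move/isom_mxcol: hT => hT; have kT := k2; move/isom_mxcol: kT => kT.
have [U [V [[U1 U2 U3 U4] VO]]] := isom_path hO kO.
have [P [Q [[P1 P2 P3 P4] QT]]] := isom_path hT kT.
pose O t j := submxrow (U t *m \mxrow_j Om j) j.
pose S t i := submxcol (P t *m \mxcol_i T i) i.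
exists (fun t ji => O t ji.1 *m S t ji.2); split.
- move=> [j i]; apply: mcontM.
    by apply: mcont_submxrow; apply: mcontM => //; apply: mcont_cst.
  by apply: mcont_submxcol; apply: mcontM => //; apply: mcont_cst.
- move=> t t0; apply/funext => -[j i]; rewrite /O /S U2 // P2 // !mul1mx.
  by rewrite mxrowK mxcolK h3.
- move=> t t0; apply/funext => -[j i]; rewrite /O /S U3 // P3 // VO QT.
  by rewrite mxrowK mxcolK k3.
- move=> t; apply: (@solform_sol _ _ (n %/ K)); exists (O t), (S t); split => //.
    apply/isom_mxrow; rewrite submxrowK; exact: isomM.
  apply/isom_mxcol; rewrite submxcolK; exact: isomM.
Qed.

(** A solution of rank r needs K r <= n <= (K + 1) r. The choice r = n %/ K satisfies the second
    bound because the remainder is less than K <= r. *)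
Lemma sol_exists K n : (0 < K)%N -> (K * K <= n)%N ->
  exists m : 'I_K * 'I_K.+1 -> 'M[C]_n, sol m.
Proof.
move=> K0 Kn; set r := (n %/ K)%N.
have isp a b : (b <= a)%N -> isom (pid_mx b : 'M[C]_(a, b)).
  move=> ba; rewrite /isom; have -> : hadj (pid_mx b : 'M[C]_(a, b)) = pid_mx b.
    by rewrite -[RHS]tr_pid_mx; congr (_^T); exact: map_pid_mx.
  by rewrite pid_mx_id // pid_mx_1.
have h1 : (\sum_(j < K) r <= n)%N by rewrite sum_nat_const card_ord mulnC leq_trunc_div.
have h2 : (n <= \sum_(j < K.+1) r)%N.
  rewrite sum_nat_const card_ord mulSn {1}(divn_eq n K) -/r addnC mulnC leq_add2r.
  by apply: ltnW; apply: (leq_trans (ltn_pmod n K0)); rewrite leq_divRL.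
exists (fun ji => submxrow (pid_mx (\sum_(j < K) r) : 'M[C]_(n, \sum_(j < K) r)) ji.1 *m
   submxcol (pid_mx n : 'M[C]_(\sum_(j < K.+1) r, n)) ji.2).
apply: (@solform_sol _ _ r); eexists; eexists; split; last by [].
  apply/isom_mxrow; rewrite submxrowK; exact: isp h1.
apply/isom_mxcol; rewrite submxcolK; exact: isp h2.
Qed.

End Solutions.

(** * Exact solutions commuting with a finite-dimensional algebra *)

Section Systems.
Context {R : realType}.
Local Notation C := R[i].

(* A unital *-representation on C^N of the finite-dimensional C*-algebra with
   blocks of sizes [d l], block by block. *)
Definition is_system L N (d : 'I_L -> nat) (rho : forall l, 'M[C]_(d l) -> 'M[C]_N) :=
  [/\ forall l a B B', rho l (a *: B + B') = a *: rho l B + rho l B',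
      forall l B B', rho l (B *m B') = rho l B *m rho l B',
      forall l B, rho l (hadj B) = hadj (rho l B),
      forall l l' B B', l != l' -> rho l B *m rho l' B' = 0 &
      \sum_l rho l 1%:M = 1%:M].

Definition commut L N (d : 'I_L -> nat) (rho : forall l, 'M[C]_(d l) -> 'M[C]_N)
    (m : 'M[C]_N) := forall l B, m *m rho l B = rho l B *m m.

Variables (L N : nat) (d : 'I_L -> nat) (rho : forall l, 'M[C]_(d l) -> 'M[C]_N).
Arguments rho : clear implicits.
Hypothesis sys : is_system rho.
Variable a0 : forall l, 'I_(d l).

Let rhoL l a B B' : rho l (a *: B + B') = a *: rho l B + rho l B'.
Proof. by have [H _ _ _ _] := sys. Qed.
Let rhoM l B B' : rho l (B *m B') = rho l B *m rho l B'.
Proof. by have [_ H _ _ _] := sys. Qed.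
Let rhoadj l B : rho l (hadj B) = hadj (rho l B).
Proof. by have [_ _ H _ _] := sys. Qed.
Let rhoO l l' B B' : l != l' -> rho l B *m rho l' B' = 0.
Proof. by have [_ _ _ H _] := sys; exact: H. Qed.
Let rho1 : \sum_l rho l 1%:M = 1%:M.
Proof. by have [_ _ _ _ H] := sys. Qed.
Let rhoD l B B' : rho l (B + B') = rho l B + rho l B'.
Proof. by rewrite -[B in LHS]scale1r rhoL scale1r. Qed.
Let rho0 l : rho l 0 = 0.
Proof. by apply: (addrI (rho l 0)); rewrite -rhoD !addr0. Qed.
Let rhoZ l a B : rho l (a *: B) = a *: rho l B.
Proof. by rewrite -[a *: B]addr0 rhoL rho0 addr0. Qed.
Let rho_sum l I (r : seq I) (P : pred I) (F : I -> 'M[C]_(d l)) :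
  rho l (\sum_(i <- r | P i) F i) = \sum_(i <- r | P i) rho l (F i).
Proof. exact: (big_morph _ (@rhoD l) (@rho0 l)). Qed.

Let e l := rho l (delta_mx (a0 l) (a0 l)).

Lemma hadj_delta m n (i : 'I_m) (j : 'I_n) : hadj (delta_mx i j : 'M[C]_(m, n)) = delta_mx j i.
Proof.
apply/matrixP => x y; rewrite hadjE !mxE andbC.
by case: (_ && _); [exact: conjc1|exact: conjc0].
Qed.

Lemma sum_delta n : \sum_i (delta_mx i i : 'M[C]_n) = 1%:M.
Proof.
apply/matrixP => x y; rewrite summxE [RHS]mxE (bigD1 x) //= mxE eqxx /= eq_sym.
rewrite big1 ?addr0 // => i ix; rewrite mxE eq_sym (negbTE ix) //.
Qed.

Section Frames.
Variables (n_ : 'I_L -> nat) (X : forall l, 'M[C]_(N, n_ l)).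
Hypothesis XX : forall l, isom (X l).
Hypothesis Xe : forall l, X l *m hadj (X l) = e l.

Let eX l : e l *m X l = X l.
Proof. by rewrite -Xe -mulmxA XX mulmx1. Qed.

Let Xadje l : hadj (X l) *m e l = hadj (X l).
Proof. by rewrite -Xe mulmxA XX mul1mx. Qed.

Let Y l a := rho l (delta_mx a (a0 l)) *m X l.

Let Yadj l a : hadj (Y (l := l) a) = hadj (X l) *m rho l (delta_mx (a0 l) a).
Proof. by rewrite /Y hadjM -rhoadj hadj_delta. Qed.

Let YO l l' a b : l != l' -> hadj (Y (l := l) a) *m Y (l := l') b = 0.
Proof.
by move=> ll; rewrite Yadj /Y mulmxA -(mulmxA (hadj _)) rhoO // mulmx0 mul0mx.
Qed.

Let YY l a b : hadj (Y (l := l) a) *m Y b = (a == b)%:R%:M.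
Proof.
rewrite Yadj /Y mulmxA -(mulmxA (hadj _)) -rhoM mul_delta_mx_cond.
case: eqVneq => _; last by rewrite mulr0n rho0 mulmx0 mul0mx raddf0.
by rewrite mulr1n Xadje XX.
Qed.

(** Rebuilds an element of the commutant from its compressions [cmp]: the commutant is a sum of full
    matrix algebras on the multiplicity spaces, of dimensions [n_ l], and [s l] is repeated along
    the d l coordinates of block l. The relations of [sol] can then be solved in each multiplicity
    space separately. *)
Definition asm (s : forall l, 'M[C]_(n_ l)) : 'M[C]_N :=
  \sum_l \sum_a Y a *m s l *m hadj (Y (l := l) a).

Lemma asmM s t : asm s *m asm t = asm (fun l => s l *m t l).
Proof.
have YYmid l a l' b : Y (l := l) a *m s l *m hadj (Y a) *m (Y (l := l') b *m t l' *m hadj (Y b)) =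
    Y a *m s l *m (hadj (Y a) *m Y b) *m t l' *m hadj (Y b) by rewrite !mulmxA.
rewrite /asm mulmx_suml; apply: eq_bigr => l _.
rewrite mulmx_suml; apply: eq_bigr => a _.
rewrite mulmx_sumr (bigD1 l) //= [X in _ + X]big1 ?addr0; last first.
  move=> l' ll; rewrite mulmx_sumr big1 // => b _.
  by rewrite YYmid YO ?mulmx0 ?mul0mx // eq_sym.
rewrite mulmx_sumr (bigD1 a) //= [X in _ + X]big1 ?addr0; last first.
  move=> b ba; rewrite YYmid YY eq_sym (negbTE ba).
  by rewrite raddf0 mulmx0 !mul0mx.
by rewrite YYmid YY eqxx mulmx1 !mulmxA.
Qed.

Lemma asm_hadj s : hadj (asm s) = asm (fun l => hadj (s l)).
Proof.
rewrite /asm hadj_sum; apply: eq_bigr => l _; rewrite hadj_sum; apply: eq_bigr => a _.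
by rewrite hadjM hadjK hadjM mulmxA.
Qed.

Lemma asm1 : asm (fun=> 1%:M) = 1%:M.
Proof.
rewrite /asm -rho1; apply: eq_bigr => l _; rewrite -(sum_delta (d l)) rho_sum.
apply: eq_bigr => a _; rewrite mulmx1 Yadj /Y mulmxA -(mulmxA _ (X l)) Xe /e.
by rewrite -!rhoM !mul_delta_mx.
Qed.

Lemma asm0 : asm (fun=> 0) = 0.
Proof.
by rewrite /asm big1 // => l _; rewrite big1 // => a _; rewrite mulmx0 mul0mx.
Qed.

Lemma asm_sum I (r : seq I) (P : pred I) (F : I -> forall l, 'M[C]_(n_ l)) :
  asm (fun l => \sum_(i <- r | P i) F i l) = \sum_(i <- r | P i) asm (F i).
Proof.
rewrite /asm exchange_big /=; apply: eq_bigr => l _.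
rewrite exchange_big /=; apply: eq_bigr => a _.
by rewrite mulmx_sumr mulmx_suml.
Qed.

Lemma asm_commut s : commut rho (asm s).
Proof.
move=> l B.
have lY a : rho l B *m Y (l := l) a = \sum_b B b a *: Y b.
  rewrite /Y mulmxA -rhoM.
  have -> : B *m delta_mx a (a0 l) = \sum_b B b a *: delta_mx b (a0 l).
    apply/matrixP => x y; rewrite summxE !mxE (bigD1 a) //= big1 ?addr0; last first.
      by move=> b ba; rewrite mxE (negbTE ba) mulr0.
    rewrite [RHS](bigD1 x) //= big1 ?addr0; last first.
      by move=> b bx; rewrite !mxE eq_sym (negbTE bx) mulr0.
    by rewrite !mxE !eqxx.
  by rewrite rho_sum mulmx_suml; apply: eq_bigr => b _; rewrite rhoZ scalemxAl.
have Yr a : hadj (Y (l := l) a) *m rho l B = \sum_b B a b *: hadj (Y b).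
  rewrite Yadj -mulmxA -rhoM.
  have -> : delta_mx (a0 l) a *m B = \sum_b B a b *: delta_mx (a0 l) b.
    apply/matrixP => x y; rewrite summxE !mxE (bigD1 a) //= big1 ?addr0; last first.
      by move=> b ba; rewrite mxE (negbTE ba) andbF mul0r.
    rewrite [RHS](bigD1 y) //= big1 ?addr0; last first.
      by move=> b bx; rewrite !mxE [y == b]eq_sym (negbTE bx) andbF mulr0.
    by rewrite !mxE !eqxx !andbT mulrC.
  by rewrite rho_sum mulmx_sumr; apply: eq_bigr => b _; rewrite rhoZ Yadj scalemxAr.
have lYO l' a : l != l' -> rho l B *m Y (l := l') a = 0.
  by move=> ll; rewrite /Y mulmxA rhoO // mul0mx.
have YrO l' a : l != l' -> hadj (Y (l := l') a) *m rho l B = 0.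
  by move=> ll; rewrite Yadj -mulmxA rhoO ?mulmx0 // eq_sym.
have z1 : \sum_(i < L | i != l) (\sum_a Y a *m s i *m hadj (Y (l := i) a)) *m rho l B = 0.
  by apply: big1 => l' ll; rewrite mulmx_suml big1 // => a _; rewrite -mulmxA YrO ?mulmx0 // eq_sym.
have z2 : \sum_(i < L | i != l) rho l B *m (\sum_a Y a *m s i *m hadj (Y (l := i) a)) = 0.
  by apply: big1 => l' ll; rewrite mulmx_sumr big1 // => a _; rewrite mulmxA [X in X *m _]mulmxA lYO ?mul0mx // eq_sym.
rewrite /asm mulmx_suml mulmx_sumr (bigD1 l) //= [RHS](bigD1 l) //= z1 z2 !addr0.
rewrite mulmx_suml mulmx_sumr.
under eq_bigr do rewrite -mulmxA Yr mulmx_sumr.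
under [RHS]eq_bigr do rewrite mulmxA [X in X *m _]mulmxA lY !mulmx_suml.
rewrite exchange_big /=; apply: eq_bigr => a _; apply: eq_bigr => b _.
by rewrite -scalemxAr -!scalemxAl.
Qed.

Definition cmp l (m : 'M[C]_N) := hadj (X l) *m m *m X l.

Lemma cmp_asm m : commut rho m -> asm (fun l => cmp l m) = m.
Proof.
move=> cm; rewrite /asm -[RHS]mulmx1 -rho1 mulmx_sumr; apply: eq_bigr => l _.
rewrite -sum_delta rho_sum mulmx_sumr; apply: eq_bigr => a _.
rewrite /cmp Yadj /Y !mulmxA -(mulmxA _ (X l) (hadj (X l))) Xe.
rewrite -!mulmxA (mulmxA (X l) (hadj (X l))) Xe !mulmxA.
by rewrite -rhoM mul_delta_mx -cm -!mulmxA -!rhoM !mul_delta_mx.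
Qed.

Lemma cmpM l m m' : commut rho m' -> cmp l m *m cmp l m' = cmp l (m *m m').
Proof.
move=> cm; rewrite /cmp !mulmxA -(mulmxA _ (X l)) Xe.
by rewrite -(mulmxA _ _ m') -(cm l) -!mulmxA eX.
Qed.

Lemma cmp_hadj l m : hadj (cmp l m) = cmp l (hadj m).
Proof. by rewrite /cmp !hadjM hadjK mulmxA. Qed.

Lemma cmp_sol K l (m : 'I_K * 'I_K.+1 -> 'M[C]_N) : (forall ji, commut rho (m ji)) ->
  sol m -> sol (fun ji => cmp l (m ji)).
Proof.
move=> cm [h1 h2 h3]; split.
- by move=> j j' i i' jj; rewrite cmp_hadj cmpM // (h1 j j') // /cmp mulmx0 mul0mx.
- by move=> j j' i i'; rewrite !cmp_hadj; (do 2 (rewrite cmpM; last exact: cm)); congr cmp; exact: h2.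
- move=> j; under eq_bigr do rewrite cmp_hadj cmpM // /cmp.
  by rewrite -mulmx_suml -mulmx_sumr h3 mulmx1 XX.
Qed.

Lemma asm_sol K (s : forall l, 'I_K * 'I_K.+1 -> 'M[C]_(n_ l)) :
  (forall l, sol (s l)) -> sol (fun ji => asm (fun l => s l ji)).
Proof.
move=> ss; split.
- move=> j j' i i' jj; rewrite asm_hadj asmM -[RHS]asm0; congr asm.
  by apply: functional_extensionality_dep => l; have [h _ _] := ss l; rewrite h.
- move=> j j' i i'; rewrite !asm_hadj !asmM; congr asm.
  by apply: functional_extensionality_dep => l; have [_ h _] := ss l; rewrite (h j j').
- move=> j; rewrite -asm1; under eq_bigr do rewrite asm_hadj asmM.
  rewrite -asm_sum; congr asm.
  by apply: functional_extensionality_dep => l; have [_ _ h] := ss l; rewrite h.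
Qed.

Lemma asm_cont (s : R -> forall l, 'M[C]_(n_ l)) :
  (forall l, mcont (fun t => s t l)) -> mcont (fun t => asm (s t)).
Proof.
move=> sc; apply: mcont_sum => l; apply: mcont_sum => a.
by apply: mcontM (mcont_cst _); apply: mcontM (mcont_cst _) _.
Qed.

Lemma frame_conn K (m m' : 'I_K * 'I_K.+1 -> 'M[C]_N) : (0 < K)%N ->
  (forall ji, commut rho (m ji)) -> (forall ji, commut rho (m' ji)) ->
  sol m -> sol m' -> pconn (fun x => sol x /\ forall ji, commut rho (x ji)) m m'.
Proof.
move=> K0 cm cm' sm sm'.
have H l := sol_conn K0 (cmp_sol l cm sm) (cmp_sol l cm' sm').
pose g l := projT1 (cid (H l)); have gP l := projT2 (cid (H l)).
exists (fun t ji => asm (fun l => g l t ji)); split.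
- by move=> ji; apply: asm_cont => l; have [h _ _ _] := gP l; apply: h.
- move=> t t0; apply/funext => ji; rewrite -[RHS]cmp_asm //; congr asm.
  by apply: functional_extensionality_dep => l; have [_ h _ _] := gP l; rewrite /g h.
- move=> t t0; apply/funext => ji; rewrite -[RHS]cmp_asm //; congr asm.
  by apply: functional_extensionality_dep => l; have [_ _ h _] := gP l; rewrite /g h.
- move=> t; split; last by move=> ji; exact: asm_commut.
  by apply: asm_sol => l; have [_ _ _ h] := gP l; exact: h.
Qed.

End Frames.

Lemma frames_exist : exists (n_ : 'I_L -> nat) (X : forall l, 'M[C]_(N, n_ l)),
  (forall l, isom (X l)) /\ forall l, X l *m hadj (X l) = e l.
Proof.
have H l : exists nX : {n : nat & 'M[C]_(N, n)},
    isom (projT2 nX) /\ projT2 nX *m hadj (projT2 nX) = e l.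
  have [r [X [S [h1 h2 h3]]]] := colspace_basis (e l).
  exists (existT _ r X) => /=; split => //.
  have ee : e l *m e l = e l by rewrite /e -rhoM mul_delta_mx.
  have es : hadj (e l) = e l by rewrite /e -rhoadj hadj_delta.
  have eX : e l *m X = X by rewrite h2 mulmxA ee.
  rewrite -{1}eX; have := congr1 (@hadj _ _ _) h3; rewrite !hadjM hadjK es => {2}->.
  by rewrite mulmxA.
have [f fP] := choice H.
exists (fun l => projT1 (f l)), (fun l => projT2 (f l)).
by split => l; have [] := fP l.
Qed.

Lemma sys_conn K (m m' : 'I_K * 'I_K.+1 -> 'M[C]_N) : (0 < K)%N ->
  (forall ji, commut rho (m ji)) -> (forall ji, commut rho (m' ji)) ->
  sol m -> sol m' -> pconn (fun x => sol x /\ forall ji, commut rho (x ji)) m m'.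
Proof.
by have [n_ [X [h1 h2]]] := frames_exist; exact: (frame_conn h1 h2).
Qed.

(** K * K orthogonal nonzero elements below the minimal projection [e l] force the multiplicity of
    block l to be at least K * K, which is what [sol_exists] asks for. *)
Lemma sys_exists K : (0 < K)%N ->
  (forall l, exists h : 'I_(K * K) -> 'M[C]_N, [/\ forall i, h i != 0,
    forall i, hadj (h i) = h i, forall i j, i != j -> h i *m h j = 0 &
    forall i, e l *m h i = h i]) ->
  exists m : 'I_K * 'I_K.+1 -> 'M[C]_N, sol m /\ forall ji, commut rho (m ji).
Proof.
move=> K0 H; have [n_ [X [h1 h2]]] := frames_exist.
have Kn l : (K * K <= n_ l)%N.
  have [h [k0 k1 k2 k3]] := H l.
  have k4 i : h i *m e l = h i.
    by rewrite -[LHS]hadjK hadjM k1 /e -rhoadj hadj_delta k3 k1.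
  apply: (@sa_orth_le _ _ _ (fun i => hadj (X l) *m h i *m X l)).
  - move=> i; apply: contra_neq (k0 i) => z.
    rewrite -(k3 i) -(k4 i) -h2 -!mulmxA (mulmxA (hadj _)) (mulmxA _ (X l)).
    by rewrite z mul0mx mulmx0.
  - by move=> i; rewrite !hadjM hadjK k1 mulmxA.
  - move=> i j ij; rewrite !mulmxA -(mulmxA _ (X l)) h2 -(mulmxA _ (h i)) k4.
    by rewrite -(mulmxA _ (h i)) k2 // mulmx0 mul0mx.
have S l := @sol_exists R _ _ K0 (Kn l).
pose s l := projT1 (cid (S l)); have sP l : sol (s l) := projT2 (cid (S l)).
exists (fun ji => asm X (fun l => s l ji)); split; first exact: asm_sol.
by move=> ji; exact: asm_commut.
Qed.

End Systems.

(** * Dimension drop algebras *)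

Section OperatorBounds.
Context {R : realType}.
Local Notation C := R[i].

(** A bound on the operator norm, in squared form and tested on vectors; this keeps suprema and
    roots out of the estimates. *)
Definition opb m n (c : R) (A : 'M[C]_(m, n)) :=
  forall v : 'cV[C]_n, nv (A *m v) <= c ^+ 2 * nv v.

Lemma nv0 n : nv (0 : 'cV[C]_n) = 0.
Proof. by apply: big1 => i _; rewrite mxE normc0 expr0n. Qed.

Lemma nvZ n a (v : 'cV[C]_n) : nv (a *: v) = normc a ^+ 2 * nv v.
Proof. by rewrite /nv mulr_sumr; apply: eq_bigr => i _; rewrite mxE normcM exprMn. Qed.

Lemma nvN n (v : 'cV[C]_n) : nv (- v) = nv v.
Proof. by apply: eq_bigr => i _; rewrite mxE normcN. Qed.

Lemma nv_isom m n (X : 'M[C]_(m, n)) v : isom X -> nv (X *m v) = nv v.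
Proof.
move=> HX; apply: complexI; have := nvE (X *m v).
rewrite hadjM mulmxA -(mulmxA (hadj v)) HX mulmx1 nvE => /matrixP /(_ ord0 ord0).
by rewrite !mxE !mulr1n.
Qed.

Lemma opb_isom m n (X : 'M[C]_(m, n)) : isom X -> opb 1 X.
Proof. by move=> HX v; rewrite nv_isom // expr1n mul1r. Qed.

Lemma opb0 m n c : opb c (0 : 'M[C]_(m, n)).
Proof. by move=> v; rewrite mul0mx nv0 mulr_ge0 ?nv_ge0 ?sqr_ge0. Qed.

Lemma opb_le m n c d (A : 'M[C]_(m, n)) : 0 <= c -> c <= d -> opb c A -> opb d A.
Proof.
move=> c0 cd HA v; apply: le_trans (HA v) _; rewrite ler_wpM2r ?nv_ge0 //.
by rewrite ler_pXn2r ?nnegrE // (le_trans c0).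
Qed.

Lemma opbM m n p c d (A : 'M[C]_(m, n)) (B : 'M[C]_(n, p)) :
  opb c A -> opb d B -> opb (c * d) (A *m B).
Proof.
move=> HA HB v; rewrite -mulmxA (le_trans (HA _)) // exprMn -[leRHS]mulrA.
by rewrite ler_wpM2l ?sqr_ge0.
Qed.

Lemma opbZ m n c a (A : 'M[C]_(m, n)) : opb c A -> opb (normc a * c) (a *: A).
Proof.
by move=> HA v; rewrite -scalemxAl nvZ exprMn -[leRHS]mulrA ler_wpM2l ?sqr_ge0.
Qed.

Lemma opbN m n c (A : 'M[C]_(m, n)) : opb c A -> opb c (- A).
Proof. by move=> HA v; rewrite mulNmx nvN. Qed.

(** Minkowski's inequality in squared form. It comes from (x + y)^2 <= (1 + b / a) x^2 + (1 + a / b)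
    y^2 entry by entry, the difference of the two sides being (b x - a y)^2 / (a b). *)
Lemma nv_add n (u v : 'cV[C]_n) (a b s : R) : 0 <= a -> 0 <= b -> 0 <= s ->
  nv u <= a ^+ 2 * s -> nv v <= b ^+ 2 * s -> nv (u + v) <= (a + b) ^+ 2 * s.
Proof.
move=> a0 b0 s0 ua vb.
have [az|an] := eqVneq a 0.
  have -> : u = 0.
    by apply: nv_eq0; apply/eqP; rewrite eq_le nv_ge0 andbT; move: ua; rewrite az expr0n mul0r.
  by rewrite az !add0r.
have [bz|bn] := eqVneq b 0.
  have -> : v = 0.
    by apply: nv_eq0; apply/eqP; rewrite eq_le nv_ge0 andbT; move: vb; rewrite bz expr0n mul0r.
  by rewrite bz !addr0.
have ap : 0 < a by rewrite lt_def an.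
have bp : 0 < b by rewrite lt_def bn.
have key (x y : R) : 0 <= x -> 0 <= y ->
    (x + y) ^+ 2 <= (1 + b / a) * x ^+ 2 + (1 + a / b) * y ^+ 2.
  move=> x0 y0; rewrite -subr_ge0.
  have -> : (1 + b / a) * x ^+ 2 + (1 + a / b) * y ^+ 2 - (x + y) ^+ 2 =
     (b * x - a * y) ^+ 2 / (a * b) by field; rewrite an bn.
  by rewrite divr_ge0 ?sqr_ge0 // mulr_ge0.
apply: (@le_trans _ _ ((1 + b / a) * nv u + (1 + a / b) * nv v)).
  rewrite /nv !mulr_sumr -big_split /=; apply: ler_sum => i _; rewrite mxE.
  apply: le_trans (key _ _ (normc_ge0 _) (normc_ge0 _)).
  by rewrite ler_pXn2r ?nnegrE ?addr_ge0 ?normc_ge0 // le_normcD.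
have -> : (a + b) ^+ 2 * s = (1 + b / a) * (a ^+ 2 * s) + (1 + a / b) * (b ^+ 2 * s).
  by field; rewrite an bn.
by apply: lerD; rewrite ler_wpM2l // addr_ge0 // divr_ge0.
Qed.

Lemma opbD m n c d (A B : 'M[C]_(m, n)) : 0 <= c -> 0 <= d ->
  opb c A -> opb d B -> opb (c + d) (A + B).
Proof. by move=> c0 d0 HA HB v; rewrite mulmxDl nv_add ?nv_ge0. Qed.

Lemma opbB m n c d (A B : 'M[C]_(m, n)) : 0 <= c -> 0 <= d ->
  opb c A -> opb d B -> opb (c + d) (A - B).
Proof. by move=> c0 d0 HA HB; apply: opbD => //; exact: opbN. Qed.

Lemma opb_sum m n I (r : seq I) (P : pred I) (c : I -> R) (F : I -> 'M[C]_(m, n)) :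
  (forall i, 0 <= c i) -> (forall i, opb (c i) (F i)) ->
  opb (\sum_(i <- r | P i) c i) (\sum_(i <- r | P i) F i).
Proof.
move=> c0 H.
suff : 0 <= \sum_(i <- r | P i) c i /\ opb (\sum_(i <- r | P i) c i) (\sum_(i <- r | P i) F i) by case.
elim/big_rec2: _ => [|i A d _ [d0 IH]]; first by split => //; exact: opb0.
by split; [rewrite addr_ge0|apply: opbD].
Qed.

Lemma nv_CS n (u v : 'cV[C]_n) :
  normc ((hadj u *m v) ord0 ord0) ^+ 2 <= nv u * nv v.
Proof.
set al := (_ *m _) _ _.
have [v0|vn] := eqVneq (nv v) 0.
  by rewrite /al (nv_eq0 v0) mulmx0 mxE normc0 expr0n nv0 mulr0.
have vp : 0 < nv v by rewrite lt_def vn nv_ge0.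
have uv : hadj u *m v = al%:M by exact: mx11_scalar.
have vu : hadj v *m u = (al^*%C)%:M.
  rewrite -[LHS]hadjK hadjM hadjK uv; apply/matrixP => i j.
  by rewrite !ord1 hadjE !mxE eqxx !mulr1n.
pose w := (nv v)%:C *: u - al^*%C *: v.
have := nv_ge0 w; have -> : nv w = nv v * (nv u * nv v - normc al ^+ 2).
  apply: complexI; have /matrixP /(_ ord0 ord0) := nvE w.
  rewrite [in X in _ = X -> _]mxE mulr1n => <-.
  rewrite /w hadjB !hadjZ conjc_real conjcK mulmxBl !mulmxBr -!scalemxAl -!scalemxAr.
  have -> : (nv v * (nv u * nv v - normc al ^+ 2))%:C =
      (nv v)%:C * ((nv u)%:C * (nv v)%:C - al^*%C * al) :> C.
    by rewrite normcMconj rmorphM rmorphB rmorphM.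
  by rewrite uv vu !nvE !mxE !mulr1n; ring.
by rewrite pmulr_rge0 // subr_ge0.
Qed.

Lemma opb_adj m n c (A : 'M[C]_(m, n)) : 0 <= c -> opb c A -> opb c (hadj A).
Proof.
move=> c0 HA v; set w := hadj A *m v.
have [w0|wn] := eqVneq (nv w) 0; first by rewrite w0 mulr_ge0 ?nv_ge0 ?sqr_ge0.
have wp : 0 < nv w by rewrite lt_def wn nv_ge0.
rewrite -(ler_pM2r wp).
have : nv w ^+ 2 <= nv v * nv (A *m w).
  apply: le_trans (nv_CS v (A *m w)).
  rewrite mulmxA -[hadj v *m A]hadjK hadjM hadjK -/w nvE mxE mulr1n normc_real.
  by rewrite ger0_norm ?nv_ge0.
move/le_trans => H; rewrite -expr2; apply: H.
by rewrite mulrC -mulrA [nv v * _]mulrC mulrA ler_wpM2r ?nv_ge0.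
Qed.

Lemma opb_adjmul m n c (A : 'M[C]_(m, n)) : 0 <= c -> opb (c ^+ 2) (hadj A *m A) -> opb c A.
Proof.
move=> c0 H v.
have h : nv (A *m v) ^+ 2 <= (c ^+ 2 * nv v) ^+ 2.
  apply: (@le_trans _ _ (nv v * nv (hadj A *m A *m v))).
    apply: le_trans (nv_CS v _).
    rewrite -mulmxA mulmxA -hadjM nvE mxE mulr1n normc_real.
    by rewrite ger0_norm ?nv_ge0.
  apply: le_trans (ler_wpM2l (nv_ge0 v) (H v)) _.
  by rewrite le_eqVlt; apply/orP; left; apply/eqP; ring.
by move: h; rewrite ler_pXn2r ?nnegrE ?mulr_ge0 ?nv_ge0 ?sqr_ge0.
Qed.

Lemma opb_entry m n c (A : 'M[C]_(m, n)) i j : 0 <= c -> opb c A -> normc (A i j) <= c.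
Proof.
move=> c0 HA; have := HA (delta_mx j ord0).
have -> : nv (delta_mx j ord0 : 'cV[C]_n) = 1.
  rewrite /nv (bigD1 j) //= big1 ?addr0; last first.
    by move=> k kj; rewrite mxE (negbTE kj) normc0 expr0n.
  by rewrite mxE !eqxx normc1 expr1n.
rewrite mulr1 -colE /nv (bigD1 i) //= => H.
rewrite -(@ler_pXn2r _ 2) ?nnegrE ?normc_ge0 //; apply: le_trans H.
by rewrite !mxE lerDl sumr_ge0 // => k _; rewrite sqr_ge0.
Qed.

(** The factor m.+1 replaces the square root of m in the natural bound. *)
Lemma entry_opb m n e (A : 'M[C]_(m, n)) : 0 <= e ->
  (forall i j, normc (A i j) <= e) -> opb (m.+1%:R * n%:R * e) A.
Proof.
move=> e0 H v; set s := Num.sqrt (nv v).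
have sv : s ^+ 2 = nv v by rewrite sqr_sqrtr // nv_ge0.
have s0 : 0 <= s by exact: sqrtr_ge0.
have vs j : normc (v j ord0) <= s.
  rewrite -(@ler_pXn2r _ 2) ?nnegrE ?normc_ge0 // sv /nv (bigD1 j) //= lerDl.
  by rewrite sumr_ge0 // => k _; rewrite sqr_ge0.
have E i : normc ((A *m v) i ord0) <= n%:R * (e * s).
  rewrite mxE; have : \sum_(j < n) normc (A i j * v j ord0) <= n%:R * (e * s).
    rewrite mulr_natl -[X in _ *+ X]card_ord -sumr_const; apply: ler_sum => j _.
    by rewrite normcM ler_pM ?normc_ge0.
  apply: le_trans; elim/big_rec2: _ => [|j x y _ IH]; first by rewrite normc0.
  by apply: le_trans (le_normcD _ _) _; rewrite lerD2l.
apply: (@le_trans _ _ (m%:R * (n%:R * (e * s)) ^+ 2)).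
  rewrite mulr_natl -[X in _ *+ X]card_ord -sumr_const; apply: ler_sum => i _.
  by rewrite ler_pXn2r ?nnegrE ?normc_ge0 ?mulr_ge0.
rewrite -sv; set z := (n%:R * (e * s)) ^+ 2.
have -> : (m.+1%:R * n%:R * e) ^+ 2 * s ^+ 2 = m.+1%:R ^+ 2 * z by rewrite /z; ring.
by rewrite ler_wpM2r ?sqr_ge0 // -natrX ler_nat; nia.
Qed.

(* The square root [1 - r] of [1 - c], as in [usqrt_lim]. *)
Fixpoint msqit n (c : 'M[C]_n) k : 'M[C]_n :=
  if k is k'.+1 then (2^-1)%:C *: (c + msqit c k' *m msqit c k') else 0.

Lemma normc_half : normc (2^-1%:C : C) = 2^-1.
Proof. by rewrite normc_real ger0_norm // invr_ge0. Qed.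

Lemma opbZ_half m n k (A : 'M[C]_(m, n)) : opb k A -> opb (2^-1 * k) (2^-1%:C *: A).
Proof. by move=> Ak; have := opbZ (2^-1%:C) Ak; rewrite normc_half. Qed.

Section MatrixSqrt.
Variables (n : nat) (c : 'M[C]_n) (k : R).
Hypothesis k0 : 0 <= k.
Hypothesis k1 : k < 1.
Hypothesis ck : opb k c.

Lemma msqit_le j : opb k (msqit c j).
Proof.
elim: j => [|j IH] /=; first exact: opb0.
apply: (@opb_le _ _ (2^-1 * (k + k * k))).
- by rewrite mulr_ge0 ?addr_ge0 ?mulr_ge0 ?invr_ge0.
- have : k * k <= k by apply: ler_piMl => //; exact: ltW.
  lra.
- apply/opbZ_half/opbD => //; first exact: mulr_ge0.
  exact: opbM.
Qed.

Lemma msqit_step j : opb (k ^+ j.+1) (msqit c j.+1 - msqit c j).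
Proof.
elim: j => [|j IH].
  rewrite /= mulmx0 addr0 subr0 expr1; apply: (@opb_le _ _ (2^-1 * k)); last first.
  - exact: opbZ_half.
  - by have := k0; lra.
  - by rewrite mulr_ge0 // invr_ge0.
have -> : msqit c j.+2 - msqit c j.+1 = 2^-1%:C *:
   ((msqit c j.+1 - msqit c j) *m msqit c j.+1 + msqit c j *m (msqit c j.+1 - msqit c j)).
  rewrite mulmxBl mulmxBr addrA subrK -[LHS]/(2^-1%:C *: (c + _ *m _) - 2^-1%:C *: (c + _ *m _)).
  by rewrite -scalerBr opprD addrACA subrr add0r.
have -> : k ^+ j.+2 = 2^-1 * (k ^+ j.+1 * k + k * k ^+ j.+1) by rewrite exprSr; field.
by apply/opbZ_half/opbD; rewrite ?mulr_ge0 ?exprn_ge0 //;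
  apply: opbM => //; exact: msqit_le.
Qed.

Lemma msqit_dist j l a b :
  normc ((msqit c (j + l) - msqit c j) a b) <= k ^+ j.+1 / (1 - k).
Proof.
have k1' : 0 < 1 - k by rewrite subr_gt0.
rewrite ler_pdivlMr //.
suff : normc ((msqit c (j + l) - msqit c j) a b) * (1 - k) <= k ^+ j.+1 - k ^+ (j + l).+1.
  by move/le_trans; apply; rewrite gerBl exprn_ge0.
elim: l => [|l IH]; first by rewrite addn0 !subrr mxE normc0 mul0r.
have -> : msqit c (j + l.+1) - msqit c j = (msqit c (j + l) - msqit c j) +
    (msqit c (j + l).+1 - msqit c (j + l)) by rewrite addnS; ncmx.
have h := opb_entry a b (exprn_ge0 _ k0) (msqit_step (j + l)).
have h2 := le_normcD ((msqit c (j + l) - msqit c j) a b)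
   ((msqit c (j + l).+1 - msqit c (j + l)) a b).
have h3 := ler_wpM2r (ltW k1') h2; have h4 := ler_wpM2r (ltW k1') h.
have mxD (A B : 'M[C]_n) : (A + B) a b = A a b + B a b by rewrite mxE.
rewrite mxD addnS [k ^+ (j + l).+2]exprS.
by set z := k ^+ (j + l).+1 in IH h4 *; lra.
Qed.

Lemma geom_small e : 0 < e -> exists N, forall j, (N <= j)%N -> k ^+ j.+1 / (1 - k) < e.
Proof.
move=> e0; have k1' : 0 < 1 - k by rewrite subr_gt0.
have : (fun n => k ^+ n) @ \oo --> (0 : R) by apply: cvg_expr; rewrite ger0_norm.
move/cvgrPdist_lt => /(_ (e * (1 - k)) (mulr_gt0 e0 k1')) [N _ H].
exists N => j Nj; rewrite ltr_pdivrMr //.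
by have := H j.+1 (leqW Nj); rewrite /= sub0r normrN ger0_norm // exprn_ge0.
Qed.

(** Requiring k < 1 gives a geometric rate that depends on k alone. In [dd_sqrt] the same rate
    serves all points of [0, 1], so the limit is uniform and stays in the dimension drop algebra. *)
Lemma msqrt_lim : exists r : 'M[C]_n,
  [/\ forall j a b, normc ((msqit c j - r) a b) <= k ^+ j.+1 / (1 - k),
      (1%:M - r) *m (1%:M - r) = 1%:M - c,
      hadj c = c -> hadj r = r & forall y, y *m c = c *m y -> y *m r = r *m y].
Proof.
have H a b : exists l, forall e : R, 0 < e -> exists N, forall j, (N <= j)%N ->
    normc (msqit c j a b - l) < e.
  apply: complex_complete => e e0; have [N HN] := geom_small e0; exists N.
  have H2 i j : (N <= i)%N -> (i <= j)%N -> normc (msqit c j a b - msqit c i a b) < e.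
    move=> Ni ij; rewrite -(subnKC ij); apply: le_lt_trans (HN i Ni).
    by have := msqit_dist i (j - i) a b; rewrite !mxE.
  move=> i j Ni Nj; case: (leqP i j) => [ij|/ltnW ji]; last exact: H2.
  by rewrite -normcN opprB; exact: H2.
pose r : 'M[C]_n := \matrix_(a, b) projT1 (cid (H a b)).
have rP a b := projT2 (cid (H a b)).
have rD j a b : normc ((msqit c j - r) a b) <= k ^+ j.+1 / (1 - k).
  apply/ler_addgt0Pr => e e0; have [N HN] := rP a b e e0.
  have := HN (j + N)%N (leq_addl _ _) => h1.
  have := msqit_dist j N a b; rewrite !mxE => h2.
  have -> : msqit c j a b - projT1 (cid (H a b)) =
    - (msqit c (j + N) a b - msqit c j a b) + (msqit c (j + N) a b - projT1 (cid (H a b))).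
    by rewrite opprB addrA subrK.
  apply: le_trans (le_normcD _ _) _; rewrite normcN; apply: lerD => //; exact: ltW.
have lim0 (x : C) (K : R) : 0 <= K ->
    (forall j, normc x <= K * (k ^+ j.+1 / (1 - k))) -> x = 0.
  move=> K0 Hx; apply/eqP; rewrite -normc_eq0 eq_le normc_ge0 andbT.
  apply/ler_addgt0Pr => e e0; rewrite add0r.
  have [N HN] := geom_small (divr_gt0 e0 (ltr_wpDl K0 ltr01)).
  apply: le_trans (Hx N) _; have := HN N (leqnn N); rewrite ltr_pdivlMr ?ltr_wpDl //.
  have : 0 <= k ^+ N.+1 / (1 - k) by rewrite divr_ge0 ?exprn_ge0 // subr_ge0 ltW.
  set z := _ / _ => z0; nra.
have rb a b : normc (r a b) <= k / (1 - k).
  by have := rD 0%N a b; rewrite !mxE sub0r normcN expr1.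
have sb j a b : normc (msqit c j a b) <= 1.
  by apply: opb_entry; [exact: ler01|apply: (opb_le k0 (ltW k1)); exact: msqit_le].
have k1' : 0 <= (1 - k)^-1 by rewrite invr_ge0 subr_ge0 ltW.
have sumle (F : 'I_n -> C) (B : R) : (forall i, normc (F i) <= B) ->
    normc (\sum_i F i) <= n%:R * B.
  move=> HF; have : \sum_(i < n) normc (F i) <= n%:R * B.
    by rewrite mulr_natl -[X in _ *+ X]card_ord -sumr_const; apply: ler_sum.
  apply: le_trans; elim/big_rec2: _ => [|i x y _ IH]; first by rewrite normc0.
  by apply: le_trans (le_normcD _ _) _; rewrite lerD2l.
exists r; split => //.
- have -> : (1%:M - r) *m (1%:M - r) = 1%:M - (r + r - r *m r).
    by ncmx.
  congr (1%:M - _); apply/eqP; rewrite -subr_eq0; apply/eqP/matrixP => a b.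
  rewrite [RHS]mxE; apply: (lim0 _ (2 + n%:R * (k / (1 - k)) + n%:R)).
    by rewrite !addr_ge0 // mulr_ge0 // mulr_ge0.
  move=> j; set z := k ^+ j.+1 / (1 - k).
  have z0 : 0 <= z by rewrite mulr_ge0 ?exprn_ge0.
  have cE : c = msqit c j.+1 + msqit c j.+1 - msqit c j *m msqit c j.
    rewrite /= -scalerDl -rmorphD.
    have -> : (2^-1 + 2^-1 : R) = 1 by field.
    by rewrite scale1r addrK.
  have E : r + r - r *m r - c = - (msqit c j.+1 - r) - (msqit c j.+1 - r) +
     ((msqit c j - r) *m r + msqit c j *m (msqit c j - r)).
    by rewrite {1}cE; ncmx.
  have zz : k ^+ j.+2 / (1 - k) <= z.
    by rewrite ler_wpM2r // exprS; apply: ler_piMl (ltW k1); rewrite exprn_ge0.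
  have h1 : normc (- ((msqit c j.+1 - r) a b)) <= z by rewrite normcN; apply: le_trans zz.
  rewrite E !mxE; apply: le_trans (le_normcD _ _) _.
  have -> : (2 + n%:R * (k / (1 - k)) + n%:R) * z =
     (z + z) + (n%:R * (z * (k / (1 - k))) + n%:R * (1 * z)) by ring.
  apply: lerD; apply: le_trans (le_normcD _ _) _; apply: lerD.
  + by move: h1; rewrite !mxE.
  + by move: h1; rewrite !mxE.
  + by apply: sumle => i; rewrite normcM ler_pM ?normc_ge0.
  + by apply: sumle => i; rewrite normcM ler_pM ?normc_ge0.
- move=> cs; have ss j : hadj (msqit c j) = msqit c j.
    elim: j => [|j IH] /=; first exact: hadj0.
    by rewrite hadjZ conjc_real hadjD cs hadjM IH.
  apply/eqP; rewrite -subr_eq0; apply/eqP/matrixP => a b; rewrite [RHS]mxE.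
  apply: (lim0 _ 2) => // j.
  have -> : hadj r - r = - hadj (msqit c j - r) + (msqit c j - r).
    by rewrite hadjB ss; ncmx.
  have mxD (A B : 'M[C]_n) : (A + B) a b = A a b + B a b by rewrite mxE.
  have mxN (A : 'M[C]_n) : (- A) a b = - A a b by rewrite mxE.
  rewrite mxD mxN hadjE; apply: le_trans (le_normcD _ _) _; rewrite normcN normc_conj.
  by rewrite mulr2n mulrDl mul1r; apply: lerD.
- move=> y yc; have ss j : y *m msqit c j = msqit c j *m y.
    elim: j => [|j IH] /=; first by rewrite mulmx0 mul0mx.
    by rewrite -scalemxAl -scalemxAr mulmxDl mulmxDr yc mulmxA IH -!mulmxA IH.
  apply/eqP; rewrite -subr_eq0; apply/eqP/matrixP => a b; rewrite [RHS]mxE.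
  pose B := \sum_i \sum_j normc (y i j).
  have B0 : 0 <= B by apply: sumr_ge0 => i _; apply: sumr_ge0 => j _; exact: normc_ge0.
  have yB i j : normc (y i j) <= B.
    rewrite /B (bigD1 i) //= (bigD1 j) //= -addrA lerDl addr_ge0 //.
      by apply: sumr_ge0 => l _; exact: normc_ge0.
    by apply: sumr_ge0 => l _; apply: sumr_ge0 => l' _; exact: normc_ge0.
  apply: (lim0 _ (n%:R * B + n%:R * B)); first by rewrite addr_ge0 // mulr_ge0.
  move=> j; have -> : y *m r - r *m y = (msqit c j - r) *m y - y *m (msqit c j - r).
    by rewrite mulmxBl mulmxBr ss; ncmx.
  have mxD (M M' : 'M[C]_n) : (M + M') a b = M a b + M' a b by rewrite mxE.
  have mxN (M : 'M[C]_n) : (- M) a b = - M a b by rewrite mxE.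
  rewrite mxD mxN; apply: le_trans (le_normcD _ _) _; rewrite normcN mulrDl -!mulrA.
  apply: lerD; rewrite mxE; apply: sumle => i; rewrite normcM; last first.
    by rewrite ler_pM ?normc_ge0.
  by rewrite [B * _]mulrC ler_pM ?normc_ge0.
Qed.

End MatrixSqrt.

End OperatorBounds.

(** * Operations and square roots in dimension drop algebras *)

Section DimensionDrop.
Context {R : realType}.
Local Notation C := R[i].

Definition seg : set R := `[0, 1]%classic.

Definition mcont01 m n (f : R -> 'M[C]_(m, n)) := @mcont R (subspace seg) m n f.

Lemma segP t : seg t <-> 0 <= t <= 1.
Proof. by rewrite /seg /= in_itv. Qed.

Lemma mcont_mcont01 m n (f : R -> 'M[C]_(m, n)) : mcont f -> mcont01 f.
Proof. by move=> H i j; have [h1 h2] := H i j; split; apply: continuous_subspaceT. Qed.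

Lemma continuous01P (f : R -> R) : {within seg, continuous f} <->
  forall c, seg c -> forall e, 0 < e -> exists2 d, 0 < d &
    forall t, seg t -> `|t - c| < d -> `|f t - f c| < e.
Proof.
split.
- move=> /subspace_continuousP fc c sc e e0.
  have /cvgrPdist_lt/(_ e e0) := fc c sc; rewrite /= /within /= => -[d /= d0 H].
  exists d => // t st tc; rewrite distrC; apply: (H t) => //.
  by rewrite /= distrC.
- move=> H; apply/subspace_continuousP => c sc.
  apply/cvgrPdist_lt => e e0; have [d d0 Hd] := H c sc e e0.
  exists d => //= t tc st; rewrite distrC; apply: Hd => //.
  by rewrite distrC.
Qed.

Lemma mcont01P m n (f : R -> 'M[C]_(m, n)) : mcont01 f <->
  forall c, seg c -> forall e, 0 < e -> exists2 d, 0 < d &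
    forall t, seg t -> `|t - c| < d -> forall i j, normc ((f t - f c) i j) < e.
Proof.
split.
- move=> H c sc e e0; have e20 : 0 < e / 2 by rewrite divr_gt0.
  have K (ij : 'I_m * 'I_n) : exists d, 0 < d /\ forall t, seg t -> `|t - c| < d ->
      normc ((f t - f c) ij.1 ij.2) < e.
    have [/continuous01P/(_ c sc _ e20)[d1 d10 H1] /continuous01P/(_ c sc _ e20)[d2 d20 H2]] := H ij.1 ij.2.
    exists (Num.min d1 d2); split; first by rewrite lt_min d10.
    move=> t st; rewrite lt_min => /andP[t1 t2]; rewrite !mxE.
    apply: le_lt_trans (normc_ReIm _) _; rewrite !raddfB /=.
    by have := H1 t st t1; have := H2 t st t2; lra.
  have [d dP] := choice K.
  exists (\big[Num.min/1]_ij d ij).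
    by apply/bigmin_gtP; split => // ij _; have [] := dP ij.
  move=> t st /bigmin_gtP[_ tc] i j; have [_ h] := dP (i, j).
  by apply: h => //; apply: tc.
- move=> H i j; split; apply/continuous01P => c sc e e0; have [d d0 Hd] := H c sc e e0;
  exists d => // t st tc; have := Hd t st tc i j; rewrite !mxE; apply: le_lt_trans;
  by rewrite -raddfB ?normc_Re ?normc_Im.
Qed.

Lemma mcont01_eq m n (f g : R -> 'M[C]_(m, n)) : (forall t, seg t -> f t = g t) ->
  mcont01 f -> mcont01 g.
Proof.
move=> fg /mcont01P H; apply/mcont01P => c sc e e0; have [d d0 Hd] := H c sc e e0.
by exists d => // t st tc i j; rewrite -!fg //; exact: Hd.
Qed.

Lemma dimdropP p q (f : R -> 'M[C]_(p * q)) : dimension_drop f <->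
  [/\ mcont01 f, exists g : 'M[C]_p, f 0 = g *t (1%:M : 'M[C]_q) &
      exists h : 'M[C]_q, f 1 = (1%:M : 'M[C]_p) *t h].
Proof.
split; first by move=> [h1 h2 h3 h4]; split => // i j; split; [exact: h1|exact: h2].
by move=> [h1 h2 h3]; split => // i j; have [] := h1 i j.
Qed.

Lemma tensD1l p q (g g' : 'M[C]_p) (h : 'M[C]_q) : (g + g') *t h = g *t h + g' *t h.
Proof. by apply/matrixP => i j; rewrite !mxE mulrDl. Qed.
Lemma tensD1r p q (g : 'M[C]_p) (h h' : 'M[C]_q) : g *t (h + h') = g *t h + g *t h'.
Proof. by apply/matrixP => i j; rewrite !mxE mulrDr. Qed.
Lemma tensZl p q a (g : 'M[C]_p) (h : 'M[C]_q) : (a *: g) *t h = a *: (g *t h).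
Proof. by apply/matrixP => i j; rewrite !mxE mulrA. Qed.
Lemma tensZr p q a (g : 'M[C]_p) (h : 'M[C]_q) : g *t (a *: h) = a *: (g *t h).
Proof. by apply/matrixP => i j; rewrite !mxE mulrCA. Qed.
Lemma tens_hadj p q (g : 'M[C]_p) (h : 'M[C]_q) : hadj (g *t h) = hadj g *t hadj h.
Proof. by apply/matrixP => i j; rewrite !mxE rmorphM. Qed.
Lemma tens_scalarl p q (a : C) : a%:M = a%:M *t (1%:M : 'M[C]_q) :> 'M[C]_(p * q).
Proof.
apply/matrixP => i j; case: (mxtens_indexP i) => x u; case: (mxtens_indexP j) => y v.
rewrite tensmxE !mxE (can_eq (@mxtens_indexK p q)) xpair_eqE.
by case: (x == y); case: (u == v); rewrite /= ?mulr1n ?mulr0n ?mulr1 ?mulr0 ?mul0r.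
Qed.
Lemma tens_scalarr p q (a : C) : a%:M = (1%:M : 'M[C]_p) *t a%:M :> 'M[C]_(p * q).
Proof. by rewrite tens_scalarl -(scalemx1 _ a) tensZl -tensZr scalemx1. Qed.
Lemma tens11 p q : (1%:M : 'M[C]_p) *t (1%:M : 'M[C]_q) = 1%:M.
Proof. by rewrite -tens_scalarl. Qed.

Lemma dd_lin p q (a : C) (f g : R -> 'M[C]_(p * q)) : dimension_drop f ->
  dimension_drop g -> dimension_drop (fun t => a *: f t + g t).
Proof.
move=> /dimdropP[f1 [f2 E2] [f3 E3]] /dimdropP[g1 [g2 F2] [g3 F3]]; apply/dimdropP; split.
- by apply: mcontD => //; apply: mcontZ => //; exact: cC_cst.
- by exists (a *: f2 + g2); rewrite E2 F2 tensD1l tensZl.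
- by exists (a *: f3 + g3); rewrite E3 F3 tensD1r tensZr.
Qed.

Lemma dd_mul p q (f g : R -> 'M[C]_(p * q)) : dimension_drop f ->
  dimension_drop g -> dimension_drop (fun t => f t *m g t).
Proof.
move=> /dimdropP[f1 [f2 E2] [f3 E3]] /dimdropP[g1 [g2 F2] [g3 F3]]; apply/dimdropP; split.
- exact: mcontM.
- by exists (f2 *m g2); rewrite E2 F2 tensmx_mul mulmx1.
- by exists (f3 *m g3); rewrite E3 F3 tensmx_mul mulmx1.
Qed.

Lemma dd_hadj p q (f : R -> 'M[C]_(p * q)) : dimension_drop f ->
  dimension_drop (fun t => hadj (f t)).
Proof.
move=> /dimdropP[f1 [f2 E2] [f3 E3]]; apply/dimdropP; split.
- exact: mcont_adj.
- by exists (hadj f2); rewrite E2 tens_hadj hadj1.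
- by exists (hadj f3); rewrite E3 tens_hadj hadj1.
Qed.

Lemma dd_eq p q (f g : R -> 'M[C]_(p * q)) : (forall t, seg t -> f t = g t) ->
  dimension_drop f -> dimension_drop g.
Proof.
move=> fg /dimdropP[f1 [f2 E2] [f3 E3]]; apply/dimdropP; split.
- exact: mcont01_eq f1.
- by exists f2; rewrite -fg ?E2 //; apply/segP; lra.
- by exists f3; rewrite -fg ?E3 //; apply/segP; lra.
Qed.

Lemma dd_scal p q (h : R -> C) : @cC R (subspace seg) h ->
  dimension_drop (fun t => (h t)%:M : 'M[C]_(p * q)).
Proof.
move=> hc; apply/dimdropP; split.
- by apply: (mcont_eq _ (mcontZ hc (mcont_cst 1%:M))) => t; rewrite scalemx1.
- by exists (h 0)%:M; rewrite -tens_scalarl.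
- by exists (h 1)%:M; rewrite -tens_scalarr.
Qed.

Lemma dd_one p q : dimension_drop (fun=> 1%:M : 'M[C]_(p * q)).
Proof. by apply: (dd_scal p q (h := fun=> 1)); exact: cC_cst. Qed.

Lemma dd_zero p q : dimension_drop (fun=> 0 : 'M[C]_(p * q)).
Proof.
apply: (@dd_eq _ _ (fun=> (0 : C)%:M)) => [t _|]; first by rewrite raddf0.
by apply: (dd_scal p q (h := fun=> 0)); exact: cC_cst.
Qed.

Lemma dd_add p q (f g : R -> 'M[C]_(p * q)) : dimension_drop f ->
  dimension_drop g -> dimension_drop (fun t => f t + g t).
Proof.
by move=> hf hg; apply: dd_eq (dd_lin 1 hf hg) => t _; rewrite scale1r.
Qed.

Lemma dd_scale p q (a : C) (f : R -> 'M[C]_(p * q)) : dimension_drop f ->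
  dimension_drop (fun t => a *: f t).
Proof.
by move=> hf; apply: dd_eq (dd_lin a hf (dd_zero p q)) => t _; rewrite addr0.
Qed.

Lemma dd_sub p q (f g : R -> 'M[C]_(p * q)) : dimension_drop f ->
  dimension_drop g -> dimension_drop (fun t => f t - g t).
Proof.
move=> hf hg; apply: dd_eq (dd_lin (-1) hg hf) => t _.
by rewrite scaleN1r addrC.
Qed.

Lemma dd_sum p q I (r : seq I) (P : pred I) (F : I -> R -> 'M[C]_(p * q)) :
  (forall i, dimension_drop (F i)) -> dimension_drop (fun t => \sum_(i <- r | P i) F i t).
Proof.
move=> H; elim: r => [|i r IH].
  by apply: dd_eq (dd_zero p q) => t _; rewrite big_nil.
have [Pi|Pi] := boolP (P i).
  by apply: dd_eq (dd_add (H i) IH) => t _; rewrite big_cons Pi.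
by apply: dd_eq IH => t _; rewrite big_cons (negbTE Pi).
Qed.

(** The endpoint condition is closed: g is read off from one diagonal corner z of M, and every
    approximant determines all other entries from that corner. *)
Lemma tens1_closed p q (M : 'M[C]_(p * q)) : (0 < q)%N ->
  (forall e : R, 0 < e -> exists g : 'M[C]_p, forall i j, normc ((M - g *t 1%:M) i j) <= e) ->
  exists g : 'M[C]_p, M = g *t (1%:M : 'M[C]_q).
Proof.
move=> q0 H; pose z := Ordinal q0.
exists (\matrix_(a, b) M (mxtens_index (a, z)) (mxtens_index (b, z))).
apply/matrixP => i j; case: (mxtens_indexP i) => a x; case: (mxtens_indexP j) => b y.
rewrite tensmxE mxE; apply/eqP; rewrite -subr_eq0 -normc_eq0 eq_le normc_ge0 andbT.
apply/ler_addgt0Pr => e e0; rewrite add0r.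
have [g gP] := H (e / 2) (divr_gt0 e0 (ltr0Sn _ _)).
have := gP (mxtens_index (a, x)) (mxtens_index (b, y)).
have := gP (mxtens_index (a, z)) (mxtens_index (b, z)).
have mB (M1 M2 : 'M[C]_(p * q)) k l : (M1 - M2) k l = M1 k l - M2 k l by rewrite !mxE.
rewrite !mB !tensmxE ![(1%:M : 'M[C]_q) _ _]mxE eqxx mulr1n mulr1; set d := (x == y)%:R.
have d1 : normc d <= 1 by rewrite /d; case: (x == y); rewrite ?normc1 ?normc0.
move=> h1 h2.
have -> : M (mxtens_index (a, x)) (mxtens_index (b, y)) - M (mxtens_index (a, z)) (mxtens_index (b, z)) * d =
  (M (mxtens_index (a, x)) (mxtens_index (b, y)) - g a b * d) -
  (M (mxtens_index (a, z)) (mxtens_index (b, z)) - g a b) * d by ring.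
apply: le_trans (le_normcD _ _) _; rewrite normcN normcM.
have : normc (M (mxtens_index (a, z)) (mxtens_index (b, z)) - g a b) * normc d <= e / 2 * 1.
  by apply: ler_pM; rewrite ?normc_ge0.
lra.
Qed.

Lemma tens_closed1 p q (M : 'M[C]_(p * q)) : (0 < p)%N ->
  (forall e : R, 0 < e -> exists g : 'M[C]_q, forall i j, normc ((M - 1%:M *t g) i j) <= e) ->
  exists g : 'M[C]_q, M = (1%:M : 'M[C]_p) *t g.
Proof.
move=> q0 H; pose z := Ordinal q0.
exists (\matrix_(a, b) M (mxtens_index (z, a)) (mxtens_index (z, b))).
apply/matrixP => i j; case: (mxtens_indexP i) => x a; case: (mxtens_indexP j) => y b.
rewrite tensmxE [X in _ * X]mxE; apply/eqP; rewrite -subr_eq0 -normc_eq0 eq_le normc_ge0 andbT.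
apply/ler_addgt0Pr => e e0; rewrite add0r.
have [g gP] := H (e / 2) (divr_gt0 e0 (ltr0Sn _ _)).
have := gP (mxtens_index (x, a)) (mxtens_index (y, b)).
have := gP (mxtens_index (z, a)) (mxtens_index (z, b)).
have mB (M1 M2 : 'M[C]_(p * q)) k l : (M1 - M2) k l = M1 k l - M2 k l by rewrite !mxE.
rewrite [(1%:M : 'M[C]_p) _ _]mxE !mB !tensmxE ![(1%:M : 'M[C]_p) _ _]mxE eqxx mulr1n mul1r; set d := (x == y)%:R.
have d1 : normc d <= 1 by rewrite /d; case: (x == y); rewrite ?normc1 ?normc0.
move=> h1 h2.
have -> : M (mxtens_index (x, a)) (mxtens_index (y, b)) - d * M (mxtens_index (z, a)) (mxtens_index (z, b)) =
  (M (mxtens_index (x, a)) (mxtens_index (y, b)) - d * g a b) -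
  (M (mxtens_index (z, a)) (mxtens_index (z, b)) - g a b) * d by ring.
apply: le_trans (le_normcD _ _) _; rewrite normcN normcM.
have : normc (M (mxtens_index (z, a)) (mxtens_index (z, b)) - g a b) * normc d <= e / 2 * 1.
  by apply: ler_pM; rewrite ?normc_ge0.
lra.
Qed.

Lemma seg0 : seg 0. Proof. by apply/segP; lra. Qed.
Lemma seg1 : seg 1. Proof. by apply/segP; lra. Qed.

(* A self-adjoint [f] with [|f| < 1] is the real part of the unitary
   [f + i (1 - r)]. *)
Lemma dd_sqrt p q (f : R -> 'M[C]_(p * q)) (k : R) : (0 < p)%N -> (0 < q)%N ->
  0 <= k -> k < 1 -> dimension_drop f -> (forall t, seg t -> hadj (f t) = f t) ->
  (forall t, seg t -> opb k (f t)) ->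
  exists r, dimension_drop r /\ forall t, seg t ->
    [/\ hadj (r t) = r t, (1%:M - r t) *m (1%:M - r t) = 1%:M - f t *m f t &
        f t *m r t = r t *m f t].
Proof.
move=> p0 q0 k0 k1 df fs fk.
have kk0 : 0 <= k * k by exact: mulr_ge0.
have kk1 : k * k < 1.
  have h : k * k <= k by apply: ler_piMl => //; exact: ltW k1.
  exact: le_lt_trans h k1.
pose c t := f t *m f t.
have H t : exists r : 'M[C]_(p * q), seg t ->
  [/\ forall j a b, normc ((msqit (c t) j - r) a b) <= (k * k) ^+ j.+1 / (1 - k * k),
      (1%:M - r) *m (1%:M - r) = 1%:M - c t, hadj r = r & f t *m r = r *m f t].
  have [st|nt] := pselect (seg t); last by exists 0.
  have [r [h1 h2 h3 h4]] := msqrt_lim kk0 kk1 (opbM (fk t st) (fk t st)).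
  exists r => _; split => //; last by apply: h4; rewrite /c mulmxA.
  by apply: h3; rewrite hadjM fs.
have [r rP] := choice H; exists r.
have cd j : dimension_drop (fun t => msqit (c t) j).
  elim: j => [|j IH] /=; first exact: dd_zero.
  by apply/dd_scale/dd_add; [exact: dd_mul|exact: dd_mul].
have small e : 0 < e -> exists j, forall t, seg t -> forall a b,
    normc ((msqit (c t) j - r t) a b) < e.
  move=> e0; have [N HN] := geom_small kk0 kk1 e0; exists N => t st a b.
  by have [h _ _ _] := rP t st; apply: le_lt_trans (h N a b) _; exact: HN.
split; last by move=> t st; have [_ h2 h3 h4] := rP t st.
apply/dimdropP; split.
- apply/mcont01P => x sx e e0; have [j Hj] := small (e / 3) (divr_gt0 e0 (ltr0Sn _ _)).
  have /dimdropP[/mcont01P Hc _ _] := cd j.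
  have [d d0 Hd] := Hc x sx (e / 3) (divr_gt0 e0 (ltr0Sn _ _)).
  exists d => // t st tx a b.
  have := Hd t st tx a b; have := Hj t st a b; have := Hj x sx a b.
  rewrite !mxE; set A := msqit _ j a b; set B := msqit _ j a b => h1 h2 h3.
  have -> : r t a b - r x a b = - (B - r t a b) + ((B - A) + (A - r x a b)) by ring.
  apply: le_lt_trans (le_normcD _ _) _; rewrite normcN.
  have := le_normcD (B - A) (A - r x a b).
  rewrite -/A -/B in h3; lra.
- apply: tens1_closed => // e e0; have [j Hj] := small e e0.
  have /dimdropP[_ [g gE] _] := cd j; exists g => a b.
  rewrite -gE; have := Hj 0 seg0 a b; rewrite -normcN !mxE opprB => h; exact: ltW.
- apply: tens_closed1 => // e e0; have [j Hj] := small e e0.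
  have /dimdropP[_ _ [g gE]] := cd j; exists g => a b.
  rewrite -gE; have := Hj 1 seg1 a b; rewrite -normcN !mxE opprB => h; exact: ltW.
Qed.

End DimensionDrop.

(** * Norm bounds for representations and embeddings *)

Section Contractive.
Context {R : realType}.
Local Notation C := R[i].

Lemma dd_unitary p q (f : R -> 'M[C]_(p * q)) (k : R) : (0 < p)%N -> (0 < q)%N ->
  0 <= k -> k < 1 -> dimension_drop f -> (forall t, seg t -> hadj (f t) = f t) ->
  (forall t, seg t -> opb k (f t)) ->
  exists u, [/\ dimension_drop u, forall t, seg t -> hadj (u t) *m u t = 1%:M &
    forall t, seg t -> f t = 2^-1%:C *: u t + 2^-1%:C *: hadj (u t)].
Proof.
move=> p0 q0 k0 k1 df fs fk.
have [r [dr Hr]] := dd_sqrt p0 q0 k0 k1 df fs fk.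
exists (fun t => f t + ii *: (1%:M - r t)); split.
- by apply: dd_add => //; apply/dd_scale/dd_sub => //; exact: dd_one.
- move=> t st; have [h1 h2 h3] := Hr t st.
  rewrite hadjD hadjZ hadjB hadj1 h1 fs // ii_conj mulmxDl !mulmxDr.
  rewrite -!scalemxAl -!scalemxAr scalerA h2 mulNr ii_sqr opprK scale1r.
  rewrite mulmxBr mulmxBl mulmx1 mul1mx h3.
  rewrite scaleNr; ncmx.
- move=> t st; have [h1 h2 h3] := Hr t st.
  rewrite hadjD hadjZ hadjB hadj1 h1 fs // ii_conj -scalerDr scaleNr.
  have -> : f t + ii *: (1%:M - r t) + (f t - ii *: (1%:M - r t)) = 2%:C *: f t.
    by rewrite addrACA subrr addr0 -[2%:C]/((1 + 1)%:C) rmorphD scalerDl !scale1r.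
  by rewrite scalerA -rmorphM mulVf ?scale1r // pnatr_eq0.
Qed.

(** The last clause is needed because elements are functions on the whole line, of which only the
    restriction to [0, 1] is meant. *)
Definition ddrep p q N (pi : (R -> 'M[C]_(p * q)) -> 'M[C]_N) : Prop :=
  [/\ forall a f g, dimension_drop f -> dimension_drop g ->
        pi (fun x => a *: f x + g x) = a *: pi f + pi g,
      forall f g, dimension_drop f -> dimension_drop g ->
        pi (fun x => f x *m g x) = pi f *m pi g,
      forall f, dimension_drop f -> pi (fun x => hadj (f x)) = hadj (pi f),
      pi (fun=> 1%:M) = 1%:M &
      forall f g, dimension_drop f -> dimension_drop g ->
        (forall t, seg t -> f t = g t) -> pi f = pi g].

Section Rep.
Variables (p q N : nat) (pi : (R -> 'M[C]_(p * q)) -> 'M[C]_N).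
Hypothesis Hpi : ddrep pi.

Lemma rep_lin a f g : dimension_drop f -> dimension_drop g ->
  pi (fun x => a *: f x + g x) = a *: pi f + pi g.
Proof. by have [H _ _ _ _] := Hpi; exact: H. Qed.
Lemma rep_mul f g : dimension_drop f -> dimension_drop g ->
  pi (fun x => f x *m g x) = pi f *m pi g.
Proof. by have [_ H _ _ _] := Hpi; exact: H. Qed.
Lemma rep_adj f : dimension_drop f -> pi (fun x => hadj (f x)) = hadj (pi f).
Proof. by have [_ _ H _ _] := Hpi; exact: H. Qed.
Lemma rep_one : pi (fun=> 1%:M) = 1%:M.
Proof. by have [_ _ _ H _] := Hpi. Qed.
Lemma rep_ext f g : dimension_drop f -> dimension_drop g ->
  (forall t, seg t -> f t = g t) -> pi f = pi g.
Proof. by have [_ _ _ _ H] := Hpi; exact: H. Qed.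

Lemma rep_zero : pi (fun=> 0) = 0.
Proof.
have d1 := @dd_one R p q.
rewrite -[RHS](addNr (pi (fun=> 1%:M))) -scaleN1r -rep_lin //.
by congr pi; apply/funext => x; rewrite scaleN1r addNr.
Qed.

Lemma rep_add f g : dimension_drop f -> dimension_drop g ->
  pi (fun x => f x + g x) = pi f + pi g.
Proof.
move=> df dg; rewrite -[pi f]scale1r -rep_lin //.
by congr pi; apply/funext => x; rewrite scale1r.
Qed.

Lemma rep_scale a f : dimension_drop f -> pi (fun x => a *: f x) = a *: pi f.
Proof.
move=> df; have d0 := @dd_zero R p q.
rewrite -[RHS]addr0 -rep_zero -rep_lin //.
by congr pi; apply/funext => x; rewrite addr0.
Qed.

Lemma rep_sub f g : dimension_drop f -> dimension_drop g ->
  pi (fun x => f x - g x) = pi f - pi g.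
Proof.
move=> df dg; rewrite -scaleN1r addrC -rep_lin //.
by congr pi; apply/funext => x; rewrite scaleN1r addrC.
Qed.

Lemma rep_sum I (r : seq I) (P : pred I) (F : I -> R -> 'M[C]_(p * q)) :
  (forall i, dimension_drop (F i)) ->
  pi (fun x => \sum_(i <- r | P i) F i x) = \sum_(i <- r | P i) pi (F i).
Proof.
move=> H; elim: r => [|i r IH].
  rewrite big_nil -rep_zero; congr pi; apply/funext => x; by rewrite big_nil.
rewrite big_cons -IH; case: ifP => Pi.
  rewrite -rep_add //; last exact: dd_sum.
  by congr pi; apply/funext => x; rewrite big_cons Pi.
by congr pi; apply/funext => x; rewrite big_cons Pi.
Qed.

(** A self-adjoint element of norm less than 1 is the mean of a unitary and its adjoint, and
    unitaries are sent to unitaries; the general case follows through f^* f. The factor 2 pays for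
    the strict inequality: f is first scaled to norm 1/2. *)
Lemma rep_opb f c : (0 < p)%N -> (0 < q)%N -> 0 < c -> dimension_drop f ->
  (forall t, seg t -> opb c (f t)) -> opb (2 * c) (pi f).
Proof.
move=> p0 q0 c0 df fc.
have d0 : 0 < 2 * c by rewrite mulr_gt0.
pose f' t := (2 * c)^-1%:C *: f t.
have df' : dimension_drop f' by exact: dd_scale.
have nd : normc ((2 * c)^-1%:C : C) = (2 * c)^-1.
  by rewrite normc_real ger0_norm // invr_ge0 ltW.
have f'k t : seg t -> opb 2^-1 (f' t).
  move=> st; have := opbZ ((2 * c)^-1%:C) (fc t st); rewrite nd.
  by congr opb; rewrite invfM mulfVK ?gt_eqF.
suff : opb 1 (pi f').
  rewrite rep_scale // => /(opbZ ((2 * c)%:C)); rewrite scalerA -rmorphM mulfV ?gt_eqF //.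
  by rewrite scale1r normc_real ger0_norm ?mulr1 // ltW.
have s1 g k : 0 <= k -> k < 1 -> dimension_drop g -> (forall t, seg t -> hadj (g t) = g t) ->
    (forall t, seg t -> opb k (g t)) -> opb 1 (pi g).
  move=> k0 k1 dg gs gk; have [u [du uu gu]] := dd_unitary p0 q0 k0 k1 dg gs gk.
  have du' : dimension_drop (fun t => hadj (u t)) by exact: dd_hadj.
  have iu : opb 1 (pi u).
    apply: opb_isom; rewrite /isom -rep_adj // -rep_mul // -rep_one.
    by apply: rep_ext => //; [exact: dd_mul|exact: dd_one].
  have -> : pi g = 2^-1%:C *: pi u + 2^-1%:C *: hadj (pi u).
    rewrite -rep_adj // -[X in _ + X]rep_scale // -rep_lin //; last exact: dd_scale.
    by apply: rep_ext => //; apply: dd_lin => //; exact: dd_scale.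
  have hh (A : 'M[C]_N) : opb 1 A -> opb 2^-1 (2^-1%:C *: A).
    by move=> /opbZ_half; rewrite mulr1.
  have i0 : 0 <= 2^-1 :> R by rewrite invr_ge0 ler0n.
  have := opbD i0 i0 (hh _ iu) (hh _ (opb_adj ler01 iu)).
  by congr opb; lra.
apply: opb_adjmul => //; rewrite expr1n -rep_adj // -rep_mul //; last exact: dd_hadj.
have dd' : dimension_drop (fun t => hadj (f' t)) by exact: dd_hadj.
apply: (s1 _ (2^-1 * 2^-1)); [by lra|by lra|exact: dd_mul| |].
- by move=> t st; rewrite hadjM hadjK.
- by move=> t st; apply: opbM; [apply: opb_adj; [by lra|exact: f'k]|exact: f'k].
Qed.

End Rep.

Section Embedding.
Variables (Z : cstarAlgType R) (p q : nat) (phi : (R -> 'M[C]_(p * q)) -> Z).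
Hypothesis Hphi : dimension_drop_embedding phi.

Lemma emb_lin a f g : dimension_drop f -> dimension_drop g ->
  phi (fun x => a *: f x + g x) = a *: phi f + phi g.
Proof. by have [H _] := Hphi; exact: H. Qed.
Lemma emb_mul f g : dimension_drop f -> dimension_drop g ->
  phi (fun x => f x *m g x) = cmul (phi f) (phi g).
Proof. by have [_ [H _]] := Hphi; exact: H. Qed.
Lemma emb_adj f : dimension_drop f -> phi (fun x => hadj (f x)) = cstar (phi f).
Proof. by have [_ [_ [H _]]] := Hphi; exact: H. Qed.
Lemma emb_one : cunit (phi (fun=> 1%:M)).
Proof. by have [_ [_ [_ [H _]]]] := Hphi. Qed.
Lemma emb_inj f : dimension_drop f -> phi f = 0 <-> forall x : R, seg x -> f x = 0.
Proof. by have [_ [_ [_ [_ H]]]] := Hphi; exact: H. Qed.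

Lemma emb_zero : phi (fun=> 0) = 0.
Proof. by apply/emb_inj => //; exact: dd_zero. Qed.

Lemma emb_add f g : dimension_drop f -> dimension_drop g ->
  phi (fun x => f x + g x) = phi f + phi g.
Proof.
move=> df dg; rewrite -[phi f]scale1r -emb_lin //.
by congr phi; apply/funext => x; rewrite scale1r.
Qed.

Lemma emb_scale a f : dimension_drop f -> phi (fun x => a *: f x) = a *: phi f.
Proof.
move=> df; have d0 := @dd_zero R p q.
rewrite -[RHS]addr0 -emb_zero -emb_lin //.
by congr phi; apply/funext => x; rewrite addr0.
Qed.

Lemma emb_sub f g : dimension_drop f -> dimension_drop g ->
  phi (fun x => f x - g x) = phi f - phi g.
Proof.
move=> df dg; rewrite -scaleN1r addrC -emb_lin //.
by congr phi; apply/funext => x; rewrite scaleN1r addrC.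
Qed.

Lemma emb_sum I (r : seq I) (P : pred I) (F : I -> R -> 'M[C]_(p * q)) :
  (forall i, dimension_drop (F i)) ->
  phi (fun x => \sum_(i <- r | P i) F i x) = \sum_(i <- r | P i) phi (F i).
Proof.
move=> H; elim: r => [|i r IH].
  rewrite big_nil -emb_zero; congr phi; apply/funext => x; by rewrite big_nil.
rewrite big_cons -IH; case: ifP => Pi.
  rewrite -emb_add //; last exact: dd_sum.
  by congr phi; apply/funext => x; rewrite big_cons Pi.
by congr phi; apply/funext => x; rewrite big_cons Pi.
Qed.

Lemma emb_ext f g : dimension_drop f -> dimension_drop g ->
  phi f = phi g <-> (forall t, seg t -> f t = g t).
Proof.
move=> df dg; split=> [E t st|E].
  apply/eqP; rewrite -subr_eq0; apply/eqP.
  have /emb_inj H : phi (fun x => f x - g x) = 0 by rewrite emb_sub // E subrr.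
  by apply: H st; exact: dd_sub.
apply/eqP; rewrite -subr_eq0 -emb_sub //; apply/eqP/emb_inj => [|t st].
  exact: dd_sub.
by rewrite E // subrr.
Qed.

Lemma cunit_norm (e : Z) : cunit e -> cnorm e <= 1.
Proof.
move=> ue; have [E _] := ue (cstar e).
have E2 : cstar e = e.
  by have := congr1 cstar E; rewrite cstarM cstarK; have [-> _] := ue (cstar e).
have := cnorm_starmul e; rewrite E2; have [-> _] := ue e.
have := cnorm_ge0 e; nra.
Qed.

(** The argument of [rep_opb], with values in Z. *)
Lemma emb_norm f c : (0 < p)%N -> (0 < q)%N -> 0 < c -> dimension_drop f ->
  (forall t, seg t -> opb c (f t)) -> cnorm (phi f) <= 2 * c.
Proof.
move=> p0 q0 c0 df fc.
have d0 : 0 < 2 * c by rewrite mulr_gt0.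
pose f' t := (2 * c)^-1%:C *: f t.
have df' : dimension_drop f' by exact: dd_scale.
have nd : normc ((2 * c)^-1%:C : C) = (2 * c)^-1.
  by rewrite normc_real ger0_norm // invr_ge0 ltW.
have f'k t : seg t -> opb 2^-1 (f' t).
  move=> st; have := opbZ ((2 * c)^-1%:C) (fc t st); rewrite nd.
  by congr opb; rewrite invfM mulfVK ?gt_eqF.
suff : cnorm (phi f') <= 1.
  by rewrite emb_scale // cnormZ nd mulrC ler_pdivrMr // mul1r.
have s1 g k : 0 <= k -> k < 1 -> dimension_drop g -> (forall t, seg t -> hadj (g t) = g t) ->
    (forall t, seg t -> opb k (g t)) -> cnorm (phi g) <= 1.
  move=> k0 k1 dg gs gk; have [u [du uu gu]] := dd_unitary p0 q0 k0 k1 dg gs gk.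
  have du' : dimension_drop (fun t => hadj (u t)) by exact: dd_hadj.
  have iu : cnorm (phi u) <= 1.
    have : cnorm (cmul (cstar (phi u)) (phi u)) <= 1.
      have -> : cmul (cstar (phi u)) (phi u) = phi (fun=> 1%:M).
        rewrite -emb_adj // -emb_mul //; apply/emb_ext => //.
          exact: dd_mul.
        exact: dd_one.
      exact: cunit_norm emb_one.
    by rewrite cnorm_starmul; have := cnorm_ge0 (phi u); nra.
  have -> : phi g = 2^-1%:C *: phi u + 2^-1%:C *: cstar (phi u).
    rewrite -emb_adj // -[X in _ + X]emb_scale // -emb_lin //; last exact: dd_scale.
    by apply/emb_ext => //; apply: dd_lin => //; exact: dd_scale.
  apply: le_trans (cnormD _ _) _; rewrite !cnormZ cnorm_star normc_half; lra.
have : cnorm (cmul (cstar (phi f')) (phi f')) <= 1.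
  rewrite -emb_adj // -emb_mul //; last exact: dd_hadj.
  have dd' : dimension_drop (fun t => hadj (f' t)) by exact: dd_hadj.
  apply: (s1 _ (2^-1 * 2^-1)); [by lra|by lra|exact: dd_mul| |].
  - by move=> t st; rewrite hadjM hadjK.
  - by move=> t st; apply: opbM; [apply: opb_adj; [by lra|exact: f'k]|exact: f'k].
by rewrite cnorm_starmul; have := cnorm_ge0 (phi f'); nra.
Qed.

End Embedding.
End Contractive.

Section Topology.
Context {R : realType} {A : cstarAlgType R}.

Lemma cmulNl (x y : A) : cmul (- x) y = - cmul x y.
Proof. by rewrite -scaleN1r cmulZl scaleN1r. Qed.
Lemma cmulNr (x y : A) : cmul x (- y) = - cmul x y.
Proof. by rewrite -scaleN1r cmulZr scaleN1r. Qed.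
Lemma cmulBl (x y z : A) : cmul (x - y) z = cmul x z - cmul y z.
Proof. by rewrite cmulDl cmulNl. Qed.
Lemma cmulBr (x y z : A) : cmul z (x - y) = cmul z x - cmul z y.
Proof. by rewrite cmulDr cmulNr. Qed.

Lemma cnorm_ball (x : A) (e : R) (y : A) : 0 < e -> ball x e%:C y <-> cnorm (x - y) < e.
Proof. by move=> e0; rewrite -ball_normE /ball_ /= cnormE ltcR. Qed.

Lemma dense_approx (D : set A) (x : A) (e : R) : dense D -> 0 < e ->
  exists2 y, D y & cnorm (x - y) < e.
Proof.
move=> dD e0; have ec : 0 < e%:C :> R[i] by rewrite ltcR.
have [|y [By Dy]] := dD (ball x e%:C) _ (ball_open x _).
  by exists x; exact: ballxx.
by exists y => //; apply/cnorm_ball.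
Qed.

Lemma closed_approx (I : set A) :
  (forall x, (forall e : R, 0 < e -> exists2 y, I y & cnorm (x - y) < e) -> I x) -> closed I.
Proof.
move=> H x clx; apply: H => e e0; have ec : 0 < e%:C :> R[i] by rewrite ltcR.
have [y [Iy By]] := clx _ (nbhsx_ballx x _ ec).
by exists y => //; apply/cnorm_ball.
Qed.
End Topology.

(** * Piecewise linear bumps *)

Section Ramps.
Context {R : realType}.
Local Notation C := R[i].
Implicit Types (a d x : R).

Definition ramp a d x : R := clamp ((x - a) / d).

Lemma ramp_cont a d : continuous (ramp a d).
Proof.
move=> x; apply: (@continuous_comp _ _ _ (fun x => (x - a) / d) clamp); last exact: clamp_cont.
by apply: cvgM; [apply: cvgB; [exact: cvg_id|exact: cvg_cst]|exact: cvg_cst].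
Qed.
Lemma ramp_ge0 a d x : 0 <= ramp a d x. Proof. exact: clamp_ge0. Qed.
Lemma ramp_le1 a d x : ramp a d x <= 1. Proof. exact: clamp_le1. Qed.
Lemma ramp0 a d x : 0 < d -> x <= a -> ramp a d x = 0.
Proof.
by move=> d0 xa; apply: clamp_le0; rewrite ler_pdivrMr // mul0r subr_le0.
Qed.
Lemma ramp1 a d x : 0 < d -> a + d <= x -> ramp a d x = 1.
Proof.
by move=> d0 xa; apply: clamp_ge1; rewrite ler_pdivlMr // mul1r; lra.
Qed.

Definition trap a d x : R := ramp a d x - ramp (a + 2 * d) d x.

Lemma trap_cont a d : continuous (trap a d).
Proof. by move=> x; apply: cvgB; exact: ramp_cont. Qed.
Lemma trap1 a d x : 0 < d -> a + d <= x <= a + 2 * d -> trap a d x = 1.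
Proof. by move=> d0 /andP[h1 h2]; rewrite /trap ramp1 // ramp0 // subr0. Qed.
Lemma trapl a d x : 0 < d -> x <= a -> trap a d x = 0.
Proof. by move=> d0 h; rewrite /trap !ramp0 ?subr0 //; lra. Qed.
Lemma trapr a d x : 0 < d -> a + 3 * d <= x -> trap a d x = 0.
Proof. by move=> d0 h; rewrite /trap !ramp1 ?subrr //; lra. Qed.
Lemma trap_ge0 a d x : 0 < d -> 0 <= trap a d x.
Proof.
move=> d0; have [h|h] := leP x (a + d).
  by rewrite /trap [X in _ - X]ramp0 ?subr0 ?ramp_ge0 //; lra.
by rewrite /trap ramp1 ?subr_ge0 ?ramp_le1 //; lra.
Qed.
Lemma trap_le1 a d x : trap a d x <= 1.
Proof. by rewrite /trap; have := ramp_le1 a d x; have := ramp_ge0 (a + 2 * d) d x; lra. Qed.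
Lemma trap_neq0 a d x : 0 < d -> trap a d x != 0 -> a < x < a + 3 * d.
Proof.
move=> d0 h; apply/andP; split; rewrite ltNge; apply: contra_neqN h => h.
  by rewrite trapl.
by rewrite trapr.
Qed.

Lemma dd_real p q (h : R -> R) : continuous h ->
  dimension_drop (fun t => (h t)%:C%:M : 'M[C]_(p * q)).
Proof.
move=> hc; apply: dd_scal; apply: cC_real => x.
exact: (continuous_subspaceT hc).
Qed.
End Ramps.

(** * What the simplicity of the Jiang-Su algebra gives in the fibres *)

Section Full.
Context {R : realType}.
Local Notation C := R[i].
Variables (Z : cstarAlgType R) (p q : nat -> nat)
  (phi : forall n, (R -> 'M[C]_(p n * q n)) -> Z).
Arguments phi : clear implicits.
Hypothesis hpq : forall n, [/\ (0 < p n)%N, (0 < q n)%N & coprime (p n) (q n)].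
Hypothesis hphi : forall n, dimension_drop_embedding (phi n).
Hypothesis hinc : forall n f, dimension_drop f ->
  exists2 g, dimension_drop g & phi n.+1 g = phi n f.
Hypothesis hdense : dense [set z | exists n f, dimension_drop f /\ z = phi n f].
Hypothesis hsimple : simple_cstar Z.

Let p0 n : (0 < p n)%N. Proof. by have [] := hpq n. Qed.
Let q0 n : (0 < q n)%N. Proof. by have [] := hpq n. Qed.

Lemma inc_le n m f : (n <= m)%N -> dimension_drop f ->
  exists2 g, dimension_drop g & phi m g = phi n f.
Proof.
move=> /subnK <- df; elim: (m - n)%N => [|k [g dg E]]; first by exists f.
by have [h dh Eh] := hinc dg; exists h => //; rewrite Eh.
Qed.

Lemma unit_eq (n m : nat) : phi n (fun=> 1%:M) = phi m (fun=> 1%:M).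
Proof.
have [h1 _] := emb_one (hphi n) (phi m (fun=> 1%:M)).
by have [_ <-] := emb_one (hphi m) (phi n (fun=> 1%:M)).
Qed.

Lemma dense_phi (z : Z) (e : R) : 0 < e -> exists n0, forall n, (n0 <= n)%N ->
  exists2 f, dimension_drop f & cnorm (z - phi n f) < e.
Proof.
move=> e0; have [y [n [f [df ->]]] yz] := dense_approx z hdense e0.
exists n => m nm; have [g dg E] := inc_le nm df.
by exists g => //; rewrite E.
Qed.

(** If g vanished at t, a narrow bump b around t would satisfy |g b| <= 1/4 by continuity and |(1 -
    g) b| <= 1/4 * 2, whereas |b| >= 1. The last bound comes from a nonzero narrower bump b' with b
    b' = b'. *)
Lemma near_one_neq0 n g t : dimension_drop g -> seg t ->
  cnorm (phi n (fun=> 1%:M) - phi n g) < 4^-1 -> g t <> 0.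
Proof.
move=> dg st gn gt; have /dimdropP[/mcont01P gc _ _] := dg.
have D0 : 0 < ((p n * q n).+1%:R * (p n * q n)%:R + 1 : R).
  by rewrite ltr_wpDl ?mulr_ge0.
set D := (_ + 1) in D0.
have h8 : (0 : R) < 8^-1 by rewrite invr_gt0 ltr0n.
have [d d0 Hd] := gc t st (8^-1 / D) (divr_gt0 h8 D0).
pose d' := d / 4; have d'0 : 0 < d' by rewrite divr_gt0.
pose d2 := d' / 3; have d20 : 0 < d2 by rewrite divr_gt0.
pose a := t - d' - d' / 2.
pose b x : 'M[C]_(p n * q n) := (trap a d' x)%:C%:M.
pose a' := t - d2 - d2 / 2.
pose b' x : 'M[C]_(p n * q n) := (trap a' d2 x)%:C%:M.
have db : dimension_drop b by apply: dd_real; exact: trap_cont.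
have db' : dimension_drop b' by apply: dd_real; exact: trap_cont.
have bb' x : b x *m b' x = b' x.
  rewrite /b /b' -scalar_mxM; congr (_%:M); rewrite -rmorphM.
  have [-> |/(trap_neq0 d20)/andP[h1 h2]] := eqVneq (trap a' d2 x) 0; first by rewrite mulr0.
  by rewrite trap1 ?mul1r // /a; rewrite /a' /d2 in h1 h2; lra.
have b't : b' t = 1%:M.
  by rewrite /b' trap1 // /a' /d2; apply/andP; split; lra.
have b'n : phi n b' <> 0.
  move/(emb_inj (hphi n) db')/(_ t st); rewrite b't => /matrixP.
  have i : 'I_(p n * q n) by apply: (@Ordinal _ 0); rewrite muln_gt0 p0 q0.
  by move=> /(_ i i); rewrite !mxE eqxx mulr1n => /eqP; rewrite oner_eq0.
have b1 : 1 <= cnorm (phi n b).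
  have y0 : 0 < cnorm (phi n b') by rewrite cnorm_gt0; apply/eqP.
  have : cmul (phi n b) (phi n b') = phi n b'.
    by rewrite -emb_mul //; congr phi; apply/funext.
  by have := cnorm_mul (phi n b) (phi n b'); move=> + E; rewrite E; nra.
have ob x : opb 1 (b x).
  rewrite /b -scalemx1 -[1]mul1r.
  apply: (@opb_le _ _ _ (normc (trap a d' x)%:C * 1)).
  - by rewrite mulr1 normc_ge0.
  - by rewrite mul1r mulr1 normc_real ger0_norm ?trap_le1 // trap_ge0.
  - by apply/opbZ/opb_isom; rewrite /isom hadj1 mulmx1.
have b2 : cnorm (phi n b) <= 2.
  by rewrite -[2]mulr1; apply: emb_norm.
have ogb x : seg x -> opb 8^-1 (g x *m b x).
  move=> sx; have [z|/(trap_neq0 d'0)/andP[h1 h2]] := eqVneq (trap a d' x) 0.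
    by rewrite /b z raddf0 mulmx0; exact: opb0.
  have xt : `|x - t| < d.
    by rewrite ltr_norml; apply/andP; split; rewrite /a /d' in h1 h2 *; lra.
  rewrite -[8^-1]mulr1; apply: opbM (ob x).
  have e0 : 0 <= 8^-1 / D by rewrite divr_ge0 // ltW.
  apply: (opb_le _ _ (entry_opb e0 _)); first by apply: mulr_ge0 => //; apply: mulr_ge0; exact: ler0n.
    rewrite mulrCA ger_pMr // ler_pdivrMr // mul1r /D; lra.
  by move=> i j; apply: ltW; have := Hd x sx xt i j; rewrite gt subr0.
have gb : cnorm (phi n (fun x => g x *m b x)) <= 4^-1.
  by have := emb_norm (hphi n) (p0 n) (q0 n) h8 (dd_mul dg db) ogb; lra.
have E : phi n b = phi n (fun x => g x *m b x) + cmul (phi n (fun=> 1%:M) - phi n g) (phi n b).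
  rewrite -[- phi n g]scaleN1r [_ + _ *: _]addrC cmulPl scaleN1r -!emb_mul //; last exact: dd_one.
  rewrite addrA subrr add0r; congr phi; apply/funext => x; by rewrite mul1mx.
have := cnormD (phi n (fun x => g x *m b x)) (cmul (phi n (fun=> 1%:M) - phi n g) (phi n b)).
rewrite -E; have := cnorm_mul (phi n (fun=> 1%:M) - phi n g) (phi n b).
set X := cnorm (_ - _) in gn *; set B := cnorm (phi n b) in b1 b2 *.
move=> h1 h2; have : X * B <= 4^-1 * 2.
  by apply: ler_pM => //; [exact: cnorm_ge0|exact: cnorm_ge0|exact: ltW].
lra.
Qed.

(** The elements approximated, at all late stages, by functions vanishing wherever the copy of f
    vanishes form a closed ideal [Q]. It contains phi n f, so by simplicity it contains the unit,
    and a function near the unit vanishes nowhere. Hence the copies of f have no zeros at late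
    stages. *)
Lemma full n f : dimension_drop f -> phi n f <> 0 ->
  exists m0, forall m, (m0 <= m)%N -> forall g, dimension_drop g ->
  phi m g = phi n f -> forall t, seg t -> g t <> 0.
Proof.
move=> df f0; pose z := phi n f.
pose Q (x : Z) := forall e : R, 0 < e -> exists m0, forall m, (m0 <= m)%N ->
  exists h, [/\ dimension_drop h, cnorm (x - phi m h) < e &
    forall t g, seg t -> dimension_drop g -> phi m g = z -> g t = 0 -> h t = 0].
have QI : closed_ideal Q.
  split.
  - apply: closed_approx => x H e e0; have e20 : 0 < e / 2 by rewrite divr_gt0.
    have [y /(_ _ e20)[m0 Hm] xy] := H _ e20; exists m0 => m /Hm[h [h1 h2 h3]].
    exists h; split => //.
    rewrite (_ : x - phi m h = x - y + (y - phi m h)) ?(le_lt_trans (cnormD _ _)) //; last by rewrite addrA subrK.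
    lra.
  - move=> e e0; exists 0%N => m _; exists (fun=> 0); split => //; first exact: dd_zero.
    by rewrite emb_zero // subr0 cnorm0.
  - move=> a x y Qx Qy e e0; have A0 : 0 < normc a + 1 by have := normc_ge0 a; lra.
    have e20 : 0 < e / 2 by rewrite divr_gt0.
    have [m1 H1] := Qx _ (divr_gt0 e20 A0); have [m2 H2] := Qy _ e20.
    exists (maxn m1 m2) => m; rewrite geq_max => /andP[/H1[h [h1 h2 h3]] /H2[k [k1 k2 k3]]].
    exists (fun t => a *: h t + k t); split; first exact: dd_lin.
      rewrite emb_lin //.
      rewrite (_ : _ - _ = a *: (x - phi m h) + (y - phi m k)); last first.
        by rewrite scalerBr addrACA opprD.
      apply: le_lt_trans (cnormD _ _) _; rewrite cnormZ.
      rewrite ltr_pdivlMr // in h2; have := cnorm_ge0 (x - phi m h); lra.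
    by move=> t g st dg E gt; rewrite (h3 t g) // (k3 t g) // scaler0 addr0.
  - have key a x : Q x -> Q (cmul a x) /\ Q (cmul x a).
      move=> Qx.
      suff H e : 0 < e -> exists m0, forall m, (m0 <= m)%N -> exists h b,
          [/\ dimension_drop h, dimension_drop b,
            cnorm (cmul a x - cmul (phi m b) (phi m h)) < e,
            cnorm (cmul x a - cmul (phi m h) (phi m b)) < e &
            forall t g, seg t -> dimension_drop g -> phi m g = z -> g t = 0 -> h t = 0].
        split=> e e0; have [m0 Hm] := H e e0; exists m0 => m /Hm[h [b [h1 h2 h3 h4 h5]]].
          exists (fun t => b t *m h t); split; [exact: dd_mul|by rewrite emb_mul|].
          by move=> t g st dg E gt; rewrite (h5 t g) // mulmx0.
        exists (fun t => h t *m b t); split; [exact: dd_mul|by rewrite emb_mul|].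
        by move=> t g st dg E gt; rewrite (h5 t g) // mul0mx.
      move=> e0; have a0 := cnorm_ge0 a; have x0 := cnorm_ge0 x.
      have A0 : 0 < cnorm a + 1 by lra.
      have X0 : 0 < cnorm x + e + 1 by lra.
      have e20 : 0 < e / 2 by rewrite divr_gt0.
      have [m1 H1] := dense_phi a (divr_gt0 e20 X0).
      have e3 : 0 < Num.min e (e / 2 / (cnorm a + 1)) by rewrite lt_min e0 divr_gt0.
      have [m2 H2] := Qx _ e3.
      exists (maxn m1 m2) => m; rewrite geq_max => /andP[/H1[b db hb] /H2[h [dh hh ht]]].
      exists h, b; rewrite lt_min in hh; case/andP: hh => hh1 hh2.
      rewrite ltr_pdivlMr // in hb; rewrite ltr_pdivlMr // in hh2.
      have nh : cnorm (phi m h) <= cnorm x + e.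
        rewrite (_ : phi m h = x - (x - phi m h)); last by rewrite opprB addrC subrK.
        by apply: le_trans (cnormD _ _) _; rewrite cnormN lerD2l ltW.
      have n1 := cnorm_ge0 (phi m h); have n2 := cnorm_ge0 (a - phi m b).
      have n3 := cnorm_ge0 (x - phi m h).
      split => //.
        rewrite (_ : _ - _ = cmul a (x - phi m h) + cmul (a - phi m b) (phi m h)); last first.
          by rewrite cmulBr cmulBl addrA subrK.
        apply: le_lt_trans (cnormD _ _) _.
        have := cnorm_mul a (x - phi m h); have := cnorm_mul (a - phi m b) (phi m h).
        set u := cnorm (cmul _ _); set v := cnorm (cmul _ _) => hu hv.
        have : cnorm (a - phi m b) * cnorm (phi m h) <= cnorm (a - phi m b) * (cnorm x + e + 1).
          by apply: ler_wpM2l => //; lra.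
        lra.
      rewrite (_ : _ - _ = cmul (x - phi m h) a + cmul (phi m h) (a - phi m b)); last first.
        by rewrite cmulBl cmulBr addrA subrK.
      apply: le_lt_trans (cnormD _ _) _.
      have := cnorm_mul (x - phi m h) a; have := cnorm_mul (phi m h) (a - phi m b).
      set u := cnorm (cmul _ _); set v := cnorm (cmul _ _) => hu hv.
      have : cnorm (phi m h) * cnorm (a - phi m b) <= (cnorm x + e + 1) * cnorm (a - phi m b).
        by apply: ler_wpM2r => //; lra.
      lra.
    by move=> a x; exact: key.
have Qz : Q z.
  move=> e e0; exists n => m nm; have [g dg E] := inc_le nm df.
  exists g; split => //; first by rewrite E subrr cnorm0.
  move=> t g' st dg' E' g't; rewrite -g't; apply: (emb_ext (hphi m) dg dg').1 st.
  by rewrite E E'.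
have [I0|IT] := hsimple QI.
  by case: f0; have : [set 0] z by rewrite -I0.
have : Q (phi n (fun=> 1%:M)) by rewrite IT.
move=> /(_ 4^-1)[|m0 Hm]; first by rewrite invr_gt0.
exists m0 => m /Hm[h [h1 h2 h3]] g dg E t st gt.
rewrite (unit_eq n m) in h2.
exact: (near_one_neq0 h1 st h2) (h3 t g st dg E gt).
Qed.

End Full.

(** * Chains of cut-off functions and the systems they define *)

Section Chain.
Context {R : realType}.
Local Notation C := R[i].
Variables (p q N : nat).
Hypothesis p0 : (0 < p)%N.
Hypothesis q0 : (0 < q)%N.

(* The fibre algebra of a cell of [0, 1]: the first and the last cell contain an
   endpoint, where the dimension drop occurs. *)
Variant cell_kind := CellL | CellM | CellR.

Definition bdim k := match k with CellL => p | CellR => q | CellM => (p * q)%N end.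

Definition iota_ k : 'M[C]_(bdim k) -> 'M[C]_(p * q) :=
  match k as k0 return 'M[C]_(bdim k0) -> 'M[C]_(p * q) with
  | CellL => fun B => B *t 1%:M
  | CellR => fun B => 1%:M *t B
  | CellM => fun B => B
  end.

Lemma bdim_gt0 k : (0 < bdim k)%N.
Proof. by case: k; rewrite /bdim ?muln_gt0 ?p0. Qed.

Lemma iota_lin k a (B B' : 'M[C]_(bdim k)) : iota_ (a *: B + B') = a *: iota_ B + iota_ B'.
Proof.
case: k B B' => B B' //=; first by rewrite tensD1l tensZl.
by rewrite tensD1r tensZr.
Qed.

Lemma iota_mul k (B B' : 'M[C]_(bdim k)) : iota_ (B *m B') = iota_ B *m iota_ B'.
Proof. by case: k B B' => B B' //=; rewrite tensmx_mul mulmx1. Qed.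

Lemma iota_adj k (B : 'M[C]_(bdim k)) : iota_ (hadj B) = hadj (iota_ B).
Proof. by case: k B => B //=; rewrite tens_hadj hadj1. Qed.

Lemma iota_one k : iota_ (1%:M : 'M[C]_(bdim k)) = 1%:M.
Proof. by case: k => //=; rewrite tens11. Qed.

Lemma iota_inj k (B : 'M[C]_(bdim k)) : B != 0 -> iota_ B != 0.
Proof.
case: k B => B //=; apply: contra_neq => /matrixP E; apply/matrixP => i j.
- pose z := Ordinal q0; have := E (mxtens_index (i, z)) (mxtens_index (j, z)).
  by rewrite tensmxE !mxE eqxx mulr1n mulr1.
- pose z := Ordinal p0; have := E (mxtens_index (z, i)) (mxtens_index (z, j)).
  by rewrite tensmxE !mxE eqxx mulr1n mul1r.
Qed.

Variable M : nat.
Hypothesis M0 : (0 < M)%N.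

(** Every member equals 1 wherever a later one is nonzero. Successive differences are therefore a
    partition of unity of [0, 1] into cells, in which only neighbours overlap, and only the first
    and the last cell reach an endpoint. *)
Record chain (sg : nat -> R -> R) : Prop := Chain {
  chain_cont : forall i, continuous (sg i);
  chain_01 : forall i x, 0 <= sg i x <= 1;
  chain_first : forall x, sg 0%N x = 1;
  chain_last : forall i x, (M < i)%N -> sg i x = 0;
  chain_at0 : forall i, (0 < i)%N -> sg i 0 = 0;
  chain_at1 : forall i, (i <= M)%N -> sg i 1 = 1;
  chain_nest : forall i j x, (i < j)%N -> sg i x * sg j x = sg j x }.

Definition chain_kind (l : nat) : cell_kind :=
  if l == 0%N then CellL else if l == M then CellR else CellM.

Section Cells.
Variable sg : nat -> R -> R.
Hypothesis sgP : chain sg.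

Definition cell (l : nat) (x : R) : R := sg l x - sg l.+1 x.

Definition cellf (l : nat) (B : 'M[C]_(bdim (chain_kind l))) (x : R) : 'M[C]_(p * q) :=
  (cell l x)%:C *: iota_ B.

Lemma cell_cont l : continuous (cell l).
Proof. by move=> x; apply: cvgB; exact: chain_cont sgP _ _. Qed.

Lemma dd_real_scale (h : R -> R) (X : 'M[C]_(p * q)) : continuous h ->
  (exists g : 'M[C]_p, (h 0)%:C *: X = g *t 1%:M) ->
  (exists g : 'M[C]_q, (h 1)%:C *: X = 1%:M *t g) ->
  dimension_drop (fun x => (h x)%:C *: X).
Proof.
move=> hc H0 H1; apply/dimdropP; split => //.
apply: mcontZ; last exact: mcont_cst.
by apply: cC_real => x; exact: (continuous_subspaceT hc).
Qed.

Lemma dd_real_scale0 (h : R -> R) (X : 'M[C]_(p * q)) : continuous h ->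
  h 0 = 0 -> h 1 = 0 -> dimension_drop (fun x => (h x)%:C *: X).
Proof.
move=> hc h0 h1; apply: dd_real_scale => //.
  by exists 0; rewrite h0 scale0r tens0mx.
by exists 0; rewrite h1 scale0r tensmx0.
Qed.

Lemma cell0 l : (0 < l)%N -> cell l 0 = 0.
Proof. by move=> l0; rewrite /cell !(chain_at0 sgP) // subrr. Qed.

Lemma cell1 l : (l < M)%N -> cell l 1 = 0.
Proof. by move=> l0; rewrite /cell !(chain_at1 sgP) ?subrr // ltnW. Qed.

Lemma cellf_dd l B : (l <= M)%N -> dimension_drop (@cellf l B).
Proof.
move=> lM; apply: dd_real_scale; first exact: cell_cont.
- have [l0|l0] := posnP l; last by exists 0; rewrite cell0 // scale0r tens0mx.
  rewrite /chain_kind l0 /= in B *.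
  by exists ((cell 0 0)%:C *: B); rewrite tensZl.
- have [lm|lm] := eqVneq l M; last first.
    by exists 0; rewrite cell1 ?scale0r ?tensmx0 // ltn_neqAle lm.
  rewrite /chain_kind lm eqxx (gtn_eqF M0) /= in B *.
  by exists ((cell M 1)%:C *: B); rewrite tensZr.
Qed.

Lemma cell_sum x : \sum_(l < M.+1) cell l x = 1.
Proof.
rewrite -(big_mkord predT (fun l => cell l x)).
rewrite (@telescope_sumr_eq _ 0%N M.+1 (fun l => - sg l x) (fun l => cell l x)) // => [|l _].
  by rewrite (chain_last sgP) // (chain_first sgP) oppr0 sub0r opprK.
by rewrite /cell opprK addrC.
Qed.

Lemma cell_at0 l : cell l 0 = (l == 0%N)%:R.
Proof.
case: l => [|l]; first by rewrite /cell (chain_first sgP) (chain_at0 sgP) // subr0.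
by rewrite cell0.
Qed.

Lemma cell_at1 l : (l <= M)%N -> cell l 1 = (l == M)%:R.
Proof.
rewrite leq_eqVlt => /predU1P[->|lM]; last by rewrite cell1 // (ltn_eqF lM).
by rewrite /cell (chain_at1 sgP) // (chain_last sgP) // subr0 eqxx.
Qed.

Variable pi : (R -> 'M[C]_(p * q)) -> 'M[C]_N.
Hypothesis Hpi : ddrep pi.

Definition scalf (h : R -> R) (x : R) : 'M[C]_(p * q) := (h x)%:C%:M.

(** The representation sends each member of the chain to a projection: its spectrum avoids the
    places where the members rise from 0 to 1. *)
Definition valid := forall i, (0 < i <= M)%N ->
  pi (scalf (fun x => sg i x * sg i x - sg i x)) = 0.

(** The constant X need not satisfy the endpoint conditions, so it cannot be factored out of h X.
    The Gram product (h X)^* (h X) is h times h X^* X, and both factors do belong to the algebra. *)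
Lemma rep_scal_ideal (h : R -> R) (X : 'M[C]_(p * q)) : continuous h -> h 0 = 0 -> h 1 = 0 ->
  pi (scalf h) = 0 -> pi (fun x => (h x)%:C *: X) = 0.
Proof.
move=> hc h0 h1 E; apply: hadjmul_eq0.
have dX (Y : 'M[C]_(p * q)) : dimension_drop (fun x => (h x)%:C *: Y) by exact: (@dd_real_scale0 h Y hc h0 h1).
rewrite -(rep_adj Hpi) // -(rep_mul Hpi) //; last exact: dd_hadj.
transitivity (pi (scalf h) *m pi (fun x => (h x)%:C *: (hadj X *m X))); last by rewrite E mul0mx.
rewrite -(rep_mul Hpi) //; last exact: dd_real.
congr pi; apply/funext => x; rewrite /scalf mul_scalar_mx hadjZ -scalemxAl -!scalemxAr.
by congr (_ *: _); rewrite /= oppr0.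
Qed.

Hypothesis sgv : valid.

Lemma valid_cell l : (l <= M)%N ->
  pi (scalf (fun x => cell l x * cell l x - cell l x)) = 0.
Proof.
move=> lM.
have v i : (i <= M.+1)%N -> pi (scalf (fun x => sg i x * sg i x - sg i x)) = 0.
  rewrite leq_eqVlt => /predU1P[->|iM].
    rewrite -(rep_zero Hpi); congr pi; apply/funext => x.
    by rewrite /scalf (chain_last sgP) // mulr0 subr0 raddf0.
  have [->|i0] := posnP i; last by apply: sgv; rewrite i0.
  rewrite -(rep_zero Hpi); congr pi; apply/funext => x.
  by rewrite /scalf (chain_first sgP) // mulr1 subrr raddf0.
have dv i : dimension_drop (scalf (fun x => sg i x * sg i x - sg i x)).
  have c : continuous (sg i) by exact: chain_cont.
  by apply: dd_real => x; apply: cvgB; [apply: cvgM; exact: c|exact: c].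
rewrite (_ : scalf _ = fun x => scalf (fun x => sg l x * sg l x - sg l x) x +
  scalf (fun x => sg l.+1 x * sg l.+1 x - sg l.+1 x) x).
  by rewrite (rep_add Hpi) // !v ?addr0 //; exact: leqW.
apply/funext => x; rewrite /scalf -raddfD -raddfD /=; congr (_%:C%:M).
by have := chain_nest sgP x (ltnSn l); rewrite /cell; move=> h; ring: h.
Qed.

Lemma valid_orth l l' : (l < l')%N -> (l' <= M)%N ->
  pi (scalf (fun x => cell l x * cell l' x)) = 0.
Proof.
move=> ll' lM.
have [l1|l1] := ltnP l.+1 l'.
  rewrite -(rep_zero Hpi); congr pi; apply/funext => x.
  rewrite /scalf /cell; have h1 := chain_nest sgP x l1.
  have h2 := chain_nest sgP x ll'; have h3 := chain_nest sgP x (ltnW l1 : (l.+1 < l'.+1)%N).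
  have h4 := chain_nest sgP x (ltnW ll' : (l < l'.+1)%N).
  rewrite mulrBl !mulrBr h1 h2 h3 h4 subrr; by rewrite raddf0.
have -> : l' = l.+1 by apply/eqP; rewrite eqn_leq l1 ll'.
rewrite (_ : scalf _ = fun x => (-1) *: scalf (fun x => sg l.+1 x * sg l.+1 x - sg l.+1 x) x).
  rewrite (rep_scale Hpi) ?sgv ?scaler0 //; first by rewrite /= (leq_trans ll').
  have c : continuous (sg l.+1) by exact: chain_cont.
  by apply: dd_real => x; apply: cvgB; [apply: cvgM; exact: c|exact: c].
apply/funext => x; rewrite /scalf scaleN1r -raddfN -raddfN /=; congr (_%:C%:M).
have h1 := chain_nest sgP x (ltnSn l); have h2 := chain_nest sgP x (ltnSn l.+1).
have h3 := chain_nest sgP x (leqW (ltnSn l) : (l < l.+2)%N).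
rewrite /cell mulrBl !mulrBr h1 h2 h3; ring.
Qed.

Definition rho (l : 'I_M.+1) (B : 'M[C]_(bdim (chain_kind l))) := pi (cellf B).

(** The defects of multiplicativity and of orthogonality are cell^2 - cell and products of two
    cells, times a constant. [valid] makes them vanish, and they are 0 at both endpoints, so
    [rep_scal_ideal] applies. *)
Lemma rho_system : is_system rho.
Proof.
have dc (l : 'I_M.+1) (B : 'M[C]_(bdim (chain_kind l))) : dimension_drop (cellf B).
  by apply: cellf_dd; rewrite -ltnS.
split.
- move=> l a B B'; rewrite -(rep_lin Hpi) //; congr pi; apply/funext => x.
  by rewrite /cellf iota_lin scalerDr !scalerA mulrC.
- move=> l B B'; apply/eqP; rewrite -subr_eq0 -(rep_mul Hpi) // -opprB oppr_eq0 -(rep_sub Hpi) //; last exact: dd_mul.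
  have lM : (l <= M)%N by rewrite -ltnS.
  apply/eqP; rewrite -[RHS](rep_scal_ideal (iota_ (B *m B')) _ _ _ (valid_cell lM)).
  + congr pi; apply/funext => x; rewrite /cellf -scalemxAl -scalemxAr scalerA -iota_mul.
    by rewrite -scalerBl -rmorphM -rmorphB.
  + by move=> x; apply: cvgB; [apply: cvgM; exact: cell_cont|exact: cell_cont].
  + by rewrite cell_at0; case: (_ == _); rewrite ?mulr1 ?mulr0 subrr.
  + by rewrite cell_at1 //; case: (_ == _); rewrite ?mulr1 ?mulr0 subrr.
- by move=> l B; rewrite -(rep_adj Hpi) //; congr pi; apply/funext => x; rewrite /cellf hadjZ iota_adj /= oppr0.
- move=> l l' B B' ll'.
  rewrite -(rep_mul Hpi) //.
  have vo : pi (scalf (fun x => cell l x * cell l' x)) = 0.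
    move: ll'; rewrite -val_eqE neq_ltn => /orP[h|h].
      by apply: valid_orth => //; rewrite -ltnS.
    rewrite (_ : scalf _ = scalf (fun x => cell l' x * cell l x)).
      by apply: valid_orth => //; rewrite -ltnS.
    by apply/funext => x; rewrite /scalf mulrC.
  rewrite -[RHS](rep_scal_ideal (iota_ B *m iota_ B') _ _ _ vo).
  + congr pi; apply/funext => x; rewrite /cellf -scalemxAl -scalemxAr scalerA.
    by rewrite rmorphM.
  + by move=> x; apply: cvgM; exact: cell_cont.
  + rewrite !cell_at0; move: ll'; rewrite -val_eqE /=.
    by case: (val l) (val l') => [|a] [|b] //=; rewrite ?mulr0 ?mul0r.
  + have lM : (l <= M)%N by rewrite -ltnS.
    have lM' : (l' <= M)%N by rewrite -ltnS.
    rewrite !cell_at1 //; move: ll'; rewrite -val_eqE /=.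
    case: (eqVneq (l : nat) M) => [->|_]; last by rewrite mul0r.
    by rewrite eq_sym => /negbTE ->; rewrite mulr0.
- rewrite -(rep_sum Hpi) // -(rep_one Hpi); congr pi; apply/funext => x.
  under eq_bigr do rewrite /cellf iota_one scalemx1.
  transitivity ((\sum_(i < M.+1) (cell i x)%:C)%:M : 'M[C]_(p * q)); first by rewrite raddf_sum.
  by rewrite -rmorph_sum cell_sum.
Qed.

End Cells.

(* Functions adapted to a chain, in Abel-summed form: omitting some members of
   the chain amounts to the vanishing of some coefficients. *)
Definition adapted (sg : nat -> R -> R) (X : nat -> 'M[C]_(p * q)) (x : R) : 'M[C]_(p * q) :=
  \sum_(i < M.+1) (sg i x)%:C *: X i.

Definition adcoef (X : nat -> 'M[C]_(p * q)) : Prop :=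
  (exists g : 'M[C]_p, X 0%N = g *t 1%:M) /\
  (exists g : 'M[C]_q, \sum_(i < M.+1) X i = 1%:M *t g).

Definition com (sg : nat -> R -> R) (pi : (R -> 'M[C]_(p * q)) -> 'M[C]_N) (s : 'M[C]_N) : Prop :=
  forall X, adcoef X -> s *m pi (adapted sg X) = pi (adapted sg X) *m s.

Section Com.
Variable sg : nat -> R -> R.
Hypothesis sgP : chain sg.

Lemma adapted_dd X : adcoef X -> dimension_drop (adapted sg X).
Proof.
move=> [[g gE] [h hE]]; apply/dimdropP; split.
- apply: mcont_sum => i; apply: mcontZ; last exact: mcont_cst.
  by apply: cC_real => x; exact: (continuous_subspaceT (chain_cont sgP (i := i))).
- exists g; rewrite /adapted big_ord_recl big1 ?addr0 /=.
    by rewrite (chain_first sgP) scale1r.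
  by move=> i _; rewrite (chain_at0 sgP) // scale0r.
- exists h; rewrite -hE; apply: eq_bigr => i _.
  by rewrite (chain_at1 sgP) ?scale1r // -ltnS.
Qed.

Lemma adapted_cells (X Y : nat -> 'M[C]_(p * q)) x : X 0%N = Y 0%N ->
  (forall i, X i.+1 = Y i.+1 - Y i) -> adapted sg X x = \sum_(l < M.+1) (cell sg l x)%:C *: Y l.
Proof.
move=> X0 XS; rewrite /adapted.
suff H k : \sum_(i < k.+1) (sg i x)%:C *: X i =
    \sum_(l < k.+1) (cell sg l x)%:C *: Y l + (sg k.+1 x)%:C *: Y k.
  by rewrite H (chain_last sgP) // scale0r addr0.
elim: k => [|k IH].
  rewrite !big_ord_recl !big_ord0 !addr0 X0 -scalerDl -rmorphD.
  by congr (_%:C *: _); rewrite /cell subrK.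
rewrite big_ord_recr /= IH XS [in X in _ = X + _]big_ord_recr /=.
rewrite [in X in _ = X + _]/cell rmorphB scalerBl scalerBr -[RHS]addrA subrK.
by rewrite -addrA [X in _ + X]addrC subrK.
Qed.

Lemma cellf_adapted (l : 'I_M.+1) (B : 'M[C]_(bdim (chain_kind l))) :
  exists X, adcoef X /\ forall x, adapted sg X x = cellf sg B x.
Proof.
pose Y k : 'M[C]_(p * q) := if k == l :> nat then iota_ B else 0.
pose X k := if k is k'.+1 then Y k - Y k' else Y 0%N.
have sumX : \sum_(i < M.+1) X i = Y M.
  rewrite big_ord_recl /=; have -> : \sum_(i < M) X (bump 0 i) = Y M - Y 0%N.
    by rewrite -(telescope_sumr _ (leq0n M)) big_mkord; apply: eq_bigr => i _.
  by rewrite addrC subrK.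
exists X; split; last first.
  move=> x; rewrite (adapted_cells _ (Y := Y)) // (bigD1 l) //= {1}/Y eqxx big1 ?addr0 // => i il.
  by rewrite /Y; move: il; rewrite -val_eqE => /negbTE ->; rewrite scaler0.
rewrite /adcoef sumX /X /Y; split.
  have [l0|l0] := eqVneq 0%N (l : nat); last by exists 0; rewrite tens0mx.
  case: l l0 B {X Y sumX} => [[|l] Hl] //= _ B; by exists B.
have [lm|lm] := eqVneq M (l : nat); last by exists 0; rewrite tensmx0.
case: l lm B {X Y sumX} => l Hl /= lm; move: Hl; rewrite -lm => Hl.
rewrite /chain_kind eqxx (gtn_eqF M0) => B; by exists B.
Qed.

Section Pi.
Variable pi : (R -> 'M[C]_(p * q)) -> 'M[C]_N.
Hypothesis Hpi : ddrep pi.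

(** Abel summation: an adapted function is a sum over the cells whose values are the partial sums of
    its coefficients, and conversely a function carried by one cell is adapted. *)
Lemma com_commut s : com sg pi s <-> commut (rho sg pi) s.
Proof.
split=> [H l B|H X Xa].
  have [X [Xa XE]] := cellf_adapted B; have := H X Xa.
  by rewrite (_ : adapted sg X = cellf sg B) //; exact/funext.
pose Y k := \sum_(i < k.+1) X i.
have YE x : adapted sg X x = \sum_(l < M.+1) (cell sg l x)%:C *: Y l.
  apply: adapted_cells; first by rewrite /Y big_ord1.
  move=> i; have -> : Y i.+1 = Y i + X i.+1 by rewrite /Y big_ord_recr.
  by rewrite addrAC subrr add0r.
have [[g gE] [h hE]] := Xa.
have K (l : 'I_M.+1) : exists B : 'M[C]_(bdim (chain_kind l)), iota_ B = Y l.
  rewrite /chain_kind; case: eqP => [->|_]; first by exists g; rewrite /Y big_ord1 gE.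
  by case: eqP => [->|_]; [exists h|exists (Y l)].
have E : pi (adapted sg X) = \sum_(l < M.+1) pi (fun x => (cell sg l x)%:C *: Y l).
  rewrite -(rep_sum Hpi); first by congr pi; exact/funext.
  move=> l; have [B BE] := K l; rewrite -BE.
  by apply: cellf_dd => //; rewrite -ltnS.
rewrite E mulmx_sumr mulmx_suml; apply: eq_bigr => l _.
by have [B BE] := K l; rewrite -BE; exact: H.
Qed.

Lemma com_conn K (m m' : 'I_K * 'I_K.+1 -> 'M[C]_N) : (0 < K)%N -> valid sg pi ->
  sol m -> sol m' -> (forall ji, com sg pi (m ji)) -> (forall ji, com sg pi (m' ji)) ->
  pconn (fun x => sol x /\ forall ji, com sg pi (x ji)) m m'.
Proof.
move=> K0 sgv sm sm' cm cm'.
have := sys_conn (rho_system sgP Hpi sgv) (fun l => Ordinal (bdim_gt0 (chain_kind l))) K0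
  (fun ji => (com_commut _).1 (cm ji)) (fun ji => (com_commut _).1 (cm' ji)) sm sm'.
by apply: pconn_sub => x [sx cx]; split => // ji; apply/com_commut.
Qed.

(** The bumps under a cell, times a minimal projection of its block, are the orthogonal elements
    that [sys_exists] requires. *)
Lemma com_exists K (bmp : 'I_M.+1 -> 'I_(K * K) -> R -> R) : (0 < K)%N -> valid sg pi ->
  (forall l i, continuous (bmp l i)) ->
  (forall l i, bmp l i 0 = 0) -> (forall l i, bmp l i 1 = 0) ->
  (forall l i x, bmp l i x * cell sg l x = bmp l i x) ->
  (forall l i i' x, i != i' -> bmp l i x * bmp l i' x = 0) ->
  (forall l i, pi (fun x => (bmp l i x)%:C *: iota_ (delta_mx (Ordinal (bdim_gt0 (chain_kind l)))
     (Ordinal (bdim_gt0 (chain_kind l))))) != 0) ->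
  exists m : 'I_K * 'I_K.+1 -> 'M[C]_N, sol m /\ forall ji, com sg pi (m ji).
Proof.
move=> K0 sgv bc b0 b1 bchi bo bn.
have := @sys_exists _ _ _ _ _ (rho_system sgP Hpi sgv)
  (fun l => Ordinal (bdim_gt0 (chain_kind l))) K K0.
case=> [l|m [sm cm]]; last by exists m; split => // ji; apply/com_commut.
set a := Ordinal _; pose e : 'M[C]_(bdim (chain_kind l)) := delta_mx a a.
have db i : dimension_drop (fun x => (bmp l i x)%:C *: iota_ e) by exact: dd_real_scale0.
exists (fun i => pi (fun x => (bmp l i x)%:C *: iota_ e)); split.
- by move=> i; exact: bn.
- move=> i; rewrite -(rep_adj Hpi) //; congr pi; apply/funext => x.
  by rewrite hadjZ -iota_adj hadj_delta /= oppr0.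
- move=> i j ij; rewrite -(rep_mul Hpi) // -(rep_zero Hpi); congr pi; apply/funext => x.
  by rewrite -scalemxAl -scalemxAr scalerA -rmorphM bo // scale0r.
- move=> i; rewrite /rho -(rep_mul Hpi) //; last by apply: cellf_dd => //; rewrite -ltnS.
  congr pi; apply/funext => x; rewrite /cellf -scalemxAl -scalemxAr scalerA -rmorphM.
  by rewrite mulrC bchi -iota_mul mul_delta_mx.
Qed.

End Pi.
End Com.
End Chain.

(** * Nearby systems are unitarily equivalent *)

Section Close.
Context {R : realType}.
Local Notation C := R[i].

Lemma opb_proj n (e : 'M[C]_n) : hadj e = e -> e *m e = e -> opb 1 e.
Proof.
move=> es ee v; rewrite expr1n mul1r.
suff : nv v = nv (e *m v) + nv (v - e *m v) by move=> ->; rewrite lerDl nv_ge0.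
apply: complexI.
have -> : (nv (e *m v) + nv (v - e *m v))%:C = (nv (e *m v))%:C + (nv (v - e *m v))%:C.
  by rewrite rmorphD.
have E (u : 'cV[C]_n) : (nv u)%:C = (hadj u *m u) ord0 ord0 by rewrite nvE mxE eqxx mulr1n.
have mxD (A B : 'M[C]_1) a b : (A + B) a b = A a b + B a b by rewrite mxE.
rewrite !E -mxD; congr (_ _ ord0 ord0).
rewrite hadjB hadjM es mulmxBl !mulmxBr !mulmxA -!(mulmxA (hadj v) e e) ee.
have gen (V : zmodType) (x y : V) : x = y + (x - y - (y - y)).
  by rewrite subrr subr0 addrC subrK.
exact: gen.
Qed.

Lemma opb_pisom m n (x : 'M[C]_(m, n)) :
  hadj x *m x *m (hadj x *m x) = hadj x *m x -> opb 1 x.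
Proof.
move=> xx; apply: opb_adjmul => //; rewrite expr1n; apply: opb_proj => //.
by rewrite hadjM hadjK.
Qed.

Lemma opb_lt1_unit n (r : 'M[C]_n) (c : R) : 0 <= c -> c < 1 -> opb c r ->
  1%:M - r \in unitmx.
Proof.
move=> c0 c1 rc; rewrite -unitmx_tr -row_free_unit -kermx_eq0; apply/rowV0P => v /sub_kermxP vk.
have w0 : (1%:M - r) *m v^T = 0 by rewrite -[LHS]trmxK trmx_mul trmxK vk trmx0.
have rw : r *m v^T = v^T.
  by move: w0; rewrite mulmxBl mul1mx => /eqP; rewrite subr_eq0 => /eqP.
have := rc v^T; rewrite rw => h.
have cc : c ^+ 2 < 1 by rewrite expr_lt1.
have : nv v^T = 0 by have := nv_ge0 v^T; nra.
by move=> /nv_eq0 h0; rewrite -[v]trmxK h0 trmx0.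
Qed.

Section TwoSystems.
Variables (L N : nat) (d : 'I_L -> nat) (a0 : forall l, 'I_(d l)).

(** The sum W of the rho' (e_{a, a0}) rho (e_{a0, a}) intertwines the two systems and is close to 1.
    Its unitary part is U = W (1 - r)^-1 with (1 - r)^2 = W^* W, and r commutes with rho. The
    tolerance depends only on the dimensions, so it can be fixed before the fibres are. *)
Lemma sys_close (e : R) : 0 < e -> exists2 eta, 0 < eta &
  forall rho rho' : forall l, 'M[C]_(d l) -> 'M[C]_N, is_system rho -> is_system rho' ->
  (forall l a b, opb eta (rho' l (delta_mx a b) - rho l (delta_mx a b))) ->
  exists U : 'M[C]_N, [/\ hadj U *m U = 1%:M, U *m hadj U = 1%:M, opb e (U - 1%:M) &
    forall l B, U *m rho l B = rho' l B *m U].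
Proof.
move=> e0; pose e' := Num.min e 1.
have e'0 : 0 < e' by rewrite lt_min e0 ltr01.
have e'1 : e' <= 1 by rewrite ge_min lexx orbT.
have e'e : e' <= e by rewrite ge_min lexx.
pose D : R := (\sum_l d l)%:R.
have D0 : 0 <= D by exact: ler0n.
pose T : R := N.+1%:R * N%:R.
have T0 : 0 <= T by rewrite mulr_ge0.
have TD0 : 0 < 24 * (T + 1) * (D + 1).
  by rewrite !mulr_gt0 // ltr_wpDl.
(* |W - 1| <= D eta =: w, so 1 - W^* W is at most 3 w and the entries of r are at most 6 w; T turns
   entry bounds into operator bounds. *)
pose eta := e' / (24 * (T + 1) * (D + 1)).
have eta0 : 0 < eta by rewrite divr_gt0.
exists eta => // rho rho' sys sys' H.
have [rL rM rA rO r1] := sys; have [rL' rM' rA' rO' r1'] := sys'.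
pose dl l a b : 'M[C]_(d l) := delta_mx a b.
have dd l (a b c f : 'I_(d l)) : dl l a b *m dl l c f = (b == c)%:R *: dl l a f.
  rewrite /dl; case: eqVneq => [->|bc]; rewrite ?scale1r ?scale0r ?mul_delta_mx //.
  by rewrite mul_delta_mx_0.
have rz (r : forall l, 'M[C]_(d l) -> 'M[C]_N) : is_system r -> forall l, r l 0 = 0.
  by move=> [h _ _ _ _] l; apply: (addrI (r l 0)); rewrite -[X in X + _ = _]scale1r -h scale1r !addr0.
have rZ (r : forall l, 'M[C]_(d l) -> 'M[C]_N) : is_system r -> forall l a B, r l (a *: B) = a *: r l B.
  by move=> h l a B; have [hh _ _ _ _] := h; rewrite -[a *: B]addr0 hh (rz _ h) addr0.
have rS (r : forall l, 'M[C]_(d l) -> 'M[C]_N) : is_system r -> forall l I (s : seq I) (P : pred I) F,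
    r l (\sum_(i <- s | P i) F i) = \sum_(i <- s | P i) r l (F i).
  move=> h l I s P F; apply: (big_morph (r l)) => [B B'|]; last exact: rz.
  by have [hh _ _ _ _] := h; rewrite -[B in LHS]scale1r hh scale1r.
have rdd (r : forall l, 'M[C]_(d l) -> 'M[C]_N) : is_system r -> forall l l' (a b : 'I_(d l)) (c f : 'I_(d l')),
   l != l' -> r l (dl l a b) *m r l' (dl l' c f) = 0.
  by move=> [_ _ _ h _] *; exact: h.
pose W : 'M[C]_N := \sum_l \sum_a rho' l (dl l a (a0 l)) *m rho l (dl l (a0 l) a).
have WL l a b : W *m rho l (dl l a b) = rho' l (dl l a (a0 l)) *m rho l (dl l (a0 l) b).
  rewrite /W mulmx_suml (bigD1 l) //= [X in _ + X]big1 ?addr0; last first.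
    move=> l' ll'; rewrite mulmx_suml big1 // => x _.
    by rewrite -mulmxA rdd ?mulmx0.
  rewrite mulmx_suml (bigD1 a) //= [X in _ + X]big1 ?addr0; last first.
    by move=> x xa; rewrite -mulmxA -rM dd (negbTE xa) scale0r rz // mulmx0.
  by rewrite -mulmxA -rM dd eqxx scale1r.
have WR l a b : rho' l (dl l a b) *m W = rho' l (dl l a (a0 l)) *m rho l (dl l (a0 l) b).
  rewrite /W mulmx_sumr (bigD1 l) //= [X in _ + X]big1 ?addr0; last first.
    move=> l' ll'; rewrite mulmx_sumr big1 // => x _.
    by rewrite mulmxA rdd ?mul0mx // eq_sym.
  rewrite mulmx_sumr (bigD1 b) //= [X in _ + X]big1 ?addr0; last first.
    by move=> x xb; rewrite mulmxA -rM' dd eq_sym (negbTE xb) scale0r rz // mul0mx.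
  by rewrite mulmxA -rM' dd eqxx scale1r.
have WB l B : W *m rho l B = rho' l B *m W.
  clearbody W; rewrite (matrix_sum_delta B) !rS // mulmx_suml mulmx_sumr; apply: eq_bigr => a _.
  rewrite !rS // mulmx_suml mulmx_sumr; apply: eq_bigr => b _.
  by rewrite !rZ // -scalemxAl -scalemxAr WL WR.
have r1d : 1%:M = \sum_l \sum_a rho l (dl l a a).
  rewrite -r1; apply: eq_bigr => l _; rewrite -rS //; congr (rho l _).
  by rewrite -sum_delta.
have oW : opb (D * eta) (W - 1%:M).
  have -> : W - 1%:M = \sum_l \sum_a
      (rho' l (dl l a (a0 l)) - rho l (dl l a (a0 l))) *m rho l (dl l (a0 l) a).
    rewrite r1d /W -sumrB; apply: eq_bigr => l _; rewrite -sumrB; apply: eq_bigr => a _.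
    by rewrite mulmxBl -rM dd eqxx scale1r.
  have -> : D * eta = \sum_l \sum_(a < d l) eta.
    rewrite /D natr_sum mulr_suml; apply: eq_bigr => l _.
    by rewrite sumr_const card_ord mulr_natl.
  apply: opb_sum => [l|l]; first by apply: sumr_ge0 => a _; exact: ltW.
  apply: opb_sum => [a|a]; first exact: ltW.
  rewrite -[eta]mulr1; apply: opbM; first exact: H.
  by apply: opb_pisom; rewrite -rA -rM hadj_delta dd eqxx scale1r -rM dd eqxx scale1r.
have w0 : 0 <= D * eta by rewrite mulr_ge0 // ltW.
have w1 : D * eta <= e' / 24 / (T + 1).
  have E : eta * (24 * (T + 1) * (D + 1)) = e' by rewrite mulfVK // gt_eqF.
  have T10 : 0 < T + 1 by rewrite ltr_wpDl.
  have hp : 0 <= eta * (T + 1) by rewrite mulr_ge0 // ltW.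
  rewrite !ler_pdivlMr // -E; lra.
have iT : (T + 1)^-1 <= 1 by rewrite invf_le1 ?ltr_wpDl // lerDr.
have iT0 : 0 < (T + 1)^-1 by rewrite invr_gt0 ltr_wpDl.
have w2 : D * eta <= e' / 24.
  by apply: le_trans w1 _; rewrite ler_piMr // divr_ge0 // ltW.
set w := D * eta in oW w0 w1 w2.
pose c : 'M[C]_N := 1%:M - hadj W *m W.
have oc : opb (3 * w) c.
  have -> : c = - (hadj (W - 1%:M) *m (W - 1%:M)) - hadj (W - 1%:M) - (W - 1%:M).
    by rewrite /c hadjB hadj1; ncmx.
  have -> : 3 * w = 1 * w + w + w by ring.
  apply: opbB => //; first by rewrite addr_ge0 // mulr_ge0.
  apply: opbB; [by rewrite mul1r|exact: w0| |exact: opb_adj].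
  apply: (@opb_le _ _ _ (w * w)); [exact: mulr_ge0| |].
    by apply: ler_wpM2r => //; lra.
  by apply/opbN/opbM; [exact: opb_adj w0 oW|exact: oW].
have k0 : 0 <= 3 * w by rewrite mulr_ge0.
have k1 : 3 * w < 1 by lra.
have [r [rb r2 rs rc]] := msqrt_lim k0 k1 oc.
have r'2 : (1%:M - r) *m (1%:M - r) = hadj W *m W by rewrite r2 /c; ncmx.
have rs' : hadj r = r by apply: rs; rewrite /c hadjB hadjM hadjK hadj1.
have rB l B : rho l B *m r = r *m rho l B.
  apply: rc; rewrite /c mulmxBr mulmxBl mulmx1 mul1mx; congr (_ - _).
  have := congr1 (@hadj R _ _) (WB l (hadj B)); rewrite !hadjM rA rA' !hadjK => E.
  by rewrite mulmxA E -mulmxA -WB mulmxA.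
have or : opb (e' / 2) r.
  have h0 : 0 <= 3 * w / (1 - 3 * w) by rewrite divr_ge0 // subr_ge0 ltW.
  apply: (opb_le _ _ (entry_opb h0 _)); first by rewrite mulr_ge0.
    rewrite -/T; have : 3 * w / (1 - 3 * w) <= 6 * w.
      by rewrite ler_pdivrMr ?subr_gt0 //; nra.
    move=> h; apply: (le_trans (ler_wpM2l T0 h)).
    have T10 : 0 < T + 1 by rewrite ltr_wpDl.
    rewrite ler_pdivlMr // in w1; nra.
  by move=> i j; have := rb 0%N i j; rewrite expr1 /= sub0r mxE normcN.
have e2 : 0 <= e' / 2 by rewrite divr_ge0 // ltW.
have u1 : 1%:M - r \in unitmx by apply: opb_lt1_unit or => //; lra.
pose U := W *m invmx (1%:M - r).
have V := mulVmx u1; have V' := mulmxV u1.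
have hs : hadj (invmx (1%:M - r)) = invmx (1%:M - r).
  have : hadj (invmx (1%:M - r)) *m (1%:M - r) = 1%:M.
    by rewrite -{2}rs' -{2}(hadj1 N) -hadjB -hadjM V' hadj1.
  by move=> /(congr1 (mulmx^~ (invmx (1%:M - r)))) /=; rewrite -mulmxA V' mulmx1 mul1mx.
have UU : hadj U *m U = 1%:M.
  rewrite /U hadjM hs !mulmxA -(mulmxA (invmx _) (hadj W)) -r'2.
  by rewrite !mulmxA V mul1mx V'.
exists U; split => //.
- exact: mulmx1C.
- have -> : U - 1%:M = (W - 1%:M) + U *m r.
    have : U *m (1%:M - r) = W by rewrite /U -mulmxA V mulmx1.
    by move=> <-; ncmx.
  apply: (@opb_le _ _ _ (w + 1 * (e' / 2))); [by rewrite addr_ge0 // mul1r|lra|].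
  apply: opbD => //; first by rewrite mul1r.
  by apply: opbM => //; exact: opb_isom.
- move=> l B; rewrite /U -mulmxA.
  have -> : invmx (1%:M - r) *m rho l B = rho l B *m invmx (1%:M - r).
    have E : rho l B *m (1%:M - r) = (1%:M - r) *m rho l B.
      by rewrite mulmxBr mulmxBl mulmx1 mul1mx rB.
    have := congr1 (fun y => invmx (1%:M - r) *m y *m invmx (1%:M - r)) E.
    by rewrite /= !mulmxA V mul1mx -!mulmxA V' mulmx1.
  by rewrite mulmxA WB mulmxA.
Qed.
End TwoSystems.
End Close.

(** * Gluing along [0, 1] *)

Section RealInduction.
Context {R : realType}.
Local Notation C := R[i].

(** This takes the place of the compactness of [0, 1]. The local hypothesis is used once, around the
    supremum of the points where P holds; it only asks that P propagate to the right near c, not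
    that it hold there. *)
Lemma real_induction (P : R -> Prop) : P 0 ->
  (forall c, seg c -> exists2 d, 0 < d & forall t t', seg t -> seg t' ->
    `|t - c| < d -> `|t' - c| < d -> t <= t' -> P t -> P t') -> P 1.
Proof.
move=> P0 H; pose S := [set t | seg t /\ P t].
have S0 : S 0 by split => //; exact: seg0.
have ubS : ubound S 1 by move=> t [/segP/andP[_ t1] _].
have hS : has_sup S by split; [exists 0|exists 1].
have s0 : 0 <= sup S by apply: sup_upper_bound.
have s1 : sup S <= 1 by apply: sup_le_ub => //; exists 0.
have ss : seg (sup S) by apply/segP; rewrite s0.
have [d d0 Hd] := H _ ss.
have [t [st Pt] ts] := sup_adherent d0 hS.
have tle : t <= sup S by apply: sup_upper_bound.
pose t' := Num.min 1 (sup S + d / 2).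
have d2 : 0 < d / 2 by rewrite divr_gt0.
have t'1 : t' <= 1 by rewrite ge_min lexx.
have t's : t' <= sup S + d / 2 by rewrite ge_min lexx orbT.
have st' : sup S <= t' by rewrite le_min s1 lerDl ltW.
have sg' : seg t' by apply/segP; rewrite t'1 (le_trans s0).
have Pt' : P t'.
  apply: (Hd t t') => //; last exact: le_trans tle st'.
  - by rewrite ltr_norml; apply/andP; split; lra.
  - by rewrite ltr_norml; apply/andP; split; lra.
have : t' <= sup S by apply: sup_upper_bound.
rewrite /t' ge_min => /orP[h|h]; last by exfalso; lra.
by rewrite /t' min_l in Pt' => //; lra.
Qed.

(** Heine's theorem, by real induction on uniform continuity over [0, t]. *)
Lemma mcont01_unif m n (f : R -> 'M[C]_(m, n)) (e : R) : mcont01 f -> 0 < e ->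
  exists2 d, 0 < d & forall x y, seg x -> seg y -> `|x - y| < d ->
    forall i j, normc ((f x - f y) i j) < e.
Proof.
move=> /mcont01P fc e0.
have e20 : 0 < e / 2 by rewrite divr_gt0.
suff [d d0 H] : exists2 d, 0 < d & forall x y, seg x -> seg y -> x <= 1 -> y <= 1 ->
    `|x - y| < d -> forall i j, normc ((f x - f y) i j) < e.
  by exists d => // x y sx sy; apply: H => //; [have /segP/andP[] := sx|have /segP/andP[] := sy].
pose P t := exists2 d, 0 < d & forall x y, seg x -> seg y -> x <= t -> y <= t ->
    `|x - y| < d -> forall i j, normc ((f x - f y) i j) < e.
apply: (@real_induction P).
  exists 1 => // x y /segP/andP[x0 _] /segP/andP[y0 _] x1 y1 _ i j.
  have -> : x = y by lra.
  by rewrite subrr mxE normc0.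
move=> c sc; have [dc dc0 Hc] := fc c sc _ e20.
exists (dc / 2); first by rewrite divr_gt0.
move=> t t' st st' tc t'c tt' [d d0 Hd].
have dc2 : 0 < dc / 2 by rewrite divr_gt0.
exists (Num.min d (dc / 2)); first by rewrite lt_min d0.
have key x y : seg x -> seg y -> t < x -> x <= t' -> `|x - y| < dc / 2 ->
    forall i j, normc ((f x - f y) i j) < e.
  move=> sx sy tx xt' xy i j.
  rewrite !ltr_norml in tc t'c xy; case/andP: tc => a1 a2; case/andP: t'c => a3 a4; case/andP: xy => a5 a6.
  have hx : `|x - c| < dc by rewrite ltr_norml; apply/andP; split; lra.
  have hy : `|y - c| < dc by rewrite ltr_norml; apply/andP; split; lra.
  have -> : (f x - f y) i j = (f x - f c) i j - (f y - f c) i j by rewrite !mxE; ring.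
  apply: le_lt_trans (le_normcD _ _) _; rewrite normcN.
  by have := Hc x sx hx i j; have := Hc y sy hy i j; lra.
move=> x y sx sy xt yt; rewrite lt_min => /andP[xy1 xy2].
have [xt1|xt1] := leP x t; last exact: key.
have [yt1|yt1] := leP y t; first by exact: Hd.
move=> i j; have -> : (f x - f y) i j = - (f y - f x) i j by rewrite !mxE opprB.
by rewrite normcN; apply: key => //; rewrite distrC.
Qed.
End RealInduction.

(** * Subchains and approximation by adapted functions *)

Section Chains.
Context {R : realType}.
Local Notation C := R[i].

Definition subc M' (ph : nat -> nat) (sg : nat -> R -> R) (i : nat) (x : R) : R :=
  if (i <= M')%N then sg (ph i) x else 0.

Lemma ph_mono M' (ph : nat -> nat) i j : (forall i, (i < M')%N -> (ph i < ph i.+1)%N) ->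
  (i < j <= M')%N -> (ph i < ph j)%N.
Proof.
move=> H /andP[ij jM]; elim: j ij jM => // j IH; rewrite ltnS leq_eqVlt => /predU1P[->|ij] jM.
  exact: H.
by apply: ltn_trans (IH ij (ltnW jM)) (H _ jM).
Qed.

Lemma subc_chain M M' ph sg : @chain R M sg -> ph 0%N = 0%N ->
  (forall i, (i < M')%N -> (ph i < ph i.+1)%N) -> (ph M' <= M)%N ->
  @chain R M' (subc M' ph sg).
Proof.
move=> sgP p0 ps pM.
have pos i : (0 < i <= M')%N -> (0 < ph i)%N.
  by move=> h; have := ph_mono ps h; rewrite p0.
have le i : (i <= M')%N -> (ph i <= M)%N.
  rewrite leq_eqVlt => /predU1P[->//|h]; apply: leq_trans pM; apply/ltnW/(ph_mono ps).
  by rewrite h /=.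
rewrite /subc; split.
- move=> i; case: (i <= M')%N; first exact: (chain_cont sgP).
  by move=> x; exact: cvg_cst.
- by move=> i x; case: ifP => _; rewrite ?(chain_01 sgP) ?lexx ?ler01.
- by move=> x; rewrite p0 (chain_first sgP).
- by move=> i x; rewrite ltnNge => /negbTE ->.
- move=> i i0; case: ifP => // iM; apply: (chain_at0 sgP); apply: pos; by rewrite i0.
- by move=> i iM; rewrite iM (chain_at1 sgP) // le.
- move=> i j x ij; case: (leqP j M') => jM; last by rewrite mulr0.
  rewrite (ltnW (leq_trans ij jM)) (chain_nest sgP) //.
  by apply: (ph_mono ps); rewrite ij.
Qed.

(** A function adapted to a subchain is adapted to the chain: the omitted members get coefficient 0.
    This is what the Abel-summed form is for. *)
Lemma com_subc p q N M M' ph sg (pi : (R -> 'M[C]_(p * q)) -> 'M[C]_N) s :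
  ph 0%N = 0%N -> (forall i, (i < M')%N -> (ph i < ph i.+1)%N) -> (ph M' <= M)%N ->
  com M sg pi s -> com M' (subc M' ph sg) pi s.
Proof.
move=> p0 ps pM H X [X0 X1].
have le i : (i <= M')%N -> (ph i <= M)%N.
  rewrite leq_eqVlt => /predU1P[->//|h]; apply: leq_trans pM; apply/ltnW/(ph_mono ps).
  by rewrite h /=.
pose Y j := \sum_(i < M'.+1 | ph i == j) X i.
have Y0 : Y 0%N = X 0%N.
  rewrite /Y (bigD1 ord0) ?p0 //= big1 ?addr0 // => i /andP[/eqP pi0 i0].
  have : (0 < ph i)%N by rewrite -p0; apply: (ph_mono ps); rewrite lt0n -ltnS ltn_ord andbT.
  by rewrite pi0.
have part (F : nat -> 'M[C]_(p * q)) : \sum_(i < M'.+1) F i =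
    \sum_(j < M.+1) \sum_(i < M'.+1 | ph i == j :> nat) F i.
  rewrite (partition_big (fun i : 'I_M'.+1 => inord (ph i) : 'I_M.+1) predT) //=.
  apply: eq_bigr => j _; apply: eq_bigl => i.
  by rewrite -val_eqE /= inordK // ltnS le // -ltnS.
have -> : adapted M' (subc M' ph sg) X = adapted M sg Y.
  apply/funext => x; rewrite /adapted (part (fun i => (subc M' ph sg i x)%:C *: X i)).
  apply: eq_bigr => j _; rewrite /Y scaler_sumr; apply: eq_bigr => i /eqP <-.
  by rewrite /subc -ltnS ltn_ord.
apply: H; split; first by rewrite Y0.
by case: X1 => g gE; exists g; rewrite -gE (part X).
Qed.

Lemma valid_subc p q N M M' ph sg (pi : (R -> 'M[C]_(p * q)) -> 'M[C]_N) :
  ph 0%N = 0%N -> (forall i, (i < M')%N -> (ph i < ph i.+1)%N) -> (ph M' <= M)%N ->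
  valid M sg pi -> valid M' (subc M' ph sg) pi.
Proof.
move=> p0 ps pM H i /andP[i0 iM]; rewrite /subc iM; apply: H.
rewrite -{1}p0 (ph_mono ps) ?i0 //=.
move: iM; rewrite leq_eqVlt => /predU1P[->//|h]; apply: leq_trans pM; apply/ltnW/(ph_mono ps).
by rewrite h /=.
Qed.

(** A sample point for each cell. The first is 0 and the last is 1, so that sampled values of an
    element satisfy the endpoint conditions. *)
Definition finech (d : R) M (sg : nat -> R -> R) : Prop :=
  exists c : nat -> R, [/\ c 0%N = 0, c M = 1 & forall l x, (l <= M)%N -> seg x ->
    seg (c l) /\ (cell sg l x != 0 -> `|x - c l| < d)].

(** The adapted function is the average of the samples of f with the cells as weights; a weight is
    nonzero only near its sample point. *)
Lemma finech_approx p q M sg (f : R -> 'M[C]_(p * q)) (d e : R) : (0 < M)%N -> @chain R M sg ->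
  finech d M sg -> dimension_drop f -> 0 <= e ->
  (forall x y, seg x -> seg y -> `|x - y| < d -> forall i j, normc ((f x - f y) i j) <= e) ->
  exists X, adcoef M X /\ forall x, seg x -> forall i j, normc ((f x - adapted M sg X x) i j) <= e.
Proof.
move=> M0 sgP [c [c0 c1 cP]] /dimdropP[fc [g gE] [h hE]] e0 fu.
pose X k := if k is k'.+1 then f (c k) - f (c k') else f (c 0%N).
have sumX k : \sum_(i < k.+1) X i = f (c k).
  elim: k => [|k IH]; first by rewrite big_ord1.
  by rewrite big_ord_recr /= IH addrC subrK.
exists X; split; first by split; [exists g; rewrite /X c0|exists h; rewrite sumX c1].
move=> x sx i j; rewrite (adapted_cells sgP (Y := fun k => f (c k))) //.
have cge l : 0 <= cell sg l x.
  rewrite /cell; have := chain_nest sgP x (ltnSn l).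
  have := chain_01 sgP l x; have := chain_01 sgP l.+1 x => /andP[a1 a2] /andP[b1 b2] E.
  nra.
have cs := cell_sum sgP x.
have -> : f x - \sum_(l < M.+1) (cell sg l x)%:C *: f (c l) =
    \sum_(l < M.+1) (cell sg l x)%:C *: (f x - f (c l)).
  rewrite -[f x in LHS]scale1r -[1]/(1%:C) -cs rmorph_sum scaler_suml -sumrB.
  by apply: eq_bigr => l _; rewrite scalerBr.
rewrite summxE; apply: (@le_trans _ _ (\sum_(l < M.+1) cell sg l x * e)); last first.
  by rewrite -mulr_suml cs mul1r.
apply: (@le_trans _ _ (\sum_(l < M.+1) normc (((cell sg l x)%:C *: (f x - f (c l))) i j))).
  elim/big_rec2: _ => [|l a b _ ab]; first by rewrite normc0.
  exact: le_trans (le_normcD _ _) (lerD _ _).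
apply: ler_sum => l _; rewrite mxE normcM normc_real ger0_norm //.
have lM : (l <= M)%N by rewrite -ltnS.
have [z|nz] := eqVneq (cell sg l x) 0; first by rewrite z !mul0r.
have [scl /(_ nz) cd] := cP l x lM sx.
by apply: ler_wpM2l => //; exact: fu.
Qed.

End Chains.

(** * Windows in which the cuts are made *)

Section Windows.
Context {R : realType}.
Local Notation C := R[i].
Variables (M Nc : nat).
Hypothesis M0 : (0 < M)%N.

(** [0, 1] is divided into 2 M + 1 intervals of this length, gaps 0 to M alternating with windows 1
    to M. Window w runs from (2 w - 1) wh to 2 w wh. *)
Definition wh : R := (2 * M + 1)%:R^-1.
Definition wd : R := wh / (3 * Nc.+1%:R).
(** The left end of slot c of window w. A window has Nc.+1 slots of three steps [wd]; the ramp [ws]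
    rises in the middle third, where the bump [wb] of the slot equals 1. *)
Definition wa (w c : nat) : R := (2 * w%:R - 1) * wh + 3 * c%:R * wd.
Definition wb w c := trap (wa w c) wd.
Definition ws w c := ramp (wa w c + wd) wd.
Definition wchain (J : nat -> nat) (i : nat) (x : R) : R :=
  if i == 0%N then 1 else if (i <= M)%N then ws i (J i) x else 0.

Lemma wh_gt0 : 0 < wh. Proof. by rewrite invr_gt0 ltr0n addn1. Qed.
Lemma wh_mul : (2 * M%:R + 1) * wh = 1.
Proof. by rewrite -natrM natr1 -addn1 mulfV // pnatr_eq0 addn1. Qed.
Lemma wd_gt0 : 0 < wd.
Proof. by rewrite divr_gt0 ?wh_gt0 // mulr_gt0 ?ltr0n. Qed.
Lemma wd_mul : 3 * Nc.+1%:R * wd = wh.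
Proof. by rewrite /wd mulrC mulfVK // mulf_neq0 // pnatr_eq0. Qed.

Lemma wa_ge w c : (2 * w%:R - 1) * wh <= wa w c.
Proof. by rewrite /wa lerDl; apply: mulr_ge0; [exact: mulr_ge0|exact: ltW wd_gt0]. Qed.
Lemma wa_le w c : (c <= Nc)%N -> wa w c + 3 * wd <= 2 * w%:R * wh.
Proof.
move=> cN; rewrite /wa; have := wd_mul; rewrite -natr1.
have : c%:R <= Nc%:R :> R by rewrite ler_nat.
have := wd_gt0; nra.
Qed.

Lemma ws0 w c x : x <= (2 * w%:R - 1) * wh -> ws w c x = 0.
Proof. by move=> h; apply: ramp0 wd_gt0 _; have := wa_ge w c; have := wd_gt0; lra. Qed.
Lemma ws1 w c x : (c <= Nc)%N -> 2 * w%:R * wh <= x -> ws w c x = 1.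
Proof. by move=> cN h; apply: ramp1 wd_gt0 _; have := wa_le w cN; have := wd_gt0; lra. Qed.
Lemma ws_wb w c x : (ws w c x * ws w c x - ws w c x) * wb w c x = ws w c x * ws w c x - ws w c x.
Proof.
have [h|h] := leP x (wa w c + wd); first by rewrite /ws ramp0 ?wd_gt0 // mulr0 subrr mul0r.
have [h'|h'] := leP (wa w c + 2 * wd) x.
  rewrite /ws ramp1 ?wd_gt0 //; last by lra.
  by rewrite mulr1 subrr mul0r.
by rewrite [wb _ _ _]trap1 ?mulr1 ?wd_gt0 // !ltW.
Qed.
Lemma wb_orth w c c' x : c != c' -> wb w c x * wb w c' x = 0.
Proof.
wlog cc : c c' / (c < c')%N.
  move=> H; rewrite neq_ltn => /orP[h|h]; first by apply: H => //; rewrite ltn_eqF.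
  by rewrite mulrC; apply: H => //; rewrite ltn_eqF.
move=> _; have [h|h] := leP x (wa w c'); first by rewrite [X in _ * X]trapl ?mulr0 ?wd_gt0.
rewrite [X in X * _]trapr ?mul0r ?wd_gt0 //.
have : wa w c + 3 * wd <= wa w c'.
  have : c.+1%:R <= c'%:R :> R by rewrite ler_nat.
  rewrite -natr1 /wa; have := wd_gt0; nra.
lra.
Qed.
Lemma wM w : (w <= M)%N -> w%:R <= M%:R :> R.
Proof. by rewrite ler_nat. Qed.

Section J.
Variable J : nat -> nat.
Hypothesis JN : forall w, (J w <= Nc)%N.

Lemma wchain0 i x : (0 < i)%N -> x <= (2 * i%:R - 1) * wh -> wchain J i x = 0.
Proof. by case: i => // i _ h; rewrite /wchain /=; case: ifP => // _; exact: ws0. Qed.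
Lemma wchain1 i x : (i <= M)%N -> (0 < i)%N -> 2 * i%:R * wh <= x -> wchain J i x = 1.
Proof. by case: i => // i iM _ h; rewrite /wchain /= iM; exact: ws1. Qed.

Lemma wchain_chain : chain M (wchain J).
Proof.
split.
- move=> i; rewrite /wchain; case: (i == 0%N); first by move=> x; exact: cvg_cst.
  by case: (i <= M)%N; [exact: ramp_cont|move=> x; exact: cvg_cst].
- move=> i x; rewrite /wchain; case: ifP => _; first by rewrite ler01 lexx.
  by case: ifP => _; rewrite ?lexx ?ler01 // ramp_ge0 ramp_le1.
- by [].
- by move=> i x; rewrite /wchain; case: i => // i; rewrite ltnNge => /negbTE ->.
- move=> i i0; apply: wchain0 => //.
  have : 1 <= i%:R :> R by rewrite ler1n.
  by have := wh_gt0; nra.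
- move=> i iM; have [->//|i0] := posnP i; apply: wchain1 => //.
  by have := wM iM; have := wh_mul; have := wh_gt0; nra.
- move=> i j x ij; have j0 : (0 < j)%N by exact: leq_ltn_trans ij.
  have [->|i0] := posnP i; first by rewrite {1}/wchain eqxx mul1r.
  have [jM|jM] := leqP j M; last first.
    by rewrite /wchain (gtn_eqF j0) [(j <= M)%N]leqNgt jM mulr0.
  have [h|h] := leP x ((2 * j%:R - 1) * wh); first by rewrite (wchain0 j0 h) mulr0.
  rewrite [wchain J i x]wchain1 ?mul1r //; first exact: leq_trans (ltnW ij) jM.
  have : i.+1%:R <= j%:R :> R by rewrite ler_nat.
  rewrite -natr1; have := wh_gt0; nra.
Qed.

(** k = pi (ws^2 - ws) is unchanged by multiplication by pi (wb), whose norm is at most 1/2; hence k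
    = 0. Asking for a bound rather than for pi (wb) = 0 makes the validity of J an open condition on
    the fibre. *)
Lemma wchain_valid p q N (pi : (R -> 'M[C]_(p * q)) -> 'M[C]_N) : ddrep pi ->
  (forall w, (0 < w <= M)%N -> opb 2^-1 (pi (scalf p q (wb w (J w))))) -> valid M (wchain J) pi.
Proof.
move=> Hpi H i /andP[i0 iM]; rewrite /wchain iM (gtn_eqF i0).
set k := pi _.
have k1 : k = k *m pi (scalf p q (wb i (J i))).
  rewrite /k -(rep_mul Hpi).
  - congr pi; apply/funext => x; rewrite /scalf -scalar_mxM; congr (_%:M).
    by rewrite -rmorphM /= ws_wb.
  - apply: dd_real => x; apply: cvgB; first by apply: cvgM; exact: ramp_cont.
    exact: ramp_cont.
  - by apply: dd_real; exact: trap_cont.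
have u : 1%:M - pi (scalf p q (wb i (J i))) \in unitmx.
  by apply: (opb_lt1_unit _ _ (H i _)); rewrite ?i0 //; lra.
have z : k *m (1%:M - pi (scalf p q (wb i (J i)))) = 0.
  by rewrite mulmxBr mulmx1 -k1 subrr.
by rewrite -[k](mulmxK u) z mul0mx.
Qed.

(** Cell l lies between (2 ph l - 1) wh and 2 ph l.+1 wh, at most 4 wh from the sample point 2 ph l
    wh since ph advances by at most 2. Moving the last sample point to 1 costs no more. Steps of 2
    are allowed for the sake of the even and odd subchains. *)
Lemma wchain_fine M' ph : (0 < M')%N -> ph 0%N = 0%N ->
  (forall i, (i < M')%N -> (ph i < ph i.+1 <= (ph i).+2)%N) ->
  (ph M' <= M)%N -> (M <= (ph M').+1)%N ->
  finech (5 * wh) M' (subc M' ph (wchain J)).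
Proof.
move=> M'0 p0 ps pM pM'.
have ps1 i : (i < M')%N -> (ph i < ph i.+1)%N by move/ps => /andP[].
have le i : (i <= M')%N -> (ph i <= M)%N.
  rewrite leq_eqVlt => /predU1P[->//|h]; apply: leq_trans pM; apply/ltnW/(ph_mono ps1).
  by rewrite h /=.
have h0 := wh_gt0; have h1 := wh_mul.
exists (fun l => if l == M' then 1 else 2 * (ph l)%:R * wh); split.
- by rewrite (ltn_eqF M'0) p0 mulr0 mul0r.
- by rewrite eqxx.
move=> l x lM /segP/andP[x0 x1]; split.
  case: eqP => [_|/eqP lM']; first exact: seg1.
  apply/segP; rewrite !mulr_ge0 ?ler0n ?(ltW h0) //=.
  have := wM (le l lM); nra.
move=> cn.
have lo : (2 * (ph l)%:R - 1) * wh < x.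
  have [l0|l0] := posnP l; first by rewrite l0 p0 mulr0 sub0r; lra.
  rewrite ltNge; apply: contraNN cn => h.
  have pl0 : (0 < ph l)%N by rewrite -p0; apply: (ph_mono ps1); rewrite l0.
  have nest := chain_nest (subc_chain wchain_chain p0 ps1 pM) x (ltnSn l).
  have z : subc M' ph (wchain J) l x = 0 by rewrite /subc lM wchain0.
  by rewrite /cell z -nest z mul0r subrr.
case: eqP => [lM'|/eqP lM'].
  move: lo; rewrite lM' => lo.
  have : M%:R <= (ph M')%:R + 1 :> R by rewrite natr1 ler_nat.
  by rewrite ltr_norml; move=> h; apply/andP; split; nra.
have ltM : (l < M')%N by rewrite ltn_neqAle lM'.
have /andP[a1 a2] := ps l ltM.
have hi : x < 2 * (ph l.+1)%:R * wh.
  rewrite ltNge; apply: contraNN cn => h.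
  have z : subc M' ph (wchain J) l.+1 x = 1 by rewrite /subc ltM wchain1 ?le // (leq_ltn_trans _ a1).
  have nest := chain_nest (subc_chain wchain_chain p0 ps1 pM) x (ltnSn l).
  by rewrite /cell z; rewrite z mulr1 in nest; rewrite nest subrr.
have : (ph l.+1)%:R <= (ph l)%:R + 2 :> R by rewrite -natrD ler_nat addn2.
by rewrite ltr_norml; move=> h; apply/andP; split; nra.
Qed.

End J.

Section Bumps.
Variable B : nat.
Hypothesis B0 : (0 < B)%N.
Definition bd : R := wh / (3 * B%:R).
(** The bumps of cell l sit in gap l, where that cell equals 1 for every choice of slots. Their
    nonvanishing can thus be arranged before J is known. *)
Definition ba (l i : nat) : R := 2 * l%:R * wh + 3 * i%:R * bd.
Definition bmp l i := trap (ba l i) bd.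

Lemma bd_gt0 : 0 < bd.
Proof. by rewrite divr_gt0 ?wh_gt0 // mulr_gt0 ?ltr0n. Qed.
Lemma bd_mul : 3 * B%:R * bd = wh.
Proof. by rewrite /bd mulrC mulfVK // mulf_neq0 // pnatr_eq0 -lt0n. Qed.

Lemma bmp_neq0 l i x : (i < B)%N -> bmp l i x != 0 ->
  2 * l%:R * wh < x < (2 * l%:R + 1) * wh.
Proof.
move=> iB /(trap_neq0 bd_gt0)/andP[h1 h2]; have b0 := bd_gt0; have bm := bd_mul.
have i0 : 0 <= i%:R :> R by [].
have iB' : i.+1%:R <= B%:R :> R by rewrite ler_nat.
rewrite -natr1 in iB'; rewrite /ba in h1 h2; apply/andP; split; nra.
Qed.

Lemma bmp_cell J l i x : (forall w, (J w <= Nc)%N) -> (l <= M)%N -> (i < B)%N ->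
  bmp l i x * cell (wchain J) l x = bmp l i x.
Proof.
move=> JN lM iB; have [->|/(bmp_neq0 iB)/andP[h1 h2]] := eqVneq (bmp l i x) 0; first by rewrite mul0r.
have h0 := wh_gt0.
have -> : cell (wchain J) l x = 1; last by rewrite mulr1.
rewrite /cell; have -> : wchain J l x = 1.
  by have [->//|l0] := posnP l; apply: wchain1 => //; exact: ltW.
rewrite wchain0 ?subr0 //; rewrite -natr1; nra.
Qed.

Lemma bmp_orth l i i' x : i != i' -> bmp l i x * bmp l i' x = 0.
Proof.
wlog ii : i i' / (i < i')%N.
  move=> H; rewrite neq_ltn => /orP[h|h]; first by apply: H => //; rewrite ltn_eqF.
  by rewrite mulrC; apply: H => //; rewrite ltn_eqF.
move=> _; have [h|h] := leP x (ba l i'); first by rewrite [X in _ * X]trapl ?mulr0 ?bd_gt0.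
rewrite [X in X * _]trapr ?mul0r ?bd_gt0 //.
have : ba l i + 3 * bd <= ba l i'.
  have : i.+1%:R <= i'%:R :> R by rewrite ler_nat.
  rewrite -natr1 /ba; have := bd_gt0; nra.
lra.
Qed.

Lemma bmp_at0 l i : (i < B)%N -> bmp l i 0 = 0.
Proof.
move=> iB; apply/eqP; apply: contraT => /(bmp_neq0 iB)/andP[h1 h2].
by have : 0 <= l%:R :> R by []; have := wh_gt0; nra.
Qed.
Lemma bmp_at1 l i : (l <= M)%N -> (i < B)%N -> bmp l i 1 = 0.
Proof.
move=> lM iB; apply/eqP; apply: contraT => /(bmp_neq0 iB)/andP[h1 h2].
by have := wM lM; have := wh_gt0; have := wh_mul; nra.
Qed.
Lemma bmp_peak l i : (l <= M)%N -> (i < B)%N -> exists2 x, seg x & bmp l i x = 1.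
Proof.
move=> lM iB; have b0 := bd_gt0; exists (ba l i + bd); last first.
  by apply: trap1 => //; apply/andP; split; lra.
have h : bmp l i (ba l i + bd) != 0.
  by rewrite /bmp trap1 ?oner_eq0 //; apply/andP; split; lra.
have /andP[h1 h2] := bmp_neq0 iB h.
apply/segP; apply/andP; split; apply: ltW.
  by have : 0 <= l%:R :> R by []; have := wh_gt0; nra.
by have := wM lM; have := wh_gt0; have := wh_mul; nra.
Qed.
End Bumps.
End Windows.

(** * Approximate solutions and perturbation *)

Section RelG.
Context {R : realType}.
Local Notation C := R[i].
Variables (K N nF : nat).

Record relG (e : R) (A : 'I_nF -> 'M[C]_N) (x : 'I_K * 'I_K.+1 -> 'M[C]_N) : Prop := RelG {
  rel_orth : forall j j' i i', j != j' -> opb e (hadj (x (j, i)) *m x (j', i'));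
  rel_same : forall j j' i i',
    opb e (hadj (x (j, i)) *m x (j, i') - hadj (x (j', i)) *m x (j', i'));
  rel_sum : forall j, opb e (\sum_i hadj (x (j, i)) *m x (j, i) - 1%:M);
  rel_bd : forall ji, opb 2 (x ji);
  rel_com : forall ji k, opb e (x ji *m A k - A k *m x ji) }.

Lemma sol_opb1 (m : 'I_K * 'I_K.+1 -> 'M[C]_N) ji : sol m -> opb 1 (m ji).
Proof.
case: ji => j i [_ _ h] v; rewrite expr1n mul1r.
suff -> : nv v = \sum_i nv (m (j, i) *m v).
  by rewrite (bigD1 i) //= lerDl; apply: sumr_ge0 => k _; exact: nv_ge0.
apply: complexI.
have E (u : 'cV[C]_N) : (nv u)%:C = (hadj u *m u) ord0 ord0 by rewrite nvE mxE eqxx mulr1n.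
rewrite E [in RHS]rmorph_sum /=.
under eq_bigr do rewrite E hadjM mulmxA -(mulmxA (hadj v)).
rewrite -summxE -mulmx_suml -mulmx_sumr h mulmx1 //.
Qed.

Lemma comm_shift (x f g : 'M[C]_N) : x *m g = g *m x ->
  x *m f - f *m x = x *m (f - g) - (f - g) *m x.
Proof. by move=> h; rewrite mulmxBr mulmxBl h opprB addrA subrK. Qed.

(** Exact solutions have norm at most 1 and their perturbations at most 2, so a product of two moves
    by at most 2 eta + eta. *)
Lemma relG_pert (e c a eta : R) (A : 'I_nF -> 'M[C]_N) (x y : 'I_K * 'I_K.+1 -> 'M[C]_N) :
  sol y -> 0 <= c -> (forall ji k, opb c (y ji *m A k - A k *m y ji)) ->
  0 <= a -> (forall k, opb a (A k)) -> 0 <= eta -> eta <= 1 ->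
  (forall ji, opb eta (x ji - y ji)) -> 6 * eta <= e -> 3 * K.+1%:R * eta <= e ->
  c + 2 * a * eta <= e -> relG e A x.
Proof.
move=> sy c0 yA a0 Aa t0 t1 xy e6 eK ec.
have [y1 y2 y3] := sy; have yb ji := sol_opb1 ji sy.
have xb ji : opb 2 (x ji).
  rewrite -(subrK (y ji) (x ji)).
  by apply: (@opb_le _ _ _ (eta + 1)); [lra|lra|exact: opbD].
have D ji ji' : opb (3 * eta) (hadj (x ji) *m x ji' - hadj (y ji) *m y ji').
  have -> : hadj (x ji) *m x ji' - hadj (y ji) *m y ji' =
    hadj (x ji - y ji) *m x ji' + hadj (y ji) *m (x ji' - y ji') by rewrite hadjB; ncmx.
  have -> : 3 * eta = eta * 2 + 1 * eta by ring.
  apply: opbD; [lra|lra| |]; apply: opbM => //; exact: opb_adj.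
split.
- move=> j j' i i' jj; apply: (@opb_le _ _ _ (3 * eta)); [lra|lra|].
  by have := D (j, i) (j', i'); rewrite (y1 _ _ _ _ jj) subr0.
- move=> j j' i i'; apply: (@opb_le _ _ _ (3 * eta + 3 * eta)); [lra|lra|].
  have := opbB _ _ (D (j, i) (j, i')) (D (j', i) (j', i')).
  rewrite (y2 j j') opprB addrA subrK; apply; lra.
- move=> j; apply: (@opb_le _ _ _ (\sum_(i < K.+1) 3 * eta)).
  + by apply: sumr_ge0 => i _; lra.
  + by rewrite sumr_const card_ord -mulr_natl; lra.
  rewrite -(y3 j) -sumrB; apply: opb_sum => i; first by lra.
  exact: D.
- exact: xb.
- move=> ji k; have at0 := mulr_ge0 a0 t0; apply: opb_le ec _; first by lra.
  have -> : x ji *m A k - A k *m x ji = (y ji *m A k - A k *m y ji) +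
    ((x ji - y ji) *m A k - A k *m (x ji - y ji)) by ncmx.
  apply: opbD => //; first by lra.
  have -> : 2 * a * eta = eta * a + a * eta by ring.
  have h := mulr_ge0 t0 a0.
  by apply: opbB; [exact: h|by rewrite mulrC|exact: opbM|exact: opbM].
Qed.

Lemma opb_ex m n (A : 'M[C]_(m, n)) : exists2 a, 0 <= a & opb a A.
Proof.
pose s : R := \sum_i \sum_j normc (A i j).
have s0 : 0 <= s by apply: sumr_ge0 => i _; apply: sumr_ge0 => j _; exact: normc_ge0.
exists (m.+1%:R * n%:R * s); first by rewrite !mulr_ge0.
apply: entry_opb => // i j; rewrite /s (bigD1 i) //= (bigD1 j) //= -addrA lerDl addr_ge0 //.
  by apply: sumr_ge0 => k _; exact: normc_ge0.
by apply: sumr_ge0 => k _; apply: sumr_ge0 => l _; exact: normc_ge0.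
Qed.

Lemma fin_delta (T : finType) (c : R) (Q : T -> R -> Prop) :
  (forall i, exists2 d, 0 < d & forall t, seg t -> `|t - c| < d -> Q i t) ->
  exists2 d, 0 < d & forall t, seg t -> `|t - c| < d -> forall i, Q i t.
Proof.
move=> H; have H' i : exists d, 0 < d /\ forall t, seg t -> `|t - c| < d -> Q i t.
  by have [d d0 h] := H i; exists d.
have [d dP] := choice H'.
exists (\big[Num.min/1]_i d i).
  by apply/bigmin_gtP; split => // i _; have [] := dP i.
by move=> t st /bigmin_gtP[_ tc] i; have [_ h] := dP i; apply: h => //; exact: tc.
Qed.
End RelG.

(** * Joining exact solutions inside one fibre *)

Section Join.
Context {R : realType}.
Local Notation C := R[i].
Variables (p q K L : nat).
Hypotheses (p0 : (0 < p)%N) (q0 : (0 < q)%N) (K0 : (0 < K)%N) (L0 : (0 < L)%N).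
Let M := L.*2.
Let M0 : (0 < M)%N. Proof. by rewrite /M double_gt0. Qed.

Definition bmpf (l : 'I_M.+1) (i : 'I_(K * K)) (x : R) : 'M[C]_(p * q) :=
  (bmp M (K * K) l i x)%:C *: iota_ (delta_mx (Ordinal (bdim_gt0 p0 q0 (chain_kind M l)))
     (Ordinal (bdim_gt0 p0 q0 (chain_kind M l)))).

(** The two halves of a window chain, with indices 0, 2, 4, ... here and 0, 1, 3, ... in [oddc]:
    both keep the constant member 0, and both advance by at most 2. *)
Definition evenc Nc (J : nat -> nat) := subc L double (@wchain R M Nc J).
Definition oddc Nc (J : nat -> nat) := subc L (fun i => i.*2.-1) (@wchain R M Nc J).

Let even_inc i : (i < L)%N -> (i.*2 < i.+1.*2 <= i.*2.+2)%N.
Proof. by move=> _; lia. Qed.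
Let odd_inc i : (i < L)%N -> (i.*2.-1 < i.+1.*2.-1 <= i.*2.-1.+2)%N.
Proof. by move=> _; lia. Qed.

Lemma KK0 : (0 < K * K)%N. Proof. by rewrite muln_gt0 K0. Qed.

Section Fixed.
Variables (N Nc : nat) (pi : (R -> 'M[C]_(p * q)) -> 'M[C]_N).
Hypothesis Hpi : ddrep pi.
Hypothesis NNc : (N <= Nc)%N.

(** What remains true along a path between solutions with different cuts: commutation with one half
    of the cuts of some J. By [comEO_approx] this is enough for approximate commutation. *)
Definition comEO (x : 'I_K * 'I_K.+1 -> 'M[C]_N) : Prop :=
  exists2 J, forall w, (J w <= Nc)%N &
  (forall ji, com L (evenc Nc J) pi (x ji)) \/ (forall ji, com L (oddc Nc J) pi (x ji)).

Definition sols (x : 'I_K * 'I_K.+1 -> 'M[C]_N) : Prop :=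
  sol x /\ exists J, [/\ forall w, (J w <= Nc)%N, valid M (wchain M Nc J) pi &
    forall ji, com M (wchain M Nc J) pi (x ji)].

Lemma sols_comEO x : sols x -> comEO x.
Proof.
move=> [_ [J [JN Jv cx]]]; exists J => //; left => ji.
by apply: com_subc (cx ji) => // i /even_inc/andP[].
Qed.

Lemma hadj_scalf (h : R -> R) x : hadj (scalf p q h x) = scalf p q h x.
Proof. by rewrite /scalf -(scalemx1 _ (h x)%:C) hadjZ hadj1 /= oppr0. Qed.

(** In each window the Nc.+1 bumps are orthogonal and the fibre has dimension N <= Nc, so the
    representation kills one of them. *)
Lemma candidate : exists J, (forall w, (J w <= Nc)%N) /\
  forall w, (0 < w <= M)%N -> pi (scalf p q (wb M Nc w (J w))) = 0.
Proof.
have H w : exists c, (c <= Nc)%N /\ ((0 < w <= M)%N -> pi (scalf p q (wb M Nc w c)) = 0).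
  have [wM|] := boolP (0 < w <= M)%N; last by exists 0%N.
  apply: contrapT => nE.
  have db i : dimension_drop (scalf p q (@wb R M Nc w i)) by apply: dd_real; exact: trap_cont.
  have : (Nc.+1 <= N)%N.
    apply: (@sa_orth_le _ _ _ (fun i => pi (scalf p q (wb M Nc w i)))).
    - move=> i; apply/eqP => z; apply: nE; exists i; split => //.
      by rewrite -ltnS.
    - move=> i; rewrite -(rep_adj Hpi) //; congr pi; apply/funext => x.
      exact: hadj_scalf.
    - move=> i j ij; rewrite -(rep_mul Hpi) // -(rep_zero Hpi); congr pi; apply/funext => x.
      by rewrite /scalf -scalar_mxM -rmorphM /= wb_orth ?raddf0.
  by rewrite ltnNge NNc.
have [J JP] := choice H; exists J; split => w; by have [] := JP w.
Qed.

Lemma cand_valid J : (forall w, (J w <= Nc)%N) ->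
  (forall w, (0 < w <= M)%N -> pi (scalf p q (wb M Nc w (J w))) = 0) ->
  valid M (wchain M Nc J) pi.
Proof.
move=> JN H; apply: wchain_valid => // w wM; rewrite H //; exact: opb0.
Qed.

Hypothesis Hfull : forall l i, pi (bmpf l i) != 0.

Lemma full_exists J : (forall w, (J w <= Nc)%N) -> valid M (wchain M Nc J) pi ->
  exists m : 'I_K * 'I_K.+1 -> 'M[C]_N, sol m /\ forall ji, com M (wchain M Nc J) pi (m ji).
Proof.
move=> JN Jv.
have lM (l : 'I_M.+1) : (l <= M)%N by rewrite -ltnS.
apply: (@com_exists _ _ _ _ p0 q0 _ M0 _ (@wchain_chain R M _ _ JN) _ Hpi _
   (fun l i => bmp M (K * K) l i)) => //.
- by move=> l i; exact: trap_cont.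
- by move=> l i; exact: (bmp_at0 M KK0).
- by move=> l i; apply: (bmp_at1 (M := M) KK0).
- by move=> l i x; apply: (bmp_cell KK0).
- by move=> l i i' x ii; exact: (bmp_orth M KK0).
Qed.

(** Cuts of J and of J' in the same window cannot be combined into one chain. Instead [J2] takes the
    even windows from J and the odd ones from J'. A solution m for [J2] shares the even chain with s
    and the odd chain with s', so it is joined to each of them inside the commutant of a single
    chain. *)
Lemma sols_conn s s' : sols s -> sols s' -> pconn (fun x => sol x /\ comEO x) s s'.
Proof.
move=> [ss [J [JN Jv cs]]] [ss' [J' [JN' Jv' cs']]].
pose J2 w := if odd w then J' w else J w.
have J2N w : (J2 w <= Nc)%N by rewrite /J2; case: ifP.
have ev : evenc Nc J2 = evenc Nc J.
  apply/funext => i; apply/funext => x; rewrite /evenc /subc /wchain /J2.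
  by rewrite odd_double.
have od : oddc Nc J2 = oddc Nc J'.
  apply/funext => i; apply/funext => x; rewrite /oddc /subc /wchain /J2.
  case: i => [|i] //; have -> : i.+1.*2.-1 = i.*2.+1 by [].
  by rewrite /= odd_double.
have J2v : valid M (wchain M Nc J2) pi.
  move=> w wM; case/andP: (wM) => w0 _.
  rewrite /wchain /J2; case: ifP => _; last exact: Jv.
  exact: Jv'.
have [m [sm cm]] := full_exists J2N J2v.
have cE (J1 : nat -> nat) (x : 'I_K * 'I_K.+1 -> 'M[C]_N) : (forall ji, com M (wchain M Nc J1) pi (x ji)) ->
    forall ji, com L (evenc Nc J1) pi (x ji).
  by move=> cx ji; apply: com_subc (cx ji) => // i /even_inc/andP[].
have oL : (L.*2.-1 <= M)%N by rewrite /M leq_pred.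
have cO (J1 : nat -> nat) (x : 'I_K * 'I_K.+1 -> 'M[C]_N) : (forall ji, com M (wchain M Nc J1) pi (x ji)) ->
    forall ji, com L (oddc Nc J1) pi (x ji).
  by move=> cx ji; apply: com_subc (cx ji) => // i /odd_inc/andP[].
have evc : chain L (evenc Nc J).
  by rewrite /evenc; apply: (subc_chain (@wchain_chain R M _ _ JN)) => // i /even_inc/andP[].
have odc : chain L (oddc Nc J').
  by rewrite /oddc; apply: (subc_chain (@wchain_chain R M _ _ JN')) => // i /odd_inc/andP[].
apply: (@pconn_trans _ _ _ _ _ _ m).
- apply: (pconn_sub (S := fun x => sol x /\ forall ji, com L (evenc Nc J) pi (x ji))).
    by move=> x [sx cx]; split => //; exists J => //; left.
  apply: (com_conn p0 q0 L0 evc Hpi K0) => //; [|exact: cE|by rewrite -ev; exact: cE].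
  by apply: (@valid_subc R p q N M L double (wchain M Nc J) pi) => // i /even_inc/andP[].
- apply: (pconn_sub (S := fun x => sol x /\ forall ji, com L (oddc Nc J') pi (x ji))).
    by move=> x [sx cx]; split => //; exists J' => //; right.
  apply: (com_conn p0 q0 L0 odc Hpi K0) => //; [|by rewrite -od; exact: cO|exact: cO].
  by apply: (@valid_subc R p q N M L (fun i => i.*2.-1) (wchain M Nc J') pi) => // i /odd_inc/andP[].
Qed.

(** f is within e of an adapted function, with which x commutes exactly; [rep_opb] doubles this
    error and the commutator doubles it again. *)
Lemma comEO_approx x (f : R -> 'M[C]_(p * q)) e1 e : sol x -> comEO x -> dimension_drop f ->
  0 <= e1 -> (p * q).+1%:R * (p * q)%:R * e1 <= e -> 0 < e ->
  (forall x y, seg x -> seg y -> `|x - y| < 5 * wh M -> forall i j, normc ((f x - f y) i j) <= e1) ->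
  forall ji, opb (4 * e) (x ji *m pi f - pi f *m x ji).
Proof.
move=> sx [J JN cJ] df e10 e1e e0 fu ji.
have [sg [sgc sgf sgcom]] : exists sg, [/\ chain L sg, finech (5 * wh M) L sg & com L sg pi (x ji)].
  case: cJ => cJ; [exists (evenc Nc J)|exists (oddc Nc J)]; split => //.
  - by rewrite /evenc; apply: (subc_chain (@wchain_chain R M _ _ JN)) => // i /even_inc/andP[].
  - by apply: wchain_fine.
  - rewrite /oddc; apply: (subc_chain (@wchain_chain R M _ _ JN)) => // [i /odd_inc/andP[]//|].
    by rewrite /M leq_pred.
  - apply: wchain_fine => //; first by rewrite /M leq_pred.
    by rewrite /M; lia.
have [X [Xa XE]] := finech_approx L0 sgc sgf df e10 fu.
have da := adapted_dd sgc Xa.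
have ob : opb (2 * e) (pi (fun t => f t - adapted L sg X t)).
  apply: rep_opb => //; first exact: dd_sub.
  move=> t st; apply: opb_le e1e (entry_opb e10 (XE t st)).
  by rewrite !mulr_ge0.
have -> : x ji *m pi f - pi f *m x ji =
    x ji *m pi (fun t => f t - adapted L sg X t) - pi (fun t => f t - adapted L sg X t) *m x ji.
  rewrite (rep_sub Hpi df da); exact: comm_shift (sgcom X Xa).
have -> : 4 * e = 1 * (2 * e) + (2 * e) * 1 by ring.
by apply: opbB; [lra|lra|apply: opbM; [exact: sol_opb1|by []]|apply: opbM; [by []|exact: sol_opb1]].
Qed.
End Fixed.
End Join.

Section Conj.
Context {R : realType}.
Local Notation C := R[i].

Lemma sol_conj K N (U : 'M[C]_N) (s : 'I_K * 'I_K.+1 -> 'M[C]_N) :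
  hadj U *m U = 1%:M -> U *m hadj U = 1%:M -> sol s ->
  sol (fun ji => U *m s ji *m hadj U).
Proof.
move=> U1 U2 [h1 h2 h3].
have E ji ji' : hadj (U *m s ji *m hadj U) *m (U *m s ji' *m hadj U) =
    U *m (hadj (s ji) *m s ji') *m hadj U.
  by rewrite !hadjM hadjK !mulmxA -(mulmxA _ (hadj U) U) U1 mulmx1.
split.
- by move=> j j' i i' jj; rewrite E h1 // mulmx0 mul0mx.
- move=> j j' i i' /=; have := congr1 (fun X => U *m X *m hadj U) (h2 j j' i i').
  by move=> h; etransitivity; [exact: E|]; etransitivity; [exact: h|]; symmetry; exact: E.
- by move=> j; under eq_bigr do rewrite E; rewrite -mulmx_suml -mulmx_sumr h3 mulmx1.
Qed.
Lemma subBB (V : zmodType) (x y z : V) : x - y = (x - z) - (y - z).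
Proof. by rewrite opprB addrA subrK. Qed.

Lemma pert_arith (e a eta k : R) : 0 < e -> 0 <= a -> eta <= e -> k * eta <= e ->
  2 * (a + 1) * eta <= e ->
  [/\ 0 <= 5 * e, 0 <= a + 1, 6 * eta <= 6 * e, 3 * k * eta <= 6 * e &
    5 * e + 2 * (a + 1) * eta <= 6 * e] /\ 5 * e = 4 * e + 2 * (e / 2).
Proof. by move=> *; split; [split|]; lra. Qed.

Lemma segment_split N (X Y : 'M[C]_N) (r : R) :
  (1 - r)%:C *: X + r%:C *: Y - X = r%:C *: (Y - X).
Proof.
rewrite rmorphB scalerBl scale1r scalerBr addrAC [X - _]addrC addrK addrC //.
Qed.

Lemma comm_split N (X A B : 'M[C]_N) :
  X *m B - B *m X = (X *m A - A *m X) + (X *m (B - A) - (B - A) *m X).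
Proof. by ncmx. Qed.

Lemma conj_split N (X U : 'M[C]_N) :
  U *m X *m hadj U - X = (U - 1%:M) *m X *m hadj U + X *m hadj (U - 1%:M).
Proof. by rewrite hadjB hadj1; ncmx. Qed.
Lemma opb_comm N (X A B : 'M[C]_N) (c d : R) : 0 <= c -> 0 <= d -> opb 1 X ->
  opb c (X *m A - A *m X) -> opb d (B - A) -> opb (c + 2 * d) (X *m B - B *m X).
Proof.
move=> c0 d0 X1 XA BA; rewrite (comm_split _ A).
have -> : 2 * d = 1 * d + d * 1 by ring.
apply: opbD => //; first by lra.
by apply: opbB; [lra|lra|exact: opbM|exact: opbM].
Qed.

Lemma opb_conj N (X U : 'M[C]_N) (d : R) : 0 <= d -> opb 1 X -> isom U ->
  opb (d / 2) (U - 1%:M) -> opb d (U *m X *m hadj U - X).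
Proof.
move=> d0 X1 iU Ub; rewrite conj_split.
have u1 : opb 1 (hadj U) by apply: opb_adj => //; exact: opb_isom.
have -> : d = d / 2 * 1 * 1 + 1 * (d / 2) by lra.
have e2 : 0 <= d / 2 by lra.
apply: opbD; [lra|lra|apply: opbM => //; exact: opbM|].
apply: opbM; [exact: X1|apply: opb_adj; [exact: e2|exact: Ub]].
Qed.

Lemma opb_half m n (A B : 'M[C]_(m, n)) (d : R) : 0 <= d ->
  opb (d / 2) A -> opb (d / 2) B -> opb d (A - B).
Proof.
move=> d0 hA hB; have -> : d = d / 2 + d / 2 by lra.
have e2 : 0 <= d / 2 by lra.
exact: opbB.
Qed.
End Conj.

(** * From solutions in the fibres to a continuous family *)

Section Family.
Context {R : realType}.
Local Notation C := R[i].
Variables (p q P Q K L nF : nat).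
Hypotheses (p0 : (0 < p)%N) (q0 : (0 < q)%N) (K0 : (0 < K)%N) (L0 : (0 < L)%N).
Hypotheses (P0 : (0 < P)%N) (Q0 : (0 < Q)%N).
Variable pi : R -> (R -> 'M[C]_(p * q)) -> 'M[C]_(P * Q).
Hypothesis Hrep : forall t, seg t -> ddrep (pi t).
Hypothesis Hdd : forall f, dimension_drop f ->
  exists2 g : R -> 'M[C]_(P * Q), dimension_drop g & forall t, seg t -> pi t f = g t.
Hypothesis Hfull : forall t, seg t -> forall (l : 'I_(L.*2.+1)) (i : 'I_(K * K)),
  pi t (bmpf p0 q0 l i) != 0.
Variables (F : 'I_nF -> R -> 'M[C]_(p * q)) (e e1 : R).
Hypothesis dF : forall k, dimension_drop (F k).
Hypotheses (e10 : 0 <= e1) (e1e : (p * q).+1%:R * (p * q)%:R * e1 <= e) (e0 : 0 < e).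
Hypothesis Fu : forall k x y, seg x -> seg y -> `|x - y| < 5 * wh L.*2 ->
  forall i j, normc ((F k x - F k y) i j) <= e1.

Let M := L.*2.
Let Nc := (P * Q)%N.
Let M0 : (0 < M)%N. Proof. by rewrite /M double_gt0. Qed.

Lemma rep_cont f c d : dimension_drop f -> seg c -> 0 < d -> exists2 del, 0 < del &
  forall t, seg t -> `|t - c| < del -> opb d (pi t f - pi c f).
Proof.
move=> df sc d0; have [g /dimdropP[/mcont01P gc _ _] gE] := Hdd df.
have D0 : 0 < (P * Q).+1%:R * (P * Q)%:R + 1 :> R by rewrite ltr_wpDl ?mulr_ge0.
have [del del0 H] := gc c sc _ (divr_gt0 d0 D0).
exists del => // t st tc; rewrite !gE //.
have h0 : 0 <= d / ((P * Q).+1%:R * (P * Q)%:R + 1) by rewrite divr_ge0 // ltW.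
apply: opb_le (entry_opb h0 _); first by apply: mulr_ge0 => //; exact: mulr_ge0.
  by rewrite mulrCA ger_pMr // ler_pdivrMr // mul1r; lra.
by move=> i j; apply: ltW; exact: H.
Qed.

Lemma rel_exact t (x : 'I_K * 'I_K.+1 -> 'M[C]_(P * Q)) : seg t -> sol x -> comEO L Nc (pi t) x ->
  relG (6 * e) (fun k => pi t (F k)) x.
Proof.
move=> st sx cx; have E0 := e0.
have [a a0 aP] : exists2 a : R, 0 <= a & forall k, opb a (pi t (F k)).
  have /choice[a aP] (k : 'I_nF) : exists a : R, 0 <= a /\ opb a (pi t (F k)).
    by have [a a0 aP] := opb_ex (pi t (F k)); exists a.
  exists (\sum_k a k); first by apply: sumr_ge0 => k _; have [] := aP k.
  move=> k; have [h1 h2] := aP k; apply: opb_le h2 => //.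
  by rewrite (bigD1 k) //= lerDl; apply: sumr_ge0 => i _; have [] := aP i.
apply: (@relG_pert _ _ _ _ (6 * e) (4 * e) a 0 _ x x) => //; try lra.
- by move=> ji k; apply: (comEO_approx p0 q0 K0 L0 (Hrep st) (leqnn Nc) sx cx (dF k) e10 e1e e0 (Fu k)).
- by move=> ji; rewrite subrr; exact: opb0.
Qed.

Lemma sols_exist t : seg t -> exists s : 'I_K * 'I_K.+1 -> 'M[C]_(P * Q), sols L Nc (pi t) s.
Proof.
move=> st; have [J [JN JP]] := candidate L (Hrep st) (leqnn Nc).
have Jv := cand_valid (Hrep st) JN JP.
have [m [sm cm]] := full_exists K0 L0 (Hrep st) (Hfull st) JN Jv.
by exists m; split => //; exists J.
Qed.

(** A cut chosen at c stays valid nearby, because the killed bumps keep norm at most 1/2. Using it,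
    s is joined to an exact solution s1 in the fibre t; s1 to its conjugate s2 by a unitary near 1
    that carries the system of t to that of t'; and s2 to s' in the fibre t'. Each point of the path
    satisfies the relations at every y near c, so the path may be run while the fibre changes. *)
Lemma local_conn c : seg c -> exists2 del, 0 < del & forall t t' (s s' : 'I_K * 'I_K.+1 -> 'M[C]_(P * Q)), seg t -> seg t' ->
  `|t - c| < del -> `|t' - c| < del -> sols L Nc (pi t) s -> sols L Nc (pi t') s' ->
  pconn (fun x => forall y, seg y -> `|y - c| < del -> relG (6 * e) (fun k => pi y (F k)) x) s s'.
Proof.
move=> sc; have E0 := e0; have [J [JN JP]] := candidate L (Hrep sc) (leqnn Nc).
pose sg := @wchain R M Nc J.
have sgc : chain M sg by exact: wchain_chain.
have h2 : 0 < 2^-1 :> R by rewrite invr_gt0.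
have [d1 d10 H1] : exists2 d, 0 < d & forall t, seg t -> `|t - c| < d -> valid M sg (pi t).
  have [|d d0 H] := @fin_delta R 'I_M c (fun w t => opb 2^-1 (pi t (scalf p q (wb M Nc w.+1 (J w.+1))))).
    move=> w; have db : dimension_drop (scalf p q (@wb R M Nc w.+1 (J w.+1))).
      by apply: dd_real; exact: trap_cont.
    have [d d0 h] := rep_cont db sc h2; exists d => // t st tc.
    by have := h t st tc; rewrite JP ?subr0 //= ltn_ord.
  exists d => // t st tc; apply: (@wchain_valid R M Nc J _ _ _ _ (Hrep st)) => -[|w] //= wM.
  exact: (H t st tc (Ordinal wM)).
have [a a0 aP] : exists2 a : R, 0 <= a & forall k, opb a (pi c (F k)).
  have /choice[a aP] (k : 'I_nF) : exists a : R, 0 <= a /\ opb a (pi c (F k)).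
    by have [a a0 aP] := opb_ex (pi c (F k)); exists a.
  exists (\sum_k a k); first by apply: sumr_ge0 => k _; have [] := aP k.
  move=> k; have [h1 h3] := aP k; apply: opb_le h3 => //.
  by rewrite (bigD1 k) //= lerDl; apply: sumr_ge0 => i _; have [] := aP i.
have m0 : 0 < Num.min 1 (e / 4) by rewrite lt_min ltr01 divr_gt0.
have [d2 d20 H2] : exists2 d, 0 < d & forall t, seg t -> `|t - c| < d ->
    forall k, opb (Num.min 1 (e / 4)) (pi t (F k) - pi c (F k)).
  by apply: fin_delta => k; exact: rep_cont.
(* One bound is for the commutators with operators of norm at most a + 1, the other for the sums
   over K.+1 indices in [relG_pert]. *)
pose eta := Num.min 1 (Num.min (e / (2 * (a + 1))) (e / K.+1%:R)).
have a10 : 0 < 2 * (a + 1) by lra.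
have eta0 : 0 < eta by rewrite !lt_min ltr01 !divr_gt0.
have eta1 : eta <= 1 by rewrite ge_min lexx.
have etaa : 2 * (a + 1) * eta <= e.
  by rewrite mulrC -ler_pdivlMr // /eta !ge_min lexx orbT.
have etaK : K.+1%:R * eta <= e.
  by rewrite mulrC -ler_pdivlMr // /eta !ge_min lexx !orbT.
have etae : eta <= e.
  by apply: le_trans etaK; rewrite ler_peMl ?(ltW eta0) // ler1n.
clearbody eta.
have eta20 : 0 < eta / 2 by rewrite divr_gt0.
have [z z0 Hz] := @sys_close R M.+1 (P * Q) (fun l => bdim p q (chain_kind M l))
  (fun l => Ordinal (bdim_gt0 p0 q0 (chain_kind M l))) _ eta20.
have z20 : 0 < z / 2 by rewrite divr_gt0.
pose fm (l : 'I_M.+1) (x y : 'I_(bdim p q (chain_kind M l))) := @cellf R p q M sg l (delta_mx x y).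
have [d3 d30 H3] : exists2 d, 0 < d & forall t, seg t -> `|t - c| < d ->
    forall l x y, opb (z / 2) (pi t (@fm l x y) - pi c (fm l x y)).
  apply: fin_delta => l; apply: fin_delta => x; apply: fin_delta => y.
  by apply: rep_cont => //; apply: cellf_dd => //; rewrite -ltnS.
exists (Num.min d1 (Num.min d2 d3)); first by rewrite !lt_min d10 d20.
move=> t t' s s' st st'; rewrite !lt_min => /and3P[t1 t2 t3] /and3P[t'1 t'2 t'3] Ss Ss'.
have near y y' : seg y -> seg y' -> `|y - c| < d2 -> `|y' - c| < d2 -> forall k,
    opb (e / 2) (pi y (F k) - pi y' (F k)).
  move=> sy sy' yc y'c k.
  rewrite (subBB _ _ (pi c (F k))).
  have le4 : Num.min 1 (e / 4) <= e / 2 / 2 by rewrite -mulrA -invfM -natrM ge_min lexx orbT.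
  by apply: opb_half; [by rewrite divr_ge0 // ltW| |];
    (apply: (@opb_le _ _ _ (Num.min 1 (e / 4))); [exact: ltW|exact: le4|exact: H2]).
have oa y : seg y -> `|y - c| < d2 -> forall k, opb (a + 1) (pi y (F k)).
  move=> sy yc k; rewrite -(subrK (pi c (F k)) (pi y (F k))) addrC.
  apply: opbD => //; have := H2 y sy yc k; apply: opb_le; [exact: ltW|].
  by rewrite ge_min lexx.
have [[ar1 ar2 ar3 ar4 ar5] ar6] := pert_arith E0 a0 etae etaK etaa.
have e4_ge0 : 0 <= 4 * e by rewrite mulr_ge0 // ltW.
have e2_ge0 : 0 <= e / 2 by rewrite divr_ge0 // ltW.
have moved y y' (x x' : 'I_K * 'I_K.+1 -> 'M[C]_(P * Q)) : seg y -> seg y' -> `|y - c| < d2 -> `|y' - c| < d2 ->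
    sol x -> comEO L Nc (pi y) x -> (forall ji, opb eta (x' ji - x ji)) ->
    relG (6 * e) (fun k => pi y' (F k)) x'.
  move=> sy sy' yc y'c sx cx xx'.
  apply: (@relG_pert _ _ _ _ (6 * e) (5 * e) (a + 1) eta _ x' x sx _ _ _ _ (ltW eta0) eta1 xx') => //.
  - move=> ji k; have hk := comEO_approx p0 q0 K0 L0 (Hrep sy) (leqnn Nc) sx cx (dF k) e10 e1e e0 (@Fu k) ji.
    rewrite ar6.
    by apply: (opb_comm e4_ge0 e2_ge0 (sol_opb1 ji sx) hk); exact: near.
  - exact: oa.
have [s1 [ss1 cs1]] := full_exists K0 L0 (Hrep st) (Hfull st) JN (H1 t st t1).
have Ss1 : sols L Nc (pi t) s1.
  by split => //; exists J; split => //; exact: H1.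
have sys1 := rho_system M0 sgc (Hrep st) (H1 t st t1).
have sys2 := rho_system M0 sgc (Hrep st') (H1 t' st' t'1).
have [l x y|U [U1 U2 Ub Uc]] := Hz _ _ sys1 sys2 _.
  rewrite /rho -/(fm l x y) (subBB _ _ (pi c (fm l x y))).
  by apply: opb_half; [exact: ltW|exact: H3|exact: H3].
pose s2 ji := U *m s1 ji *m hadj U.
have ss2 : sol s2 by exact: sol_conj.
have cs2 ji : com M sg (pi t') (s2 ji).
  apply/(com_commut M0 sgc (Hrep st')) => l B.
  have := (com_commut M0 sgc (Hrep st) (s1 ji)).1 (cs1 ji) l B.
  have E := Uc l B.
  have E2 : rho sg (pi t') B = U *m rho sg (pi t) B *m hadj U by rewrite E -mulmxA U2 mulmx1.
  move=> h; rewrite /s2 E2 !mulmxA -!(mulmxA _ (hadj U) U) U1 !mulmx1 -!(mulmxA U) h.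
  by rewrite !mulmxA.
have Ss2 : sols L Nc (pi t') s2.
  by split => //; exists J; split => //; exact: H1.
have s12 ji : opb eta (s2 ji - s1 ji).
  by apply: opb_conj => //; [exact: ltW|exact: sol_opb1].
apply: (@pconn_trans _ _ _ _ _ _ s1).
  apply: pconn_sub (sols_conn K0 L0 (Hrep st) (Hfull st) Ss Ss1) => x [sx cx] y sy.
  rewrite !lt_min => /and3P[y1 y2 y3]; apply: (moved t y x x st sy t2 y2 sx cx) => ji.
  by rewrite subrr; exact: opb0.
apply: (@pconn_trans _ _ _ _ _ _ s2).
  apply: pconn_segment => r /andP[r0 r1] y sy.
  rewrite !lt_min => /and3P[y1 y2 y3]; apply: (moved t y s1 _ st sy t2 y2 ss1); first exact: sols_comEO.
  move=> ji; rewrite segment_split.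
  have := opbZ r%:C (s12 ji); rewrite normc_real ger0_norm //.
  apply: opb_le; first by rewrite mulr_ge0 // ltW.
  by rewrite ler_piMl // ltW.
apply: pconn_sub (sols_conn K0 L0 (Hrep st') (Hfull st') Ss2 Ss') => x [sx cx] y sy.
rewrite !lt_min => /and3P[y1 y2 y3]; apply: (moved t' y x x st' sy t'2 y2 sx cx) => ji.
by rewrite subrr; exact: opb0.
Qed.

Lemma reach s0 s1 : sols L Nc (pi 0) s0 -> sols L Nc (pi 1) s1 ->
  exists m : R -> 'I_K * 'I_K.+1 -> 'M[C]_(P * Q),
    [/\ forall ji, mcont (fun x => m x ji), m 0 = s0, m 1 = s1 &
      forall x, seg x -> relG (6 * e) (fun k => pi x (F k)) (m x)].
Proof.
move=> S0 S1.
pose Pt t := forall s, sols L Nc (pi t) s -> (t = 0 -> s = s0) ->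
  exists m : R -> 'I_K * 'I_K.+1 -> 'M[C]_(P * Q),
    [/\ forall ji, mcont (fun x => m x ji), m 0 = s0, m t = s &
      forall x, 0 <= x <= t -> relG (6 * e) (fun k => pi x (F k)) (m x)].
suff : Pt 1.
  move=> /(_ s1 S1)[|m [m1 m2 m3 m4]]; first by move/eqP; rewrite oner_eq0.
  by exists m; split => // x /segP; exact: m4.
apply: real_induction.
  move=> s Ss /(_ erefl) ->; exists (fun=> s0); split => //.
    by move=> ji; exact: mcont_cst.
  move=> x /andP[x1 x2]; have -> : x = 0 by apply/eqP; rewrite eq_le x1 x2.
  by apply: rel_exact; [exact: seg0|have [] := S0|exact: sols_comEO].
move=> c sc; have [d d0 Hd] := local_conn sc; exists d => // t t' st st' tc t'c tt' Ht s' Ss' s'0.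
have [tE|tn] := eqVneq t t'; first by move: Ss' s'0; rewrite -tE; exact: Ht.
have lt : t < t' by rewrite lt_neqAle tn.
have t0 : 0 <= t by have /segP/andP[] := st.
have [s [Ss hs0]] : exists s, sols L Nc (pi t) s /\ (t = 0 -> s = s0).
  have [tz|tz] := eqVneq t 0; first by exists s0; split => //; rewrite tz.
  by have [s Ss] := sols_exist st; exists s; split => // z; rewrite z eqxx in tz.
have [m [m1 m2 m3 m4]] := Ht s Ss hs0.
have [g [g1 g2 g3 g4]] := Hd t t' s s' st st' tc t'c Ss Ss'.
have dt : 0 < t' - t by rewrite subr_gt0.
(* Left of t the second term equals s ji, right of t the first one does: the two paths are pasted at
   t. *)
exists (fun x ji => m (Num.min x t) ji + g ((x - t) / (t' - t)) ji - s ji).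
have lo x : x <= t -> (fun ji => m (Num.min x t) ji + g ((x - t) / (t' - t)) ji - s ji) = m x.
  move=> xt; apply/funext => ji; rewrite g2 ?min_l ?addrK //.
  by rewrite ler_pdivrMr // mul0r subr_le0.
have hi x : t <= x -> (fun ji => m (Num.min x t) ji + g ((x - t) / (t' - t)) ji - s ji) =
    g ((x - t) / (t' - t)).
  by move=> tx; apply/funext => ji; rewrite min_r // m3 addrAC subrr add0r.
split.
- move=> ji; apply: mcontB; last exact: mcont_cst.
  apply: mcontD.
    apply: (mcont_comp (m1 ji)) => x; apply: continuous_min; [exact: cvg_id|exact: cvg_cst].
  apply: (mcont_comp (g1 ji)) => x.
  by apply: cvgM; [apply: cvgB; [exact: cvg_id|exact: cvg_cst]|exact: cvg_cst].
- by rewrite lo.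
- by rewrite hi // divff ?g3 // gt_eqF.
- move=> x /andP[x0 xt']; have /orP[xt|xt] := le_total x t; first by rewrite lo //; apply: m4; rewrite x0.
  rewrite hi //.
  have /segP/andP[_ t'1] := st'.
  apply: g4; first by apply/segP; rewrite x0 (le_trans xt').
  move: tc t'c; rewrite !ltr_norml => /andP[a1 a2] /andP[a3 a4]; apply/andP.
  by split; [apply: lt_le_trans a1 _; rewrite lerD2r|apply: le_lt_trans a4; rewrite lerD2r].
Qed.

(** At an endpoint the representation takes values in the copy [th] of a smaller matrix algebra.
    Solving in that algebra gives a solution of the shape which the dimension drop demands there;
    [th] being injective, rp induces a representation rp' on it, to which the nonvanishing of the
    bumps passes. *)
Lemma endpoint n (th : 'M[C]_n -> 'M[C]_(P * Q)) (rp : (R -> 'M[C]_(p * q)) -> 'M[C]_(P * Q)) :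
  (forall a x y, th (a *: x + y) = a *: th x + th y) ->
  (forall x y, th (x *m y) = th x *m th y) -> (forall x, th (hadj x) = hadj (th x)) ->
  th 1%:M = 1%:M -> injective th -> ddrep rp ->
  (forall f, dimension_drop f -> exists g, rp f = th g) ->
  (forall (l : 'I_(L.*2.+1)) (i : 'I_(K * K)), rp (bmpf p0 q0 l i) != 0) ->
  exists s : 'I_K * 'I_K.+1 -> 'M[C]_n, sols L Nc rp (fun ji => th (s ji)).
Proof.
move=> thL thM thA th1 thI Hrp Hth Hf.
have th0 : th 0 = 0.
  by apply: (addrI (th 0)); rewrite -[X in X + _ = _]scale1r -thL scale1r !addr0.
have [rp' rE] : exists rp', forall f, dimension_drop f -> rp f = th (rp' f).
  have /choice[r' rP] f : exists g, dimension_drop f -> rp f = th g.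
    have [df|nf] := pselect (dimension_drop f); last by exists 0.
    by have [g gE] := Hth f df; exists g.
  by exists r'.
have Hr' : ddrep rp'.
  split.
  - move=> a f g df dg; apply: thI; rewrite thL -!rE //; last exact: dd_lin.
    exact: rep_lin.
  - move=> f g df dg; apply: thI; rewrite thM -!rE //; last exact: dd_mul.
    exact: rep_mul.
  - move=> f df; apply: thI; rewrite thA -!rE //; last exact: dd_hadj.
    exact: rep_adj.
  - by apply: thI; rewrite -rE; [rewrite (rep_one Hrp) th1|exact: dd_one].
  - by move=> f g df dg fg; apply: thI; rewrite -!rE //; exact: (rep_ext Hrp).
have [J [JN JP]] := candidate L Hrp (leqnn Nc).
have Jv := cand_valid Hrp JN JP.
have JP' w : (0 < w <= M)%N -> rp' (scalf p q (wb M Nc w (J w))) = 0.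
  move=> wM; apply: thI; rewrite -rE ?JP ?th0 //.
  by apply: dd_real; exact: trap_cont.
have Jv' := cand_valid Hr' JN JP'.
have Hf' (l : 'I_(L.*2.+1)) (i : 'I_(K * K)) : rp' (bmpf p0 q0 l i) != 0.
  apply: contra_neq (Hf l i) => z; rewrite rE ?z //.
  apply: dd_real_scale0; first exact: trap_cont.
    exact: (bmp_at0 M (KK0 K0)).
  by apply: (bmp_at1 (M := M) (KK0 K0)) => //; rewrite -ltnS.
have [s [[s1 s2 s3] cs]] := full_exists K0 L0 Hr' Hf' JN Jv'.
have thS I (r : seq I) (Pr : pred I) G : th (\sum_(i <- r | Pr i) G i) = \sum_(i <- r | Pr i) th (G i).
  apply: (big_morph th) => // x y; by rewrite -[x in LHS]scale1r thL scale1r.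
exists s; split; first split.
- by move=> j j' i i' jj; rewrite -thA -thM s1.
- by move=> j j' i i'; rewrite -!thA -!thM (s2 j j').
- by move=> j; rewrite -th1 -(s3 j) thS; apply: eq_bigr => i _; rewrite thM thA.
exists J; split => // ji X Xa.
have dX := adapted_dd (wchain_chain M JN) Xa.
by rewrite rE // -!thM; congr th; exact: cs.
Qed.

Lemma family_sol : exists m : 'I_K * 'I_K.+1 -> R -> 'M[C]_(P * Q),
  (forall ji, dimension_drop (m ji)) /\
  forall x, seg x -> relG (6 * e) (fun k => pi x (F k)) (fun ji => m ji x).
Proof.
have tl1 (g h : 'M[C]_P) : g *t (1%:M : 'M[C]_Q) = h *t 1%:M -> g = h.
  move=> /matrixP E; apply/matrixP => i j; pose z := Ordinal Q0.
  have := E (mxtens_index (i, z)) (mxtens_index (j, z)).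
  by rewrite !tensmxE !mxE eqxx mulr1n !mulr1.
have tr1 (g h : 'M[C]_Q) : (1%:M : 'M[C]_P) *t g = 1%:M *t h -> g = h.
  move=> /matrixP E; apply/matrixP => i j; pose z := Ordinal P0.
  have := E (mxtens_index (z, i)) (mxtens_index (z, j)).
  by rewrite !tensmxE !mxE eqxx mulr1n !mul1r.
have [s0 S0] : exists s : 'I_K * 'I_K.+1 -> 'M[C]_P, sols L Nc (pi 0) (fun ji => s ji *t (1%:M : 'M[C]_Q)).
  apply: (@endpoint P (fun g => g *t (1%:M : 'M[C]_Q)) (pi 0)) => //.
  - by move=> a x y; rewrite tensD1l tensZl.
  - by move=> x y; rewrite tensmx_mul mulmx1.
  - by move=> x; rewrite tens_hadj hadj1.
  - by rewrite tens11.
  - exact: Hrep seg0.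
  - move=> f df; have [g /dimdropP[_ [h hE] _] gE] := Hdd df.
    by exists h; rewrite gE ?hE //; exact: seg0.
  - exact: Hfull seg0.
have [s1 S1] : exists s : 'I_K * 'I_K.+1 -> 'M[C]_Q, sols L Nc (pi 1) (fun ji => (1%:M : 'M[C]_P) *t s ji).
  apply: (@endpoint Q (fun g => (1%:M : 'M[C]_P) *t g) (pi 1)) => //.
  - by move=> a x y; rewrite tensD1r tensZr.
  - by move=> x y; rewrite tensmx_mul mulmx1.
  - by move=> x; rewrite tens_hadj hadj1.
  - by rewrite tens11.
  - exact: Hrep seg1.
  - move=> f df; have [g /dimdropP[_ _ [h hE]] gE] := Hdd df.
    by exists h; rewrite gE ?hE //; exact: seg1.
  - exact: Hfull seg1.
have [m [m1 m2 m3 m4]] := reach S0 S1.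
exists (fun ji x => m x ji); split => // ji; apply/dimdropP; split.
- exact: mcont_mcont01.
- by exists (s0 ji); rewrite m2.
- by exists (s1 ji); rewrite m3.
Qed.
End Family.

(** * Central families in the Jiang-Su algebra *)

Section Zcentral.
Context {R : realType}.
Local Notation C := R[i].

Record central_family (Z : cstarAlgType R) K (e : R) (fs : seq Z) (u : Z)
    (m : 'I_K * 'I_K.+1 -> Z) : Prop := CentralFamily {
  cf_bd : forall ji, cnorm (m ji) <= 4;
  cf_com : forall ji f, f \in fs -> cnorm (cmul (m ji) f - cmul f (m ji)) <= e;
  cf_orth : forall j j' i i', j != j' -> cnorm (cmul (cstar (m (j, i))) (m (j', i'))) <= e;
  cf_same : forall j j' i i', cnorm (cmul (cstar (m (j, i))) (m (j, i')) -
     cmul (cstar (m (j', i))) (m (j', i'))) <= e;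
  cf_sum : forall j, cnorm (\sum_i cmul (cstar (m (j, i))) (m (j, i)) - u) <= e }.

Lemma wh_small (d : R) : 0 < d -> exists2 L, (0 < L)%N & 5 * wh L.*2 < d.
Proof.
move=> d0; have d5 : 0 < d / 5 by rewrite divr_gt0.
have [n nE] : exists n : nat, (d / 5)^-1 < n%:R.
  by exists (Num.bound (d / 5)^-1); apply: archi_boundP; rewrite invr_ge0 ltW.
exists n.+1 => //; rewrite mulrC -ltr_pdivlMr //.
rewrite /wh invf_plt ?posrE ?ltr0n ?addn1 //.
apply: lt_le_trans nE _; rewrite ler_nat -mul2n; lia.
Qed.

Lemma fin_max (T : finType) (P : T -> nat -> Prop) :
  (forall i, exists n0, forall n, (n0 <= n)%N -> P i n) ->
  exists n0, forall n, (n0 <= n)%N -> forall i, P i n.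
Proof.
move=> /choice[n nP]; exists (\max_i n i)%N => k kn i; apply: nP.
by apply: leq_trans kn; exact: leq_bigmax.
Qed.

Lemma sub_sub4 (V : zmodType) (a b c d : V) : a - b = (c - d) + ((a - c) - (b - d)).
Proof. by rewrite opprB addrACA [c + _]addrC subrK addKr. Qed.

(** Stage n of the inductive sequence approximates fs; at a later stage m the copies of all bumps
    vanish nowhere. Evaluation of these copies at t is a representation of stage n on the fibre of
    stage m, and a continuous family of solutions is a family of elements of stage m. *)
Lemma Zcentral (Z : cstarAlgType R) K (e : R) (fs : seq Z) : jiang_su Z -> (0 < K)%N -> 0 < e ->
  exists u m, cunit u /\ @central_family Z K e fs u m.
Proof.
move=> [hsimple [p [q [phi [hpq [hphi [hinc hdense]]]]]] _] K0 e0.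
have p0 n : (0 < p n)%N by have [] := hpq n.
have q0 n : (0 < q n)%N by have [] := hpq n.
pose nF := size fs.
(* [family_sol] multiplies the error by 6 and [emb_norm] by 2, which leaves e / 2. *)
pose ee := e / 24; have ee0 : 0 < ee by rewrite divr_gt0.
have e16 : 0 < e / 16 by rewrite divr_gt0.
have [n Hn] : exists n, forall k : 'I_nF, exists2 f, dimension_drop f &
    cnorm (fs`_k - phi n f) < e / 16.
  have [n0 Hn0] := @fin_max 'I_nF (fun k n => exists2 f, dimension_drop f &
    cnorm (fs`_k - phi n f) < e / 16) (fun k => dense_phi hinc hdense fs`_k e16).
  by exists n0; exact: Hn0.
have /choice[F HF] (k : 'I_nF) : exists f, dimension_drop f /\ cnorm (fs`_k - phi n f) < e / 16.
  by have [f] := Hn k; exists f.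
have D0 : 0 < (p n * q n).+1%:R * (p n * q n)%:R + 1 :> R by rewrite ltr_wpDl ?mulr_ge0.
pose e1 := ee / ((p n * q n).+1%:R * (p n * q n)%:R + 1).
have e10 : 0 < e1 by rewrite divr_gt0.
have e1e : (p n * q n).+1%:R * (p n * q n)%:R * e1 <= ee.
  by rewrite mulrCA ger_pMr // ler_pdivrMr // mul1r; lra.
have [d d0 Hd] : exists2 d, 0 < d & forall k x y, seg x -> seg y -> `|x - y| < d ->
    forall i j, normc ((F k x - F k y) i j) <= e1.
  have /choice[d dP] (k : 'I_nF) : exists d, 0 < d /\ forall x y, seg x -> seg y -> `|x - y| < d ->
      forall i j, normc ((F k x - F k y) i j) < e1.
    have [dF _] := HF k; have /dimdropP[Fc _ _] := dF.
    by have [d d0 h] := mcont01_unif Fc e10; exists d.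
  exists (\big[Num.min/1]_k d k); first by apply/bigmin_gtP; split => // k _; have [] := dP k.
  move=> k x y sx sy /bigmin_gtP[_ xy] i j; have [_ h] := dP k.
  by apply/ltW/h => //; exact: xy.
have [L L0 wd] := wh_small d0.
have bdd (l : 'I_(L.*2.+1)) (i : 'I_(K * K)) : dimension_drop (@bmpf R _ _ _ _ (p0 n) (q0 n) l i).
  apply: dd_real_scale0; first exact: trap_cont.
    exact: (bmp_at0 L.*2 (KK0 K0)).
  by apply: (bmp_at1 (M := L.*2) (KK0 K0)) => //; rewrite -ltnS.
have bn0 (l : 'I_(L.*2.+1)) (i : 'I_(K * K)) : phi n (@bmpf R _ _ _ _ (p0 n) (q0 n) l i) <> 0.
  move/(emb_inj (hphi n) (bdd l i)) => H.
  have lL : (l <= L.*2)%N by rewrite -ltnS.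
  have [x sx E] := @bmp_peak R L.*2 _ (KK0 K0) l i lL (ltn_ord i).
  have := H x sx; rewrite /bmpf E scale1r; apply/eqP; apply: iota_inj => //.
  apply/eqP => /matrixP/(_ (Ordinal (bdim_gt0 (p0 n) (q0 n) (chain_kind L.*2 l))) (Ordinal (bdim_gt0 (p0 n) (q0 n) (chain_kind L.*2 l)))).
  by rewrite !mxE !eqxx => /eqP; rewrite oner_eq0.
have [m1 Hm1] := @fin_max ('I_(L.*2.+1) * 'I_(K * K))%type (fun li m =>
   forall g, dimension_drop g -> phi m g = phi n (@bmpf R _ _ _ _ (p0 n) (q0 n) li.1 li.2) ->
   forall t, seg t -> g t <> 0)
   (fun li => full hpq hphi hinc hdense hsimple (bdd li.1 li.2) (bn0 li.1 li.2)).
pose m := maxn n m1.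
have nm : (n <= m)%N by exact: leq_maxl.
(* [ka f] is the copy in stage m of an element f of stage n. *)
have /choice[ka kaP] f : exists g, dimension_drop f -> dimension_drop g /\ phi m g = phi n f.
  have [df|ndf] := pselect (dimension_drop f); last by exists (fun=> 0).
  by have [g dg E] := inc_le hinc nm df; exists g.
have kd f : dimension_drop f -> dimension_drop (ka f) by move=> /kaP[].
have kE f : dimension_drop f -> phi m (ka f) = phi n f by move=> /kaP[].
pose pi t f := ka f t.
have ext (f g : R -> 'M[C]_(p m * q m)) t : dimension_drop f -> dimension_drop g -> phi m f = phi m g -> seg t -> f t = g t.
  by move=> df dg E; exact: (emb_ext (hphi m) df dg).1 E t.
have Hrep t : seg t -> ddrep (pi t).
  move=> st; split.
  - move=> a f g df dg.
    rewrite /pi (ext _ (fun x => a *: ka f x + ka g x)) //; try exact: kd; try exact: dd_lin.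
    + by apply: kd; exact: dd_lin.
    + by apply: dd_lin; exact: kd.
    + by rewrite kE ?(emb_lin (hphi _)) ?kE //; first [exact: kd|exact: dd_lin].
  - move=> f g df dg; rewrite /pi (ext _ (fun x => ka f x *m ka g x)) //.
    + by apply: kd; exact: dd_mul.
    + by apply: dd_mul; exact: kd.
    + by rewrite kE ?(emb_mul (hphi _)) ?kE //; first [exact: kd|exact: dd_mul].
  - move=> f df; rewrite /pi (ext _ (fun x => hadj (ka f x))) //.
    + by apply: kd; exact: dd_hadj.
    + by apply: dd_hadj; exact: kd.
    + by rewrite kE ?(emb_adj (hphi _)) ?kE //; first [exact: kd|exact: dd_hadj].
  - rewrite /pi (ext _ (fun=> 1%:M)) //.
    + by apply: kd; exact: dd_one.
    + exact: dd_one.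
    + by rewrite kE ?(unit_eq hphi n m) //; exact: dd_one.
  - move=> f g df dg fg; apply: ext => //; [exact: kd|exact: kd|].
    by rewrite !kE //; apply/(emb_ext (hphi n)).
have Hdd f : dimension_drop f -> exists2 g : R -> 'M[C]_(p m * q m), dimension_drop g &
    forall t, seg t -> pi t f = g t.
  by move=> df; exists (ka f) => //; exact: kd.
have Hfull t : seg t -> forall (l : 'I_(L.*2.+1)) (i : 'I_(K * K)), pi t (@bmpf R _ _ _ _ (p0 n) (q0 n) l i) != 0.
  move=> st l i; apply/eqP; apply: (Hm1 m (leq_maxr _ _) (l, i)) => //; first exact: kd.
  exact: kE.
have dF k : dimension_drop (F k) by have [] := HF k.
have Fu k x y : seg x -> seg y -> `|x - y| < 5 * wh L.*2 -> forall i j, normc ((F k x - F k y) i j) <= e1.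
  by move=> sx sy xy; apply: Hd => //; exact: lt_trans xy wd.
have [mm [dm mP]] := family_sol K0 L0 (p0 m) (q0 m) Hrep Hdd Hfull dF (ltW e10) e1e ee0 Fu.
have e6 : 0 < 6 * ee by rewrite mulr_gt0.
have e12 : 2 * (6 * ee) <= e / 2 by rewrite /ee; lra.
have dh f : dimension_drop f -> dimension_drop (fun t => hadj (f t)) := @dd_hadj R (p m) (q m) f.
have norm f : dimension_drop f -> (forall t, seg t -> opb (6 * ee) (f t)) -> cnorm (phi m f) <= e / 2.
  by move=> df fb; apply: le_trans e12; exact: (emb_norm (hphi m)).
have he : e / 2 <= e by lra.
exists (phi m (fun=> 1%:M)), (fun ji => phi m (mm ji)); split; first exact: emb_one (hphi m).
split.
- move=> ji; have h2 : 0 < 2 :> R by [].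
  have := emb_norm (hphi m) (p0 m) (q0 m) h2 (dm ji) (fun t st => rel_bd (mP t st) ji).
  by rewrite -natrM.
- move=> ji f ff; pose k : 'I_nF := Ordinal (etrans (index_mem f fs) ff).
  have [_ fk] := HF k; rewrite /= nth_index // in fk.
  have bd : cnorm (phi m (mm ji)) <= 4.
    have h2 : 0 < 2 :> R by [].
    have := emb_norm (hphi m) (p0 m) (q0 m) h2 (dm ji) (fun t st => rel_bd (mP t st) ji).
    by rewrite -natrM.
  set x := phi m (mm ji) in bd *.
  have -> : cmul x f - cmul f x = (cmul x (phi n (F k)) - cmul (phi n (F k)) x) +
      (cmul x (f - phi n (F k)) - cmul (f - phi n (F k)) x).
    by rewrite cmulBr cmulBl; exact: sub_sub4.
  have dka : dimension_drop (ka (F k)) by exact: kd.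
  have c1 : cnorm (cmul x (phi n (F k)) - cmul (phi n (F k)) x) <= e / 2.
    rewrite -(kE _ (dF k)) /x -!(emb_mul (hphi m)) //.
    rewrite -(emb_sub (hphi m)); try (apply: dd_mul => //; exact: kd).
    apply: norm; first by apply: dd_sub; apply: dd_mul => //; exact: kd.
    by move=> t st; exact: (rel_com (mP t st) ji k).
  apply: le_trans (cnormD _ _) _; apply: (@le_trans _ _ (e / 2 + (e / 4 + e / 4))); last by lra.
  apply: lerD => //; apply: le_trans (cnormD _ _) _; rewrite cnormN.
  have := cnorm_mul x (f - phi n (F k)); have := cnorm_mul (f - phi n (F k)) x.
  have := cnorm_ge0 (f - phi n (F k)); have := cnorm_ge0 x; nra.
- move=> j j' i i' jj; rewrite -(emb_adj (hphi m)) // -(emb_mul (hphi m)) //; last exact: dh.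
  apply: le_trans he; apply: norm; first by apply: dd_mul => //; exact: dh.
  by move=> t st; exact: (rel_orth (mP t st)).
- move=> j j' i i'; rewrite -!(emb_adj (hphi m)) // -!(emb_mul (hphi m)) //; try exact: dh.
  rewrite -(emb_sub (hphi m)); try (apply: dd_mul => //; exact: dh).
  apply: le_trans he; apply: norm; first by apply: dd_sub; apply: dd_mul => //; exact: dh.
  by move=> t st; exact: (rel_same (mP t st)).
- move=> j; have dj i : dimension_drop (fun t => hadj (mm (j, i) t) *m mm (j, i) t).
    by apply: dd_mul => //; exact: dh.
  have -> : \sum_i cmul (cstar (phi m (mm (j, i)))) (phi m (mm (j, i))) =
      phi m (fun t => \sum_i hadj (mm (j, i) t) *m mm (j, i) t).
    rewrite (emb_sum (hphi m)) //; apply: eq_bigr => i _.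
    by rewrite (emb_mul (hphi m)) //; [rewrite (emb_adj (hphi m))|exact: dh].
  rewrite -(emb_sub (hphi m)); [|exact: dd_sum|exact: dd_one].
  apply: le_trans he; apply: norm; first by apply: dd_sub; [exact: dd_sum|exact: dd_one].
  by move=> t st; exact: (rel_sum (mP t st)).
Qed.
End Zcentral.

(** * Z-stable subalgebras *)

Section Misc.
Context {R : realType} {A : cstarAlgType R}.
Implicit Types (x y : A).

Lemma cstarN x : cstar (- x) = - cstar x.
Proof. by rewrite -scaleN1r cstarZ rmorphN1 scaleN1r. Qed.
Lemma cstarB x y : cstar (x - y) = cstar x - cstar y.
Proof. by rewrite cstarD cstarN. Qed.
Lemma cmul_suml I (r : seq I) (P : pred I) (F : I -> A) y :
  cmul (\sum_(i <- r | P i) F i) y = \sum_(i <- r | P i) cmul (F i) y.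
Proof. by apply: (big_morph (fun x => cmul x y)) => [u v|]; rewrite ?cmulDl ?cmul0l. Qed.
Lemma cmul_sumr I (r : seq I) (P : pred I) (F : I -> A) y :
  cmul y (\sum_(i <- r | P i) F i) = \sum_(i <- r | P i) cmul y (F i).
Proof. by apply: (big_morph (fun x => cmul y x)) => [u v|]; rewrite ?cmulDr ?cmul0r. Qed.
Lemma cstar_sum I (r : seq I) (P : pred I) (F : I -> A) :
  cstar (\sum_(i <- r | P i) F i) = \sum_(i <- r | P i) cstar (F i).
Proof. by apply: (big_morph (@cstar R A)) => [u v|]; rewrite ?cstarD ?cstar0. Qed.
Lemma cnorm_sum I (r : seq I) (P : pred I) (F : I -> A) :
  cnorm (\sum_(i <- r | P i) F i) <= \sum_(i <- r | P i) cnorm (F i).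
Proof.
elim/big_rec2: _ => [|i u v _ h]; first by rewrite cnorm0.
exact: le_trans (cnormD _ _) (lerD _ _).
Qed.
End Misc.

(** * Homomorphisms and their contractivity *)

Section StarHom.
Context {R : realType} {A B : cstarAlgType R}.
Variable f : A -> B.
Hypothesis fP : star_hom f.

Lemma hom_mul x y : f (cmul x y) = cmul (f x) (f y).
Proof. by have [_ H _] := fP. Qed.
Lemma hom_star x : f (cstar x) = cstar (f x).
Proof. by have [_ _ H] := fP. Qed.
Lemma hom_add x y : f (x + y) = f x + f y.
Proof. by have [H _ _] := fP; rewrite -[x in LHS]scale1r H scale1r. Qed.
Lemma hom0 : f 0 = 0.
Proof. by apply: (addrI (f 0)); rewrite -hom_add !addr0. Qed.
Lemma homZ a x : f (a *: x) = a *: f x.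
Proof. by have [H _ _] := fP; rewrite -[a *: x in LHS]addr0 H hom0 addr0. Qed.
Lemma homN x : f (- x) = - f x.
Proof. by rewrite -scaleN1r homZ scaleN1r. Qed.
Lemma homB x y : f (x - y) = f x - f y.
Proof. by rewrite hom_add homN. Qed.
Lemma hom_sum I (r : seq I) (P : pred I) (F : I -> A) :
  f (\sum_(i <- r | P i) F i) = \sum_(i <- r | P i) f (F i).
Proof. by apply: (big_morph f) => [u v|]; rewrite ?hom_add ?hom0. Qed.

Definition uhom (u : uniz A) : uniz B := (f u.1, u.2).

Lemma uhomM u v : uhom (u * v) = uhom u * uhom v.
Proof. by apply: unizP => //=; rewrite /uhom !hom_add !homZ hom_mul. Qed.
Lemma uhom_star u : uhom (ustar u) = ustar (uhom u).
Proof. by apply: unizP => //=; rewrite hom_star. Qed.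
Lemma uhomB u v : uhom (u - v) = uhom u - uhom v.
Proof. by apply: unizP => //=; rewrite homB. Qed.
Lemma uhomZ a u : uhom (a *: u) = a *: uhom u.
Proof. by apply: unizP => //=; rewrite homZ. Qed.
Lemma uhom1 : uhom 1 = 1.
Proof. by apply: unizP => //=; rewrite hom0. Qed.

End StarHom.

Section Unitary.
Context {R : realType} {A : cstarAlgType R}.
Implicit Types (u y r : uniz A).

(* The self-adjoint contraction [y] is the imaginary part of [1 - r + i y]. *)
Lemma sa_unitary y : usa y -> un y <= 1 -> exists r, [/\ usa r, un r <= 1,
  (1 - r) * (1 - r) = 1 - y * y & GRing.comm y r].
Proof.
move=> ys y1; have c1 : un (y * y) <= 1 by rewrite un_sqr // expr_le1 ?un_ge0.
have [r [rc rE rs rcomm]] := usqrt_lim c1.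
exists r; split => //; [by apply: rs; exact: usaM|exact: le_trans c1|].
by apply: rcomm; apply: commrM.
Qed.

Lemma circle_mul (s y : uniz A) : s * y = y * s ->
  (s - ii *: y) * (s + ii *: y) = s * s + y * y /\ (s + ii *: y) * (s - ii *: y) = s * s + y * y.
Proof.
move=> C; split.
  rewrite mulrBl !mulrDr -!scalerAl -!scalerAr scalerA ii_sqr scaleN1r C.
  by rewrite opprD opprK addrA addrK.
rewrite mulrDl !mulrBr -!scalerAl -!scalerAr scalerA ii_sqr scaleN1r C.
by rewrite opprK addrA subrK.
Qed.

(** The unitary is taken in the corner of p. In one use p = 1; in the other p is the unit of Z
    placed in the unitization, where it is not 1. *)
Lemma unitary_mul (p y r : uniz A) : usa y -> usa r -> GRing.comm y r ->
  (1 - r) * (1 - r) = 1 - y * y -> p * p = p -> p * r = r -> r * p = r -> p * y = y -> y * p = y ->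
  usa p -> (p - r - ii *: y) * (p - r + ii *: y) = p /\ (p - r + ii *: y) * (p - r - ii *: y) = p.
Proof.
move=> ys rs yr rE pp pr rp py yp ps.
have E : (p - r) * (p - r) + y * y = p.
  have -> : (p - r) * (p - r) = p - r - r + r * r.
    by rewrite mulrBl !mulrBr pp pr rp opprB addrA addrAC.
  have : 1 - r - r + r * r + y * y = 1 - 1 + 1.
    have -> : 1 - r - r + r * r = (1 - r) * (1 - r) by ncring.
    by rewrite rE subrK subrr add0r.
  move=> h; have : p - r - r + r * r + y * y = p + (1 - r - r + r * r + y * y - 1) by ncring.
  by rewrite h subrr add0r subrr addr0.
have C : (p - r) * y = y * (p - r) by rewrite mulrBl mulrBr py yp yr.
by have [h1 h2] := circle_mul C; rewrite h1 h2 E.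
Qed.
End Unitary.

Section HomBound.
Context {R : realType} {A B : cstarAlgType R}.
Variable f : A -> B.
Hypothesis fP : star_hom f.

(** Twice a self-adjoint contraction is, up to a scalar of modulus 1, the difference of two
    unitaries, and the extension of f to the unitizations sends unitaries to unitaries. The general
    case follows from f (y^* y). *)
Lemma hom_norm x : cnorm (f x) <= cnorm x.
Proof.
have sa y : cstar y = y -> cnorm y <= 1 -> cnorm (f y) <= 1.
  move=> ys y1; have iys : usa (inA y) by rewrite /usa -inA_star ys.
  have iy1 : un (inA y) <= 1 by rewrite un_inA.
  have [r [rs _ rE yr]] := sa_unitary iys iy1.
  have [U1 U2] := @unitary_mul R A 1 (inA y) r iys rs yr rE (mulr1 _) (mul1r _) (mulr1 _) (mul1r _) (mulr1 _) ustar1.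
  pose v : uniz A := 1 - r + ii *: inA y; pose w : uniz A := 1 - r - ii *: inA y.
  have vw : ustar v = w.
    by rewrite /v /w ustarD ustarB ustar1 rs ustarZ ii_conj iys scaleNr.
  have wv : ustar w = v by rewrite -vw ustarK.
  have nv : un (uhom f v) <= 1.
    have : un (uhom f v) ^+ 2 = 1.
      by rewrite -un_starmul -(uhom_star fP) -(uhomM fP) vw U1 (uhom1 fP) un1.
    by have := un_ge0 (uhom f v); nra.
  have nw : un (uhom f w) <= 1.
    have : un (uhom f w) ^+ 2 = 1.
      by rewrite -un_starmul -(uhom_star fP) -(uhomM fP) wv U2 (uhom1 fP) un1.
    by have := un_ge0 (uhom f w); nra.
  have E : (2%:C * ii) *: inA (f y) = uhom f v - uhom f w.
    have -> : inA (f y) = uhom f (inA y) by [].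
    rewrite -(uhomB fP) -(uhomZ fP); congr uhom.
    rewrite /v /w; set a := 1 - r; rewrite opprB addrA addrAC [a + _]addrC addrK.
    by rewrite -scalerA scale2C.
  have : un ((2%:C * ii) *: inA (f y)) <= 2.
    by rewrite E; apply: le_trans (unD _ _) _; rewrite unN; lra.
  rewrite unZ un_inA normcM normc_real.
  have -> : normc (ii : R[i]) = 1 by rewrite /normc /= expr0n expr1n add0r sqrtr1.
  by rewrite ger0_norm //; lra.
have key y : cnorm y <= 1 -> cnorm (f y) <= 1.
  move=> y1; have : cnorm (f (cmul (cstar y) y)) <= 1.
    apply: sa; first by rewrite cstarM cstarK.
    by rewrite cnorm_starmul expr_le1 ?cnorm_ge0.
  rewrite (hom_mul fP) (hom_star fP) cnorm_starmul.
  by have := cnorm_ge0 (f y); nra.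
have [->|x0] := eqVneq x 0; first by rewrite (hom0 fP) !cnorm0.
have n0 : 0 < cnorm x by rewrite cnorm_gt0.
have nV : normc ((cnorm x)^-1%:C : R[i]) = (cnorm x)^-1.
  by rewrite normc_real ger0_norm // invr_ge0 ltW.
have := key ((cnorm x)^-1%:C *: x); rewrite (homZ fP) !cnormZ nV mulVf ?gt_eqF // => /(_ (lexx _)).
by rewrite mulrC ler_pdivrMr // mul1r.
Qed.
End HomBound.

(** * Multiplication by the second tensor factor *)

Section Tensor.
Context {R : realType} {D Z E : cstarAlgType R}.
Variable t : D -> Z -> E.
Hypothesis Ht : cstar_tensor t.
Variable e : Z.
Hypothesis ue : cunit e.
Implicit Types (s : seq (D * Z)) (g : Z).

Definition tsum s : E := \sum_(x <- s) t x.1 x.2.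
Definition tmul g s : seq (D * Z) := [seq (x.1, cmul g x.2) | x <- s].

Lemma tl a x y z : t (a *: x + y) z = a *: t x z + t y z.
Proof. by have [H _] := Ht. Qed.
Lemma tr a x y z : t x (a *: y + z) = a *: t x y + t x z.
Proof. by have [_ [H _]] := Ht. Qed.
Lemma tmulE x x' y y' : t (cmul x x') (cmul y y') = cmul (t x y) (t x' y').
Proof. by have [_ [_ [H _]]] := Ht. Qed.
Lemma tstar x y : t (cstar x) (cstar y) = cstar (t x y).
Proof. by have [_ [_ [_ [H _]]]] := Ht. Qed.
Lemma tdense : dense [set x | exists n (d : 'I_n -> D) (b : 'I_n -> Z), x = \sum_i t (d i) (b i)].
Proof. by have [_ [_ [_ [_ [_ H]]]]] := Ht. Qed.
Lemma t0l z : t 0 z = 0.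
Proof. by apply: (addrI (t 0 z)); rewrite -[X in X + _ = _]scale1r -tl scale1r !addr0. Qed.
Lemma t0r x : t x 0 = 0.
Proof. by apply: (addrI (t x 0)); rewrite -[X in X + _ = _]scale1r -tr scale1r !addr0. Qed.
Lemma tZl a x z : t (a *: x) z = a *: t x z.
Proof. by rewrite -[a *: x]addr0 tl t0l addr0. Qed.
Lemma tZr a x z : t x (a *: z) = a *: t x z.
Proof. by rewrite -[a *: z]addr0 tr t0r addr0. Qed.
Lemma tDr x y z : t x (y + z) = t x y + t x z.
Proof. by rewrite -[y]scale1r tr !scale1r. Qed.
Lemma tBr x y z : t x (y - z) = t x y - t x z.
Proof. by rewrite tDr -scaleN1r tZr scaleN1r. Qed.

Lemma tsum_lin a g g' s : tsum (tmul (a *: g + g') s) = a *: tsum (tmul g s) + tsum (tmul g' s).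
Proof.
rewrite /tsum /tmul !big_map scaler_sumr -big_split /=; apply: eq_bigr => x _.
by rewrite cmulDl cmulZl tr.
Qed.
Lemma tsum_scale a g s : tsum (tmul (a *: g) s) = a *: tsum (tmul g s).
Proof.
by rewrite /tsum /tmul !big_map scaler_sumr; apply: eq_bigr => x _; rewrite cmulZl tZr.
Qed.

Lemma tsum_gram s s' : cmul (cstar (tsum s)) (tsum s') =
  \sum_(x <- s) \sum_(y <- s') t (cmul (cstar x.1) y.1) (cmul (cstar x.2) y.2).
Proof.
rewrite /tsum cstar_sum cmul_suml; apply: eq_bigr => x _; rewrite cmul_sumr; apply: eq_bigr => y _.
by rewrite tmulE tstar.
Qed.

Lemma tmul_isometry g s : cmul (cstar g) g = e -> cnorm (tsum (tmul g s)) = cnorm (tsum s).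
Proof.
move=> ge; suff E2 : cmul (cstar (tsum (tmul g s))) (tsum (tmul g s)) = cmul (cstar (tsum s)) (tsum s).
  have := cnorm_starmul (tsum s); rewrite -E2 cnorm_starmul => /eqP.
  by rewrite eqrXn2 ?cnorm_ge0 // => /eqP.
rewrite !tsum_gram big_map; apply: eq_bigr => x _; rewrite big_map; apply: eq_bigr => y _ /=.
congr (t _ _); rewrite cstarM cmulA -(cmulA _ (cstar g)) ge.
by have [_ ->] := ue (cstar x.2).
Qed.

(** Isometries of Z preserve the Gram sums, hence the norm, and g is a combination of two unitaries
    of Z. *)
Lemma tmul_sa g s : cstar g = g -> cnorm g <= 1 -> cnorm (tsum (tmul g s)) <= cnorm (tsum s).
Proof.
move=> gs g1; have iys : usa (inA g) by rewrite /usa -inA_star gs.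
have iy1 : un (inA g) <= 1 by rewrite un_inA.
have [r [rs r1 rE yr]] := sa_unitary iys iy1.
(* (1 - r.2)^2 = 1 leaves 0 or 2, and [un r <= 1] excludes 2. So the unitaries lie in Z itself. *)
have r2 : r.2 = 0.
  have h : (1 - r.2) * (1 - r.2) = 1 by have := congr1 snd rE; rewrite /= mulr0 subr0.
  have : r.2 * (r.2 - 2) = 0.
    have -> : r.2 * (r.2 - 2) = (1 - r.2) * (1 - r.2) - 1 by ring.
    by rewrite h subrr.
  move/eqP; rewrite mulf_eq0 => /orP[/eqP //|]; rewrite subr_eq0 => /eqP r22.
  have := un_snd r; rewrite r22 => h'; have := le_trans h' r1.
  by rewrite -[2]/(2%:R) -(rmorph_nat (real_complex R)) normc_real ger0_norm // lern1.
have eE := inAE r2; pose q := inA e.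
have qx (x : Z) : q * inA x = inA x /\ inA x * q = inA x.
  by rewrite /q -!inAM; have [-> ->] := ue x.
have qs : usa q.
  rewrite /usa /q -inA_star; congr inA.
  have [h _] := ue (cstar e); have := congr1 cstar h; rewrite cstarM cstarK.
  by have [-> _] := ue (cstar e).
have qr : q * r = r by rewrite eE; have [] := qx r.1.
have rq : r * q = r by rewrite eE; have [] := qx r.1.
have [qq _] := qx e; have [qy yq] := qx g.
have [U1 U2] := unitary_mul iys rs yr rE qq qr rq qy yq qs.
pose v : Z := e - r.1 + ii *: g; pose w : Z := e - r.1 - ii *: g.
have vE : inA v = q - r + ii *: inA g by rewrite /v inAD inAB inAZ -eE.
have wE : inA w = q - r - ii *: inA g by rewrite /w inAB inAB inAZ -eE.
have vs : cstar v = w.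
  by apply: inAI; rewrite inA_star vE wE ustarD ustarB qs rs ustarZ ii_conj iys scaleNr.
have ws : cstar w = v by rewrite -vs cstarK.
have nv : cnorm (tsum (tmul v s)) = cnorm (tsum s).
  by apply: tmul_isometry; apply: inAI; rewrite vs inAM vE wE.
have nw : cnorm (tsum (tmul w s)) = cnorm (tsum s).
  by apply: tmul_isometry; apply: inAI; rewrite ws inAM vE wE.
have gE : (2%:C * ii) *: g = -1 *: w + v.
  rewrite scaleN1r /v /w opprB addrC addrA addrAC [(e - r.1) + _]addrC -addrA.
  rewrite -[in LHS]scalerA -[2]/(1 + 1) rmorphD scalerDl !scale1r.
  by rewrite -addrA addNKr.
have : cnorm (tsum (tmul ((2%:C * ii) *: g) s)) <= 2 * cnorm (tsum s).
  by rewrite gE tsum_lin scaleN1r; apply: le_trans (cnormD _ _) _; rewrite cnormN nv nw; lra.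
rewrite tsum_scale cnormZ normcM normc_real.
have -> : normc (ii : R[i]) = 1 by rewrite /normc /= expr0n expr1n add0r sqrtr1.
by rewrite ger0_norm //; lra.
Qed.

(** D may lack a unit, so 1 (x) g need not be an element of E and its boundedness has to come from
    the Gram sums. The factor 2 is the price of splitting g into real and imaginary parts. *)
Lemma tmul_bound g s : cnorm (tsum (tmul g s)) <= 2 * cnorm g * cnorm (tsum s).
Proof.
have key h : cnorm h <= 1 -> cnorm (tsum (tmul h s)) <= 2 * cnorm (tsum s).
  move=> h1; pose a := 2^-1%:C *: (h + cstar h); pose b := (2^-1%:C * - ii) *: (h - cstar h).
  have hE : h = ii *: b + a.
    rewrite /a /b scalerA mulrCA mulrN ii_sqr opprK mulr1 -scalerDr.
    have two : h + h = 2%:C *: h by rewrite -[2]/(1 + 1) rmorphD scalerDl !scale1r.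
    by rewrite addrACA addNr addr0 two scalerA -rmorphM mulVf ?scale1r // pnatr_eq0.
  have ni : normc (ii : R[i]) = 1 by rewrite /normc /= expr0n expr1n add0r sqrtr1.
  have nn : normc (- ii : R[i]) = 1 by rewrite normcN.
  have sa1 : cstar a = a.
    by rewrite /a cstarZ cstarD cstarK addrC /= oppr0.
  have sb1 : cstar b = b.
    have -> : cstar b = (2^-1%:C * ii) *: (cstar h - h).
      rewrite /b cstarZ cstarB cstarK cconjM; congr ((_ * _) *: _); first by rewrite /= oppr0.
      by apply/eqP; rewrite eq_complex /= !oppr0 opprK !eqxx.
    by rewrite /b -[cstar h - h]opprB scalerN mulrN scaleNr.
  have na : cnorm a <= 1.
    rewrite /a cnormZ normc_half; have := cnormD h (cstar h); rewrite cnorm_star; lra.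
  have nb : cnorm b <= 1.
    rewrite /b cnormZ normcM nn normc_half; have := cnormD h (- cstar h).
    by rewrite cnormN cnorm_star; lra.
  rewrite hE tsum_lin; apply: le_trans (cnormD _ _) _; rewrite cnormZ ni mul1r.
  by have := tmul_sa s sa1 na; have := tmul_sa s sb1 nb; lra.
have [->|g0] := eqVneq g 0.
  have -> : tmul 0 s = tmul (0 *: e) s by rewrite scale0r.
  by rewrite tsum_scale scale0r !cnorm0 mulr0 mul0r.
have n0 : 0 < cnorm g by rewrite cnorm_gt0.
have nV : normc ((cnorm g)^-1%:C : R[i]) = (cnorm g)^-1.
  by rewrite normc_real ger0_norm // invr_ge0 ltW.
have := key ((cnorm g)^-1%:C *: g); rewrite tsum_scale !cnormZ nV mulVf ?gt_eqF // => /(_ (lexx _)).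
by rewrite mulrC ler_pdivrMr // => h; rewrite mulrAC.
Qed.

Definition salg : set E := [set w | exists s, w = tsum s].

Lemma tsum_cat s s' : tsum (s ++ s') = tsum s + tsum s'.
Proof. by rewrite /tsum big_cat. Qed.
Lemma tmul_cat g s s' : tmul g (s ++ s') = tmul g s ++ tmul g s'.
Proof. exact: map_cat. Qed.
Definition tscale (a : R[i]) s : seq (D * Z) := [seq (a *: x.1, x.2) | x <- s].
Lemma tsum_tscale a s : tsum (tscale a s) = a *: tsum s.
Proof. by rewrite /tsum /tscale big_map scaler_sumr; apply: eq_bigr => x _; rewrite tZl. Qed.
Lemma tmul_tscale g a s : tmul g (tscale a s) = tscale a (tmul g s).
Proof. by rewrite /tmul /tscale -!map_comp. Qed.

(* Multiplication by [1 (x) g] on the algebraic tensor product. *)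
Definition tact g (w : E) : E := xget 0 [set v | exists s, w = tsum s /\ v = tsum (tmul g s)].

(** Two expressions of one element differ by a tensor sum equal to 0, whose image is 0 by
    [tmul_bound]. *)
Lemma tactE g s : tact g (tsum s) = tsum (tmul g s).
Proof.
rewrite /tact; set P := [set v | _].
have : P (xget 0 P) by apply: xgetPex; exists (tsum (tmul g s)), s.
case=> s' [E1 ->]; apply/eqP; rewrite -subr_eq0 -cnorm_eq0 eq_le cnorm_ge0 andbT.
have := tmul_bound g (s' ++ tscale (-1) s).
rewrite tmul_cat tmul_tscale !tsum_cat !tsum_tscale !scaleN1r -E1 subrr cnorm0 mulr0.
by [].
Qed.

Lemma tact_lin g a w w' : salg w -> salg w' -> tact g (a *: w + w') = a *: tact g w + tact g w'.
Proof.
move=> [s ->] [s' ->]; rewrite -tsum_tscale -tsum_cat !tactE tmul_cat tmul_tscale.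
by rewrite tsum_cat tsum_tscale.
Qed.
Lemma tact_norm g w : salg w -> cnorm (tact g w) <= 2 * cnorm g * cnorm w.
Proof. by move=> [s ->]; rewrite tactE; exact: tmul_bound. Qed.

Lemma salg_lin a w w' : salg w -> salg w' -> salg (a *: w + w').
Proof.
by move=> [s ->] [s' ->]; exists (tscale a s ++ s'); rewrite tsum_cat tsum_tscale.
Qed.
Lemma salg_star w : salg w -> salg (cstar w).
Proof.
move=> [s ->]; exists [seq (cstar x.1, cstar x.2) | x <- s].
by rewrite /tsum big_map cstar_sum; apply: eq_bigr => x _; rewrite tstar.
Qed.
Lemma salg_mul w w' : salg w -> salg w' -> salg (cmul w w').
Proof.
move=> [s ->] [s' ->]; exists [seq (cmul x.1 y.1, cmul x.2 y.2) | x <- s, y <- s'].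
rewrite /tsum big_allpairs_dep cmul_suml; apply: eq_bigr => x _.
by rewrite cmul_sumr; apply: eq_bigr => y _; rewrite tmulE.
Qed.
Lemma salg_dense (w : E) (d : R) : 0 < d -> exists2 v, salg v & cnorm (w - v) < d.
Proof.
move=> d0; have [v [n [a [b ->]]] h] := dense_approx w tdense d0.
exists (\sum_i t (a i) (b i)) => //; exists [seq (a i, b i) | i <- enum 'I_n].
by rewrite /tsum big_map big_enum.
Qed.

Lemma tsumr d I (r : seq I) (P : pred I) (F : I -> Z) :
  t d (\sum_(i <- r | P i) F i) = \sum_(i <- r | P i) t d (F i).
Proof. by apply: (big_morph (t d)) => [u v|]; rewrite ?tDr ?t0r. Qed.

Lemma tsum_gram3 s1 s2 s3 : cmul (cstar (tsum s1)) (cmul (tsum s2) (tsum s3)) =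
  \sum_(a <- s1) \sum_(w <- s2) \sum_(v <- s3)
    t (cmul (cstar a.1) (cmul w.1 v.1)) (cmul (cstar a.2) (cmul w.2 v.2)).
Proof.
rewrite /tsum cstar_sum cmul_suml; apply: eq_bigr => a _.
rewrite cmul_suml cmul_sumr; apply: eq_bigr => w _; rewrite !cmul_sumr; apply: eq_bigr => v _.
by rewrite !tmulE tstar.
Qed.

Lemma tact_gram3 g s1 s2 s3 : tact g (cmul (cstar (tsum s1)) (cmul (tsum s2) (tsum s3))) =
  \sum_(a <- s1) \sum_(w <- s2) \sum_(v <- s3)
    t (cmul (cstar a.1) (cmul w.1 v.1)) (cmul g (cmul (cstar a.2) (cmul w.2 v.2))).
Proof.
pose s := [seq (cmul (cstar a.1) b.1, cmul (cstar a.2) b.2) | a <- s1,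
  b <- [seq (cmul w.1 v.1, cmul w.2 v.2) | w <- s2, v <- s3]].
have -> : cmul (cstar (tsum s1)) (cmul (tsum s2) (tsum s3)) = tsum s.
  rewrite tsum_gram3 /tsum big_allpairs_dep; apply: eq_bigr => a _.
  by rewrite big_allpairs_dep.
rewrite tactE /tsum /tmul big_map big_allpairs_dep; apply: eq_bigr => a _.
by rewrite big_allpairs_dep.
Qed.

Lemma telem_norm d z : cnorm (t d z) <= 2 * cnorm z * cnorm (t d e).
Proof.
have := tmul_bound z [:: (d, e)]; rewrite /tsum /tmul /= !big_seq1 /=.
by have [_ ->] := ue z.
Qed.
End Tensor.

Lemma sum_mem_le {R : realType} (T : eqType) (s : seq T) (F : T -> R) x :
  (forall y, 0 <= F y) -> x \in s -> F x <= \sum_(y <- s) F y.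
Proof.
move=> F0; elim: s => // a s IH; rewrite inE big_cons => /predU1P[->|/IH h].
  by rewrite lerDl; apply: sumr_ge0.
by apply: le_trans h _; rewrite lerDr.
Qed.

Lemma sum_le_seq {R : realType} (A : cstarAlgType R) (T : eqType) (s : seq T) (F : T -> A) (G : T -> R) :
  (forall x, x \in s -> cnorm (F x) <= G x) -> cnorm (\sum_(x <- s) F x) <= \sum_(x <- s) G x.
Proof.
move=> H; apply: le_trans (cnorm_sum _ _ _) _.
by rewrite big_seq [leRHS]big_seq; apply: ler_sum.
Qed.

(** * Central families seen from a subalgebra of A *)

Section Interface.
Context {R : realType}.

(* [mu (j, i)] imitates left multiplication by the elements of a central family,
   and [gam i i'] by the products of their adjoints. *)
Definition zstable_on (A : cstarAlgType R) (S : set A) (c : R) : Prop :=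
  forall K (F : seq A) (eta : R), (0 < K)%N -> (forall x, x \in F -> S x) -> 0 < eta ->
  exists (mu : 'I_K * 'I_K.+1 -> A -> A) (gam : 'I_K.+1 -> 'I_K.+1 -> A -> A),
  [/\ forall ji x, S x -> cnorm (mu ji x) <= c * cnorm x,
      forall i i' x, S x -> cnorm (gam i i' x) <= c * cnorm x,
      forall i i' a x y, S x -> S y -> gam i i' (a *: x + y) = a *: gam i i' x + gam i i' y,
      forall x z y j j' i i', x \in F -> z \in F -> y \in F ->
        cnorm (cmul (cstar (mu (j, i) x)) (cmul z (mu (j', i') y)) -
          (if j == j' then gam i i' (cmul (cstar x) (cmul z y)) else 0)) <= eta &
      forall w, w \in F -> cnorm (\sum_i gam i i w - w) <= eta].

Lemma cnorm_mul_le (A : cstarAlgType R) (x y : A) a b :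
  cnorm x <= a -> cnorm y <= b -> cnorm (cmul x y) <= a * b.
Proof.
by move=> xa yb; apply: le_trans (cnorm_mul _ _) _; apply: ler_pM; rewrite ?cnorm_ge0.
Qed.

Lemma tele4 (V : zmodType) (a b c d e : V) : a - e = (a - b) + ((b - c) + ((c - d) + (d - e))).
Proof. by rewrite !addrA !subrK. Qed.

(** Four replacements, each changing one pair of neighbouring factors: three cost 4 b^2 e and the
    last costs b^3 e, whence 13. *)
Lemma triple_err (Z : cstarAlgType R) (x z y m m' g : Z) (b e : R) :
  1 <= b -> 0 <= e -> cnorm x <= b -> cnorm z <= b -> cnorm y <= b ->
  cnorm m <= 4 -> cnorm m' <= 4 ->
  cnorm (cmul m x - cmul x m) <= e -> cnorm (cmul m' (cstar x) - cmul (cstar x) m') <= e ->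
  cnorm (cmul m' z - cmul z m') <= e -> cnorm (cmul (cstar m) m' - g) <= e ->
  cnorm (cmul (cstar (cmul m x)) (cmul z (cmul m' y)) - cmul g (cmul (cstar x) (cmul z y))) <=
    13 * b ^+ 3 * e.
Proof.
move=> b1 e0 xb zb yb mb m'b c1 c2 c3 c4.
set xs := cstar x in c2 *; set ms := cstar m in c4 *.
have xsb : cnorm xs <= b by rewrite cnorm_star.
have msb : cnorm ms <= 4 by rewrite cnorm_star.
have c1' : cnorm (cmul xs ms - cmul ms xs) <= e.
  by rewrite -!cstarM -cstarB cnorm_star.
have b0 : 0 <= b by lra.
have -> : cmul (cstar (cmul m x)) (cmul z (cmul m' y)) - cmul g (cmul xs (cmul z y)) =
   cmul (cmul xs ms - cmul ms xs) (cmul z (cmul m' y)) +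
   (cmul ms (cmul xs (cmul (cmul z m' - cmul m' z) y)) +
   (cmul ms (cmul (cmul xs m' - cmul m' xs) (cmul z y)) +
    cmul (cmul ms m' - g) (cmul xs (cmul z y)))).
  rewrite cstarM -/xs -/ms !cmulBl !cmulBr !cmulA.
  exact: tele4.
have cb2 : cnorm (cmul z (cmul m' y)) <= b * (4 * b) by do !apply: cnorm_mul_le.
have t1 : cnorm (cmul (cmul xs ms - cmul ms xs) (cmul z (cmul m' y))) <= e * (b * (4 * b)).
  exact: cnorm_mul_le.
have t2 : cnorm (cmul ms (cmul xs (cmul (cmul z m' - cmul m' z) y))) <= 4 * (b * (e * b)).
  by do !apply: cnorm_mul_le => //; rewrite cnormB.
have t3 : cnorm (cmul ms (cmul (cmul xs m' - cmul m' xs) (cmul z y))) <= 4 * (e * (b * b)).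
  by do !apply: cnorm_mul_le => //; rewrite cnormB.
have t4 : cnorm (cmul (cmul ms m' - g) (cmul xs (cmul z y))) <= e * (b * (b * b)).
  by do !apply: cnorm_mul_le.
have be : b * b * e <= b ^+ 3 * e.
  rewrite ler_wpM2r // exprS expr2 ler_peMl ?mulr_ge0 //.
apply: le_trans (cnormD _ _) _; apply: le_trans (lerD t1 (cnormD _ _)) _.
apply: le_trans (lerD (lexx _) (lerD t2 (cnormD _ _))) _.
apply: le_trans (lerD (lexx _) (lerD (lexx _) (lerD t3 t4))) _.
move: be; rewrite !exprS expr0 mulr1; lra.
Qed.

(** S is the image of the algebraic tensor product: dense in i(B), and stable under multiplication
    by 1 (x) m. The constant 32 is twice the bound 4 * 4 on a product of two members of a central
    family, the 2 being that of [tmul_bound]. *)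
Lemma ZB (Z B A : cstarAlgType R) (i : B -> A) : jiang_su Z -> separable_stable Z B ->
  cstar_embedding i -> exists S : set A,
  [/\ forall a x y, S x -> S y -> S (a *: x + y), forall x y, S x -> S y -> S (cmul x y),
      forall x, S x -> S (cstar x),
      forall b (d : R), 0 < d -> exists2 x, S x & cnorm (i b - x) < d & zstable_on S 32].
Proof.
move=> hZ [_ [E [t [[Ht _] [f [fP [finv fK fK']]]]]]] [iP iN].
have finvP : star_hom finv.
  split.
  - by move=> a x y; apply: (can_inj fK); rewrite fK' (hom_add fP) (homZ fP) !fK'.
  - by move=> x y; apply: (can_inj fK); rewrite (hom_mul fP) !fK'.
  - by move=> x; apply: (can_inj fK); rewrite (hom_star fP) !fK'.
pose h w := i (f w).
have hP : star_hom h.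
  split.
  - by move=> a x y; rewrite /h (hom_add fP) (homZ fP) (hom_add iP) (homZ iP).
  - by move=> x y; rewrite /h (hom_mul fP) (hom_mul iP).
  - by move=> x; rewrite /h (hom_star fP) (hom_star iP).
have hN w : cnorm (h w) = cnorm w.
  rewrite /h iN; apply/eqP; rewrite eq_le (hom_norm fP) /=.
  by rewrite -{1}(fK w) (hom_norm finvP).
have hI : injective h.
  move=> x y /eqP; rewrite -subr_eq0 -(homB hP) -cnorm_eq0 hN cnorm_eq0 subr_eq0.
  by move/eqP.
pose S : set A := [set x | exists s, x = h (tsum t s)].
have [e0 [_ [ue _]]] : exists e m, cunit e /\ @central_family R Z 1 1 [::] e m.
  by apply: Zcentral.
exists S; split.
- move=> a x y [s ->] [s' ->].
  have [s2 E2] := salg_lin Ht a (ex_intro _ s erefl) (ex_intro _ s' erefl : salg t (tsum t s')).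
  by exists s2; rewrite -E2 (hom_add hP) (homZ hP).
- move=> x y [s ->] [s' ->].
  have [s2 E2] := salg_mul Ht (ex_intro _ s erefl) (ex_intro _ s' erefl : salg t (tsum t s')).
  by exists s2; rewrite -E2 (hom_mul hP).
- move=> x [s ->]; have [s2 E2] := salg_star Ht (ex_intro _ s erefl : salg t (tsum t s)).
  by exists s2; rewrite -E2 (hom_star hP).
- move=> b d d0; have [v [s ->] vd] := salg_dense Ht (finv b) d0.
  exists (h (tsum t s)); first by exists s.
  by rewrite -[b in i b]fK' -/(h (finv b)) -(homB hP) hN.
have /choice[rp rpP] (x : A) : exists s, S x -> x = h (tsum t s).
  have [[s ->]|nS] := pselect (S x); first by exists s.
  by exists [::].
move=> K F eta K0 FS eta0.
pose zs : seq Z := flatten [seq [seq y.2 | y <- rp x] | x <- F].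
pose fs := zs ++ [seq cstar y | y <- zs].
pose b : R := 1 + \sum_(y <- zs) cnorm y.
have b1 : 1 <= b by rewrite lerDl; apply: sumr_ge0 => y _; exact: cnorm_ge0.
(* [ct] and [cs] measure the decompositions chosen by [rp]; they are fixed before the central
   family, whose accuracy eta / c is then known. *)
pose ct (u : A * A * A) : R := \sum_(x <- rp u.1.1) \sum_(z <- rp u.1.2) \sum_(y <- rp u.2)
   2 * (13 * b ^+ 3) * cnorm (t (cmul (cstar x.1) (cmul z.1 y.1)) e0).
pose cs (w : A) : R := \sum_(x <- rp w) 2 * b * cnorm (t x.1 e0).
have ct0 u : 0 <= ct u.
  apply: sumr_ge0 => x _; apply: sumr_ge0 => z _; apply: sumr_ge0 => y _.
  by rewrite !mulr_ge0 ?cnorm_ge0 ?exprn_ge0 //; lra.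
have cs0 w : 0 <= cs w.
  by apply: sumr_ge0 => x _; rewrite !mulr_ge0 ?cnorm_ge0 //; lra.
pose c : R := 1 + (\sum_(u <- [seq (v, y) | v <- [seq (x, z) | x <- F, z <- F], y <- F]) ct u + \sum_(w <- F) cs w).
have c0 : 0 < c by rewrite ltr_wpDr // addr_ge0 //; apply: sumr_ge0.
have ec0 : 0 < eta / c by rewrite divr_gt0.
have [e [m [ue' [m1 m2 m3 m4 m5]]]] := @Zcentral R Z K _ fs hZ K0 ec0.
have ee : e = e0 by have [<- _] := ue e; have [_ ->] := ue' e0.
pose j0 := Ordinal K0.
(* Row j0 represents all rows, up to the error of [cf_same]. *)
pose g k k' := cmul (cstar (m (j0, k))) (m (j0, k')).
have gn k k' : cnorm (g k k') <= 16.
  have -> : 16 = 4 * 4 :> R by rewrite -natrM.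
  by apply: cnorm_mul_le => //; rewrite cnorm_star.
have /choice[hv hvP] (x : A) : exists w, S x -> salg t w /\ h w = x.
  have [[s ->]|nS] := pselect (S x); last by exists 0.
  by exists (tsum t s) => _; split => //; exists s.
pose mu ji x := h (tact t (m ji) (hv x)).
pose gam k k' x := h (tact t (g k k') (hv x)).
have hvE s : hv (h (tsum t s)) = tsum t s.
  by have [|_ /hI] := hvP (h (tsum t s)); first by exists s.
exists mu, gam; split.
- move=> ji x Sx; have [Sw wE] := hvP x Sx; rewrite /mu hN -[x in X in _ <= X]wE hN.
  apply: le_trans (tact_norm Ht ue _ Sw) _; apply: ler_wpM2r; first exact: cnorm_ge0.
  by have := m1 ji; lra.
- move=> k k' x Sx; have [Sw wE] := hvP x Sx; rewrite /gam hN -[x in X in _ <= X]wE hN.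
  apply: le_trans (tact_norm Ht ue _ Sw) _; apply: ler_wpM2r; first exact: cnorm_ge0.
  by have := gn k k'; lra.
- move=> k k' a x y [s ->] [s' ->]; rewrite /gam -(homZ hP) -(hom_add hP).
  have Sl : salg t (a *: tsum t s + tsum t s').
    by apply: (salg_lin Ht); [exists s|exists s'].
  have [s2 E2] := Sl; rewrite {1}E2 !hvE -E2 (tact_lin Ht ue); [|by exists s|by exists s'].
  by rewrite (hom_add hP) (homZ hP).
- move=> x z y j j' k k' xF zF yF.
  pose G := if j == j' then g k k' else 0.
  have muE ji w : w \in F -> mu ji w = h (tsum t (tmul (m ji) (rp w))).
    by move=> wF; rewrite /mu {1}(rpP w (FS w wF)) hvE (tactE Ht ue).
  have gamE : (if j == j' then gam k k' (cmul (cstar x) (cmul z y)) else 0) =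
      h (\sum_(a <- rp x) \sum_(w <- rp z) \sum_(v <- rp y)
        t (cmul (cstar a.1) (cmul w.1 v.1)) (cmul G (cmul (cstar a.2) (cmul w.2 v.2)))).
    rewrite /G; case: (j == j'); last first.
      rewrite big1 ?(hom0 hP) // => a _; rewrite big1 // => w _; rewrite big1 // => v _.
      by rewrite cmul0l (t0r Ht).
    rewrite (rpP x (FS x xF)) (rpP z (FS z zF)) (rpP y (FS y yF)).
    rewrite -(hom_star hP) -!(hom_mul hP) /gam.
    have [s sE] : salg t (cmul (cstar (tsum t (rp x))) (cmul (tsum t (rp z)) (tsum t (rp y)))).
      by apply: (salg_mul Ht); [apply: (salg_star Ht); exists (rp x)|apply: (salg_mul Ht); [exists (rp z)|exists (rp y)]].
    rewrite sE hvE -sE; congr h.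
    by rewrite (tact_gram3 Ht ue) -!(rpP _ (FS _ _)).
  have zE : cmul z (h (tsum t (tmul (m (j', k')) (rp y)))) =
      h (cmul (tsum t (rp z)) (tsum t (tmul (m (j', k')) (rp y)))).
    by rewrite (hom_mul hP) -(rpP z (FS z zF)).
  rewrite !muE // gamE zE -(hom_star hP) -(hom_mul hP) -(homB hP) hN (tsum_gram3 Ht) !big_map.
  rewrite -sumrB; apply: (@le_trans _ _ (ct (x, z, y) * (eta / c))); last first.
    rewrite mulrCA ger_pMr // ler_pdivrMr // mul1r.
    have h1 : ct (x, z, y) <= \sum_(u <- [seq (v, y) | v <- [seq (x, z) | x <- F, z <- F], y <- F]) ct u.
      by apply: sum_mem_le => //; apply/allpairsP; exists ((x, z), y); split => //; apply/allpairsP; exists (x, z).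
    have h2 : 0 <= \sum_(w <- F) cs w by apply: sumr_ge0.
    by rewrite /c; lra.
  have inzs w u : w \in F -> u \in rp w -> u.2 \in zs.
    by move=> wF uw; apply/flattenP; exists [seq y.2 | y <- rp w]; apply: map_f.
  have bd u : u \in zs -> cnorm u <= b.
    move=> us; have := sum_mem_le (fun y => cnorm_ge0 y) us; rewrite /b; lra.
  have fz u : u \in zs -> u \in fs by rewrite /fs mem_cat => ->.
  have fzs u : u \in zs -> cstar u \in fs.
    by rewrite /fs mem_cat => us; rewrite (map_f (@cstar R Z)) // orbT.
  rewrite /ct mulr_suml; apply: sum_le_seq => a ax; rewrite -sumrB mulr_suml.
  apply: sum_le_seq => w wz; rewrite big_map -sumrB mulr_suml; apply: sum_le_seq => v vy /=.
  rewrite -(tBr Ht); apply: le_trans (telem_norm Ht ue _ _) _.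
  rewrite [leRHS]mulrAC; apply: ler_wpM2r; first exact: cnorm_ge0.
  rewrite -[leRHS]mulrA; apply: ler_wpM2l => //.
  apply: (triple_err b1 (ltW ec0)).
  + exact: bd (inzs _ _ xF ax).
  + exact: bd (inzs _ _ zF wz).
  + exact: bd (inzs _ _ yF vy).
  + exact: m1.
  + exact: m1.
  + exact: m2 (fz _ (inzs _ _ xF ax)).
  + exact: m2 (fzs _ (inzs _ _ xF ax)).
  + exact: m2 (fz _ (inzs _ _ zF wz)).
  + rewrite /G; case: eqP => [->|/eqP jj]; first exact: m4.
    by rewrite subr0; exact: m3.
- move=> w wF; have bd u : u \in rp w -> cnorm u.2 <= b.
    move=> uw; have us : u.2 \in zs.
      by apply/flattenP; exists [seq y.2 | y <- rp w]; apply: map_f.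
    have := sum_mem_le (fun y => cnorm_ge0 y) us; rewrite /b; lra.
  have -> : \sum_k gam k k w - w =
      h (\sum_(x <- rp w) t x.1 (cmul (\sum_k g k k - e0) x.2)).
    have E1 k : gam k k w = h (\sum_(x <- rp w) t x.1 (cmul (g k k) x.2)).
      by rewrite /gam {1}(rpP w (FS w wF)) hvE (tactE Ht ue) /tsum big_map.
    under eq_bigr do rewrite E1.
    rewrite -(hom_sum hP) {2}(rpP w (FS w wF)) -(homB hP); congr h.
    rewrite exchange_big /tsum /= -sumrB; apply: eq_bigr => x _.
    rewrite cmulBl (tBr Ht) cmul_suml (tsumr Ht); congr (_ - t _ _).
    by have [-> _] := ue x.2.
  rewrite hN; apply: (@le_trans _ _ (cs w * (eta / c))); last first.
    rewrite mulrCA ger_pMr // ler_pdivrMr // mul1r.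
    have h1 : cs w <= \sum_(w <- F) cs w by apply: sum_mem_le.
    have h2 : 0 <= \sum_(u <- [seq (v, y) | v <- [seq (x, z) | x <- F, z <- F], y <- F]) ct u by apply: sumr_ge0.
    by rewrite /c; lra.
  rewrite /cs mulr_suml; apply: sum_le_seq => x xw; apply: le_trans (telem_norm Ht ue _ _) _.
  rewrite [leRHS]mulrAC; apply: ler_wpM2r; first exact: cnorm_ge0.
  rewrite -[leRHS]mulrA; apply: ler_wpM2l => //; rewrite [leRHS]mulrC.
  apply: cnorm_mul_le; last exact: bd.
  by rewrite -ee; exact: m5.
Qed.
End Interface.

(** * Cuntz comparison by entries *)

Section UMatrix.
Context {R : realType} {A : cstarAlgType R}.
Local Notation U := (uniz A).

Definition madj m n (X : 'M[U]_(m, n)) : 'M[U]_(n, m) := (map_mx ustar X)^T.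
(** A norm for rectangular matrices, invariant under adjoints and submultiplicative. By [mxcnorm_le]
    and [mn_mxcnorm] it is equivalent to the C*-norm on matrices over A, so comparison can be tested
    with it. *)
Definition mn m n (X : 'M[U]_(m, n)) : R := \sum_i \sum_j un (X i j).
Definition mA m n (X : 'M[A]_(m, n)) : 'M[U]_(m, n) := map_mx inA X.
(** Computations need the unit of the unitization, while the witnesses of a Cuntz comparison must
    have their entries in A. *)
Definition isA m n (X : 'M[U]_(m, n)) : Prop := forall i j, (X i j).2 = 0.

Lemma madjE m n (X : 'M[U]_(m, n)) i j : madj X i j = ustar (X j i).
Proof. by rewrite !mxE. Qed.
Lemma madjK m n (X : 'M[U]_(m, n)) : madj (madj X) = X.
Proof. by apply/matrixP => i j; rewrite !madjE ustarK. Qed.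
Lemma madjD m n (X Y : 'M[U]_(m, n)) : madj (X + Y) = madj X + madj Y.
Proof. by apply/matrixP => i j; rewrite !mxE ustarD. Qed.
Lemma madjN m n (X : 'M[U]_(m, n)) : madj (- X) = - madj X.
Proof. by apply/matrixP => i j; rewrite !mxE ustarN. Qed.
Lemma madjB m n (X Y : 'M[U]_(m, n)) : madj (X - Y) = madj X - madj Y.
Proof. by rewrite madjD madjN. Qed.
Lemma madj0 m n : madj (0 : 'M[U]_(m, n)) = 0.
Proof. by apply/matrixP => i j; rewrite !mxE ustar0. Qed.
Lemma madj_scalar n (c : U) : madj (c%:M : 'M[U]_n) = (ustar c)%:M.
Proof.
apply/matrixP => i j; rewrite !mxE eq_sym; case: (_ == _); rewrite ?mulr1n ?mulr0n //.
exact: ustar0.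
Qed.
Lemma madj1 n : madj (1%:M : 'M[U]_n) = 1%:M.
Proof. by rewrite madj_scalar ustar1. Qed.
Lemma madjM m n p (X : 'M[U]_(m, n)) (Y : 'M[U]_(n, p)) : madj (X *m Y) = madj Y *m madj X.
Proof.
apply/matrixP => i j; rewrite !mxE ustar_sum; apply: eq_bigr => k _.
by rewrite ustarM !mxE.
Qed.
Lemma madj_sum m n I (r : seq I) (P : pred I) (F : I -> 'M[U]_(m, n)) :
  madj (\sum_(i <- r | P i) F i) = \sum_(i <- r | P i) madj (F i).
Proof. exact: (big_morph _ (@madjD m n) (@madj0 m n)). Qed.

Lemma mn_ge0 m n (X : 'M[U]_(m, n)) : 0 <= mn X.
Proof. by apply: sumr_ge0 => i _; apply: sumr_ge0 => j _; exact: un_ge0. Qed.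
Lemma mn_entry m n (X : 'M[U]_(m, n)) i j : un (X i j) <= mn X.
Proof.
rewrite /mn (bigD1 i) //= (bigD1 j) //= -addrA lerDl addr_ge0 //.
  by apply: sumr_ge0 => k _; exact: un_ge0.
by apply: sumr_ge0 => k _; apply: sumr_ge0 => l _; exact: un_ge0.
Qed.
Lemma mn_le m n (X : 'M[U]_(m, n)) (F : 'I_m -> 'I_n -> R) :
  (forall i j, un (X i j) <= F i j) -> mn X <= \sum_i \sum_j F i j.
Proof. by move=> H; apply: ler_sum => i _; apply: ler_sum => j _. Qed.
Lemma mnD m n (X Y : 'M[U]_(m, n)) : mn (X + Y) <= mn X + mn Y.
Proof.
rewrite /mn -big_split; apply: ler_sum => i _; rewrite -big_split; apply: ler_sum => j _.
by rewrite mxE; exact: unD.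
Qed.
Lemma mnN m n (X : 'M[U]_(m, n)) : mn (- X) = mn X.
Proof. by apply: eq_bigr => i _; apply: eq_bigr => j _; rewrite mxE unN. Qed.
Lemma mn_sub m n (X Y : 'M[U]_(m, n)) : mn (X - Y) = mn (Y - X).
Proof. by rewrite -mnN opprB. Qed.
Lemma mn0 m n : mn (0 : 'M[U]_(m, n)) = 0.
Proof. by rewrite /mn big1 // => i _; rewrite big1 // => j _; rewrite mxE un0. Qed.
Lemma mn_eq0 m n (X : 'M[U]_(m, n)) : mn X = 0 -> X = 0.
Proof.
move=> X0; apply/matrixP => i j; rewrite mxE; apply: un_eq0.
by apply/eqP; rewrite eq_le un_ge0 andbT -X0 mn_entry.
Qed.
Lemma mn_adj m n (X : 'M[U]_(m, n)) : mn (madj X) = mn X.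
Proof.
rewrite /mn exchange_big; apply: eq_bigr => i _; apply: eq_bigr => j _.
by rewrite madjE un_star.
Qed.
Lemma mn_sum m n I (r : seq I) (P : pred I) (F : I -> 'M[U]_(m, n)) :
  mn (\sum_(i <- r | P i) F i) <= \sum_(i <- r | P i) mn (F i).
Proof.
elim/big_rec2: _ => [|i u v _ h]; first by rewrite mn0.
exact: le_trans (mnD _ _) (lerD _ _).
Qed.
Lemma mnM m n p (X : 'M[U]_(m, n)) (Y : 'M[U]_(n, p)) : mn (X *m Y) <= mn X * mn Y.
Proof.
rewrite /mn mulr_suml; apply: ler_sum => i _.
apply: (@le_trans _ _ (\sum_(k < p) \sum_(j < n) un (X i j) * un (Y j k))).
  apply: ler_sum => k _; rewrite mxE; apply: le_trans (un_sum _ _ _) _.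
  by apply: ler_sum => j _; exact: unM.
rewrite exchange_big mulr_suml /=; apply: ler_sum => j _; rewrite -mulr_sumr.
apply: ler_wpM2l; first exact: un_ge0.
rewrite (bigD1 j) //= lerDl.
by apply: sumr_ge0 => l _; apply: sumr_ge0 => k _; exact: un_ge0.
Qed.

Lemma mA_mul m n p (X : 'M[A]_(m, n)) (Y : 'M[A]_(n, p)) : mA (mxcmul X Y) = mA X *m mA Y.
Proof.
apply/matrixP => i j; rewrite !mxE inA_sum; apply: eq_bigr => k _.
by rewrite inAM !mxE.
Qed.
Lemma mA_star m n (X : 'M[A]_(m, n)) : mA (mxcstar X) = madj (mA X).
Proof. by apply/matrixP => i j; rewrite !mxE inA_star. Qed.
Lemma mAB m n (X Y : 'M[A]_(m, n)) : mA (X - Y) = mA X - mA Y.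
Proof. by apply/matrixP => i j; rewrite !mxE inAB. Qed.
Lemma mA0 m n : mA (0 : 'M[A]_(m, n)) = 0.
Proof. by apply/matrixP => i j; rewrite !mxE. Qed.
Lemma isA_mA m n (X : 'M[A]_(m, n)) : isA (mA X).
Proof. by move=> i j; rewrite mxE. Qed.
Lemma isAE m n (X : 'M[U]_(m, n)) : isA X -> exists Y, X = mA Y.
Proof.
move=> H; exists (\matrix_(i, j) (X i j).1); apply/matrixP => i j; rewrite !mxE.
exact: inAE.
Qed.
Lemma snd_sum I (r : seq I) (P : pred I) (F : I -> U) :
  (\sum_(i <- r | P i) F i).2 = \sum_(i <- r | P i) (F i).2.
Proof. by apply: (big_morph snd). Qed.
Lemma isA_mull m n p (X : 'M[U]_(m, n)) (Y : 'M[U]_(n, p)) : isA Y -> isA (X *m Y).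
Proof.
move=> H i j; rewrite mxE snd_sum big1 // => k _.
by have := H k j; case: (Y k j) => y c /= ->; rewrite mulr0.
Qed.
Lemma isA_mulr m n p (X : 'M[U]_(m, n)) (Y : 'M[U]_(n, p)) : isA X -> isA (X *m Y).
Proof.
move=> H i j; rewrite mxE snd_sum big1 // => k _.
by have := H i k; case: (X i k) => y c /= ->; rewrite mul0r.
Qed.
Lemma isA_add m n (X Y : 'M[U]_(m, n)) : isA X -> isA Y -> isA (X + Y).
Proof. by move=> HX HY i j; rewrite mxE /= HX HY addr0. Qed.
Lemma isA_sum m n I (r : seq I) (P : pred I) (F : I -> 'M[U]_(m, n)) :
  (forall i, isA (F i)) -> isA (\sum_(i <- r | P i) F i).
Proof.
move=> H; elim/big_rec: _ => [i j|k X _]; first by rewrite mxE.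
exact: isA_add.
Qed.

(* Cuntz comparison of matrices of arbitrary sizes. *)
Definition aple n m (a : 'M[U]_n) (b : 'M[U]_m) : Prop := forall e : R, 0 < e ->
  exists2 y : 'M[U]_(m, n), isA y & mn (a - madj y *m b *m y) < e.

Lemma colnormE n (v : 'cV[A]_n) : colnorm v ^+ 2 = un (\sum_i ustar (inA (v i ord0)) * inA (v i ord0)).
Proof.
rewrite sqr_sqrtr ?cnorm_ge0 // mxE -un_inA inA_sum; congr un; apply: eq_bigr => i _.
by rewrite inAM mxE inA_star.
Qed.
Lemma colnorm_ge0 n (v : 'cV[A]_n) : 0 <= colnorm v. Proof. exact: sqrtr_ge0. Qed.
Lemma colnorm_entry n (v : 'cV[A]_n) j : cnorm (v j ord0) <= n%:R * colnorm v.
Proof.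
have := un_sum_starmul (fun i => inA (v i ord0)) j; rewrite -colnormE un_inA => h.
have n1 : 1 <= n%:R :> R by rewrite ler1n; case: n v j {h} => // ? [].
rewrite -(@ler_pXn2r _ 2) ?nnegrE ?cnorm_ge0 ?mulr_ge0 ?colnorm_ge0 //.
apply: le_trans h _; rewrite exprMn; apply: ler_wpM2r; first exact: sqr_ge0.
by rewrite expr2 ler_peMl // ler0n.
Qed.
Lemma colnorm_le n (v : 'cV[A]_n) : colnorm v <= \sum_i cnorm (v i ord0).
Proof.
have s0 : 0 <= \sum_i cnorm (v i ord0) by apply: sumr_ge0 => i _; exact: cnorm_ge0.
rewrite -(@ler_pXn2r _ 2) ?nnegrE ?colnorm_ge0 // colnormE.
apply: le_trans (un_sum _ _ _) _; rewrite expr2 mulr_suml; apply: ler_sum => i _.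
rewrite un_starmul un_inA expr2; apply: ler_wpM2l; first exact: cnorm_ge0.
by rewrite (bigD1 i) //= lerDl; apply: sumr_ge0 => j _; exact: cnorm_ge0.
Qed.

Lemma colnorm_mul n (D : 'M[A]_n) (v : 'cV[A]_n) : colnorm v <= 1 ->
  colnorm (mxcmul D v) <= n%:R * mn (mA D).
Proof.
move=> v1; apply: le_trans (colnorm_le _) _; rewrite /mn mulr_sumr; apply: ler_sum => i _.
rewrite mxE; apply: le_trans (cnorm_sum _ _ _) _; rewrite mulr_sumr; apply: ler_sum => j _.
rewrite mxE un_inA mulrC; apply: cnorm_mul_le => //.
by apply: le_trans (colnorm_entry _ _) _; rewrite ler_piMr.
Qed.

Lemma colnorm0 n : colnorm (0 : 'cV[A]_n) = 0.
Proof.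
apply/eqP; rewrite eq_le colnorm_ge0 andbT; apply: le_trans (colnorm_le _) _.
by rewrite big1 // => i _; rewrite mxE cnorm0.
Qed.

Lemma mxcnorm_le n (D : 'M[A]_n) : mxcnorm D <= n%:R * mn (mA D).
Proof.
apply: sup_le_ub.
  by exists (colnorm (mxcmul D 0)), 0 => //=; rewrite colnorm0.
by move=> _ [v /= v1 <-]; exact: colnorm_mul.
Qed.

Lemma mxcnorm_ge n (D : 'M[A]_n) v : colnorm v <= 1 -> colnorm (mxcmul D v) <= mxcnorm D.
Proof.
move=> v1; apply: sup_upper_bound; last by exists v.
split; first by exists (colnorm (mxcmul D v)), v.
by exists (n%:R * mn (mA D)) => _ [w /= w1 <-]; exact: colnorm_mul.
Qed.

Lemma mxcnorm_ge0 n (D : 'M[A]_n) : 0 <= mxcnorm D.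
Proof.
apply: le_trans (colnorm_ge0 (mxcmul D 0)) _.
by apply: mxcnorm_ge; rewrite colnorm0.
Qed.

(** Test on the vector whose only nonzero entry is the normalized adjoint of D i j. *)
Lemma mxcnorm_entry n (D : 'M[A]_n) i j : cnorm (D i j) <= n%:R * mxcnorm D.
Proof.
have [->|d0] := eqVneq (D i j) 0; first by rewrite cnorm0 mulr_ge0 ?mxcnorm_ge0.
have n0 : 0 < cnorm (D i j) by rewrite cnorm_gt0.
have nV : normc ((cnorm (D i j))^-1%:C : R[i]) = (cnorm (D i j))^-1.
  by rewrite normc_real ger0_norm // invr_ge0 ltW.
pose x := (cnorm (D i j))^-1%:C *: cstar (D i j).
pose v : 'cV[A]_n := \col_k (if k == j then x else 0).
have v1 : colnorm v <= 1.
  apply: le_trans (colnorm_le _) _; rewrite (bigD1 j) //= big1 ?addr0.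
    by rewrite mxE eqxx cnormZ nV cnorm_star mulVf // gt_eqF.
  by move=> k /negbTE kj; rewrite mxE kj cnorm0.
have -> : cnorm (D i j) = cnorm (mxcmul D v i ord0).
  rewrite mxE (bigD1 j) //= big1 ?addr0.
    rewrite mxE eqxx cmulZr cnormZ nV; have := cnorm_starmul (cstar (D i j)).
    by rewrite cstarK cnorm_star => ->; rewrite expr2 mulKf // gt_eqF.
  by move=> k /negbTE kj; rewrite mxE kj cmul0r.
apply: le_trans (colnorm_entry _ _) _; rewrite ler_wpM2l //; exact: mxcnorm_ge.
Qed.

Lemma mn_mxcnorm n (D : 'M[A]_n) : mn (mA D) <= n%:R ^+ 3 * mxcnorm D.
Proof.
apply: (@le_trans _ _ (\sum_(i < n) \sum_(j < n) n%:R * mxcnorm D)).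
  by apply: mn_le => i j; rewrite mxE un_inA; exact: mxcnorm_entry.
have -> : \sum_(i < n) \sum_(j < n) n%:R * mxcnorm D = n%:R ^+ 3 * mxcnorm D; last exact: lexx.
by rewrite !sumr_const !card_ord -mulrnA -[LHS]mulr_natr natrM; ring.
Qed.

Lemma cuntz_leP n (a b : 'M[A]_n) : cuntz_le a b <-> aple (mA a) (mA b).
Proof.
have E x : mA (a - mxcmul (mxcstar x) (mxcmul b x)) = mA a - madj (mA x) *m mA b *m mA x.
  by rewrite mAB !mA_mul mA_star mulmxA.
split.
- move=> [x xl] e e0.
  have n0 : 0 < n%:R ^+ 3 + 1 :> R by rewrite ltr_wpDl // exprn_ge0.
  have /cvgrPdist_lt/(_ (e / (n%:R ^+ 3 + 1)) (divr_gt0 e0 n0))[k _ kP] := xl.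
  have := kP k (leqnn k); rewrite /= sub0r normrN ger0_norm ?mxcnorm_ge0 // => h.
  exists (mA (x k)); first exact: isA_mA.
  rewrite -E; apply: le_lt_trans (mn_mxcnorm _) _.
  rewrite ltr_pdivlMr // in h; apply: le_lt_trans h.
  by rewrite mulrDr mulr1 mulrC lerDl mxcnorm_ge0.
- move=> H; have /choice[x xP] k : exists x, mxcnorm (a - mxcmul (mxcstar x) (mxcmul b x)) < k.+1%:R^-1.
    have n0 : 0 < n%:R + 1 :> R by rewrite ltr_wpDl.
    have k0 : 0 < k.+1%:R^-1 :> R by rewrite invr_gt0.
    have [y /isAE[x ->] h] := H _ (divr_gt0 k0 n0).
    exists x; apply: le_lt_trans (mxcnorm_le _) _; rewrite E.
    rewrite ltr_pdivlMr // in h; apply: le_lt_trans h.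
    by rewrite mulrDr mulr1 mulrC lerDl mn_ge0.
  exists x; apply/cvgrPdist_lt => e e0.
  have /cvgrPdist_lt/(_ e e0)[N _ HN] := @cvg_harmonic R.
  exists N => // k Nk; have := HN k Nk; rewrite /= !sub0r !normrN.
  rewrite (ger0_norm (mxcnorm_ge0 _)) /harmonic ger0_norm; last by rewrite invr_ge0.
  exact: lt_trans (xP k).
Qed.

(** Padding by zeros is conjugation by an isometry, so the comparison does not depend on the sizes
    in which it is read. *)
Lemma aple_conj n m n' m' (a : 'M[U]_n) (b : 'M[U]_m) (P : 'M[U]_(n', n)) (Q : 'M[U]_(m', m)) :
  madj P *m P = 1%:M -> madj Q *m Q = 1%:M ->
  aple (P *m a *m madj P) (Q *m b *m madj Q) <-> aple a b.
Proof.
move=> PP QQ; split=> H e e0.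
- have c0 : 0 < mn (madj P) * mn P + 1 by rewrite ltr_wpDl // mulr_ge0 // mn_ge0.
  have [y ya h] := H _ (divr_gt0 e0 c0).
  exists (madj Q *m y *m P); first by apply: isA_mulr; exact: isA_mull.
  have -> : a - madj (madj Q *m y *m P) *m b *m (madj Q *m y *m P) =
      madj P *m (P *m a *m madj P - madj y *m (Q *m b *m madj Q) *m y) *m P.
    rewrite mulmxBr mulmxBl !madjM madjK !mulmxA PP mul1mx -!(mulmxA a) PP mulmx1.
    by [].
  apply: le_lt_trans (mnM _ _) _; apply: le_lt_trans (ler_wpM2r (mn_ge0 _) (mnM _ _)) _.
  rewrite ltr_pdivlMr // in h; apply: le_lt_trans h.
  have := mn_ge0 (P *m a *m madj P - madj y *m (Q *m b *m madj Q) *m y); nra.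
- have c0 : 0 < mn P * mn (madj P) + 1 by rewrite ltr_wpDl // mulr_ge0 // mn_ge0.
  have [y ya h] := H _ (divr_gt0 e0 c0).
  exists (Q *m y *m madj P); first by apply: isA_mulr; exact: isA_mull.
  have -> : P *m a *m madj P - madj (Q *m y *m madj P) *m (Q *m b *m madj Q) *m (Q *m y *m madj P) =
      P *m (a - madj y *m b *m y) *m madj P.
    rewrite mulmxBr mulmxBl !madjM madjK; congr (_ - _).
    by rewrite !mulmxA -!(mulmxA _ (madj Q) Q) QQ !mulmx1.
  apply: le_lt_trans (mnM _ _) _; apply: le_lt_trans (ler_wpM2r (mn_ge0 _) (mnM _ _)) _.
  rewrite ltr_pdivlMr // in h; apply: le_lt_trans h.
  have := mn_ge0 (a - madj y *m b *m y); nra.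
Qed.

Lemma madj_col_mx m1 m2 n (X : 'M[U]_(m1, n)) (Y : 'M[U]_(m2, n)) :
  madj (col_mx X Y) = row_mx (madj X) (madj Y).
Proof. by rewrite /madj map_col_mx tr_col_mx. Qed.

Lemma block_conj n k (a : 'M[U]_n) : let P := col_mx 1%:M 0 : 'M[U]_(n + k, n) in
  madj P *m P = 1%:M /\ block_mx a 0 0 0 = P *m a *m madj P :> 'M[U]_(n + k).
Proof.
rewrite /= madj_col_mx madj1 madj0; split.
  by rewrite mul_row_col mulmx1 mul0mx addr0.
by rewrite mul_col_mx mul1mx mul0mx mul_col_row mulmx1 mulmx0 !mul0mx.
Qed.

Lemma mA_block n k (a : 'M[A]_n) : mA (block_mx a 0 0 0 : 'M[A]_(n + k)) = block_mx (mA a) 0 0 0.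
Proof. by rewrite /mA map_block_mx -!/(mA _) !mA0. Qed.

Lemma aple_cast n N N' (e : N = N') (a : 'M[U]_n) (b : 'M[U]_N) :
  aple a (castmx (e, e) b) <-> aple a b.
Proof. by case: N' / e; rewrite castmx_id. Qed.

Lemma W_leP n m (a : 'M[A]_n) (b : 'M[A]_m) : W_le a b <-> aple (mA a) (mA b).
Proof.
rewrite /W_le cuntz_leP.
have -> : mA (castmx (addnC m n, addnC m n) (block_mx b 0 0 0 : 'M[A]_(m + n))) =
    castmx (addnC m n, addnC m n) (mA (block_mx b 0 0 0 : 'M[A]_(m + n))) by exact: map_castmx.
rewrite aple_cast !mA_block.
have [P1 ->] := block_conj m (mA a); have [Q1 ->] := block_conj n (mA b).
exact: aple_conj.
Qed.

Lemma mA_diag k n (a : 'M[A]_n) : mA (\mxdiag_(i < k) a) = \mxdiag_(i < k) mA a.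
Proof.
apply/matrixP => i j; rewrite /mA /mxdiag !mxE; case: eqP => [E|_]; last by rewrite !mxE.
by rewrite !conform_mx_id mxE.
Qed.

Lemma madj_mxcol n q (p_ : 'I_q -> nat) (X : forall i, 'M[U]_(p_ i, n)) :
  madj (\mxcol_i X i) = \mxrow_i madj (X i).
Proof.
apply/mxrowP => i; rewrite mxrowK -[in RHS](mxcolK X i).
by apply/matrixP => k l; rewrite !mxE.
Qed.

(** Compression of a witness by the coordinate columns [P i]; the inequality between multiples
    becomes a family of Gram relations, the form in which it is used from here on. *)
Lemma aple_diag n m k (a : 'M[U]_n) (b : 'M[U]_m) :
  aple (\mxdiag_(i < k.+1) a) (\mxdiag_(j < k) b) -> forall e : R, 0 < e ->
  exists x : 'I_k -> 'I_k.+1 -> 'M[U]_(m, n), (forall j i, isA (x j i)) /\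
    forall i i', mn ((if i == i' then a else 0) - \sum_j madj (x j i) *m b *m x j i') < e.
Proof.
move=> H e e0; pose P i : 'M[U]_(\sum_(l < k.+1) n, n) := \mxcol_(l < k.+1) ((if l == i then 1%:M else 0) : 'M[U]_n).
pose c : R := \sum_i mn (P i); have c0 : 0 <= c by apply: sumr_ge0 => i _; exact: mn_ge0.
have Pc i : mn (P i) <= c.
  exact: (@sum_mem_le R _ (index_enum _) (fun i => mn (P i)) i (fun=> mn_ge0 _) (mem_index_enum _)).
have d0 : 0 < c * c + 1 by rewrite ltr_wpDl // mulr_ge0.
have [y ya h] := H _ (divr_gt0 e0 d0).
exists (fun j i => submxcol (y *m P i) j); split.
  by move=> j i r s; have := isA_mulr (P i) ya; rewrite mxE; apply.
move=> i i'.
have -> : (if i == i' then a else 0) = madj (P i) *m (\mxdiag_(i < k.+1) a) *m P i'.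
  rewrite -mulmxA mul_mxdiag_mxcol madj_mxcol mul_mxrow_mxcol (bigD1 i) //= big1 ?addr0.
    rewrite eqxx madj1 mul1mx; case: eqVneq => _; by rewrite ?mulmx1 ?mulmx0.
  by move=> l /negbTE ->; rewrite madj0 mul0mx.
have -> : \sum_j madj (submxcol (y *m P i) j) *m b *m submxcol (y *m P i') j =
    madj (P i) *m (madj y *m (\mxdiag_(j < k) b) *m y) *m P i'.
  have E l : y *m P l = \mxcol_j submxcol (y *m P l) j by rewrite submxcolK.
  transitivity (madj (y *m P i) *m (\mxdiag_(j < k) b *m (y *m P i'))); last by rewrite madjM !mulmxA.
  rewrite [in RHS](E i') [in RHS](E i) mul_mxdiag_mxcol madj_mxcol mul_mxrow_mxcol.
  by apply: eq_bigr => j _; rewrite mulmxA.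
rewrite -mulmxBl -mulmxBr; apply: le_lt_trans (mnM _ _) _.
set D := _ - _ in h *; have D0 := mn_ge0 D.
apply: (@le_lt_trans _ _ (c * mn D * c)).
  apply: ler_pM => //; try exact: mn_ge0.
  apply: le_trans (mnM _ _) _; apply: ler_wpM2r => //; by rewrite mn_adj.
by rewrite ltr_pdivlMr // in h; nra.
Qed.
End UMatrix.

(** * Tracial approximation *)

Section Tracial.
Context {R : realType} {Z A : cstarAlgType R}.
Hypothesis hZ : jiang_su Z.
Hypothesis htr : essentially_tracially_in (separable_stable Z) A.
Local Notation U := (uniz A).

Lemma aple11 (e s : A) : cuntz_le (const_mx e : 'M[A]_1) (const_mx s : 'M[A]_1) ->
  forall d : R, 0 < d -> exists2 u : U, u.2 = 0 & un (inA e - ustar u * inA s * u) < d.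
Proof.
move=> /cuntz_leP H d d0; have [y ya h] := H d d0.
exists (y ord0 ord0); first exact: ya.
apply: le_lt_trans h; apply: le_trans (mn_entry _ ord0 ord0).
by rewrite !mxE big_ord1 !mxE big_ord1 !mxE.
Qed.

Lemma tracial (F : seq A) (eps : R) (s : A) : 0 < eps -> cpositive s -> s <> 0 ->
  exists (e : A) (S : set A) (ap : A -> A),
  [/\ cpositive e /\ cnorm e <= 1,
      exists2 u : U, u.2 = 0 & un (inA e - ustar u * inA s * u) < eps,
      forall x, x \in F -> [/\ cnorm (cmul e x - cmul x e) < eps, S (ap x),
        cnorm ((x - cmul e x) - ap x) < eps & cnorm x - eps <= cnorm (x - cmul e x)],
      [/\ forall a x y, S x -> S y -> S (a *: x + y), forall x y, S x -> S y -> S (cmul x y) &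
        forall x, S x -> S (cstar x)] & zstable_on S 32].
Proof.
move=> e0 sp s0; have e20 : 0 < eps / 2 by rewrite divr_gt0.
have [e [B [i [h1 [iB _ sB] h3 h4 h5]]]] := htr F e20 sp s0.
have [S [S1 S2 S3 S4 S5]] := ZB hZ sB iB.
have /choice[ap apP] (x : A) : exists y, x \in F -> S y /\ cnorm ((x - cmul e x) - y) < eps.
  have [xF|nF] := boolP (x \in F); last by exists 0.
  have [[b hb] _] := h4 x xF; have [y Sy hy] := S4 b _ e20.
  exists y => _; split => //.
  rewrite (_ : x - cmul e x - y = (x - cmul e x - i b) + (i b - y)); last by rewrite addrA subrK.
  by apply: le_lt_trans (cnormD _ _) _; lra.
exists e, S, ap; split => //; first exact: aple11.
move=> x xF; have [a1 a2] := apP x xF; have [_ h] := h4 x xF; split => //.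
  by apply: lt_trans (h3 x xF) _; lra.
by apply: le_trans h; lra.
Qed.

Lemma zero_S (S : set A) : (forall a x y, S x -> S y -> S (a *: x + y)) -> (exists x, S x) -> S 0.
Proof. by move=> H [x Sx]; have := H (-1) x x Sx Sx; rewrite scaleN1r addNr. Qed.

Section Base.
Variables (m n K : nat) (beta : 'M[A]_m) (xh : 'I_K * 'I_K.+1 -> 'M[A]_(m, n)) (al : 'M[A]_n) (y s : A).
Hypotheses (K0 : (0 < K)%N) (sp : cpositive s) (s0 : s <> 0).

Definition Q (b : 'M[U]_m) := madj b *m b.

(* The outcome of a tracial approximation with [c = 1 - e]: [b0] and [x0] are
   approximations of [c beta] and [c xh] in the Z-stable subalgebra, and [M ji]
   imitates [m_ji (x0 ji)] for a central family [m_ji] with Gram matrix [G]. *)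
Record base (eps : R) (e : A) (b0 : 'M[U]_m) (x0 M : 'I_K * 'I_K.+1 -> 'M[U]_(m, n))
  (G : 'I_K.+1 -> 'I_K.+1 -> 'M[U]_n -> 'M[U]_n) (Sm : set 'M[U]_n) : Prop := Base {
  bs_pos : cpositive e /\ cnorm e <= 1;
  bs_u : exists2 u : U, u.2 = 0 & un (inA e - ustar u * inA s * u) < eps;
  bs_y : cnorm y - eps <= un ((1 - inA e) * inA y);
  bs_cb : mn ((1 - inA e)%:M *m mA beta - mA beta *m (1 - inA e)%:M) <= eps;
  bs_cx : forall ji, mn ((1 - inA e)%:M *m mA (xh ji) - mA (xh ji) *m (1 - inA e)%:M) <= eps;
  bs_ca : mn ((1 - inA e)%:M *m mA al - mA al *m (1 - inA e)%:M) <= eps;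
  bs_b0 : mn ((1 - inA e)%:M *m mA beta - b0) <= eps;
  bs_x0 : forall ji, mn ((1 - inA e)%:M *m mA (xh ji) - x0 ji) <= eps;
  bs_M : forall ji, isA (M ji) /\ mn (M ji) <= 32 * mn (x0 ji);
  bs_gram : forall j i j' i', mn (madj (M (j, i)) *m Q b0 *m M (j', i') -
    (if j == j' then G i i' (madj (x0 (j, i)) *m Q b0 *m x0 (j', i')) else 0)) <= eps;
  bs_Sm : forall ji ji', Sm (madj (x0 ji) *m Q b0 *m x0 ji');
  bs_SmB : forall X Y, Sm X -> Sm Y -> Sm (X - Y);
  bs_SmD : forall X Y, Sm X -> Sm Y -> Sm (X + Y);
  bs_GB : forall i i' X Y, Sm X -> Sm Y -> G i i' (X - Y) = G i i' X - G i i' Y;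
  bs_GD : forall i i' X Y, Sm X -> Sm Y -> G i i' (X + Y) = G i i' X + G i i' Y;
  bs_Gn : forall i i' X, Sm X -> mn (G i i' X) <= 32 * mn X;
  bs_sum : forall ji ji', mn (\sum_k G k k (madj (x0 ji) *m Q b0 *m x0 ji') -
    madj (x0 ji) *m Q b0 *m x0 ji') <= eps }.

Lemma mn_unif p r (X : 'M[U]_(p, r)) (d : R) : (forall i j, un (X i j) <= d) -> mn X <= p%:R * r%:R * d.
Proof.
move=> H; apply: le_trans (mn_le H) _.
by rewrite !sumr_const !card_ord -mulrnA -[leLHS]mulr_natl natrM [r%:R * _]mulrC.
Qed.

Lemma entry_c (e x : A) : (1 - inA e) * inA x = inA (x - cmul e x).
Proof. by rewrite inAB inAM mulrBl mul1r. Qed.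

Lemma entry_r (e x : A) : inA x * (1 - inA e) = inA (x - cmul x e).
Proof. by rewrite inAB inAM mulrBr mulr1. Qed.

Lemma sum_ord_const p (c : R) : \sum_(i < p) c = c *+ p.
Proof. by rewrite sumr_const card_ord. Qed.

Lemma mAE p r (X : 'M[A]_(p, r)) i j : mA X i j = inA (X i j).
Proof. by rewrite mxE. Qed.

Lemma mxctripE p q r t (X : 'M[A]_(q, p)) (B : 'M[A]_(q, r)) (Y : 'M[A]_(r, t)) i j :
  mxcmul (mxcstar X) (mxcmul B Y) i j = \sum_k \sum_l cmul (cstar (X k i)) (cmul (B k l) (Y l j)).
Proof.
by rewrite mxE; apply: eq_bigr => k _; rewrite !mxE cmul_sumr.
Qed.

Lemma mul_mx_scalarU p r (X : 'M[U]_(p, r)) (c : U) i j : (X *m c%:M) i j = X i j * c.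
Proof.
rewrite mxE (bigD1 j) //= big1 ?addr0 ?mxE ?eqxx ?mulr1n // => k /negbTE kj.
by rewrite mxE kj mulr0n mulr0.
Qed.

Lemma base_exists (eps : R) : 0 < eps -> exists e b0 x0 M G Sm, base eps e b0 x0 M G Sm.
Proof.
(* D dominates n^2 m^2, the number of terms in the largest entrywise sum below, so that errors eps /
   D add up to at most eps. *)
move=> e0; pose D : R := ((m + n + 1) ^ 4)%:R.
have D1 : 1 <= D by rewrite ler1n expn_gt0 addn1.
have D0 : 0 < D by lra.
have cnt k : (k <= (m + n + 1) ^ 4)%N -> k%:R * (eps / D) <= eps.
  by move=> h; rewrite mulrCA ger_pMr // ler_pdivrMr // mul1r ler_nat.
have cnt2 p r : (p * r <= (m + n + 1) ^ 4)%N -> p%:R * r%:R * (eps / D) <= eps.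
  by move=> h; rewrite -natrM; exact: cnt.
have pw k : (1 <= k)%N -> (k ^ 2 <= k ^ 4)%N by move=> k1; rewrite leq_pexp2l.
have c1 : (m * m <= (m + n + 1) ^ 4)%N.
  by apply: leq_trans (pw _ _); [rewrite expnS expn1; apply: leq_mul; lia|lia].
have c2 : (m * n <= (m + n + 1) ^ 4)%N.
  by apply: leq_trans (pw _ _); [rewrite expnS expn1; apply: leq_mul; lia|lia].
have c3 : (n * n <= (m + n + 1) ^ 4)%N.
  by apply: leq_trans (pw _ _); [rewrite expnS expn1; apply: leq_mul; lia|lia].
have c4 : (n * n * (m * m) <= (m + n + 1) ^ 4)%N.
  rewrite (expnD _ 2 2); apply: leq_mul; rewrite expnS expn1; apply: leq_mul; lia.
have eD0 : 0 < eps / D by rewrite divr_gt0.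
have eDe : eps / D <= eps by rewrite ler_pdivrMr // ler_peMr // ltW.
pose ent p r (X : 'M[A]_(p, r)) : seq A := [seq X ij.1 ij.2 | ij <- enum (('I_p * 'I_r)%type : finType)].
have entP p r (X : 'M[A]_(p, r)) i j : X i j \in ent _ _ X.
  by apply/mapP; exists (i, j); rewrite ?mem_enum.
pose F := y :: ent _ _ beta ++ ent _ _ al ++ flatten [seq ent _ _ (xh ji) | ji <- enum (('I_K * 'I_K.+1)%type : finType)].
have Fb i j : beta i j \in F by rewrite inE mem_cat entP orbT.
have Fa i j : al i j \in F by rewrite inE !mem_cat entP !orbT.
have Fx ji i j : xh ji i j \in F.
  rewrite inE !mem_cat; apply/orP; right; apply/orP; right; apply/orP; right.
  by apply/flattenP; exists (ent _ _ (xh ji)); [apply: map_f; rewrite mem_enum|exact: entP].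
have [e [S [ap [h1 h2 h3 [S1 S2 S3] S5]]]] := tracial F eD0 sp s0.
have S0 : S 0 by apply: zero_S => //; exists (ap y); have [] := h3 y (mem_head _ _).
have SM x x' : S x -> S x' -> S (cmul x x') by exact: S2.
have SD x x' : S x -> S x' -> S (x + x') by move=> h h'; rewrite -[x]scale1r; exact: S1.
have SB x x' : S x -> S x' -> S (x - x').
  by move=> h h'; rewrite -scaleN1r addrC; exact: S1.
have Ssum I (r : seq I) (P : pred I) (f : I -> A) : (forall i, S (f i)) -> S (\sum_(i <- r | P i) f i).
  by move=> H; elim/big_rec: _ => // i x _; exact: SD.
pose b0 : 'M[A]_m := \matrix_(i, j) ap (beta i j).
pose x0 ji : 'M[A]_(m, n) := \matrix_(i, j) ap (xh ji i j).
pose qq : 'M[A]_m := mxcmul (mxcstar b0) b0.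
pose ww ji ji' : 'M[A]_n := mxcmul (mxcstar (x0 ji)) (mxcmul qq (x0 ji')).
have Sb i j : S (b0 i j) by rewrite mxE; have [] := h3 _ (Fb i j).
have Sx ji i j : S (x0 ji i j) by rewrite mxE; have [] := h3 _ (Fx ji i j).
have Ssum2 p (f : 'I_p -> A) : (forall i, S (f i)) -> S (\sum_i f i) by move=> H; exact: Ssum.
have Sq i j : S (qq i j).
  rewrite mxE; apply: Ssum2 => k; rewrite [mxcstar _ _ _]mxE; apply: S2; last exact: Sb.
  by apply: S3; exact: Sb.
have Sw ji ji' i j : S (ww ji ji' i j).
  rewrite mxE; apply: (Ssum2) => k; rewrite [mxcstar _ _ _]mxE.
  have h1' : S (cstar (x0 ji k i)) by apply: S3; exact: Sx.
  apply: (SM _ _ h1'); rewrite [mxcmul _ _ _ _]mxE; apply: Ssum2 => l.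
    by apply: SM; [exact: Sq|exact: Sx].
(* The second finite set lies in S: the middle factor b0^* b0 and the columns x0 for the Gram
   relations, their triple products for [bs_sum]. *)
pose F2 := ent _ _ qq ++ flatten [seq ent _ _ (x0 ji) | ji <- enum (('I_K * 'I_K.+1)%type : finType)] ++
  flatten [seq ent _ _ (ww u.1 u.2) | u <- enum ((('I_K * 'I_K.+1) * ('I_K * 'I_K.+1))%type : finType)].
have F2q i j : qq i j \in F2 by rewrite mem_cat entP.
have F2x ji i j : x0 ji i j \in F2.
  rewrite !mem_cat; apply/orP; right; apply/orP; left.
  by apply/flattenP; exists (ent _ _ (x0 ji)); [apply: map_f; rewrite mem_enum|exact: entP].
have F2w ji ji' i j : ww ji ji' i j \in F2.
  rewrite !mem_cat; apply/orP; right; apply/orP; right.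
  apply/flattenP; exists (ent _ _ (ww ji ji')); last exact: entP.
  by apply/mapP; exists (ji, ji'); rewrite ?mem_enum.
have F2S x : x \in F2 -> S x.
  rewrite !mem_cat => /or3P[/mapP[[i j] _ ->]|/flattenP[l /mapP[ji _ ->] /mapP[[i j] _ ->]]|
    /flattenP[l /mapP[u _ ->] /mapP[[i j] _ ->]]] //=.
have [mu [gam [m1 m2 m3 m4 m5]]] := S5 K F2 _ K0 F2S eD0.
pose mm ji : 'M[A]_(m, n) := \matrix_(i, j) mu ji (x0 ji i j).
have mmE ji i j : mm ji i j = mu ji (x0 ji i j) by rewrite mxE.
pose M ji : 'M[U]_(m, n) := mA (mm ji).
pose G k k' (X : 'M[U]_n) : 'M[U]_n := \matrix_(i, j) inA (gam k k' (X i j).1).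
pose Sm : set 'M[U]_n := [set X | forall i j, exists2 a, S a & X i j = inA a].
have gam0 k k' : gam k k' 0 = 0.
  have := m3 k k' (-1) 0 0 S0 S0; rewrite scaler0 addr0 scaleN1r addNr.
  by [].
have gamD k k' x x' : S x -> S x' -> gam k k' (x + x') = gam k k' x + gam k k' x'.
  by move=> h h'; rewrite -[x in LHS]scale1r m3 // scale1r.
have gamB k k' x x' : S x -> S x' -> gam k k' (x - x') = gam k k' x - gam k k' x'.
  by move=> h h'; rewrite -scaleN1r addrC m3 // scaleN1r addrC.
have gamS k k' I (r : seq I) (P : pred I) (f : I -> A) : (forall i, S (f i)) ->
    gam k k' (\sum_(i <- r | P i) f i) = \sum_(i <- r | P i) gam k k' (f i).
  move=> H; suff [_ ->] : S (\sum_(i <- r | P i) f i) /\ gam k k' (\sum_(i <- r | P i) f i) = \sum_(i <- r | P i) gam k k' (f i) by [].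
  elim/big_rec2: _ => [|i x x' _ [Sx'' E]]; first by split.
  by rewrite gamD //; split; [exact: SD|rewrite E].
have WE ji ji' : madj (mA (x0 ji)) *m Q (mA b0) *m mA (x0 ji') = mA (ww ji ji').
  by rewrite /ww /qq !mA_mul !mA_star /Q !mulmxA.
have cc p r (X : 'M[A]_(p, r)) : (p * r <= (m + n + 1) ^ 4)%N -> (forall i j, X i j \in F) ->
    mn ((1 - inA e)%:M *m mA X - mA X *m (1 - inA e)%:M) <= eps.
  move=> hp XF; apply: le_trans (cnt2 _ _ hp); apply: mn_unif => i j.
  have [h _ _ _] := h3 _ (XF i j).
  rewrite mul_scalar_mx mxE [in X in X + _]mxE [in X in _ + X]mxE mul_mx_scalarU.
  rewrite [mA X i j]mxE entry_c entry_r unB -inAB un_inA opprB addrC addrA subrK.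
  exact: ltW.
have ca p r (X : 'M[A]_(p, r)) : (p * r <= (m + n + 1) ^ 4)%N -> (forall i j, X i j \in F) ->
    mn ((1 - inA e)%:M *m mA X - mA (\matrix_(i, j) ap (X i j))) <= eps.
  move=> hp XF; apply: le_trans (cnt2 _ _ hp); apply: mn_unif => i j.
  have [_ _ h _] := h3 _ (XF i j).
  rewrite mul_scalar_mx mxE [in X in X + _]mxE [in X in _ + X]mxE.
  by rewrite [mA X i j]mxE entry_c mxE mxE -inAB un_inA; exact: ltW.
exists e, (mA b0), (fun ji => mA (x0 ji)), M, G, Sm; split => //.
- have [u u2 hu] := h2; exists u => //; exact: lt_le_trans eDe.
- rewrite entry_c un_inA; have [_ _ _ h] := h3 y (mem_head _ _); apply: le_trans h.
  by rewrite lerD2l lerN2.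
- exact: cc c1 Fb.
- by move=> ji; exact: cc c2 (Fx ji).
- exact: cc c3 Fa.
- exact: ca c1 Fb.
- by move=> ji; exact: ca c2 (Fx ji).
- move=> ji; split; first exact: isA_mA.
  rewrite /mn mulr_sumr; apply: ler_sum => i _; rewrite mulr_sumr; apply: ler_sum => j _.
  by rewrite /M !mAE mmE !un_inA; apply: m1; exact: Sx.
- move=> j i j' i'; apply: le_trans (cnt _ c4); rewrite natrM -mulrA natrM.
  apply: mn_unif => r r'; rewrite WE.
  have -> : madj (M (j, i)) *m Q (mA b0) *m M (j', i') =
      mA (mxcmul (mxcstar (mm (j, i))) (mxcmul qq (mm (j', i')))).
    by rewrite /qq !mA_mul !mA_star /Q !mulmxA.
  have -> : (mA (mxcmul (mxcstar (mm (j, i))) (mxcmul qq (mm (j', i')))) -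
      (if j == j' then G i i' (mA (ww (j, i) (j', i'))) else 0)) r r' =
      inA (\sum_k \sum_l (cmul (cstar (mu (j, i) (x0 (j, i) k r))) (cmul (qq k l) (mu (j', i') (x0 (j', i') l r'))) -
        (if j == j' then gam i i' (cmul (cstar (x0 (j, i) k r)) (cmul (qq k l) (x0 (j', i') l r'))) else 0))).
    rewrite mxE [in X in _ + X]mxE mAE mxctripE.
    under eq_bigr => k _ do under eq_bigr => l _ do rewrite mmE mmE.
    under [in RHS]eq_bigr => k _ do rewrite sumrB.
    rewrite sumrB inAB; congr (_ - _).
    case: (j == j'); last by rewrite big1 ?mxE // => k _; rewrite big1.
    rewrite mxE mAE mxctripE /= gamS => [|k]; last first.
      by apply: (Ssum2) => l; apply: (SM); [apply: S3; exact: Sx|apply: SM; [exact: Sq|exact: Sx]].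
    congr inA; apply: eq_bigr => k _; rewrite gamS // => l.
    by apply: (SM); [apply: S3; exact: Sx|apply: SM; [exact: Sq|exact: Sx]].
  rewrite un_inA natrM -mulrA; apply: le_trans (cnorm_sum _ _ _) _.
  rewrite mulr_natl -[leRHS](sum_ord_const m); apply: ler_sum => k _.
  apply: le_trans (cnorm_sum _ _ _) _.
  rewrite mulr_natl -[leRHS](sum_ord_const m); apply: ler_sum => l _.
  by apply: m4; [exact: F2x|exact: F2q|exact: F2x].
- by move=> ji ji' i j; rewrite WE; exists (ww ji ji' i j); [exact: Sw|rewrite mxE].
- move=> X Y hX hY i j; have [a Sa Ea] := hX i j; have [b Sb' Eb] := hY i j.
  by exists (a - b); [exact: SB|rewrite !mxE Ea Eb inAB].
- move=> X Y hX hY i j; have [a Sa Ea] := hX i j; have [b Sb' Eb] := hY i j.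
  by exists (a + b); [exact: SD|rewrite !mxE Ea Eb inAD].
- move=> i i' X Y hX hY; apply/matrixP => r r'.
  have [a Sa Ea] := hX r r'; have [b Sb' Eb] := hY r r'.
  by rewrite !mxE Ea Eb /= gamB // inAB.
- move=> i i' X Y hX hY; apply/matrixP => r r'.
  have [a Sa Ea] := hX r r'; have [b Sb' Eb] := hY r r'.
  by rewrite !mxE Ea Eb /= gamD // inAD.
- move=> i i' X hX; rewrite /mn mulr_sumr; apply: ler_sum => r _; rewrite mulr_sumr.
  apply: ler_sum => r' _; have [a Sa Ea] := hX r r'.
  by rewrite mxE Ea /= !un_inA; exact: m2.
- move=> ji ji'; rewrite WE; apply: le_trans (cnt2 _ _ c3); apply: mn_unif => r r'.
  rewrite mxE summxE [in X in _ + X]mxE [mA _ r r']mxE.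
  rewrite (eq_bigr (fun k => inA (gam k k (ww ji ji' r r')))); last by move=> k _; rewrite mxE mxE.
  by rewrite -inA_sum -inAB un_inA; apply: m5; exact: F2w.
Qed.
End Base.
End Tracial.

(** * Calculus with sequences up to a fixed error *)

Section Seq.
Context {R : realType} {A : cstarAlgType R}.
Local Notation U := (uniz A).

Definition bds m n (X : nat -> 'M[U]_(m, n)) : Prop := exists2 c : R, 0 <= c & forall v, mn (X v) <= c.
(** With d = 0 this is equality of bounded sequences modulo null sequences. The number d carries the
    error of the hypothesis, which stays fixed while the tracial approximation improves. *)
Definition simd m n (d : R) (X Y : nat -> 'M[U]_(m, n)) : Prop := forall e : R, 0 < e ->
  exists N, forall v, (N <= v)%N -> mn (X v - Y v) <= d + e.
Local Notation sim := (simd 0).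

Lemma bds_const m n (X : 'M[U]_(m, n)) : bds (fun=> X).
Proof. by exists (mn X) => //; exact: mn_ge0. Qed.
Lemma bdsM m n p (X : nat -> 'M[U]_(m, n)) (Y : nat -> 'M[U]_(n, p)) :
  bds X -> bds Y -> bds (fun v => X v *m Y v).
Proof.
move=> [c c0 cP] [d d0 dP]; exists (c * d) => [|v]; first exact: mulr_ge0.
by apply: le_trans (mnM _ _) _; apply: ler_pM; rewrite ?mn_ge0.
Qed.
Lemma bds_adj m n (X : nat -> 'M[U]_(m, n)) : bds X -> bds (fun v => madj (X v)).
Proof. by move=> [c c0 cP]; exists c => // v; rewrite mn_adj. Qed.
Lemma bds_near m n (X Y : nat -> 'M[U]_(m, n)) : bds X ->
  (forall v, mn (X v - Y v) <= v.+1%:R^-1) -> bds Y.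
Proof.
move=> [c c0 cP] H; exists (c + 1) => [|v]; first by rewrite addr_ge0.
rewrite -[Y v](subKr (X v)); apply: le_trans (mnD _ _) _; rewrite mnN; apply: lerD => //.
by apply: le_trans (H v) _; rewrite invf_le1 ?ltr0n // ler1n.
Qed.

Lemma simd_le m n d d' (X Y : nat -> 'M[U]_(m, n)) : d <= d' -> simd d X Y -> simd d' X Y.
Proof.
move=> dd H e e0; have [N HN] := H e e0; exists N => v Nv.
by apply: le_trans (HN v Nv) _; rewrite lerD2r.
Qed.
Lemma simd_ub m n d (X Y : nat -> 'M[U]_(m, n)) : (forall v, mn (X v - Y v) <= d) -> simd d X Y.
Proof. by move=> H e e0; exists 0%N => v _; apply: le_trans (H v) _; rewrite lerDl ltW. Qed.
Lemma simd_eq m n d (X Y : nat -> 'M[U]_(m, n)) : 0 <= d -> (forall v, X v = Y v) -> simd d X Y.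
Proof. by move=> d0 XY; apply: simd_ub => v; rewrite XY subrr mn0. Qed.
Lemma sim_inv m n (X Y : nat -> 'M[U]_(m, n)) :
  (forall v, mn (X v - Y v) <= v.+1%:R^-1) -> sim X Y.
Proof.
move=> H e e0; have /cvgrPdist_lt/(_ e e0)[N _ HN] := @cvg_harmonic R.
exists N => v Nv; rewrite add0r; apply: le_trans (H v) _.
have := HN v Nv; rewrite /= sub0r normrN /harmonic ger0_norm; last by rewrite invr_ge0.
exact: ltW.
Qed.
Lemma simd_sym m n d (X Y : nat -> 'M[U]_(m, n)) : simd d X Y -> simd d Y X.
Proof. by move=> H e e0; have [N HN] := H e e0; exists N => v Nv; rewrite mn_sub; exact: HN. Qed.
Lemma half_add (x z a b e : R) : x <= a + e / 2 -> z <= b + e / 2 -> x + z <= a + b + e.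
Proof. lra. Qed.
Lemma simd_trans m n d d' (Y X Z : nat -> 'M[U]_(m, n)) :
  simd d X Y -> simd d' Y Z -> simd (d + d') X Z.
Proof.
move=> H H' e e0; have e20 : 0 < e / 2 by rewrite divr_gt0.
have [N HN] := H _ e20; have [N' HN'] := H' _ e20; exists (maxn N N') => v.
rewrite geq_max => /andP[Nv Nv'].
have -> : X v - Z v = (X v - Y v) + (Y v - Z v) by rewrite addrA subrK.
by apply: le_trans (mnD _ _) (half_add (HN v Nv) (HN' v Nv')).
Qed.
Lemma sim_trans m n (Y X Z : nat -> 'M[U]_(m, n)) : sim X Y -> sim Y Z -> sim X Z.
Proof. by move=> H H'; rewrite -[X in simd X]addr0; exact: simd_trans H H'. Qed.
Lemma simdD m n d d' (X Y X' Y' : nat -> 'M[U]_(m, n)) :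
  simd d X Y -> simd d' X' Y' -> simd (d + d') (fun v => X v + X' v) (fun v => Y v + Y' v).
Proof.
move=> H H' e e0; have e20 : 0 < e / 2 by rewrite divr_gt0.
have [N HN] := H _ e20; have [N' HN'] := H' _ e20; exists (maxn N N') => v.
rewrite geq_max => /andP[Nv Nv']; rewrite opprD addrACA.
by apply: le_trans (mnD _ _) (half_add (HN v Nv) (HN' v Nv')).
Qed.
Lemma simd_sum m n p d (X Y : 'I_p -> nat -> 'M[U]_(m, n)) :
  (forall i, simd d (X i) (Y i)) -> simd (p%:R * d) (fun v => \sum_i X i v) (fun v => \sum_i Y i v).
Proof.
elim: p X Y => [|p IH] X Y H.
  by apply: simd_ub => v; rewrite !big_ord0 subrr mn0 mul0r.
have E (F : 'I_p.+1 -> nat -> 'M[U]_(m, n)) : (fun v => \sum_i F i v) = (fun v => F ord0 v + \sum_i F (lift ord0 i) v).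
  by apply/funext => v; rewrite big_ord_recl.
rewrite !E -natr1 mulrDl mul1r addrC; apply: simdD; first exact: H.
by apply: IH => i; exact: H.
Qed.
Lemma simdMl m n p c d (X : nat -> 'M[U]_(m, n)) (Y Y' : nat -> 'M[U]_(n, p)) : 0 < c ->
  (forall v, mn (X v) <= c) -> simd d Y Y' -> simd (c * d) (fun v => X v *m Y v) (fun v => X v *m Y' v).
Proof.
move=> c0 Xc H e e0; have [N HN] := H _ (divr_gt0 e0 c0); exists N => v Nv.
rewrite -mulmxBr; apply: le_trans (mnM _ _) _.
have -> : c * d + e = c * (d + e / c) by field; rewrite gt_eqF.
by apply: ler_pM; rewrite ?mn_ge0 //; exact: HN.
Qed.
Lemma simdMr m n p c d (X X' : nat -> 'M[U]_(m, n)) (Y : nat -> 'M[U]_(n, p)) : 0 < c ->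
  (forall v, mn (Y v) <= c) -> simd d X X' -> simd (c * d) (fun v => X v *m Y v) (fun v => X' v *m Y v).
Proof.
move=> c0 Xc H e e0; have [N HN] := H _ (divr_gt0 e0 c0); exists N => v Nv.
rewrite -mulmxBl; apply: le_trans (mnM _ _) _.
have -> : c * d + e = (d + e / c) * c by field; rewrite gt_eqF.
by apply: ler_pM; rewrite ?mn_ge0 //; exact: HN.
Qed.
Lemma simM m n p (X X' : nat -> 'M[U]_(m, n)) (Y Y' : nat -> 'M[U]_(n, p)) : bds X -> bds Y' ->
  sim X X' -> sim Y Y' -> sim (fun v => X v *m Y v) (fun v => X' v *m Y' v).
Proof.
move=> [c c0 cP] [d d0 dP] H H'; apply: (@sim_trans _ _ (fun v => X v *m Y' v)).
  rewrite -[X in simd X](mulr0 (c + 1)); apply: simdMl => //; first by rewrite ltr_wpDl.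
  by move=> v; apply: le_trans (cP v) _; rewrite lerDl.
rewrite -[X in simd X](mulr0 (d + 1)); apply: simdMr => //; first by rewrite ltr_wpDl.
by move=> v; apply: le_trans (dP v) _; rewrite lerDl.
Qed.
Lemma simMl m n p (X : nat -> 'M[U]_(m, n)) (Y Y' : nat -> 'M[U]_(n, p)) : bds X ->
  sim Y Y' -> sim (fun v => X v *m Y v) (fun v => X v *m Y' v).
Proof.
move=> [c c0 cP] H; rewrite -[X in simd X](mulr0 (c + 1)); apply: simdMl => //.
  by rewrite ltr_wpDl.
by move=> v; apply: le_trans (cP v) _; rewrite lerDl.
Qed.
Lemma simMr m n p (X X' : nat -> 'M[U]_(m, n)) (Y : nat -> 'M[U]_(n, p)) : bds Y ->
  sim X X' -> sim (fun v => X v *m Y v) (fun v => X' v *m Y v).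
Proof.
move=> [d d0 dP] H; rewrite -[X in simd X](mulr0 (d + 1)); apply: simdMr => //.
  by rewrite ltr_wpDl.
by move=> v; apply: le_trans (dP v) _; rewrite lerDl.
Qed.
Lemma simd_adj m n d (X Y : nat -> 'M[U]_(m, n)) : simd d X Y ->
  simd d (fun v => madj (X v)) (fun v => madj (Y v)).
Proof.
move=> H e e0; have [N HN] := H e e0; exists N => v Nv.
by rewrite -madjB mn_adj; exact: HN.
Qed.
End Seq.
Notation sim := (simd 0).

(** * The main estimate under a tracial approximation *)

Section Core.
Context {R : realType} {A : cstarAlgType R}.
Local Notation U := (uniz A).
Variables (m n K : nat) (beta : 'M[A]_m) (xh : 'I_K * 'I_K.+1 -> 'M[A]_(m, n)) (al : 'M[A]_n) (y s : A).
Variables (e : nat -> A) (b0 : nat -> 'M[U]_m) (x0 M : nat -> 'I_K * 'I_K.+1 -> 'M[U]_(m, n))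
  (G : nat -> 'I_K.+1 -> 'I_K.+1 -> 'M[U]_n -> 'M[U]_n) (Sm : nat -> set 'M[U]_n).
Hypothesis Hb : forall v, base beta xh al y s v.+1%:R^-1 (e v) (b0 v) (x0 v) (M v) (G v) (Sm v).

Definition cc (a : A) : U := 1 - inA a.
Definition CC p (a : A) : 'M[U]_p := (cc a)%:M.

Lemma cpos_inA (a : A) : cpositive a -> cnorm a <= 1 -> usa (inA a) /\ unn 1 (inA a).
Proof.
move=> [b ->] h; rewrite inAM inA_star; split; first exact: usa_starmul.
apply: unn_ge (unn_starmul _); first exact: sqr_ge0.
by rewrite -un_starmul -inA_star -inAM un_inA.
Qed.

Lemma esa v : usa (inA (e v)) /\ unn 1 (inA (e v)).
Proof. by have [h1 h2] := bs_pos (Hb v); exact: cpos_inA. Qed.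

Lemma ccsa v : usa (cc (e v)).
Proof. by apply: usaB; [exact: usa1|have [] := esa v]. Qed.

Lemma un_cc v : un (cc (e v)) <= 1.
Proof. by have [_] := esa v; rewrite /unn scale1r. Qed.

Lemma CCadj p v : madj (CC p (e v)) = CC p (e v).
Proof. by rewrite madj_scalar ccsa. Qed.

Lemma mnCC p v : mn (CC p (e v)) <= p%:R * p%:R.
Proof.
rewrite -[leRHS]mulr1; apply: mn_unif => i j; rewrite mxE; case: (_ == _).
  by rewrite mulr1n un_cc.
by rewrite mulr0n un0.
Qed.

Lemma bdsCC p : bds (fun v => CC p (e v)).
Proof. by exists (p%:R * p%:R) => [|v]; [rewrite mulr_ge0|exact: mnCC]. Qed.

Local Notation B := (mA beta).
Local Notation X ji := (mA (xh ji)).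
Local Notation C := (fun v => CC _ (e v)).

Lemma CB : sim (fun v => CC _ (e v) *m B) (fun v => B *m CC _ (e v)).
Proof. by apply: sim_inv => v; exact: bs_cb (Hb v). Qed.
Lemma CX ji : sim (fun v => CC _ (e v) *m X ji) (fun v => X ji *m CC _ (e v)).
Proof. by apply: sim_inv => v; exact: bs_cx (Hb v) ji. Qed.
Lemma CAl : sim (fun v => CC _ (e v) *m mA al) (fun v => mA al *m CC _ (e v)).
Proof. by apply: sim_inv => v; exact: bs_ca (Hb v). Qed.
Lemma Cadj p q (Y : 'M[U]_(p, q)) : sim (fun v => CC _ (e v) *m Y) (fun v => Y *m CC _ (e v)) ->
  sim (fun v => CC _ (e v) *m madj Y) (fun v => madj Y *m CC _ (e v)).
Proof.
move=> /simd_adj/simd_sym H; apply: sim_trans; last apply: sim_trans H _.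
  by apply: simd_eq => // v; rewrite madjM CCadj.
by apply: simd_eq => // v; rewrite madjM CCadj.
Qed.
Lemma Cb0 : sim (fun v => CC _ (e v) *m B) b0.
Proof. by apply: sim_inv => v; exact: bs_b0 (Hb v). Qed.
Lemma Cx0 ji : sim (fun v => CC _ (e v) *m X ji) (fun v => x0 v ji).
Proof. by apply: sim_inv => v; exact: bs_x0 (Hb v) ji. Qed.
Lemma bds_b0 : bds b0.
Proof.
apply: (@bds_near _ _ _ _ (fun v => CC _ (e v) *m B)); last by move=> v; exact: bs_b0 (Hb v).
by apply: bdsM; [exact: bdsCC|exact: bds_const].
Qed.
Lemma bds_x0 ji : bds (fun v => x0 v ji).
Proof.
apply: (@bds_near _ _ _ _ (fun v => CC _ (e v) *m X ji)); last by move=> v; exact: bs_x0 (Hb v) ji.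
by apply: bdsM; [exact: bdsCC|exact: bds_const].
Qed.
Lemma bds_M ji : bds (fun v => M v ji).
Proof.
have [c c0 cP] := bds_x0 ji; exists (32 * c) => [|v]; first by rewrite mulr_ge0.
by have [_ h] := bs_M (Hb v) ji; apply: le_trans h _; rewrite ler_wpM2l.
Qed.

Ltac bd := repeat lazymatch goal with
  | |- bds (fun v => @mulmx _ _ _ _ _ _) => apply: bdsM
  | |- bds (fun v => madj _) => apply: bds_adj
  | |- bds (fun v => CC _ _) => exact: bdsCC
  | |- bds (fun v => x0 v _) => exact: bds_x0
  | |- bds (fun v => M v _) => exact: bds_M
  | |- bds (fun v => b0 v) => exact: bds_b0
  | |- bds b0 => exact: bds_b0
  | |- bds (fun v => Q (b0 v)) => rewrite /Q
  | |- bds (fun v => Q (mA _)) => exact: bds_const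
  | |- bds _ => exact: bds_const
  end.

Lemma Qb0 : sim (fun v => Q (b0 v)) (fun v => CC _ (e v) *m Q B *m CC _ (e v)).
Proof.
have h : sim (fun v => b0 v) (fun v => B *m CC _ (e v)).
  by apply: sim_trans CB; exact: simd_sym Cb0.
apply: sim_trans (simM _ _ (simd_adj h) h) _; [by bd..|].
by apply: simd_eq => // v; rewrite madjM CCadj !mulmxA.
Qed.

Definition WW v ji ji' : 'M[U]_n := madj (x0 v ji) *m Q (b0 v) *m x0 v ji'.
Definition TT ji ji' : 'M[U]_n := madj (X ji) *m Q B *m X ji'.

(** Two columns and two factors b0 bring one c each; as c asymptotically commutes with [beta] and
    [xh], they can be moved outside, two on either side. *)
Lemma WWsim ji ji' : sim (fun v => WW v ji ji')
  (fun v => CC _ (e v) *m (CC _ (e v) *m TT ji ji' *m CC _ (e v)) *m CC _ (e v)).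
Proof.
have h i : sim (fun v => x0 v i) (fun v => X i *m CC _ (e v)).
  by apply: sim_trans (CX i); exact: simd_sym (Cx0 i).
have t1 : sim (fun v => WW v ji ji') (fun v => madj (X ji *m CC _ (e v)) *m
    (CC _ (e v) *m Q B *m CC _ (e v)) *m (X ji' *m CC _ (e v))).
  apply: simM; [by bd..| |exact: h].
  by apply: simM; [by bd..|apply: simd_adj; exact: h|exact: Qb0].
apply: sim_trans t1 _.
apply: (@sim_trans _ _ _ _ (fun v => CC _ (e v) *m ((madj (X ji) *m CC _ (e v)) *m
  (Q B *m (CC _ (e v) *m X ji'))) *m CC _ (e v))).
  by apply: simd_eq => // v; rewrite madjM CCadj !mulmxA.
apply: (@sim_trans _ _ _ _ (fun v => CC _ (e v) *m ((CC _ (e v) *m madj (X ji)) *m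
  (Q B *m (X ji' *m CC _ (e v)))) *m CC _ (e v))).
  apply: simMr; first by bd.
  apply: simMl; first by bd.
  apply: simM; [by bd..|apply: simd_sym; exact: Cadj (CX ji)|].
  by apply: simMl; [bd|exact: CX].
by apply: simd_eq => // v; rewrite /TT !mulmxA.
Qed.

Lemma gram j i j' i' : sim
  (fun v => madj (M v (j, i)) *m (CC _ (e v) *m Q B *m CC _ (e v)) *m M v (j', i'))
  (fun v => if j == j' then G v i i' (WW v (j, i) (j', i')) else 0).
Proof.
apply: (@sim_trans _ _ _ _ (fun v => madj (M v (j, i)) *m Q (b0 v) *m M v (j', i'))).
  apply: simMr; first by bd.
  by apply: simMl; [bd|exact: simd_sym Qb0].
by apply: sim_inv => v; exact: bs_gram (Hb v) j i j' i'.
Qed.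
End Core.

Section CoreSum.
Lemma sim_sum (R : realType) (A : cstarAlgType R) m n p (X Y : 'I_p -> nat -> 'M[uniz A]_(m, n)) :
  (forall i, sim (X i) (Y i)) -> sim (fun v => \sum_i X i v) (fun v => \sum_i Y i v).
Proof. by move=> H; have := simd_sum H; rewrite mulr0. Qed.

Context {R : realType} {A : cstarAlgType R}.
Local Notation U := (uniz A).
Variables (m n K : nat) (beta : 'M[A]_m) (xh : 'I_K * 'I_K.+1 -> 'M[A]_(m, n)) (al : 'M[A]_n) (y s : A).
Variables (e : nat -> A) (b0 : nat -> 'M[U]_m) (x0 M : nat -> 'I_K * 'I_K.+1 -> 'M[U]_(m, n))
  (G : nat -> 'I_K.+1 -> 'I_K.+1 -> 'M[U]_n -> 'M[U]_n) (Sm : nat -> set 'M[U]_n).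
Hypothesis Hb : forall v, base beta xh al y s v.+1%:R^-1 (e v) (b0 v) (x0 v) (M v) (G v) (Sm v).
Hypothesis K0 : (0 < K)%N.
Local Notation W := (WW b0 x0).
Local Notation T := (TT beta xh).
Local Notation B := (mA beta).
Local Notation L := (mA al).

Lemma Sm0 v : Sm v 0.
Proof. by rewrite -(subrr (W v (Ordinal K0, ord0) (Ordinal K0, ord0))); apply: bs_SmB (Hb v) _ _ _ _; exact: bs_Sm (Hb v) _ _. Qed.

Lemma Gzero v i i' : G v i i' 0 = 0.
Proof. by have := bs_GB (Hb v) i i' (Sm0 v) (Sm0 v); rewrite !subrr. Qed.

Lemma Gsum v i i' (f : 'I_K -> 'M[U]_n) : (forall j, Sm v (f j)) ->
  Sm v (\sum_j f j) /\ G v i i' (\sum_j f j) = \sum_j G v i i' (f j).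
Proof.
move=> H; elim/big_rec2: _ => [|j g h _ [S E]]; first by rewrite Gzero; split => //; exact: Sm0.
by rewrite -E; split; [exact: bs_SmD (Hb v) _ _ (H j) S|exact: bs_GD (Hb v) i i' _ _ (H j) S].
Qed.

Definition VV v i i' : 'M[U]_n := \sum_j W v (j, i) (j, i').

Lemma SmV v i i' : Sm v (VV v i i').
Proof. by have [] := @Gsum v i i' (fun j => W v (j, i) (j, i')) (fun j => bs_Sm (Hb v) _ _). Qed.

Lemma GV v k k' i i' : G v k k' (VV v i i') = \sum_j G v k k' (W v (j, i) (j, i')).
Proof. by have [] := @Gsum v k k' (fun j => W v (j, i) (j, i')) (fun j => bs_Sm (Hb v) _ _). Qed.

Definition YY v : 'M[U]_(m, n) := \sum_i \sum_j M v (j, i).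

(** The Gram relations remove the terms with j != j', and the additivity of G on [Sm] collects the
    others into [VV]. *)
Lemma YYsim : sim (fun v => madj (YY v) *m (CC _ (e v) *m Q B *m CC _ (e v)) *m YY v)
  (fun v => \sum_i \sum_i' G v i i' (VV v i i')).
Proof.
apply: (@sim_trans _ _ _ _ (fun v => \sum_i \sum_j \sum_i' \sum_j'
    madj (M v (j, i)) *m (CC _ (e v) *m Q B *m CC _ (e v)) *m M v (j', i'))).
  apply: simd_eq => // v; rewrite /YY madj_sum !mulmx_suml; apply: eq_bigr => i _.
  rewrite madj_sum !mulmx_suml; apply: eq_bigr => j _.
  by rewrite mulmx_sumr; apply: eq_bigr => i' _; rewrite mulmx_sumr.
apply: (@sim_trans _ _ _ _ (fun v => \sum_i \sum_j \sum_i' \sum_j'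
    if j == j' then G v i i' (W v (j, i) (j', i')) else 0)).
  apply: sim_sum => i.
  apply: sim_sum => j.
  apply: sim_sum => i'.
  apply: sim_sum => j'.
  exact: (gram Hb j i j' i').
apply: simd_eq => // v; apply: eq_bigr => i _; rewrite exchange_big; apply: eq_bigr => i' _.
rewrite GV; apply: eq_bigr => j _; rewrite (bigD1 j) //= eqxx big1 ?addr0 // => j' /negbTE.
by rewrite eq_sym => ->.
Qed.

Lemma comm2 p r (Y : 'M[U]_(p, r)) : sim (fun v => CC _ (e v) *m Y) (fun v => Y *m CC _ (e v)) ->
  sim (fun v => CC _ (e v) *m (CC _ (e v) *m Y)) (fun v => Y *m CC _ (e v) *m CC _ (e v)).
Proof.
move=> h; apply: (@sim_trans _ _ _ _ (fun v => CC _ (e v) *m (Y *m CC _ (e v)))).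
  by apply: simMl => //; exact: bdsCC.
apply: (@sim_trans _ _ _ _ (fun v => CC _ (e v) *m Y *m CC _ (e v))).
  by apply: simd_eq => // v; rewrite !mulmxA.
by apply: simMr => //; exact: bdsCC.
Qed.

Variables (d : R).
Hypotheses (d0 : 0 <= d)
  (hT : forall i i', mn ((if i == i' then madj L *m L else 0) - \sum_j T (j, i) (j, i')) <= d).
Let q : R := n%:R * n%:R + 1.

Lemma q0 : 0 < q.
Proof. by rewrite /q ltr_wpDl // mulr_ge0. Qed.

Lemma mnq v : mn (CC n (e v)) <= q.
Proof. by apply: le_trans (mnCC Hb n v) _; rewrite lerDl. Qed.

Definition cac v : 'M[U]_n := CC _ (e v) *m (CC _ (e v) *m (madj L *m L) *m CC _ (e v)) *m CC _ (e v).

Lemma Vsim i i' : simd (q * (q * (q * (q * d)))) (fun v => VV v i i') (fun v => if i == i' then cac v else 0).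
Proof.
rewrite -[X in simd X]add0r; apply: (@simd_trans _ _ _ _ _ _ (fun v => \sum_j
    CC _ (e v) *m (CC _ (e v) *m T (j, i) (j, i') *m CC _ (e v)) *m CC _ (e v))).
  by apply: sim_sum => j; exact: (WWsim Hb (j, i) (j, i')).
rewrite -[X in simd X]add0r; apply: (@simd_trans _ _ _ _ _ _ (fun v =>
    CC _ (e v) *m (CC _ (e v) *m (\sum_j T (j, i) (j, i')) *m CC _ (e v)) *m CC _ (e v))).
  by apply: simd_eq => // v; rewrite [in RHS]mulmx_sumr [in RHS]mulmx_suml [in RHS]mulmx_sumr [in RHS]mulmx_suml.
rewrite -[X in simd X]addr0; apply: (@simd_trans _ _ _ _ _ _ (fun v =>
    CC _ (e v) *m (CC _ (e v) *m (if i == i' then madj L *m L else 0) *m CC _ (e v)) *m CC _ (e v))).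
  apply: (@simdMr _ _ _ _ _ q) => [|v|]; [exact: q0|exact: mnq|].
  apply: (@simdMl _ _ _ _ _ q) => [|v|]; [exact: q0|exact: mnq|].
  apply: (@simdMr _ _ _ _ _ q) => [|v|]; [exact: q0|exact: mnq|].
  apply: (@simdMl _ _ _ _ _ q) => [|v|]; [exact: q0|exact: mnq|].
  by apply: simd_sym; apply: simd_ub => v; exact: hT.
by apply: simd_eq => // v; case: (_ == _) => //; rewrite !(mulmx0, mul0mx).
Qed.

Lemma Gdist v i i' Y Y' : Sm v Y -> Sm v Y' -> mn (G v i i' Y - G v i i' Y') <= 32 * mn (Y - Y').
Proof.
move=> S S'; rewrite -(bs_GB (Hb v)) //; apply: bs_Gn (Hb v) _ _ _ _.
exact: bs_SmB (Hb v) _ _ S S'.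
Qed.

Lemma simdG c (i i' : 'I_K.+1) (Y Y' : nat -> 'M[U]_n) : (forall v, Sm v (Y v)) -> (forall v, Sm v (Y' v)) ->
  simd c Y Y' -> simd (32 * c) (fun v => G v i i' (Y v)) (fun v => G v i i' (Y' v)).
Proof.
move=> S S' H x x0'; have x32 : 0 < x / 32 by rewrite divr_gt0.
have [N HN] := H _ x32; exists N => v Nv; apply: le_trans (Gdist _ _ (S v) (S' v)) _.
have -> : 32 * c + x = 32 * (c + x / 32) by field.
by rewrite ler_pM2l //; exact: HN.
Qed.

Let k := q * (q * (q * (q * d))).
Lemma k0 : 0 <= k.
Proof. by rewrite /k !mulr_ge0 // ltW // q0. Qed.

(** (K + 1)^2 terms, each replaced at a cost of at most twice q^4 d and enlarged 32 times by G, plus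
    the last replacement of [VV] by c^2 a c^2. *)
Definition DD : R := K.+1%:R * (K.+1%:R * (32 * (2 * (q * (q * (q * q)))))) + q * (q * (q * q)).

Lemma core_sum : simd (DD * d)
  (fun v => madj (YY v) *m (CC _ (e v) *m Q B *m CC _ (e v)) *m YY v)
  (fun v => madj L *m (CC _ (e v) *m CC _ (e v) *m CC _ (e v) *m CC _ (e v)) *m L).
Proof.
rewrite -[X in simd X]add0r; apply: simd_trans YYsim _.
have -> : DD * d = K.+1%:R * (K.+1%:R * (32 * (k + k))) + k by rewrite /DD /k; ring.
(* Each [VV v i i'] is close to c^2 a c^2 or to 0. Since c^2 a c^2 need not lie in [Sm v], where G
   is controlled, [VV v ord0 ord0] stands for it; the sum of the G i i then acts as the identity. *)
apply: (@simd_trans _ _ _ _ _ _ (fun v => \sum_i \sum_i' if i == i' then G v i i (VV v ord0 ord0) else 0)).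
  apply: simd_sum => i; apply: simd_sum => i'.
  have [<-|ne] := eqVneq i i'.
    apply: simdG => [v|v|]; [exact: SmV|exact: SmV|].
    apply: simd_trans (simd_sym (Vsim ord0 ord0)).
    by have := Vsim i i; rewrite !eqxx.
  rewrite (_ : (fun=> 0) = (fun v => G v i i' 0)); last by apply/funext => v; rewrite Gzero.
  apply: simdG => [v|v|]; [exact: SmV|exact: Sm0|].
  apply: simd_le (_ : k <= _) _; first by rewrite lerDl k0.
  by have := Vsim i i'; rewrite (negbTE ne).
rewrite -[X in simd X]add0r; apply: (@simd_trans _ _ _ _ _ _ (fun v => VV v ord0 ord0)).
  apply: (@sim_trans _ _ _ _ (fun v => \sum_j \sum_i G v i i (W v (j, ord0) (j, ord0)))).
    apply: simd_eq => // v; rewrite [RHS]exchange_big; apply: eq_bigr => i _.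
    rewrite (bigD1 i) //= eqxx big1 ?addr0 ?GV // => i' /negbTE.
    by rewrite eq_sym => ->.
  apply: sim_sum => j.
  by apply: sim_inv => v; exact: bs_sum (Hb v) _ _.
rewrite -[X in simd X]addr0; apply: simd_trans (Vsim ord0 ord0) _; rewrite eqxx /cac.
have h : sim (fun v => CC _ (e v) *m L) (fun v => L *m CC _ (e v)) := CAl Hb.
have bC p : bds (fun v => CC p (e v)) := bdsCC Hb p.
apply: (@sim_trans _ _ _ _ (fun v => (CC _ (e v) *m (CC _ (e v) *m madj L)) *m ((L *m CC _ (e v)) *m CC _ (e v)))).
  by apply: simd_eq => // v; rewrite !mulmxA.
have h2 : sim (fun v => CC _ (e v) *m (CC _ (e v) *m L)) (fun v => L *m CC _ (e v) *m CC _ (e v)) := comm2 h.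
have h3 := comm2 (Cadj Hb h).
apply: (@sim_trans _ _ _ _ (fun v => (madj L *m CC _ (e v) *m CC _ (e v)) *m (CC _ (e v) *m (CC _ (e v) *m L)))).
  apply: simM _ _ h3 (simd_sym h2).
    by apply: bdsM (bC _) _; apply: bdsM (bC _) _; exact: bds_const.
  by apply: bdsM (bC _) _; apply: bdsM (bC _) _; exact: bds_const.
by apply: simd_eq => // v; rewrite !mulmxA.
Qed.
End CoreSum.

Section Arith.
Context {R : realType}.
Implicit Types d t p q a k : R.
Lemma quarter_le d : 0 < d -> d / 4 <= d. Proof. lra. Qed.
Lemma four_quarters t d : t <= d / 4 -> t + t + (t + t) <= d. Proof. lra. Qed.
Lemma half_sub_quarter a p q : a / 2 <= p -> q <= a / 4 -> a / 4 <= p - q. Proof. lra. Qed.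
Lemma le_half_add a t : a <= a / 2 + t -> a / 2 <= t. Proof. lra. Qed.
Lemma le_of_double a t p : 0 < a -> t <= a / 4 -> 2 * a <= t + t + p -> a <= p. Proof. lra. Qed.
Lemma eighth a k : k != 0 -> 2 * (a / (8 * k)) * k = a / 4. Proof. by move=> k0; field. Qed.
End Arith.

(** * Orthogonal spare columns *)

Section Zetas.
Context {R : realType} {Z A : cstarAlgType R}.
Hypothesis hZ : jiang_su Z.
Hypothesis htr : essentially_tracially_in (separable_stable Z) A.
Local Notation U := (uniz A).

Lemma bases (m n K : nat) (beta : 'M[A]_m) (xh : 'I_K * 'I_K.+1 -> 'M[A]_(m, n)) (al : 'M[A]_n) (y s : A) :
  (0 < K)%N -> cpositive s -> s <> 0 ->
  exists (e : nat -> A) (b0 : nat -> 'M[U]_m) (x0 M : nat -> 'I_K * 'I_K.+1 -> 'M[U]_(m, n))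
  (G : nat -> 'I_K.+1 -> 'I_K.+1 -> 'M[U]_n -> 'M[U]_n) (Sm : nat -> set 'M[U]_n),
  forall v, base beta xh al y s v.+1%:R^-1 (e v) (b0 v) (x0 v) (M v) (G v) (Sm v).
Proof.
move=> K0 sp s0.
pose T := (A * 'M[U]_m * (('I_K * 'I_K.+1 -> 'M[U]_(m, n)) * ('I_K * 'I_K.+1 -> 'M[U]_(m, n))) *
  (('I_K.+1 -> 'I_K.+1 -> 'M[U]_n -> 'M[U]_n) * set 'M[U]_n))%type.
have /choice[f fP] (v : nat) : exists t : T, base beta xh al y s v.+1%:R^-1 t.1.1.1 t.1.1.2 t.1.2.1 t.1.2.2 t.2.1 t.2.2.
  have v0 : 0 < v.+1%:R^-1 :> R by rewrite invr_gt0.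
  have [e [b0 [x0 [M [G [Sm H]]]]]] := base_exists hZ htr beta xh al y K0 sp s0 v0.
  by exists (e, b0, (x0, M), (G, Sm)).
by exists (fun v => (f v).1.1.1), (fun v => (f v).1.1.2), (fun v => (f v).1.2.1), (fun v => (f v).1.2.2),
  (fun v => (f v).2.1), (fun v => (f v).2.2).
Qed.

Lemma ev_fin (T : finType) (P : T -> nat -> Prop) : (forall i, exists N, forall v, (N <= v)%N -> P i v) ->
  exists N, forall v, (N <= v)%N -> forall i, P i v.
Proof.
move=> /choice[f fP]; exists (\max_i f i)%N => v Nv i; apply: fP.
by apply: leq_trans Nv; exact: leq_bigmax.
Qed.

Lemma ev_and (P P' : nat -> Prop) : (exists N, forall v, (N <= v)%N -> P v) ->
  (exists N, forall v, (N <= v)%N -> P' v) -> exists N, forall v, (N <= v)%N -> P v /\ P' v.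
Proof.
move=> [N H] [N' H']; exists (maxn N N') => v; rewrite geq_max => /andP[h h'].
by split; [exact: H|exact: H'].
Qed.

Lemma ev_inv (t : R) : 0 < t -> exists N, forall v, (N <= v)%N -> v.+1%:R^-1 <= t.
Proof.
move=> t0; have /cvgrPdist_lt/(_ t t0)[N _ HN] := @cvg_harmonic R.
exists N => v Nv; have := HN v Nv; rewrite /= sub0r normrN /harmonic ger0_norm; last by rewrite invr_ge0.
exact: ltW.
Qed.

Lemma mn_tri m n (X Y : 'M[U]_(m, n)) : mn X <= mn (X - Y) + mn Y.
Proof. by rewrite -{1}(subrK Y X); exact: mnD. Qed.

Lemma mn_tri3 m n (X Y V : 'M[U]_(m, n)) (c d : R) : mn (X - V) <= c -> mn (Y - V) <= d -> mn (X - Y) <= c + d.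
Proof.
move=> h h'; have -> : X - Y = (X - V) + (V - Y) by rewrite addrA subrK.
rewrite mn_sub in h'; exact: le_trans (mnD _ _) (lerD h h').
Qed.

Lemma exists_big (p : nat) (f : 'I_p.+1 -> R) (t : R) : t <= \sum_i f i -> exists i, t / p.+1%:R <= f i.
Proof.
move=> h; apply/not_existsP => H.
have : \sum_i f i < \sum_(i < p.+1) t / p.+1%:R.
  apply: ltr_sum; last by move=> i _; rewrite ltNge; apply/negP; exact: H.
  by apply/hasP; exists ord0; rewrite ?mem_index_enum.
by rewrite sum_ord_const -[X in _ < X]mulr_natr divfK ?pnatr_eq0 // ltNge h.
Qed.

(** (|g| / 2)^2 <= |c g|^2 = |g c c g| <= |g c c| |g|. *)
Lemma un_cge (c g : U) t : 0 < un g -> usa c -> usa g -> un g - t <= un (c * g) -> t <= un g / 2 ->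
  un g / 4 <= un (g * c * c).
Proof.
move=> g0 cs gs h ht; have h2 : un g / 2 <= un (c * g) by lra.
have : (un g / 2) ^+ 2 <= un g * un (g * c * c).
  apply: le_trans (_ : un (c * g) ^+ 2 <= _).
    by rewrite ler_pXn2r ?nnegrE ?un_ge0 // divr_ge0 ?un_ge0.
  rewrite -un_starmul ustarM cs gs; apply: le_trans (_ : un (g * c * c * g) <= _).
    by rewrite !mulrA.
  by apply: le_trans (unM _ _) _; rewrite mulrC.
move=> h3; rewrite -(ler_pM2l g0); apply: le_trans h3.
by rewrite expr2 le_eqVlt; apply/orP; left; apply/eqP; field.
Qed.

Lemma two_min (a b : R) : 0 < a -> 0 < b -> exists t, [/\ 0 < t, t <= a & t <= b].
Proof.
move=> a0 b0; case: (lerP a b) => ab; [exists a|exists b]; split => //.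
exact: ltW.
Qed.

(** The columns are c m_jk X for a well chosen k, where X is the adjoint of a nonzero row of beta.
    The relations of the family make them nearly orthogonal with nearly equal Gram elements. That
    the approximation nearly preserves |y| keeps those elements away from 0, by a tau that does not
    depend on d. *)
Lemma zetas m K (beta : 'M[A]_m) : (0 < K)%N -> beta != 0 ->
  exists tau c : R, [/\ 0 < tau, 0 <= c & forall d : R, 0 < d ->
  exists z : 'I_K -> 'M[U]_(m, 1), [/\ forall j, isA (z j), forall j, mn (z j) <= c,
    forall j j', j != j' -> mn (madj (z j) *m Q (mA beta) *m z j') <= d,
    forall j j', mn (madj (z j) *m Q (mA beta) *m z j - madj (z j') *m Q (mA beta) *m z j') <= d &
    forall j, tau <= mn (madj (z j) *m Q (mA beta) *m z j)]].
Proof.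
move=> K0 bn0; set B := mA beta.
have [r0 [c0 b00]] : exists r0 c0, beta r0 c0 != 0.
  apply/not_existsP => H; move: bn0; apply/negP; rewrite negbK; apply/eqP/matrixP => i j.
  rewrite mxE; apply/eqP/negP => /negP h; apply: (H i); by exists j.
have m0 : 0 < m%:R :> R by rewrite ltr0n; exact: leq_ltn_trans (leq0n _) (ltn_ord r0).
pose y : A := mxcmul beta (mxcstar beta) r0 r0.
pose X : 'M[A]_(m, 1) := \matrix_(k, _) cstar (beta r0 k).
have yE : inA y = \sum_k inA (beta r0 k) * ustar (inA (beta r0 k)).
  by rewrite /y mxE inA_sum; apply: eq_bigr => k _; rewrite inAM mxE inA_star.
have ysa : usa (inA y).
  by rewrite yE /usa ustar_sum; apply: eq_bigr => k _; rewrite ustarM ustarK.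
have ypos : 0 < un (inA y).
  rewrite lt_def un_ge0 andbT; apply/eqP => y0.
  have := un_sum_starmul (fun k => ustar (inA (beta r0 k))) c0.
  under eq_bigr => k _ do rewrite ustarK.
  rewrite -yE y0 mulr0 un_star un_inA => h; move: b00; rewrite -cnorm_eq0.
  by rewrite -sqrf_eq0 eq_le h sqr_ge0.
have sp : cpositive (cmul (cstar (beta r0 c0)) (beta r0 c0)) by exists (beta r0 c0).
have s0 : cmul (cstar (beta r0 c0)) (beta r0 c0) <> 0.
  move=> /eqP; rewrite -cnorm_eq0 cnorm_starmul sqrf_eq0 cnorm_eq0.
  by rewrite (negbTE b00).
have [e [b0 [x0 [M [G [Sm Hb]]]]]] := bases beta (fun=> X) (0 : 'M[A]_1) y K0 sp s0.
pose j0 := Ordinal K0; pose W0 v := WW b0 x0 v (j0, ord0) (j0, ord0).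
pose T : 'M[U]_1 := madj (mA X) *m Q B *m mA X.
pose W' v : 'M[U]_1 := CC _ (e v) *m (CC _ (e v) *m T *m CC _ (e v)) *m CC _ (e v).
have WW' ji ji' : sim (fun v => WW b0 x0 v ji ji') W' by exact: WWsim Hb ji ji'.
(* The entry r0 of B X is y; [un_cge] keeps a quarter of its norm after two factors c, and
   [un_sum_starmul] costs the factor m. *)
pose tau0 := (un (inA y) / 4) ^+ 2 / m%:R.
have tau00 : 0 < tau0 by rewrite divr_gt0 // exprn_gt0 // divr_gt0.
have W'ge : exists N, forall v, (N <= v)%N -> tau0 <= mn (W' v).
  have [N HN] := ev_inv (divr_gt0 ypos (ltr0Sn _ 1)); exists N => v /HN hv.
  apply: le_trans (mn_entry _ ord0 ord0).
  pose g k : U := (B *m mA X) k ord0.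
  have gE : g r0 = inA y.
    by rewrite /g mxE yE; apply: eq_bigr => k _; rewrite !mxE inA_star.
  have -> : W' v ord0 ord0 = \sum_k ustar (g k * cc (e v) * cc (e v)) * (g k * cc (e v) * cc (e v)).
    rewrite /W' /CC mul_mx_scalarU mul_scalar_mx mxE mul_mx_scalarU mul_scalar_mx mxE.
    have -> : T ord0 ord0 = \sum_k ustar (g k) * g k.
      rewrite /T /Q -!mulmxA mulmxA -madjM mxE; apply: eq_bigr => k _.
      by rewrite madjE.
    rewrite mulr_sumr mulr_suml mulr_sumr mulr_suml; apply: eq_bigr => k _.
    by rewrite !ustarM (ccsa Hb) !mulrA.
  rewrite /tau0 ler_pdivrMr // [leRHS]mulrC; apply: le_trans (un_sum_starmul (fun k => g k * cc (e v) * cc (e v)) r0).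
  rewrite /= gE ler_pXn2r ?nnegrE ?un_ge0 ?divr_ge0 ?un_ge0 //.
  apply: (@un_cge _ _ v.+1%:R^-1) => //; first exact: ccsa Hb v.
  by rewrite un_inA; exact: bs_y (Hb v).
have W0ge : exists N, forall v, (N <= v)%N -> tau0 / 2 <= mn (W0 v).
  have [N HN] := ev_and W'ge (simd_sym (WW' (j0, ord0) (j0, ord0)) (divr_gt0 tau00 (ltr0Sn _ 1))).
  exists N => v /HN [h1 h2]; have h3 := mn_tri (W' v) (W0 v).
  rewrite add0r in h2; exact: le_half_add (le_trans h1 (le_trans h3 (lerD h2 (lexx _)))).
(* The G k k W0 nearly add up to W0, so one of them keeps a share 1 / (K + 1) of the norm. *)
have /choice[kk kkP] (v : nat) : exists k, (mn (W0 v) - v.+1%:R^-1) / K.+1%:R <= mn (G v k k (W0 v)).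
  apply: exists_big; rewrite lerBlDl; apply: le_trans (mn_tri _ (\sum_k G v k k (W0 v))) _.
  apply: lerD; last exact: mn_sum.
  by rewrite mn_sub; exact: bs_sum (Hb v) _ _.
(* tau0 / 2 survives in W0 and an error takes at most half of that; one share of the rest is 2 tau,
   and the Gram errors cost at most tau / 2. *)
pose tau := tau0 / (8 * K.+1%:R).
have tau1 : 0 < tau by rewrite divr_gt0 // mulr_gt0.
pose c : R := m%:R * m%:R * (32 * (m%:R * m%:R * mn (mA X) + 1)).
exists tau, c; split => // [|d d0].
  by rewrite !mulr_ge0 // addr_ge0 // !mulr_ge0 // mn_ge0.
pose z v j : 'M[U]_(m, 1) := CC _ (e v) *m M v (j, kk v).
have zc v j : mn (z v j) <= c.
  rewrite /c; apply: le_trans (mnM _ _) _; apply: ler_pM; rewrite ?mn_ge0 //; first exact: mnCC Hb _ _.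
  have [_ h] := bs_M (Hb v) (j, kk v); apply: le_trans h _; rewrite ler_pM2l //.
  apply: le_trans (mn_tri _ (CC _ (e v) *m mA X)) _; rewrite addrC; apply: lerD.
    by apply: le_trans (mnM _ _) _; apply: ler_wpM2r; [exact: mn_ge0|exact: mnCC Hb _ _].
  rewrite mn_sub; apply: le_trans (bs_x0 (Hb v) _) _.
  by rewrite invf_le1 ?ltr0n // ler1n.
have zA v j : isA (z v j) by apply: isA_mull; have [] := bs_M (Hb v) (j, kk v).
have zz v j j' : madj (z v j) *m Q B *m z v j' =
    madj (M v (j, kk v)) *m (CC _ (e v) *m Q B *m CC _ (e v)) *m M v (j', kk v).
  by rewrite madjM (CCadj Hb) !mulmxA.
have E1 (t : R) : 0 < t -> exists N, forall v, (N <= v)%N -> forall j j',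
    mn (madj (z v j) *m Q B *m z v j' - if j == j' then G v (kk v) (kk v) (WW b0 x0 v (j, kk v) (j', kk v)) else 0) <= t.
  move=> t0; have [N HN] : exists N, forall v, (N <= v)%N -> forall u : 'I_K * 'I_K * 'I_K.+1,
      mn (madj (M v (u.1.1, u.2)) *m (CC _ (e v) *m Q B *m CC _ (e v)) *m M v (u.1.2, u.2) -
      (if u.1.1 == u.1.2 then G v u.2 u.2 (WW b0 x0 v (u.1.1, u.2) (u.1.2, u.2)) else 0)) <= t.
    apply: ev_fin => -[[j j'] k]; have [N HN] := gram Hb j k j' k t0.
    by exists N => v /HN; rewrite add0r.
  by exists N => v /HN h j j'; rewrite zz; exact: h (j, j', kk v).
have E2 (t : R) : 0 < t -> exists N, forall v, (N <= v)%N -> forall j,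
    mn (G v (kk v) (kk v) (WW b0 x0 v (j, kk v) (j, kk v)) - G v (kk v) (kk v) (W0 v)) <= t.
  move=> t0; have [N HN] : exists N, forall v, (N <= v)%N -> forall u : 'I_K * 'I_K.+1,
      mn (G v u.2 u.2 (WW b0 x0 v (u.1, u.2) (u.1, u.2)) - G v u.2 u.2 (W0 v)) <= t.
    apply: ev_fin => -[j k]; have h : sim (fun v => WW b0 x0 v (j, k) (j, k)) W0.
      by apply: sim_trans (WW' (j, k) (j, k)) _; exact: simd_sym (WW' (j0, ord0) (j0, ord0)).
    have [N HN] := simdG Hb k k (fun v => bs_Sm (Hb v) (j, k) (j, k)) (fun v => bs_Sm (Hb v) (j0, ord0) (j0, ord0)) h t0.
    by exists N => v /HN; rewrite mulr0 add0r.
  by exists N => v /HN h j; exact: h (j, kk v).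
have [t [t0 td tt]] := two_min (divr_gt0 d0 (ltr0Sn R 3)) (divr_gt0 tau1 (ltr0Sn R 3)).
have [N HN] := ev_and (E1 t t0) (ev_and (E2 t t0) (ev_and W0ge (ev_inv (divr_gt0 tau00 (ltr0Sn _ 3))))).
have [h1 [h2 [h3 h4]]] := HN N (leqnn N).
have h5 j : mn (madj (z N j) *m Q B *m z N j - G N (kk N) (kk N) (W0 N)) <= t + t.
  have := h1 j j; rewrite eqxx => h6.
  by apply: mn_tri3 h6 _; rewrite mn_sub; exact: h2.
exists (z N); split => //.
- move=> j j' /negbTE ne; have := h1 j j'; rewrite ne subr0 => h; apply: le_trans h _; apply: le_trans td _.
  exact: quarter_le.
- move=> j j'; apply: le_trans (mn_tri3 (h5 j) (h5 j')) _.
  exact: four_quarters.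
- move=> j; have h := mn_tri (G N (kk N) (kk N) (W0 N)) (madj (z N j) *m Q B *m z N j).
  have h6 := h5 j; rewrite mn_sub in h6; have h7 := le_trans (kkP N) (le_trans h (lerD h6 (lexx _))).
  have h8 : 2 * tau <= (mn (W0 N) - N.+1%:R^-1) / K.+1%:R.
    rewrite ler_pdivlMr // (_ : 2 * tau * K.+1%:R = tau0 / 4); last by apply: eighth; rewrite pnatr_eq0.
    exact: half_sub_quarter.
  exact: le_of_double tau1 tt (le_trans h8 h7).
Qed.
End Zetas.

(** * Cutting a positive element *)

Section Cutoff.
Context {R : realType} {A : cstarAlgType R}.
Local Notation U := (uniz A).

Lemma central_expand (S : nzRingType) (D w p : S) : (forall u, D * u = u * D) ->
  D * w * (D * w) + (D * (w * p * w) + D * (w * p * w) + w * p * p * w) = w * (D + p) * ((D + p) * w).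
Proof.
move=> Dc; rewrite !(mulrDr, mulrDl) !mulrA !(Dc w) -!(mulrA w p D) -(Dc p) !mulrA.
by rewrite !addrA.
Qed.

Lemma comm_sub_add (S : nzRingType) (x p : S) : x * p = p * x -> p * p = x * x -> (x - p) * (p + x) = 0.
Proof. by move=> xp pp; rewrite mulrBl !mulrDr pp xp [p * x + _]addrC subrr. Qed.

Lemma twice_comm_mul (S : nzRingType) (a r s c : S) : s * r = r * s ->
  (a * r + a * r) * s * c = a * s * (r * c + r * c).
Proof. by move=> sr; rewrite mulrDr !mulrDl -(mulrA a r s) -sr !mulrA. Qed.

Lemma comm_pull (S : nzRingType) (s phi r : S) : s * r = r * s -> s * phi = phi * s ->
  s * phi * phi * r * s = s * phi * (s * phi) * r.
Proof. by move=> sr sp; rewrite -(mulrA _ r s) -sr !mulrA -(mulrA _ phi s) -sp !mulrA. Qed.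

Lemma comm_pull2 (S : nzRingType) (s phi r : S) : s * r = r * s -> s * phi = phi * s -> phi * r = r * phi ->
  phi * r * s * (phi * r) = r * (s * phi * phi * r).
Proof. by move=> sr sp pr; rewrite pr -!mulrA; congr (r * _); rewrite !mulrA -sp -!mulrA pr. Qed.

Lemma four_terms (S : nzRingType) (r g : S) :
  g + g + (g + g) - (1 - r + (1 - r)) * (g + g) = r * g + r * g + (r * g + r * g).
Proof.
by rewrite !(mulrDl, mulrDr) !mul1r !mulNr; ncring.
Qed.

(** Expanding 1 = w (d + p)^2 w gives (d w)^2 plus positive terms, so |d w|^2 <= 1 by
    [un_sqr_le_add]. *)
Lemma un_inv_le (d t : R) (p w : U) : 0 < d -> 0 < t -> usa p -> unn t p -> usa w ->
  w * (d%:C *: 1 + p) = 1 -> (d%:C *: 1 + p) * w = 1 -> un w <= d^-1.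
Proof.
move=> d0 t0 ps pt ws w1 w2.
have [r [rs rr _ _ _]] := unn_sqrt t0 ps pt.
have dd : 0 < d ^+ 2 by rewrite exprn_gt0.
pose v := (d + d)%:C *: (ustar (r * w) * (r * w)) + ustar (p * w) * (p * w).
pose D : U := d%:C *: 1.
have DE u : d%:C *: u = D * u by rewrite /D -scalerAl mul1r.
have Dc u : D * u = u * D by rewrite -scalerAl -scalerAr mul1r mulr1.
have wpw : ustar (r * w) * (r * w) = w * p * w by rewrite ustarM rs ws -rr !mulrA.
have wppw : ustar (p * w) * (p * w) = w * p * p * w by rewrite ustarM ps ws !mulrA.
have E : (d%:C *: w) * (d%:C *: w) + v = 1.
  rewrite -[RHS]mulr1 -[X in _ = X * _]w1 -[X in _ = _ * X]w2 /v wpw wppw rmorphD scalerDl -/D !DE.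
  exact: central_expand.
have vt : exists2 t', 0 < t' & unn t' v.
  have a0 : 0 <= un (r * w) ^+ 2 by exact: sqr_ge0.
  have b0 : 0 <= un (p * w) ^+ 2 by exact: sqr_ge0.
  have c0 : 0 <= (d + d) * un (r * w) ^+ 2 + un (p * w) ^+ 2.
    by rewrite addr_ge0 // mulr_ge0 // addr_ge0 // ltW.
  exists ((d + d) * un (r * w) ^+ 2 + un (p * w) ^+ 2 + 1); first by rewrite ltr_wpDl.
  apply: (@unn_ge _ _ ((d + d) * un (r * w) ^+ 2 + un (p * w) ^+ 2)) => //; first by rewrite lerDl.
  by apply: unnD; [apply: unnZ (unn_starmul _); rewrite addr_ge0 // ltW|exact: unn_starmul].
have [t' t'0 vt'] := vt.
have vs : usa v by apply: usaD; [apply: usaZ; exact: usa_starmul|exact: usa_starmul].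
have := un_sqr_le_add t'0 (usaZ d ws) vs vt'; rewrite E un1 un_sqr; last exact: usaZ.
rewrite unZr ?(ltW d0) // expr_le1 ?mulr_ge0 ?un_ge0 ?(ltW d0) // => h.
by rewrite -[d^-1]mul1r ler_pdivlMr // mulrC.
Qed.

(* With [x = s - tau / 2], one takes [chi = |x| + x], a multiple of the positive
   part of [x]; then [phi = (tau / 2 + |x|)^-1] inverts [s] on the range of [chi].
   The shape of [Phi] makes [Phi + Phi - Phi s Phi], the loss caused by
   [1 - xi Phi xi^*] when [xi^* xi = s], of the form [v s v]. *)
Lemma cutoff (s : U) (t tau : R) : usa s -> 0 < t -> unn t s -> 0 < tau -> tau <= un s ->
  exists chi Phi v : U, [/\ usa chi, usa Phi, usa v & un v <= 4 / tau] /\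
  [/\ Phi * s * chi = chi, Phi + Phi - Phi * s * Phi = v * s * v & chi * s * chi != 0].
Proof.
move=> ss t0 st tau0 taus; pose T := tau / 2; have T0 : 0 < T by rewrite divr_gt0.
pose x : U := s - T%:C *: 1; have xs : usa x by apply: usaB => //; exact/usaZ/usa1.
have sE : s = T%:C *: 1 + x by rewrite addrC subrK.
have tt0 : 0 < un x ^+ 2 + 1 by rewrite ltr_wpDl // sqr_ge0.
have xxt : unn (un x ^+ 2 + 1) (x * x).
  by apply: unn_ge (unn_sqr xs); [exact: sqr_ge0|rewrite lerDl].
have [p [ps pp pt pc _]] := unn_sqrt tt0 (usaM xs xs (erefl _)) xxt.
have sx : GRing.comm s x by apply: commBr => //; exact: commZ1.
have cp y : GRing.comm y x -> GRing.comm y p by move=> yx; apply: pc; exact: commrM.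
have sp := cp _ sx; have xp := cp _ (erefl (x * x)).
have [phi [phis phi1 phi2 phic]] := uinv_pos (sqrtr_ge0 _) T0 ps pt.
have sphi := phic _ sp.
pose chi : U := p + x; have chis : usa chi by apply: usaD.
have pchi : GRing.comm chi p by apply/commr_sym/commrD => //; exact: commr_sym.
have sc : s * chi = (T%:C *: 1 + p) * chi.
  apply/eqP; rewrite -subr_eq0 -mulrBl sE opprD addrACA subrr add0r; apply/eqP.
  exact: comm_sub_add.
have psc : phi * s * chi = chi by rewrite -mulrA sc mulrA phi1 mul1r.
pose h : U := s * phi; have hs : usa h by apply: usaM.
(* r = (1 + h^2)^-1 and Phi = 2 h phi r. Then Phi s = 2 h^2 r = 2 (1 - r), and 2 Phi - Phi s Phi = 2
   r Phi = v s v for v = 2 phi r. On the range of chi, h is 1 and r is 1/2, so Phi still inverts s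
   there. *)
have [r [rs r1 r2 rc]] := uinv_pos (sqr_ge0 (un h)) ltr01 (usaM hs hs (erefl _)) (unn_sqr hs).
have cr y : GRing.comm y s -> GRing.comm y phi -> GRing.comm y r.
  by move=> ys yp; apply: rc; do 2 apply: commrM.
have sr := cr _ (erefl _) sphi; have phir := cr _ (commr_sym sphi) (erefl _).
have hr : GRing.comm h r by apply/commr_sym/commrM; exact: commr_sym.
have hphi : GRing.comm h phi by apply/commr_sym/commrM => //; exact: commr_sym.
have hc : h * chi = chi by rewrite /h sphi.
have rcc : r * chi + r * chi = chi.
  rewrite -{3}[chi]mul1r -r1 -mulrA mulrDl -[h * h * chi]mulrA !hc scale1r mul1r.
  by rewrite mulrDr.
pose g : U := h * phi * r.
have gs : usa g.
  by apply: usaM => //; [exact: usaM|apply/commr_sym/commrM; exact: commr_sym].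
have vs : usa (phi * r) by apply: usaM.
exists chi, (g + g), (phi * r + phi * r); split; split => //.
- exact: usaD.
- exact: usaD.
- apply: le_trans (unD _ _) _; rewrite (_ : 4 / tau = T^-1 * 1 + T^-1 * 1); last by rewrite /T; field; rewrite gt_eqF.
  have h1 : un phi <= T^-1.
    by apply: (@un_inv_le T (Num.sqrt (un x ^+ 2 + 1)) p) => //; rewrite sqrtr_gt0.
  have h2 : un r <= 1.
    rewrite -invr1; apply: (@un_inv_le 1 (un h ^+ 2 + 1) (h * h)) => //.
      - by rewrite ltr_wpDl // sqr_ge0.
      - exact: usaM.
    by apply: unn_ge (unn_sqr hs); [exact: sqr_ge0|rewrite lerDl].
  by apply: lerD; apply: le_trans (unM _ _) _; apply: ler_pM; rewrite ?un_ge0.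
- have -> : (g + g) * s * chi = h * phi * s * (r * chi + r * chi).
    exact: (twice_comm_mul (h * phi) chi sr).
  by rewrite rcc -2!mulrA (mulrA phi) psc hc.
- have r2' : r + h * h * r = 1 by rewrite -[RHS]r2 scale1r mulrDl mul1r.
  have hhr : h * h * r = 1 - r by apply/eqP; rewrite eq_sym subr_eq addrC r2'.
  have gsE : (g + g) * s = (1 - r) + (1 - r).
    by rewrite mulrDl (comm_pull sr sphi) hhr.
  have vsv : phi * r * s * (phi * r) = r * g by exact: comm_pull2.
  by rewrite gsE four_terms !(mulrDl, mulrDr) vsv.
(* If chi s chi = 0 then chi = 0, so s + |x| = tau / 2 and the norm of s would be at most tau /
   2. *)
- apply/eqP => E; have c0 : chi * chi = 0.
    have : phi * (chi * s * chi) = 0 by rewrite E mulr0.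
    have cT : GRing.comm chi (T%:C *: 1 + p) by apply: commrD => //; exact: commZ1.
    by rewrite -mulrA sc (mulrA chi) cT -mulrA mulrA phi1 mul1r.
  have chi0 : chi = 0.
    by apply: un_eq0; apply/eqP; rewrite -sqrf_eq0 -un_sqr // c0 un0.
  have spT : s + p = T%:C *: 1 by rewrite sE -addrA [x + p]addrC -/chi chi0 addr0.
  have [r' [r's r'r' _ _ _]] := unn_sqrt t0 ss st.
  have tt1 : 0 < Num.sqrt (un x ^+ 2 + 1) by rewrite sqrtr_gt0.
  have := un_sqr_le_add tt1 r's ps pt; rewrite r'r' spT unZr ?(ltW T0) // un1 mulr1 => le.
  have := le_trans taus le; rewrite leNgt => /negP; apply.
  by rewrite /T ltr_pdivrMr // ltr_pMr // ltr1n.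
Qed.
End Cutoff.

(** * One spare column *)

Section Split.
Context {R : realType} {Z A : cstarAlgType R}.
Hypothesis hZ : jiang_su Z.
Hypothesis htr : essentially_tracially_in (separable_stable Z) A.
Local Notation U := (uniz A).

Lemma mn11 (x : U) : mn (x%:M : 'M[U]_1) = un x.
Proof. by rewrite /mn !big_ord1 mxE eqxx mulr1n. Qed.

Lemma mnM3 m n p q (X : 'M[U]_(m, n)) (Y : 'M[U]_(n, p)) (V : 'M[U]_(p, q)) (a b c : R) :
  mn X <= a -> mn Y <= b -> mn V <= c -> mn (X *m Y *m V) <= a * b * c.
Proof.
move=> h1 h2 h3; apply: le_trans (mnM _ _) _; apply: ler_pM; rewrite ?mn_ge0 //.
by apply: le_trans (mnM _ _) _; apply: ler_pM; rewrite ?mn_ge0.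
Qed.

Lemma scalar_mx3 n (a b c : U) : (a + b - c)%:M = a%:M + b%:M - c%:M :> 'M[U]_n.
Proof. by apply/matrixP => i j; rewrite !mxE; case: (i == j); rewrite ?mulr1n // !mulr0n subr0 addr0. Qed.

Lemma mulmx_sub2 m n p q (a : 'M[U]_(m, n)) (x y : 'M[U]_(n, p)) (b : 'M[U]_(p, q)) :
  a *m (x - y) *m b = a *m x *m b - a *m y *m b.
Proof. by rewrite mulmxBr mulmxBl. Qed.

Lemma sub_twice (V : zmodType) (a b c : V) : a = a - b - (b - c) + (b + b - c).
Proof. by rewrite -[a - b - _]addrA -opprD [b + (b - c)]addrA subrK. Qed.

(* Multiplying [B] by [y1] frees the column [z chi] exactly, and only loses
   [Y^* v s v Y], which copies of [z] can repay. *)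
Lemma split_cutoff m (B : 'M[U]_m) (z : 'M[U]_(m, 1)) (chi Phi v s : U) :
  usa Phi -> madj z *m Q B *m z = s%:M -> Phi * s * chi = chi -> Phi + Phi - Phi * s * Phi = v * s * v ->
  let Y := madj (B *m z) *m B in let y1 := 1%:M - z *m Phi%:M *m Y in
  madj y1 *m Q B *m (z *m chi%:M) = 0 /\ Q B = Q (B *m y1) + madj Y *m (v * s * v)%:M *m Y.
Proof.
move=> Phis zs e1 e2 Y y1; set xi := B *m z.
have xs : madj xi *m xi = s%:M by rewrite -zs madjM /Q !mulmxA.
have By : B *m y1 = B - xi *m Phi%:M *m Y by rewrite /y1 mulmxBr mulmx1 !mulmxA.
have Bya : madj (B *m y1) = madj B - madj Y *m Phi%:M *m madj xi.
  by rewrite By madjB !madjM madj_scalar Phis !mulmxA.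
have Ya : madj Y = madj B *m xi by rewrite madjM madjK.
split.
  have -> : madj y1 *m Q B *m (z *m chi%:M) = madj (B *m y1) *m xi *m chi%:M.
    by rewrite madjM !mulmxA.
  rewrite Bya mulmxBl -(mulmxA _ (madj xi)) xs -Ya mulmxBl -!(mulmxA (madj Y)) -!scalar_mxM e1.
  exact: subrr.
rewrite -e2 /Q Bya By mulmxBl !mulmxBr.
have t1 : madj B *m (xi *m Phi%:M *m Y) = madj Y *m Phi%:M *m Y by rewrite Ya !mulmxA.
have t2 : madj Y *m Phi%:M *m madj xi *m B = madj Y *m Phi%:M *m Y by rewrite /Y -!mulmxA.
have t3 : madj Y *m Phi%:M *m madj xi *m (xi *m Phi%:M *m Y) = madj Y *m (Phi * s * Phi)%:M *m Y.
  rewrite !scalar_mxM -xs !mulmxA //.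
rewrite t1 t2 t3 scalar_mx3 mulmxBr mulmxBl mulmxDr mulmxDl.
exact: sub_twice.
Qed.

(** Of N + 1 columns, the first is cut and becomes spare. Each of the N copies of beta thereby loses
    Y^* v s v Y. Since the remaining z_l are nearly orthogonal with Gram element near s, the columns
    z_l v Y repay all these losses within a single additional copy. *)
Lemma split_exists m N (beta : 'M[A]_m) (d : R) : beta != 0 -> 0 < d ->
  exists (beta1 : 'M[A]_m) (y1 : 'M[U]_m) (w : 'M[U]_(m, 1)) (s : A) (X : 'I_N.+1 -> 'I_N -> 'M[U]_m),
  [/\ Q (mA beta1) = madj y1 *m Q (mA beta) *m y1, madj y1 *m Q (mA beta) *m w = 0 &
    isA w /\ madj w *m Q (mA beta) *m w = (inA s)%:M] /\
  [/\ cpositive s, s <> 0 & forall l l',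
    mn (\sum_J madj (X J l) *m Q (mA beta1) *m X J l' - (if l == l' then Q (mA beta) else 0)) <= d].
Proof.
move=> b0 d0; set B := mA beta.
have [tau [c [tau0 c0 H]]] := zetas hZ htr (ltn0Sn N) b0.
pose Yb := mn B * c * mn B; pose V := 4 / tau; pose Sb := c * mn (Q B) * c.
have V0 : 0 <= V by rewrite divr_ge0 // ltW.
have Yb0 : 0 <= Yb by rewrite !mulr_ge0 ?mn_ge0.
have Sb0 : 0 <= Sb by rewrite !mulr_ge0 ?mn_ge0.
(* The final error is E conjugated by v Y, where E is at most d' (1 + V Sb V). *)
pose C2 := (Yb * V) * (1 + V * Sb * V) * (V * Yb) + 1.
have VS0 : 0 <= V * Sb * V by apply: mulr_ge0 => //; exact: mulr_ge0.
have C20 : 0 < C2 by apply: ltr_wpDl => //; apply: mulr_ge0; [apply: mulr_ge0; [exact: mulr_ge0|exact: addr_ge0]|exact: mulr_ge0].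
have [d' [d'0 d'1 d'd]] := two_min (ltr01 : 0 < 1 :> R) (divr_gt0 d0 C20).
have [z [zA zc zorth zeq ztau]] := H d' d'0.
pose xi : 'M[U]_(m, 1) := B *m z ord0; pose s := (madj xi *m xi) ord0 ord0.
have sM : madj (z ord0) *m Q B *m z ord0 = s%:M.
  by rewrite /s -mx11_scalar /xi madjM /Q !mulmxA.
have sE : s = \sum_k ustar (xi k ord0) * xi k ord0 by rewrite /s mxE; apply: eq_bigr => k _; rewrite madjE.
have ss : usa s by rewrite sE; apply: usa_sum => k _; exact: usa_starmul.
pose t := \sum_k un (xi k ord0) ^+ 2.
have t0 : 0 <= t by apply: sumr_ge0 => k _; exact: sqr_ge0.
have st : unn (t + 1) s.
  apply: (@unn_ge _ _ t); rewrite ?lerDl // sE; apply: unn_sum => k; exact: unn_starmul.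
have t1 : 0 < t + 1 by rewrite ltr_wpDl.
have taus : tau <= un s by have := ztau ord0; rewrite sM mn11.
have [chi [Phi [v [[chis Phis vs vb] [e1 e2 e3]]]]] := cutoff ss t1 st tau0 taus.
have s2 : s.2 = 0.
  have -> : s = (madj (z ord0) *m Q B *m z ord0) ord0 ord0 by rewrite sM mxE eqxx mulr1n.
  by have := isA_mull (madj (z ord0) *m Q B) (zA ord0); apply.
pose Y := madj xi *m B; pose y1 : 'M[U]_m := 1%:M - z ord0 *m Phi%:M *m Y.
have [hy1 hy2] := split_cutoff Phis sM e1 e2; rewrite -/xi -/Y -/y1 in hy1 hy2.
have [beta1 E1] : exists b1, B *m y1 = mA b1 by apply/isAE/isA_mulr; exact: isA_mA.
have [q [qs qq _ _ q2]] := unn_sqrt t1 ss st.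
pose k : A := (q * chi).1; have kE : inA k = q * chi by rewrite -inAE //= q2 // mul0r.
pose s' : A := cmul (cstar k) k.
have s'E : inA s' = chi * s * chi by rewrite inAM inA_star kE ustarM qs chis -qq !mulrA.
(* Copy 0 receives the repayments, the other N copies are kept as they are. *)
pose X (J : 'I_N.+1) (l : 'I_N) : 'M[U]_m := if unlift ord0 J is Some j then (if j == l then 1%:M else 0)
  else z (lift ord0 l) *m v%:M *m Y.
exists beta1, y1, (z ord0 *m chi%:M), s', X; split; split.
- by rewrite -E1 /Q !madjM !mulmxA.
- exact: hy1.
- split; first by apply: isA_mulr; exact: zA.
  by rewrite s'E !scalar_mxM -sM madjM madj_scalar chis !mulmxA.
- by exists k.
- by move=> h; move/eqP: e3; apply; rewrite -s'E h.
move=> l l'; rewrite -E1.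
pose E : 'M[U]_1 := madj (z (lift ord0 l)) *m Q (B *m y1) *m z (lift ord0 l') - (if l == l' then s%:M else 0).
have -> : \sum_J madj (X J l) *m Q (B *m y1) *m X J l' - (if l == l' then Q B else 0) =
    (madj Y *m v%:M) *m E *m (v%:M *m Y).
  rewrite big_ord_recl {1 2}/X unlift_none.
  rewrite (eq_bigr (fun j : 'I_N => madj (if j == l then 1%:M else 0) *m Q (B *m y1) *m (if j == l' then 1%:M else 0))); last first.
    by move=> j _; rewrite /X liftK.
  rewrite (bigD1 l) //= big1 => [|j /negbTE ->]; last by rewrite madj0 !mul0mx.
  rewrite eqxx madj1 mul1mx addr0 /E.
  have -> : madj (z (lift ord0 l) *m v%:M *m Y) *m Q (B *m y1) *m (z (lift ord0 l') *m v%:M *m Y) =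
      madj Y *m v%:M *m (madj (z (lift ord0 l)) *m Q (B *m y1) *m z (lift ord0 l')) *m (v%:M *m Y).
    by rewrite !madjM madj_scalar vs !mulmxA.
  rewrite mulmx_sub2; case: eqVneq => [_|_]; last by rewrite !(mulmx0, mul0mx, addr0, subr0).
  rewrite mulmx1 [in X in _ - X]hy2 opprD addrA addrK; congr (_ - _).
  by rewrite !scalar_mxM !mulmxA.
have zl i : mn (Y *m z (lift ord0 i)) <= d'.
  have -> : Y *m z (lift ord0 i) = madj (z ord0) *m Q B *m z (lift ord0 i).
    by rewrite /Y /xi madjM /Q !mulmxA.
  by apply: zorth; exact: neq_lift.
have mns : un s <= Sb by rewrite -mn11 -sM; apply: mnM3; rewrite ?mn_adj.
have mnvsv : un (v * s * v) <= V * Sb * V.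
  apply: le_trans (unM _ _) _; apply: ler_pM; rewrite ?un_ge0 //.
  by apply: le_trans (unM _ _) _; apply: ler_pM; rewrite ?un_ge0.
have mnE : mn E <= d' * (1 + V * Sb * V).
  have -> : E = (madj (z (lift ord0 l)) *m Q B *m z (lift ord0 l') - (if l == l' then s%:M else 0)) -
      madj (Y *m z (lift ord0 l)) *m (v * s * v)%:M *m (Y *m z (lift ord0 l')).
    have hy3 : Q (B *m y1) = Q B - madj Y *m (v * s * v)%:M *m Y by rewrite hy2 addrK.
    rewrite /E hy3 mulmx_sub2 addrAC; congr (_ - _ - _).
    by rewrite madjM !mulmxA.
  apply: le_trans (mnD _ _) _; rewrite mnN mulrDr mulr1; apply: lerD.
    have [<-|ne] := eqVneq l l'; first by rewrite -sM; exact: zeq.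
    by rewrite subr0; apply: zorth; rewrite (inj_eq lift_inj).
  apply: (@le_trans _ _ (d' * (V * Sb * V) * d')).
    by apply: mnM3; rewrite ?mn_adj ?mn11.
  by rewrite ler_piMr //; apply: mulr_ge0 => //; exact: ltW.
have mnxi : mn xi <= mn B * c.
  by apply: le_trans (mnM _ _) _; apply: ler_wpM2l; [exact: mn_ge0|exact: zc].
have mnY : mn Y <= Yb.
  by apply: le_trans (mnM _ _) _; rewrite mn_adj; apply: ler_wpM2r; [exact: mn_ge0|exact: mnxi].
apply: (@le_trans _ _ ((Yb * V) * (d' * (1 + V * Sb * V)) * (V * Yb))).
  apply: mnM3; [|exact: mnE|].
    by apply: le_trans (mnM _ _) _; rewrite mn11 mn_adj; apply: ler_pM; rewrite ?mn_ge0 ?un_ge0.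
  by apply: le_trans (mnM _ _) _; rewrite mn11; apply: ler_pM; rewrite ?mn_ge0 ?un_ge0.
rewrite ler_pdivlMr // in d'd; apply: le_trans d'd.
have -> : Yb * V * (d' * (1 + V * Sb * V)) * (V * Yb) = d' * (Yb * V * (1 + V * Sb * V) * (V * Yb)) by ring.
by rewrite ler_pM2l // lerDl.
Qed.
End Split.

(** * Several spare columns with one Gram element *)

Section Spares.
Context {R : realType} {Z A : cstarAlgType R}.
Hypothesis hZ : jiang_su Z.
Hypothesis htr : essentially_tracially_in (separable_stable Z) A.
Hypothesis hA : simple_cstar A.
Local Notation U := (uniz A).

(** The z with a A z = 0 form a closed two-sided ideal. It is not 0 if it contains b, and if it were
    everything it would contain the adjoint of a, which forces a = 0. *)
Lemma simple_prime (a b : A) : a <> 0 -> b <> 0 -> exists x, cmul a (cmul x b) <> 0.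
Proof.
move=> a0 b0; apply/not_existsP => H0.
have H x : cmul a (cmul x b) = 0 by have := H0 x; move/contrapT.
pose I : set A := [set z | forall x, cmul a (cmul x z) = 0].
have Icl : closed_ideal I.
  split.
  - apply: closed_approx => z Hz x; apply/eqP; rewrite -cnorm_eq0 eq_le cnorm_ge0 andbT.
    apply/ler_addgt0Pr => e e0; rewrite add0r.
    have p0 : 0 < cnorm a * cnorm x + 1 by rewrite ltr_wpDl // mulr_ge0 // cnorm_ge0.
    have [z' Iz' hz'] := Hz _ (divr_gt0 e0 p0).
    have -> : cmul a (cmul x z) = cmul (cmul a x) (z - z').
      by rewrite cmulBr -!cmulA (Iz' x) subr0.
    apply: le_trans (cnorm_mul_le (cnorm_mul _ _) (ltW hz')) _.
    rewrite mulrCA ger_pMr // ler_pdivrMr // mul1r lerDl.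
    exact: ler01.
  - by move=> x; rewrite !cmul0r.
  - by move=> l u v Iu Iv x; rewrite !cmulPr Iu Iv scaler0 addr0.
  - move=> u z Iz; split => x; first by rewrite (cmulA x) Iz.
    by rewrite !cmulA -(cmulA a) Iz cmul0l.
have [I0|IT] := hA Icl.
  by apply: b0; have : I b by []; rewrite I0.
apply: a0; have : I (cstar a) by rewrite IT.
move/(_ (cmul (cstar a) a)) => h; apply/eqP; rewrite -cnorm_eq0.
have : cnorm (cmul (cstar (cmul a (cstar a))) (cmul a (cstar a))) = 0.
  by rewrite cstarM cstarK -cmulA (cmulA (cstar a)) h cnorm0.
rewrite cnorm_starmul => /eqP; rewrite sqrf_eq0 -{1}[a]cstarK cnorm_starmul sqrf_eq0.
by rewrite cnorm_star.
Qed.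

(* With [s1 = a^* a], [s2 = b^* b] and [t = a x b^*], take [s = (t^* t)^2]. *)
Lemma common_below (s1 s2 : A) : cpositive s1 -> cpositive s2 -> s1 <> 0 -> s2 <> 0 ->
  exists s y1 y2 : A, [/\ cpositive s, s <> 0, s = cmul (cstar y1) (cmul s1 y1) & s = cmul (cstar y2) (cmul s2 y2)].
Proof.
move=> [a ->] [b ->] a0 b0; have [x hx] := simple_prime a0 b0.
pose t := cmul a (cmul x (cstar b)).
have t0 : t <> 0.
  move=> t0; apply: hx; rewrite -!cmulA.
  rewrite (_ : cmul a (cmul x (cmul (cstar b) b)) = cmul t b); last by rewrite /t !cmulA.
  by rewrite t0 cmul0l cmul0r.
pose h := cmul (cstar t) t.
have hs : usa (inA h) by rewrite /h inAM inA_star; exact: usa_starmul.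
have ht : unn (un (inA t) ^+ 2 + 1) (inA h).
  apply: (@unn_ge _ _ (un (inA t) ^+ 2)); rewrite ?sqr_ge0 ?lerDl //.
  by rewrite /h inAM inA_star; exact: unn_starmul.
have t1 : 0 < un (inA t) ^+ 2 + 1 by rewrite ltr_wpDl // sqr_ge0.
have [q [qs qq _ qc q2]] := unn_sqrt t1 hs ht.
have qE : inA q.1 = q by rewrite -inAE // q2.
have rs : cstar q.1 = q.1 by apply: inAI; rewrite inA_star qE.
have rr : cmul q.1 q.1 = h by apply: inAI; rewrite inAM qE.
have hstar : cstar h = h by rewrite /h cstarM cstarK.
exists (cmul h h), (cmul (cmul x (cstar b)) q.1), (cmul (cmul (cstar x) (cstar a)) t); split.
- by exists h; rewrite hstar.
- move=> /eqP; rewrite -cnorm_eq0 -{1}hstar cnorm_starmul sqrf_eq0 /h cnorm_starmul sqrf_eq0 cnorm_eq0.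
  by move/eqP.
- have -> : cmul (cstar (cmul (cmul x (cstar b)) q.1)) (cmul (cmul (cstar a) a) (cmul (cmul x (cstar b)) q.1)) =
     cmul q.1 (cmul h q.1).
    by rewrite /h /t !cstarM !cstarK rs !cmulA.
  by rewrite -{1}rr -{2}rr -{1}rr !cmulA.
- by rewrite /h /t !cstarM !cstarK !cmulA.
Qed.

(** Transitivity for comparisons between several copies: the Gram relations of X' collapse the
    double sum over p and p'. *)
Lemma combine m n K N L (X' : 'I_K -> 'I_N -> 'M[U]_m) (b2 b1 : 'M[U]_m) (X : 'I_N -> 'I_L -> 'M[U]_(m, n)) (d : R) :
  (forall p p', mn (\sum_J madj (X' J p) *m b2 *m X' J p' - (if p == p' then b1 else 0)) <= d) ->
  forall l l', mn (\sum_J madj (\sum_p X' J p *m X p l) *m b2 *m (\sum_p X' J p *m X p l') -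
    \sum_p madj (X p l) *m b1 *m X p l') <= (\sum_p mn (X p l)) * d * (\sum_p mn (X p l')).
Proof.
move=> H l l'.
have -> : \sum_J madj (\sum_p X' J p *m X p l) *m b2 *m (\sum_p X' J p *m X p l') -
    \sum_p madj (X p l) *m b1 *m X p l' =
    \sum_p \sum_p' madj (X p l) *m (\sum_J madj (X' J p) *m b2 *m X' J p' - (if p == p' then b1 else 0)) *m X p' l'.
  transitivity (\sum_p (\sum_p' madj (X p l) *m (\sum_J madj (X' J p) *m b2 *m X' J p') *m X p' l' -
      madj (X p l) *m b1 *m X p l')).
    rewrite sumrB; congr (_ - _).
    transitivity (\sum_J \sum_p \sum_p' madj (X p l) *m (madj (X' J p) *m b2 *m X' J p') *m X p' l').
      apply: eq_bigr => J _; rewrite madj_sum !mulmx_suml; apply: eq_bigr => p _.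
      by rewrite mulmx_sumr; apply: eq_bigr => p' _; rewrite madjM !mulmxA.
    rewrite exchange_big; apply: eq_bigr => p _; rewrite exchange_big; apply: eq_bigr => p' _.
    by rewrite mulmx_sumr mulmx_suml.
  apply: eq_bigr => p _; under [RHS]eq_bigr => p' _ do rewrite mulmx_sub2.
  rewrite sumrB; congr (_ - _); rewrite (bigD1 p) //= eqxx big1 ?addr0 // => p' /negbTE.
  by rewrite eq_sym => ->; rewrite mulmx0 mul0mx.
apply: le_trans (mn_sum _ _ _) _; rewrite -mulrA mulr_suml; apply: ler_sum => p _.
apply: le_trans (mn_sum _ _ _) _; rewrite !mulr_sumr; apply: ler_sum => p' _.
by rewrite mulrA; apply: mnM3; rewrite ?mn_adj.
Qed.

Lemma madj_row_mx m n1 n2 (X : 'M[U]_(m, n1)) (Y : 'M[U]_(m, n2)) :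
  madj (row_mx X Y) = col_mx (madj X) (madj Y).
Proof. by rewrite /madj map_row_mx tr_row_mx. Qed.

Lemma isA_row_mx m n1 n2 (X : 'M[U]_(m, n1)) (Y : 'M[U]_(m, n2)) : isA X -> isA Y -> isA (row_mx X Y).
Proof. by move=> hX hY i j; rewrite mxE; case: (fintype.split j) => k. Qed.

Lemma row_kill p m r (b : 'M[U]_(p, m)) (c : 'M[U]_(m, 1)) (w : 'M[U]_(m, r)) :
  b *m c = 0 -> b *m w = 0 -> b *m row_mx c w = 0 :> 'M[U]_(p, 1 + r).
Proof. by move=> h1 h2; rewrite mul_mx_row h1 h2 row_mx0. Qed.

Lemma Qadj m (B : 'M[U]_m) : madj (Q B) = Q B.
Proof. by rewrite /Q madjM madjK. Qed.

Lemma row_gram m r (b : 'M[U]_m) (c : 'M[U]_(m, 1)) (w : 'M[U]_(m, r)) (s : U) : madj b = b ->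
  madj c *m b *m c = s%:M -> madj w *m b *m w = s%:M -> madj c *m b *m w = 0 ->
  madj (row_mx c w) *m b *m row_mx c w = s%:M :> 'M[U]_(1 + r).
Proof.
move=> bb h1 h2 h3; have h4 : madj w *m b *m c = 0.
  by have := congr1 (@madj _ _ _ _) h3; rewrite !madjM madjK bb madj0 mulmxA.
by rewrite madj_row_mx mul_col_mx mul_col_row h1 h2 h3 h4 -scalar_mx_block.
Qed.

(** Each step cuts one more column at the price of one more copy, so r columns turn N copies into r
    + N. The new column is orthogonal to the old ones because it is taken behind y, and
    [common_below] replaces the two Gram elements by one. *)
Lemma spares m N (beta : 'M[A]_m) (r : nat) (d : R) : (0 < N)%N -> beta != 0 -> 0 < d -> d < mn (Q (mA beta)) ->
  exists (beta' : 'M[A]_m) (y : 'M[U]_m) (w : 'M[U]_(m, r)) (s : A) (X : 'I_(r + N) -> 'I_N -> 'M[U]_m),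
  [/\ Q (mA beta') = madj y *m Q (mA beta) *m y, madj y *m Q (mA beta) *m w = 0, isA w &
    madj w *m Q (mA beta) *m w = (inA s)%:M] /\
  [/\ cpositive s, s <> 0 & forall l l',
    mn (\sum_J madj (X J l) *m Q (mA beta') *m X J l' - (if l == l' then Q (mA beta) else 0)) <= d].
Proof.
move=> N0 b0; elim: r d => [|r IH] d d0 dQ.
  have [i [j bij]] : exists i j, beta i j != 0.
    apply/not_existsP => H; move: b0; apply/negP; rewrite negbK; apply/eqP/matrixP => i j.
    rewrite mxE; apply/eqP/negP => /negP h; apply: (H i); by exists j.
  exists beta, 1%:M, 0, (cmul (cstar (beta i j)) (beta i j)), (fun J l => if J == l then 1%:M else 0).
  split; split.
  - by rewrite madj1 mul1mx mulmx1.
  - by rewrite mulmx0.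
  - by move=> p q; rewrite mxE.
  - by apply/matrixP => -[].
  - by exists (beta i j).
  - by move=> /eqP; rewrite -cnorm_eq0 cnorm_starmul sqrf_eq0 cnorm_eq0 (negbTE bij).
  - move=> l l'; rewrite (bigD1 l) //= eqxx madj1 mul1mx big1 => [|J /negbTE ->].
      by case: eqVneq => _; rewrite ?mulmx1 ?mulmx0 addr0 subrr mn0 ltW.
    by rewrite madj0 !mul0mx.
have d20 : 0 < d / 2 by rewrite divr_gt0.
have dd : d / 2 < d by rewrite ltr_pdivrMr // ltr_pMr // ltr1n.
have [be1 [y [w [s [X [[h1 h2 h3 h4] [h5 h6 h7]]]]]]] := IH _ d20 (lt_trans dd dQ).
(* If be1 were 0, the comparison would bound mn (Q (mA beta)) by d / 2. *)
have be10 : be1 != 0.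
  apply/eqP => E; have := h7 (Ordinal N0) (Ordinal N0); rewrite eqxx big1.
    by rewrite sub0r mnN leNgt (lt_trans dd dQ).
  by move=> J _; rewrite E mA0 /Q mulmx0 mulmx0 mul0mx.
pose c := \sum_p \sum_l mn (X p l).
have cl l : \sum_p mn (X p l) <= c.
  by apply: ler_sum => p _; rewrite (bigD1 l) //= lerDl; apply: sumr_ge0 => l' _; exact: mn_ge0.
have s0 l : 0 <= \sum_p mn (X p l) by apply: sumr_ge0 => p _; exact: mn_ge0.
have c0 : 0 <= c by apply: sumr_ge0 => p _; apply: sumr_ge0 => l _; exact: mn_ge0.
have cc1 : 0 < c * c + 1 by rewrite ltr_wpDl // mulr_ge0.
have [be2 [y' [w' [s' [X' [[k1 k2 [k3 k4]] [k5 k6 k7]]]]]]] :=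
  @split_exists _ _ _ hZ htr m (r + N) be1 _ be10 (divr_gt0 d20 cc1).
have [t [r1 [r2 [t1 t2 t3 t4]]]] := common_below h5 k5 h6 k6.
have scal n1 (r0 s1 : A) : t = cmul (cstar r0) (cmul s1 r0) ->
    (ustar (inA r0) * inA s1 * inA r0)%:M = (inA t)%:M :> 'M[U]_n1.
  by move=> ->; rewrite !inAM inA_star mulrA.
exists be2, (y *m y'), (row_mx (y *m w' *m (inA r2)%:M) (w *m (inA r1)%:M) : 'M[U]_(m, 1 + r)), t,
  (fun J l => \sum_p X' J p *m X p l).
split; split => //.
- by rewrite k1 h1 madjM !mulmxA.
- apply: row_kill.
    have -> : madj (y *m y') *m Q (mA beta) *m (y *m w' *m (inA r2)%:M) =
        madj y' *m (madj y *m Q (mA beta) *m y) *m w' *m (inA r2)%:M by rewrite madjM !mulmxA.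
    by rewrite -h1 k2 mul0mx.
  have -> : madj (y *m y') *m Q (mA beta) *m (w *m (inA r1)%:M) =
      madj y' *m (madj y *m Q (mA beta) *m w) *m (inA r1)%:M by rewrite madjM !mulmxA.
  by rewrite h2 mulmx0 mul0mx.
- apply: (@isA_row_mx m 1 r); apply: isA_mulr => //; exact: isA_mull.
- apply: (@row_gram m r); first exact: Qadj.
  + rewrite -(scal _ _ _ t4) !scalar_mxM -k4 h1 !madjM madj_scalar !mulmxA //.
  + rewrite -(scal _ _ _ t3) !scalar_mxM -h4 !madjM madj_scalar !mulmxA //.
  + have -> : madj (y *m w' *m (inA r2)%:M) *m Q (mA beta) *m (w *m (inA r1)%:M) =
        madj (inA r2)%:M *m madj w' *m (madj y *m Q (mA beta) *m w) *m (inA r1)%:M.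
      by rewrite !madjM !mulmxA.
    by rewrite h2 mulmx0 mul0mx.
move=> l l'.
rewrite -(subrKA (\sum_p madj (X p l) *m Q (mA be1) *m X p l')).
apply: le_trans (mnD _ _) _; rewrite [leRHS](splitr d); apply: lerD => //.
apply: le_trans (combine X k7 l l') _.
apply: (@le_trans _ _ (c * (d / 2 / (c * c + 1)) * c)).
  by apply: ler_pM => //; [apply: mulr_ge0 => //; rewrite ltW // divr_gt0|apply: ler_wpM2r => //; rewrite ltW // divr_gt0].
rewrite mulrAC -mulrCA -[leRHS]mulr1 ler_pM2l // ler_pdivrMr // mul1r lerDl.
exact: ler01.
Qed.
End Spares.

Section Arith.
Context {R : realType}.
Implicit Types e D x z : R.
Lemma quarter_bound e D : 0 <= D -> 0 < e -> D * (e / (4 * (D + 1))) <= e / 4.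
Proof.
move=> D0 e0; have D1 : 0 < 4 * (D + 1) by lra.
rewrite mulrA ler_pdivrMr // (_ : e / 4 * (4 * (D + 1)) = e * D + e); last by field.
by rewrite mulrC lerDl ltW.
Qed.
Lemma three_quarters e x z : 0 < e -> x <= e / 4 + e / 4 -> z <= e / 4 -> x + z < e.
Proof. lra. Qed.
End Arith.

(** * The comparison *)

Section Main.
Context {R : realType} {Z A : cstarAlgType R}.
Hypothesis hZ : jiang_su Z.
Hypothesis htr : essentially_tracially_in (separable_stable Z) A.
Hypothesis hA : simple_cstar A.
Local Notation U := (uniz A).

(* With [c = 1 - e] this is [e (1 + c) (1 + c^2) = 1 - c^4]. *)
Lemma factor_1c4 (S : nzRingType) (e q1 q2 : S) : q1 * q1 = 1 + (1 - e) -> q2 * q2 = 1 + (1 - e) * (1 - e) ->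
  q1 * q2 = q2 * q1 -> e * q1 = q1 * e -> e * q2 = q2 * e ->
  q1 * q2 * e * (q1 * q2) = 1 - (1 - e) * (1 - e) * (1 - e) * (1 - e).
Proof.
move=> h1 h2 q12 e1 e2.
have -> : q1 * q2 * e * (q1 * q2) = e * (q1 * q1) * (q2 * q2).
  by rewrite -(mulrA q1 q2 e) -e2 (mulrA q1 e q2) -e1 -!mulrA (mulrA q2 q1) -q12 !mulrA.
rewrite h1 h2; move: (1 - e) (subKr 1 e) => c <-.
by rewrite !(mulrDr, mulrDl, mulrN, mulNr, mul1r, mulr1) -!addrA; ncring.
Qed.

(** W is the product of the roots of 1 + c and 1 + c^2, which commute with e. The bound 4 is crude;
    it matters that it is the same for all e. *)
Lemma weight (e : A) : cpositive e -> cnorm e <= 1 -> exists W : U, [/\ usa W, un W <= 4 &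
  W * inA e * W = 1 - cc e * cc e * cc e * cc e].
Proof.
move=> ep e1; have [es et] := cpos_inA ep e1.
have cs : usa (cc e) by apply: usaB => //; exact: usa1.
have c1 : un (cc e) <= 1 by move: et; rewrite /unn scale1r.
have s1 : usa (1 + cc e) by apply: usaD => //; exact: usa1.
have ccs : usa (cc e * cc e) by apply: usaM.
have s2 : usa (1 + cc e * cc e) by apply: usaD => //; exact: usa1.
have two (z : U) : 2%:C *: 1 - (1 + z) = 1 - z.
  by rewrite (_ : 2%:C = 1 + 1 :> R[i]) ?scalerDl ?scale1r ?opprD ?addrA ?addrK // rmorphD.
have t1 : unn 2 (1 + cc e).
  rewrite /unn two /cc opprB addrC subrK un_inA.
  by apply: le_trans e1 _; rewrite ler1n.
have t2 : unn 2 (1 + cc e * cc e).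
  rewrite /unn two; have := unn_sqr1 cs c1; rewrite /unn scale1r => h.
  by apply: le_trans h _; rewrite ler1n.
have [q1 [q1s q1q _ q1c _]] := unn_sqrt (ltr0Sn _ 1) s1 t1.
have [q2 [q2s q2q _ q2c _]] := unn_sqrt (ltr0Sn _ 1) s2 t2.
have cq1 y : GRing.comm y (cc e) -> GRing.comm y q1.
  by move=> h; apply: q1c; apply: commrD => //; exact: commr1.
have cq2 y : GRing.comm y (cc e) -> GRing.comm y q2.
  by move=> h; apply: q2c; apply: commrD; [exact: commr1|exact: commrM].
have ec : GRing.comm (inA e) (cc e) by apply: commBr => //; exact: commr1.
have q1cc : GRing.comm q1 (cc e) by apply/commr_sym/cq1.
have n1 (q : U) : usa q -> un (q * q) <= 2 -> un q <= 2.
  move=> qs; rewrite un_sqr // => h; rewrite -(@ler_pXn2r _ 2) ?nnegrE ?un_ge0 //.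
  by apply: le_trans h _; rewrite -natrX ler_nat.
exists (q1 * q2); split.
- by apply: usaM => //; exact: cq2.
- apply: le_trans (unM _ _) _; rewrite (_ : 4 = 2 * 2 :> R); last by rewrite -natrM.
  apply: ler_pM; rewrite ?un_ge0 //; apply: n1 => //.
    by rewrite q1q; apply: le_trans (unD _ _) _; rewrite un1 -[leRHS]/(1 + 1); apply: lerD.
  rewrite q2q; apply: le_trans (unD _ _) _; rewrite un1 -[leRHS]/(1 + 1); apply: lerD => //.
  by rewrite un_sqr // expr_le1 // un_ge0.
- apply: factor_1c4 => //; [exact: cq2|exact: cq1|exact: cq2].
Qed.

Lemma amplify m n k M (a : 'M[U]_n) (b : 'M[U]_m) (x : 'I_k -> 'I_k.+1 -> 'M[U]_(m, n)) (d : R) : 0 < d ->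
  (forall j i, isA (x j i)) ->
  (forall i i', mn ((if i == i' then a else 0) - \sum_j madj (x j i) *m b *m x j i') < d) ->
  exists x' : 'I_(M * k) -> 'I_(M * k.+1) -> 'M[U]_(m, n), (forall j i, isA (x' j i)) /\
    forall i i', mn ((if i == i' then a else 0) - \sum_j madj (x' j i) *m b *m x' j i') < d.
Proof.
move=> d0 xA H.
have cg : #|{: 'I_M * 'I_k}| = (M * k)%N by rewrite card_prod !card_ord.
have cf : #|{: 'I_M * 'I_k.+1}| = (M * k.+1)%N by rewrite card_prod !card_ord.
pose g (l : 'I_(M * k)) : 'I_M * 'I_k := enum_val (cast_ord (esym cg) l).
pose f (l : 'I_(M * k.+1)) : 'I_M * 'I_k.+1 := enum_val (cast_ord (esym cf) l).
have fI i i' : (f i == f i') = (i == i').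
  by rewrite /f (inj_eq enum_val_inj) (inj_eq (@cast_ord_inj _ _ _)).
have gB : bijective g.
  exists (fun p => cast_ord cg (enum_rank p)) => l; first by rewrite /g enum_valK cast_ordKV.
  by rewrite /g cast_ordK enum_rankK.
exists (fun l i => if (g l).1 == (f i).1 then x (g l).2 (f i).2 else 0); split.
  by move=> l i; case: ifP => _ //; move=> p q; rewrite mxE.
move=> i i'.
have -> : \sum_l madj (if (g l).1 == (f i).1 then x (g l).2 (f i).2 else 0) *m b *m
    (if (g l).1 == (f i').1 then x (g l).2 (f i').2 else 0) =
    if (f i).1 == (f i').1 then \sum_j madj (x j (f i).2) *m b *m x j (f i').2 else 0.
  transitivity (\sum_p madj (if p.1 == (f i).1 then x p.2 (f i).2 else 0) *m b *m
      (if p.1 == (f i').1 then x p.2 (f i').2 else 0)).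
    by rewrite [RHS](reindex g) //; exact: onW_bij.
  rewrite -(pair_bigA _ (fun c j => madj (if c == (f i).1 then x j (f i).2 else 0) *m b *m
      (if c == (f i').1 then x j (f i').2 else 0))) /=.
  rewrite (bigD1 (f i).1) //= eqxx [X in _ + X]big1 => [|c /negbTE ->]; last first.
    by rewrite big1 // => j _; rewrite madj0 !mul0mx.
  rewrite addr0; case: eqVneq => // _; by rewrite big1 // => j _; rewrite mulmx0.
rewrite -fI.
have E : (f i == f i') = ((f i).1 == (f i').1) && ((f i).2 == (f i').2) by [].
rewrite E; case: ((f i).1 == (f i').1) => /=; first exact: H.
by rewrite subr0 mn0.
Qed.

Lemma mn_scalar n (c : U) : mn (c%:M : 'M[U]_n) <= n%:R * n%:R * un c.
Proof.
apply: mn_unif => i j; rewrite mxE; case: (_ == _); first by rewrite mulr1n.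
by rewrite mulr0n un0 un_ge0.
Qed.

Lemma assemble m n p r (b : 'M[U]_m) (y : 'M[U]_(m, p)) (w : 'M[U]_(m, r)) (Y : 'M[U]_(p, n)) (T : 'M[U]_(r, n)) :
  madj b = b -> madj y *m b *m w = 0 ->
  madj (y *m Y + w *m T) *m b *m (y *m Y + w *m T) =
  madj Y *m (madj y *m b *m y) *m Y + madj T *m (madj w *m b *m w) *m T.
Proof.
move=> bb h; have h' : madj w *m b *m y = 0.
  by have := congr1 (@madj _ _ _ _) h; rewrite !madjM madjK bb madj0 mulmxA.
rewrite madjD !mulmxDl !mulmxDr !madjM.
have e1 : madj Y *m madj y *m b *m (w *m T) = 0.
  by rewrite -[RHS](mul0mx _ T) -[in RHS](mulmx0 _ (madj Y)) -h !mulmxA.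
have e2 : madj T *m madj w *m b *m (y *m Y) = 0.
  by rewrite -[RHS](mul0mx _ Y) -[in RHS](mulmx0 _ (madj T)) -h' !mulmxA.
by rewrite e1 e2 addr0 add0r !mulmxA.
Qed.

Lemma weight_conj n (L : 'M[U]_n) (W u s : U) : usa W ->
  madj ((u * W)%:M *m L) *m s%:M *m ((u * W)%:M *m L) = madj L *m (W * (ustar u * s * u) * W)%:M *m L.
Proof. by move=> Ws; rewrite madjM madj_scalar ustarM Ws !scalar_mxM !mulmxA. Qed.

Lemma almost_unperf n m k (al : 'M[A]_n) (be : 'M[A]_m) :
  aple (\mxdiag_(i < k.+1) Q (mA al)) (\mxdiag_(j < k) Q (mA be)) -> aple (Q (mA al)) (Q (mA be)).
Proof.
move=> H; set L := mA al; set B := mA be.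
have triv : Q L = 0 -> aple (Q L) (Q B).
  by move=> -> e e0; exists 0; [move=> p q; rewrite mxE|rewrite mulmx0 subr0 mn0].
have small : (forall e : R, 0 < e -> mn (Q L) < e) -> Q L = 0.
  move=> h; apply: mn_eq0; apply/eqP; rewrite eq_le mn_ge0 andbT leNgt; apply/negP => h1.
  by have := h _ h1; rewrite ltxx.
(* For k = 0 the right-hand side is an empty sum, so a = 0. *)
case: (posnP k) => [k0|k0].
  apply/triv/small => e e0; have [x [_ hx]] := aple_diag H e0.
  have := hx ord0 ord0; rewrite eqxx big1 ?subr0 // => j _.
  by have := leq_trans (ltn_ord j) (eq_leq k0).
have [b0|b0] := eqVneq be 0.
  apply/triv/small => e e0; have [x [_ hx]] := aple_diag H e0.
  have := hx ord0 ord0; rewrite eqxx big1 ?subr0 // => j _.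
  by rewrite b0 mA0 /Q mulmx0 mulmx0 mul0mx.
have Qb0 : 0 < mn (Q B).
  rewrite lt_def mn_ge0 andbT; apply/eqP => /mn_eq0 h.
  move: b0 => /eqP; apply; apply/matrixP => i j; rewrite mxE.
  have := un_sum_starmul (fun l => B l j) i.
  have -> : \sum_l ustar (B l j) * B l j = Q B j j.
    by rewrite mxE; apply: eq_bigr => l _; rewrite madjE.
  have q0 : Q B j j = 0 by rewrite h mxE.
  rewrite q0 un0 mulr0 => h1; apply/eqP; rewrite -cnorm_eq0 -un_inA -sqrf_eq0.
  by rewrite eq_le sqr_ge0 andbT; move: h1; rewrite [B i j]mxE.
(* This N makes (n + 1)(k + 1) equal to K + 1 for K = n + N, see [KE]. *)
move=> eps eps0; pose N := (n.+1 * k)%N; have N0 : (0 < N)%N by rewrite muln_gt0.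
pose K := (n + N)%N; have K0 : (0 < K)%N by rewrite /K addn_gt0 N0 orbT.
have D0 : 0 <= DD n K :> R.
  have q0 : 0 <= n%:R * n%:R + 1 :> R by rewrite addr_ge0 // mulr_ge0.
  by rewrite /DD addr_ge0 // !mulr_ge0.
(* [core_sum] multiplies d0 by DD, which leaves a quarter of eps; the limit in [core_sum] and the
   comparison of e with s take a quarter each. *)
pose d0 := eps / (4 * (DD n K + 1)).
have D1 : 0 < 4 * (DD n K + 1) :> R by rewrite mulr_gt0 // ltr_wpDl.
have d00 : 0 < d0 by rewrite divr_gt0.
have d02 : 0 < d0 / 2 by rewrite divr_gt0.
have [x [xA hx]] := aple_diag H d02.
have [x1 [x1A hx1]] := amplify n.+1 d02 xA hx.
pose c := \sum_l \sum_i mn (x1 l i).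
have cl i : \sum_l mn (x1 l i) <= c.
  by apply: ler_sum => l _; rewrite (bigD1 i) //= lerDl; apply: sumr_ge0 => i' _; exact: mn_ge0.
have s0 i : 0 <= \sum_l mn (x1 l i) by apply: sumr_ge0 => l _; exact: mn_ge0.
have c0 : 0 <= c by apply: sumr_ge0 => p _; apply: sumr_ge0 => l _; exact: mn_ge0.
have cc1 : 0 < c * c + 1 by rewrite ltr_wpDl // mulr_ge0.
have [d [dp d1 d2]] := two_min (divr_gt0 Qb0 (ltr0Sn _ 1)) (divr_gt0 d02 cc1).
have dQ : d < mn (Q B) by apply: le_lt_trans d1 _; rewrite ltr_pdivrMr // ltr_pMr // ltr1n.
have [be' [y [w [s [X [[h1 h2 h3 h4] [h5 h6 h7]]]]]]] := spares hZ htr hA n N0 b0 dp dQ.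
have KE : K.+1 = (n.+1 * k.+1)%N by rewrite /K /N mulnS addSn.
pose ci (i : 'I_K.+1) : 'I_(n.+1 * k.+1) := cast_ord KE i.
have /choice[xh xhE] (ji : 'I_K * 'I_K.+1) : exists Y, \sum_l X ji.1 l *m x1 l (ci ji.2) = mA Y.
  by apply: isAE; apply: isA_sum => l; exact: isA_mull.
have hT (i i' : 'I_K.+1) : mn ((if i == i' then madj L *m L else 0) - \sum_j TT be' xh (j, i) (j, i')) <= d0.
  have -> : \sum_j TT be' xh (j, i) (j, i') =
      \sum_J madj (\sum_p X J p *m x1 p (ci i)) *m Q (mA be') *m (\sum_p X J p *m x1 p (ci i')).
    by apply: eq_bigr => j _; rewrite /TT -!xhE.
  rewrite [leRHS](splitr d0).
  apply: mn_tri3 (_ : mn (_ - \sum_p madj (x1 p (ci i)) *m Q B *m x1 p (ci i')) <= _) _.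
    by apply: ltW; have := hx1 (ci i) (ci i'); rewrite (inj_eq (@cast_ord_inj _ _ _)).
  apply: le_trans (combine x1 h7 (ci i) (ci i')) _.
  apply: (@le_trans _ _ (c * (d0 / 2 / (c * c + 1)) * c)).
    apply: ler_pM => //; first by apply: mulr_ge0 => //; exact: ltW.
    by apply: ler_pM => //; exact: ltW.
  rewrite mulrAC -mulrCA -[leRHS]mulr1 ler_pM2l // ler_pdivrMr // mul1r lerDl.
  exact: ler01.
have [e [b0' [x0 [M [G [Sm Hb]]]]]] := bases hZ htr be' xh al 0 K0 h5 h6.
have core := core_sum Hb K0 (ltW d00) hT.
pose E := mn (madj L) * (n%:R * n%:R * 16) * mn L.
have E0 : 0 <= E by rewrite !mulr_ge0 ?mn_ge0.
have E1 : 0 < E + 1 by rewrite ltr_wpDl.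
have ep4 : 0 < eps / 4 by rewrite divr_gt0.
have [v0 hv0] := ev_and (core _ ep4) (ev_inv (divr_gt0 ep4 E1)).
have [hv1 hv2] := hv0 v0 (leqnn v0).
have [u u2 hu] := bs_u (Hb v0); have [ep e1] := bs_pos (Hb v0).
have [W [Ws W4 WE]] := weight ep e1.
pose Y2 : 'M[U]_(m, n) := CC _ (e v0) *m YY M v0.
(* The first term reproduces alpha^* c^4 alpha. The second lies in the spare columns; its Gram
   matrix alpha^* W u^* s u W alpha is close to alpha^* W e W alpha, and W is bounded independently
   of the accuracy of u. *)
exists (y *m Y2 + w *m ((u * W)%:M *m L)).
  apply: isA_add; last exact: isA_mulr.
  apply: isA_mull; apply: isA_mull; apply: isA_sum => i; apply: isA_sum => j.
  by have [] := bs_M (Hb v0) (j, i).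
rewrite assemble ?Qadj // -h1 h4.
have T1 : madj Y2 *m Q (mA be') *m Y2 =
    madj (YY M v0) *m (CC _ (e v0) *m Q (mA be') *m CC _ (e v0)) *m YY M v0.
  by rewrite /Y2 madjM (CCadj Hb) !mulmxA.
have T2 : madj ((u * W)%:M *m L) *m (inA s)%:M *m ((u * W)%:M *m L) =
    madj L *m (W * (ustar u * inA s * u) * W)%:M *m L.
  exact: weight_conj.
have T3 : Q L = madj L *m (CC _ (e v0) *m CC _ (e v0) *m CC _ (e v0) *m CC _ (e v0)) *m L +
    madj L *m (W * inA (e v0) * W)%:M *m L.
  rewrite -mulmxDl -mulmxDr /CC -!scalar_mxM -raddfD /= WE addrC subrK.
  by rewrite mulmx1.
rewrite T1 T2 T3 opprD addrACA.
apply: le_lt_trans (mnD _ _) _.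
have b1 : mn (madj L *m (CC _ (e v0) *m CC _ (e v0) *m CC _ (e v0) *m CC _ (e v0)) *m L -
    madj (YY M v0) *m (CC _ (e v0) *m Q (mA be') *m CC _ (e v0)) *m YY M v0) <= eps / 4 + eps / 4.
  rewrite mn_sub; apply: le_trans hv1 _; rewrite lerD2r /d0.
  exact: quarter_bound.
have b2 : mn (madj L *m (W * inA (e v0) * W)%:M *m L - madj L *m (W * (ustar u * inA s * u) * W)%:M *m L) <= eps / 4.
  rewrite -mulmx_sub2 -raddfB /= -mulrBl -mulrBr.
  apply: (@le_trans _ _ (E * (eps / 4 / (E + 1)))); last first.
    by rewrite mulrCA ger_pMr // ler_pdivrMr // mul1r lerDl ler01.
  apply: le_trans (_ : _ <= E * v0.+1%:R^-1) _; last exact: ler_wpM2l.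
  rewrite (_ : E * _ = mn (madj L) * (n%:R * n%:R * (4 * v0.+1%:R^-1 * 4)) * mn L); last by rewrite /E; move: (_^-1) => t; ring.
  apply: mnM3 => //; apply: le_trans (mn_scalar _ _) _; apply: ler_wpM2l; first exact: mulr_ge0.
  apply: le_trans (unM _ _) _; apply: ler_pM; rewrite ?un_ge0 //.
  by apply: le_trans (unM _ _) _; apply: ler_pM; rewrite ?un_ge0 // ltW.
exact: three_quarters.
Qed.
End Main.

Theorem corollary4p4 (R : realType) (Z : cstarAlgType R) (hZ : jiang_su Z)
    (A : cstarAlgType R) (hA : simple_cstar A)
    (htr : essentially_tracially_in (separable_stable Z) A) :
  W_almost_unperforated A.
Proof.
move=> n m a b k [al aE] [be bE] /W_leP; rewrite !mA_diag.
have aQ : mA a = Q (mA al) by rewrite aE mA_mul mA_star.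
have bQ : mA b = Q (mA be) by rewrite bE mA_mul mA_star.
by rewrite aQ bQ => h; apply/W_leP; rewrite aQ bQ; exact: almost_unperf hZ htr hA _ _ _ _ _ h.
Qed.
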